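(* Let $U_1,U_2$ be monic complex polynomials with $\deg U_2-\deg U_1=2$ such that $\Psi=-\frac{U_1(z)}{U_2(z)}dz^2$ is Strebel on $\mathbb{CP}^1$. Then there exists at most one positive compactly supported measure $\mu$ on $\mathbb C$ of total mass $1$ whose Cauchy transform satisfies $\mathcal C_\mu^2(z)=\frac{U_1(z)}{U_2(z)}$ for almost every $z\in\mathbb C$. Moreover the support of such a measure is contained in $K_\Psi$; in particular, among the $2^{d-1}$ real measures of total mass $1$ supported in $K_\Psi$ with this property ($d$ = number of connected components of $\mathbb{CP}^1\setminus K_\Psi$), at most one is positive.
   Context: A rational quadratic differential $\Psi=R(z)dz^2$ on $\mathbb{CP}^1$ ($R$ rational) has as singular points its zeros and poles (including $\infty$ if applicable; for $R=-U_1/U_2$ with $\deg U_2-\deg U_1=2$, $\infty$ is a double pole). Horizontal trajectories are maximal integral curves, in the complement of the singular points, of the line field $R(z)dz^2>0$. A trajectory is singular if its closure contains a singular point. A non-singular trajectory is closed if it is periodic. $\Psi$ is Strebel if the union of its closed trajectories has full Lebesgue measure. $K_\Psi$ denotes the union of all singular (horizontal) trajectories and all singular points of $\Psi$. The Cauchy transform of a compactly supported measure $\mu$ is $\mathcal C_\mu(z)=\int\frac{d\mu(\xi)}{z-\xi}$. *)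

(* Defs.v *)
From HB Require Import structures.
From mathcomp Require Import all_boot all_order all_algebra.
From mathcomp Require Import complex.
From mathcomp Require Import all_classical all_reals all_analysis.
Set Implicit Arguments. Unset Strict Implicit. Unset Printing Implicit Defensive.
Import Order.TTheory GRing.Theory Num.Theory ComplexField.
Import numFieldNormedType.Exports.
Local Open Scope classical_set_scope.
Local Open Scope ring_scope.
Local Open Scope complex_scope.

Section QuadDiff.
Variable R : realType.

Definition toC (p : (R * R)%type) : R[i] := p.1 +i* p.2.

Definition lebC := ((@lebesgue_measure R) \x (@lebesgue_measure R))%E.

(* Finite singular points of Psi = -(U1/U2) dz^2: the zeros and poles of the
   rational function U1/U2, i.e. the points where the root multiplicities of
   U1 and U2 differ.  (infinity is always a (double) pole, handled separately) *)
Definition sing_fin (U1 U2 : {poly R[i]}) (z : R[i]) : Prop :=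
  mup z U1 != mup z U2.

Definition Rquad (U1 U2 : {poly R[i]}) (z : R[i]) : R[i] :=
  - ((U1 %/ gcdp U1 U2).[z] / (U2 %/ gcdp U1 U2).[z]).

(* gamma(t) = x(t) + i y(t) is a horizontal arc of Psi on the open interval I:
   it is differentiable, avoids the singular points, and R(gamma) gamma'^2 > 0
   (a positive real number; in R[i], 0 < w means w is real and positive). *)
Definition horiz_arc (U1 U2 : {poly R[i]}) (I : set R) (x y : R -> R) : Prop :=
  open I /\ is_interval I /\ I 0 /\
  forall t, I t ->
    [/\ derivable x t 1, derivable y t 1,
        ~ sing_fin U1 U2 (x t +i* y t) &
        0 < Rquad U1 U2 (x t +i* y t) * (derive1 x t +i* derive1 y t) ^+ 2].

(* z lies on a closed trajectory: a periodic (hence maximal, non-singular)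
   horizontal trajectory passes through z *)
Definition on_closed_traj (U1 U2 : {poly R[i]}) (z : R[i]) : Prop :=
  exists (x y : R -> R) (T : R),
    [/\ 0 < T, horiz_arc U1 U2 setT x y,
        (forall t, x (t + T) = x t /\ y (t + T) = y t) &
        x 0 +i* y 0 = z].

Definition strebel (U1 U2 : {poly R[i]}) : Prop :=
  lebC.-negligible [set p | ~ on_closed_traj U1 U2 (toC p)].

(* K_Psi (intersected with C): singular points, and points lying on a
   trajectory whose closure in CP^1 contains a singular point (a finite one,
   or infinity, i.e. the trajectory is unbounded). *)
Definition K_Psi (U1 U2 : {poly R[i]}) : set R[i] :=
  [set z | sing_fin U1 U2 z \/
     exists (I : set R) (x y : R -> R),
       [/\ horiz_arc U1 U2 I x y, x 0 +i* y 0 = z &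
           (exists s, sing_fin U1 U2 s /\
              forall e : R, 0 < e -> exists t, I t /\ `|(x t +i* y t) - s| < e%:C)
           \/ (forall M : R, exists t, I t /\ M%:C < `|x t +i* y t|)]].

Definition cauchy_re (z : R[i]) (q : R * R) : R :=
  complex.Re (1 / (z - toC q)).
Definition cauchy_im (z : R[i]) (q : R * R) : R :=
  complex.Im (1 / (z - toC q)).
Definition cauchy (mu : {measure set (R * R)%type -> \bar R}) (z : R[i]) : R[i] :=
  Rintegral mu setT (cauchy_re z) +i* Rintegral mu setT (cauchy_im z).

Definition cauchy_sq_eq (U1 U2 : {poly R[i]}) (mu : {measure set (R * R)%type -> \bar R}) : Prop :=
  {ae lebC, forall p,
     mu.-integrable setT (EFin \o cauchy_re (toC p)) /\
     mu.-integrable setT (EFin \o cauchy_im (toC p)) /\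
     cauchy mu (toC p) ^+ 2 = U1.[toC p] / U2.[toC p]}.

Definition prob_compact (mu : {measure set (R * R)%type -> \bar R}) : Prop :=
  mu setT = 1%E /\ exists K : set (R * R), compact K /\ mu (~` K) = 0%E.

Definition msupp (mu : {measure set (R * R)%type -> \bar R}) : set (R * R) :=
  [set p | forall e : R, 0 < e -> (0 < mu (ball p e))%E].

End QuadDiff.

(* Main.v *)
Require Import Defs.
From HB Require Import structures.
From mathcomp Require Import all_boot all_order all_algebra.
From mathcomp Require Import complex.
From mathcomp Require Import all_classical all_reals all_analysis.
From mathcomp Require Import measurable_realfun.
From mathcomp Require Import ring lra.
Set Implicit Arguments. Unset Strict Implicit. Unset Printing Implicit Defensive.
Import Order.TTheory GRing.Theory Num.Theory ComplexField.
Import numFieldNormedType.Exports.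
Local Open Scope classical_set_scope.
Local Open Scope ring_scope.
Local Open Scope complex_scope.

(** Let R = -U1/U2.  Near a regular point the primitive W of sqrt R is a chart in which horizontal
    trajectories are horizontal lines; its local inverses are the solutions F of F'^2 R(F) = 1.
    If p is off K_Psi, such an F with F(0) = p exists on a whole strip |Im w| < r.  Its image is
    open, so it meets a closed trajectory, hence F is periodic with a real period T.  On a thinner
    strip distinct levels are disjoint closed curves, and the winding number of a level around a
    point off that level is either 0 or one fixed number a.

    If C is the Cauchy transform of a positive measure mu and C^2 = U1/U2 almost everywhere, then
    C(F) F' = i s with s = 1 or s = -1 almost everywhere.  By Fubini, the integral of s over a period
    of a level is the mu-average of the winding numbers of this level, so it has the sign of a;
    and since ln |F - q| is single valued for every q, the integrals of s over the vertical sides of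
    a rectangle agree.  Hence s is almost everywhere the sign of a: near p the Cauchy transform is
    almost everywhere a branch of sqrt (U1/U2) that does not depend on mu.

    Two solutions mu therefore have the same Cauchy transform almost everywhere.  The imaginary part
    of the contour integral of C along almost every rectangle is 2 pi times the measure of its
    interior, so mu is determined by C, and mu vanishes near p because C is holomorphic there. *)

(** The equation fixes the Cauchy transform only up to a measurable sign at almost every point, so s
    has no continuity and can be pinned by integrals alone. On a horizontal side C(F) F' = i s is
    purely imaginary, so the real part of the contour integral over a rectangle sees the vertical
    sides only. The integral of s over a vertical side is thus the same for almost every x; averaged
    over x it becomes, by Fubini, an average of period integrals, all of the sign of a. Lebesgue
    differentiation then passes this sign to s itself.

    No Jordan curve theorem is invoked: the two possible winding numbers come from moving a point
    and a level together through the disjoint levels of the strip, and from the value 0 far away.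

    The Cauchy transform is uncontrolled on any individual line. Every line used is therefore drawn
    from almost all lines, namely those on which a majorant of the potential is integrable; the
    majorant is made infinite on the exceptional null set, so that one finiteness condition gives
    absolute convergence and avoids the bad points almost everywhere on the line. *)

Section ComplexNorm.
Variable R : realType.
Implicit Types (z w : R[i]) (a b : R).

(** The norm of [R[i]] is itself an element of [R[i]]; this modulus lies in [R], so that estimates
    can be closed by real arithmetic. *)
Definition nc (z : R[i]) : R := Normc.normc z.

Lemma ncE z : nc z = Num.sqrt (complex.Re z ^+ 2 + complex.Im z ^+ 2).
Proof. by rewrite /nc; case: z. Qed.
Lemma nc_ge0 z : 0 <= nc z.
Proof. by rewrite ncE sqrtr_ge0. Qed.
Lemma ncM z w : nc (z * w) = nc z * nc w. Proof. exact: Normc.normcM. Qed.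
Lemma ncV z : nc z^-1 = (nc z)^-1. Proof. exact: Normc.normcV. Qed.
Lemma nc0 : nc 0 = 0. Proof. exact: Normc.normc0. Qed.
Lemma nc1 : nc 1 = 1. Proof. exact: Normc.normc1. Qed.
Lemma ncN z : nc (- z) = nc z. Proof. exact: normcN. Qed.
Lemma ncD z w : nc (z + w) <= nc z + nc w. Proof. exact: le_normcD. Qed.
Lemma ncBC z w : nc (z - w) = nc (w - z). Proof. by rewrite -ncN opprB. Qed.
Lemma nc_eq0 z : (nc z == 0) = (z == 0).
Proof.
by apply/eqP/eqP => [/Normc.eq0_normc//|->]; exact: nc0.
Qed.
Lemma nc_gt0 z : (0 < nc z) = (z != 0).
Proof. by rewrite lt_neqAle nc_ge0 andbT eq_sym nc_eq0. Qed.
Lemma ncC a : nc a%:C = `|a|.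
Proof. by rewrite ncE /= expr0n addr0 sqrtr_sqr. Qed.
Lemma nc_Re z : `|complex.Re z| <= nc z.
Proof. by rewrite ncE -sqrtr_sqr ler_wsqrtr// lerDl sqr_ge0. Qed.
Lemma nc_Im z : `|complex.Im z| <= nc z.
Proof. by rewrite ncE -sqrtr_sqr ler_wsqrtr// lerDr sqr_ge0. Qed.
Lemma nc_le z : nc z <= `|complex.Re z| + `|complex.Im z|.
Proof.
rewrite ncE -[leRHS]ger0_norm ?addr_ge0// -sqrtr_sqr ler_wsqrtr//.
rewrite sqrrD !real_normK ?num_real//.
have : 0 <= `|complex.Re z| * `|complex.Im z| by rewrite mulr_ge0.
lra.
Qed.
Lemma nc_sqr z : nc z ^+ 2 = complex.Re z ^+ 2 + complex.Im z ^+ 2.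
Proof. by rewrite ncE sqr_sqrtr// addr_ge0// sqr_ge0. Qed.
Lemma nc_normE z : `|z| = (nc z)%:C.
Proof. by rewrite normc_def ncE. Qed.
Lemma ncX z n : nc (z ^+ n) = nc z ^+ n.
Proof. by elim: n => [|n IH]; rewrite ?expr0 ?nc1// !exprS ncM IH. Qed.
Lemma ncB_ge z w : nc z - nc w <= nc (z - w).
Proof. by rewrite lerBlDr (le_trans _ (ncD _ _))// subrK. Qed.
Lemma ncB_le z w : nc (z - w) <= nc z + nc w.
Proof. by rewrite (le_trans (ncD _ _))// ncN. Qed.
Lemma nc_tri (z1 z2 z3 : R[i]) : nc (z1 - z3) <= nc (z1 - z2) + nc (z2 - z3).
Proof. by rewrite (le_trans _ (ncD _ _))// addrA subrK. Qed.
Lemma cReD z w : complex.Re (z + w) = complex.Re z + complex.Re w. Proof. by case: z w => ? ? []. Qed.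
Lemma cImD z w : complex.Im (z + w) = complex.Im z + complex.Im w. Proof. by case: z w => ? ? []. Qed.
Lemma cReN z : complex.Re (- z) = - complex.Re z. Proof. by case: z. Qed.
Lemma cImN z : complex.Im (- z) = - complex.Im z. Proof. by case: z. Qed.
Lemma cReB z w : complex.Re (z - w) = complex.Re z - complex.Re w. Proof. by rewrite cReD cReN. Qed.
Lemma cImB z w : complex.Im (z - w) = complex.Im z - complex.Im w. Proof. by rewrite cImD cImN. Qed.
Lemma cReM z w : complex.Re (z * w) = complex.Re z * complex.Re w - complex.Im z * complex.Im w.
Proof. by case: z w => ? ? []. Qed.
Lemma cImM z w : complex.Im (z * w) = complex.Re z * complex.Im w + complex.Im z * complex.Re w.
Proof. by case: z w => ? ? [? ?] /=. Qed.
Lemma cReV z : complex.Re z^-1 = complex.Re z / nc z ^+ 2.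
Proof. by rewrite nc_sqr; case: z => a b. Qed.
Lemma cImV z : complex.Im z^-1 = - (complex.Im z / nc z ^+ 2).
Proof. by rewrite nc_sqr; case: z => a b. Qed.
Lemma Cext z w : complex.Re z = complex.Re w -> complex.Im z = complex.Im w -> z = w.
Proof. by case: z w => ? ? [? ?] /= -> ->. Qed.
Lemma nci : nc ('i : R[i]) = 1.
Proof. by rewrite ncE /= expr0n add0r expr1n sqrtr1. Qed.

End ComplexNorm.

Arguments nc {R} z : simpl never.

(** * Calculus of complex-valued functions *)

Section RealCalc.
Variable R : realType.

Lemma eps_is_derive (f : R -> R) (t d : R) :
  (forall e, 0 < e -> exists2 D : R, 0 < D & forall s, `|s| < D -> `|f (t + s) - f t - s * d| <= e * `|s|) ->
  is_derive t 1 f d.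
Proof.
move=> H.
have C : (fun h => h^-1 *: ((f \o shift t) (h *: (1:R)) - f t)) @ 0^' --> d.
  apply/cvgrPdist_le => e e0.
  have [D D0 HD] := H _ e0.
  near=> h.
  have h0 : h != 0 by near: h; exact: nbhs_dnbhs_neq.
  have hD : `|h| < D.
    near: h; apply: dnbhs0_lt => //.
  have := HD _ hD.
  rewrite /= /GRing.scale /= mulr1 (addrC h).
  rewrite -(ler_pM2r (_ : 0 < `|h|^-1)) ?invr_gt0 ?normr_gt0//.
  rewrite -mulrA divff ?normr_eq0// mulr1 => /(le_trans _); apply.
  rewrite -normfV -normrM distrC le_eqVlt; apply/orP; left; apply/eqP; congr `|_|.
  by rewrite mulrBl mulrAC mulfV// mul1r mulrC.
have D1 : derivable f t 1 by apply/cvg_ex; exists d.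
apply: DeriveDef => //.
by rewrite /derive; apply/cvg_lim.
Unshelve. all: by end_near.
Qed.

Lemma is_derive_eps (f : R -> R) (t d : R) : is_derive t 1 f d ->
  (forall e, 0 < e -> exists2 D : R, 0 < D & forall s, `|s| < D -> `|f (t + s) - f t - s * d| <= e * `|s|).
Proof.
move=> [D1 D2] e e0.
have C : (fun h => h^-1 *: ((f \o shift t) (h *: (1:R)) - f t)) @ 0^' --> d.
  by rewrite -D2; exact: D1.
move/cvgrPdist_le : C => /(_ e e0).
rewrite /prop_near1 /dnbhs /within /= -nbhs_ballE => -[D /= D0 HD].
exists D => // s sD.
have [->|s0] := eqVneq s 0.
  by rewrite addr0 subrr mul0r subr0 normr0 mulr0.
have := HD s; rewrite /ball/= sub0r normrN => /(_ sD s0).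
rewrite /GRing.scale/= mulr1 (addrC s) => H.
rewrite -(@ler_pM2r _ `|s|^-1) ?invr_gt0 ?normr_gt0//.
rewrite -mulrA divff ?normr_eq0// mulr1; apply: le_trans H.
rewrite -normfV -normrM distrC le_eqVlt; apply/orP; left; apply/eqP.
by rewrite [in RHS]mulrC [in LHS]mulrBl (mulrC s) mulfK.
Qed.

Lemma eps_within_continuous (f : R -> R) (A : set R) :
  (forall x, A x -> forall e, 0 < e -> exists2 D : R, 0 < D & forall y, A y -> `|y - x| < D -> `|f y - f x| < e) ->
  {within A, continuous f}.
Proof.
move=> H; apply/subspace_continuousP => x Ax.
apply/cvgrPdist_lt => e e0.
have [D D0 HD] := H _ Ax _ e0.
rewrite /prop_near1 /within /= -nbhs_ballE; exists D => //= y.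
by rewrite /ball/= distrC => yx Ay; rewrite distrC; exact: HD.
Qed.

Lemma is_derive_derivable (f : R -> R) (t d : R) : is_derive t 1 f d -> derivable f t 1.
Proof. by case. Qed.

Lemma is_derive_cvg (f : R -> R) (t d : R) : is_derive t 1 f d -> f x @[x --> t] --> f t.
Proof. by move=> /is_derive_derivable ft; exact/differentiable_continuous/derivable1_diffP. Qed.

Definition rint (f : R -> R) (a b : R) : R := \int[lebesgue_measure]_(x in `[a, b]) f x.

Lemma rint_FTC (f F : R -> R) (a b : R) : a <= b ->
  (forall x : R, a <= x <= b -> is_derive x 1 F (f x)) ->
  {within `[a, b], continuous f} -> rint f a b = F b - F a.
Proof.
rewrite le_eqVlt => /predU1P[->|ab] dF cf.
  by rewrite /rint set_itv1 Rintegral_set1 subrr.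
rewrite /rint /Rintegral (continuous_FTC2 ab cf (F := F)) //.
- split.
  + move=> x /[!in_itv]/= /andP[xa xb].
    by apply: is_derive_derivable; apply: dF; rewrite !ltW.
  + by apply: cvg_at_right_filter; apply: is_derive_cvg; apply: dF; rewrite lexx ltW.
  + by apply: cvg_at_left_filter; apply: is_derive_cvg; apply: dF; rewrite lexx ltW.
- move=> x /[!in_itv]/= /andP[xa xb]; rewrite derive1E.
  by apply: derive_val; apply: dF; rewrite !ltW.
Qed.

(* Local constancy is stated as an equivalence so that one hypothesis covers both propagation and its failure. *)
Lemma locally_constant_01 (P : R -> Prop) :
  (forall t, 0 <= t <= 1 -> exists2 e, 0 < e & forall s, 0 <= s <= 1 -> `|s - t| < e -> (P s <-> P t)) ->
  P 0 -> P 1.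
Proof.
move=> H P0.
pose A := [set t | 0 <= t <= 1 /\ forall s, 0 <= s <= t -> P s].
have A0 : A 0.
  split; first by rewrite lexx ler01.
  by move=> s s0; have -> : s = 0 by apply/eqP; rewrite eq_le andbC.
have supA : has_sup A by split; [exists 0|exists 1 => t [/andP[]]].
pose T := sup A.
have T0 : 0 <= T by exact: sup_upper_bound.
have T1 : T <= 1 by apply: ge_sup; [exists 0|move=> t [/andP[]]].
have [e e0 He] := H T (introT andP (conj T0 T1)).
have [t [/andP[t0 t1] At] tT] := sup_adherent e0 supA.
have tT' : t <= T by apply: sup_upper_bound => //; split => //; rewrite t0 t1.
have PT : P T.
  rewrite -(He t); first by apply: At; rewrite t0 lexx.
    by rewrite t0 t1.
  by rewrite ler0_norm ?subr_le0// opprB ltrBlDr -ltrBlDl.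
have Ps s : 0 <= s <= 1 -> s < T + e -> P s.
  move=> /andP[s0 s1] sT.
  have [st|ts] := leP s t; first by apply: At; rewrite s0 st.
  apply/He => //; first by rewrite s0 s1.
  rewrite ltr_norml; apply/andP; split; last by rewrite ltrBlDl.
  by rewrite ltrBrDl (lt_trans _ ts).
pose u := Num.min 1 (T + e / 2).
have Au : A u.
  have u1 : u <= 1 by rewrite ge_min lexx.
  split.
    by rewrite u1 andbT le_min ler01 addr_ge0// divr_ge0// ltW.
  move=> s /andP[s0 su]; apply: Ps; first by rewrite s0 (le_trans su).
  rewrite (le_lt_trans su)// gt_min; apply/orP; right.
  by rewrite ltrD2l ltr_pdivrMr// ltr_pMr// ltr1n.
have : u <= T by exact: sup_upper_bound.
rewrite ge_min => /orP[T1'|]; first by apply: Ps; rewrite ?ler01 ?lexx// (le_lt_trans T1')// ltrDl.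
by rewrite gerDl leNgt divr_gt0.
Qed.

End RealCalc.

Section ComplexCalc.
Variable R : realType.
Implicit Types (z w k : R[i]) (f g h : R[i] -> R[i]).

(** An increment estimate in [nc] instead of a limit of quotients: composition and products reduce
    to inequalities, and k = 0 needs no exclusion. *)
Definition cderiv f z d := forall e : R, 0 < e ->
  exists2 D : R, 0 < D & forall k, nc k < D -> nc (f (z + k) - f z - d * k) <= e * nc k.

Definition ccont f z := forall e : R, 0 < e ->
  exists2 D : R, 0 < D & forall k, nc k < D -> nc (f (z + k) - f z) < e.

Definition rderiv (f : R -> R[i]) (t : R) (d : R[i]) := forall e : R, 0 < e ->
  exists2 D : R, 0 < D & forall s : R, `|s| < D -> nc (f (t + s) - f t - d * s%:C) <= e * `|s|.

Definition cball (z0 : R[i]) (r : R) : set R[i] := [set z | nc (z - z0) < r].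

Lemma cball_center z0 r : 0 < r -> cball z0 r z0.
Proof. by rewrite /cball /= subrr nc0. Qed.

Lemma cball_subset z z0 r r' : nc (z - z0) + r' <= r -> cball z r' `<=` cball z0 r.
Proof.
move=> H w; rewrite /cball /= => wz; apply: le_lt_trans (nc_tri w z z0) _.
by rewrite addrC; apply: lt_le_trans H; rewrite ltrD2l.
Qed.

Lemma rderiv_ReIm (f : R -> R[i]) (t : R) d : rderiv f t d <->
  is_derive t 1 (fun s => complex.Re (f s)) (complex.Re d) /\
  is_derive t 1 (fun s => complex.Im (f s)) (complex.Im d).
Proof.
have E1 s : complex.Re (f (t + s) - f t - d * s%:C) =
    complex.Re (f (t + s)) - complex.Re (f t) - s * complex.Re d.
  by rewrite !cReB cReM /=; ring.
have E2 s : complex.Im (f (t + s) - f t - d * s%:C) =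
    complex.Im (f (t + s)) - complex.Im (f t) - s * complex.Im d.
  by rewrite !cImB cImM /=; ring.
split=> [H|[H1 H2]].
  split; apply: eps_is_derive => e e0; have [D D0 HD] := H e e0; exists D => // s sD.
    by rewrite -E1 (le_trans (nc_Re _))// HD.
  by rewrite -E2 (le_trans (nc_Im _))// HD.
move=> e e0; have e20 : 0 < e / 2 by rewrite divr_gt0.
have [D1 D10 HD1] := is_derive_eps H1 e20.
have [D2 D20 HD2] := is_derive_eps H2 e20.
exists (Num.min D1 D2); first by rewrite lt_min D10.
move=> s; rewrite lt_min => /andP[s1 s2].
rewrite (le_trans (nc_le _))// E1 E2.
by have := HD1 _ s1; have := HD2 _ s2; lra.
Qed.

Lemma rderiv_Re (f : R -> R[i]) (t : R) d : rderiv f t d ->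
  is_derive t 1 (fun s => complex.Re (f s)) (complex.Re d).
Proof. by move=> /rderiv_ReIm[]. Qed.

Lemma rderiv_Im (f : R -> R[i]) (t : R) d : rderiv f t d ->
  is_derive t 1 (fun s => complex.Im (f s)) (complex.Im d).
Proof. by move=> /rderiv_ReIm[]. Qed.

Lemma rderiv_lip (f : R -> R[i]) (t : R) d : rderiv f t d -> exists2 D : R, 0 < D &
  forall s : R, `|s| < D -> nc (f (t + s) - f t) <= (nc d + 1) * `|s|.
Proof.
move=> /(_ 1 ltr01)[D D0 HD]; exists D => // s sD.
rewrite -[X in nc X](subrK (d * s%:C)) (le_trans (ncD _ _))// ncM ncC addrC mulrDl.
by rewrite lerD2l HD.
Qed.

Lemma cderiv_lip f z d : cderiv f z d -> exists2 D : R, 0 < D &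
  forall k, nc k < D -> nc (f (z + k) - f z) <= (nc d + 1) * nc k.
Proof.
move=> /(_ 1 ltr01)[D D0 HD]; exists D => // s sD.
rewrite -[X in nc X](subrK (d * s)) (le_trans (ncD _ _))// ncM addrC mulrDl.
by rewrite lerD2l HD.
Qed.

Lemma cderiv_ccont f z d : cderiv f z d -> ccont f z.
Proof.
move=> /cderiv_lip[D D0 HD] e e0.
have d0 : 0 < nc d + 1 by rewrite ltr_wpDl ?nc_ge0.
exists (Num.min D (e / (nc d + 1))); first by rewrite lt_min D0 divr_gt0.
move=> k; rewrite lt_min => /andP[k1 k2]; apply: le_lt_trans (HD _ k1) _.
by rewrite mulrC -ltr_pdivlMr.
Qed.

Lemma cderiv_rderiv_comp f (g : R -> R[i]) (t : R) d d' :
  cderiv f (g t) d -> rderiv g t d' -> rderiv (fun s => f (g s)) t (d * d').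
Proof.
move=> H1 H2 e e0.
have L0 : 0 < nc d' + 1 by rewrite ltr_wpDl ?nc_ge0.
have L1 : 0 < nc d + 1 by rewrite ltr_wpDl ?nc_ge0.
have e10 : 0 < e / 2 / (nc d' + 1) by rewrite !divr_gt0.
have e20 : 0 < e / 2 / (nc d + 1) by rewrite !divr_gt0.
have [D1 D10 HD1] := H1 _ e10.
have [D2 D20 HD2] := H2 _ e20.
have [D3 D30 HD3] := rderiv_lip H2.
exists (Num.min (D1 / (nc d' + 1)) (Num.min D2 D3)).
  by rewrite !lt_min D20 D30 !divr_gt0.
move=> s; rewrite !lt_min => /and3P[s1 s2 s3].
have h3 := HD3 _ s3; have h2 := HD2 _ s2.
have k1 : nc (g (t + s) - g t) < D1.
  by apply: le_lt_trans h3 _; rewrite mulrC -ltr_pdivlMr.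
have := HD1 _ k1; rewrite [g t + _]addrC subrK => h1.
have -> : f (g (t + s)) - f (g t) - d * d' * s%:C =
  (f (g (t + s)) - f (g t) - d * (g (t + s) - g t)) + d * (g (t + s) - g t - d' * s%:C).
  by ring.
apply: le_trans (ncD _ _) _; rewrite ncM.
have a1 : nc (f (g (t + s)) - f (g t) - d * (g (t + s) - g t)) <= e / 2 * `|s|.
  apply: le_trans h1 _; rewrite -!mulrA ler_pM2l// ler_pM2l ?invr_gt0//.
  by rewrite -ler_pdivlMl ?invr_gt0// invrK.
have a2 : nc d * nc (g (t + s) - g t - d' * s%:C) <= e / 2 * `|s|.
  apply: le_trans (_ : nc d * (e / 2 / (nc d + 1) * `|s|) <= _).
    by rewrite ler_wpM2l ?nc_ge0.
  rewrite mulrA ler_wpM2r// mulrCA ger_pMr ?divr_gt0//.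
  by rewrite ler_pdivrMr// mul1r lerDl.
lra.
Qed.

Lemma cderiv_comp f g z d d' :
  cderiv f (g z) d -> cderiv g z d' -> cderiv (fun s => f (g s)) z (d * d').
Proof.
move=> H1 H2 e e0.
have L0 : 0 < nc d' + 1 by rewrite ltr_wpDl ?nc_ge0.
have L1 : 0 < nc d + 1 by rewrite ltr_wpDl ?nc_ge0.
have e10 : 0 < e / 2 / (nc d' + 1) by rewrite !divr_gt0.
have e20 : 0 < e / 2 / (nc d + 1) by rewrite !divr_gt0.
have [D1 D10 HD1] := H1 _ e10.
have [D2 D20 HD2] := H2 _ e20.
have [D3 D30 HD3] := cderiv_lip H2.
exists (Num.min (D1 / (nc d' + 1)) (Num.min D2 D3)).
  by rewrite !lt_min D20 D30 !divr_gt0.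
move=> s; rewrite !lt_min => /and3P[s1 s2 s3].
have h3 := HD3 _ s3; have h2 := HD2 _ s2.
have k1 : nc (g (z + s) - g z) < D1.
  by apply: le_lt_trans h3 _; rewrite mulrC -ltr_pdivlMr.
have := HD1 _ k1; rewrite [g z + _]addrC subrK => h1.
have -> : f (g (z + s)) - f (g z) - d * d' * s =
  (f (g (z + s)) - f (g z) - d * (g (z + s) - g z)) + d * (g (z + s) - g z - d' * s).
  by ring.
apply: le_trans (ncD _ _) _; rewrite ncM.
have a1 : nc (f (g (z + s)) - f (g z) - d * (g (z + s) - g z)) <= e / 2 * nc s.
  apply: le_trans h1 _; rewrite -!mulrA ler_pM2l// ler_pM2l ?invr_gt0//.
  by rewrite -ler_pdivlMl ?invr_gt0// invrK.
have a2 : nc d * nc (g (z + s) - g z - d' * s) <= e / 2 * nc s.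
  apply: le_trans (_ : nc d * (e / 2 / (nc d + 1) * nc s) <= _).
    by rewrite ler_wpM2l ?nc_ge0.
  rewrite mulrA ler_wpM2r ?nc_ge0// mulrCA ger_pMr ?divr_gt0//.
  by rewrite ler_pdivrMr// mul1r lerDl.
lra.
Qed.

Lemma cderiv_affine (c s : R[i]) z : cderiv (fun w => c + s * w) z s.
Proof.
move=> e e0; exists 1 => // k _.
by rewrite (_ : _ - _ = 0) ?nc0 ?mulr_ge0 ?nc_ge0 ?ltW//; ring.
Qed.

Lemma rderiv_affine (c v : R[i]) (t : R) : rderiv (fun s => c + s%:C * v) t v.
Proof.
move=> e e0; exists 1 => // s _.
rewrite (_ : _ - _ = 0) ?nc0 ?mulr_ge0 ?normr_ge0 ?ltW//.
by rewrite (rmorphD (real_complex R)) /=; ring.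
Qed.

Lemma cderiv_line f (c v : R[i]) (t : R) d :
  cderiv f (c + t%:C * v) d -> rderiv (fun s => f (c + s%:C * v)) t (d * v).
Proof. by move=> H; apply: cderiv_rderiv_comp H _; exact: rderiv_affine. Qed.

Lemma cderivM f g z d d' : cderiv f z d -> cderiv g z d' ->
  cderiv (fun w => f w * g w) z (d * g z + f z * d').
Proof.
move=> H1 H2 e e0.
have cg := cderiv_ccont H2.
have [Dg Dg0 HDg] := cg _ ltr01.
have L0 : 0 < nc (g z) + 1 by rewrite ltr_wpDl ?nc_ge0.
have L1 : 0 < nc (f z) + 1 by rewrite ltr_wpDl ?nc_ge0.
have L2 : 0 < nc d + 1 by rewrite ltr_wpDl ?nc_ge0.
have e10 : 0 < e / 3 / (nc (g z) + 1) by rewrite !divr_gt0.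
have e20 : 0 < e / 3 / (nc (f z) + 1) by rewrite !divr_gt0.
have e30 : 0 < e / 3 / (nc d + 1) by rewrite !divr_gt0.
have [D1 D10 HD1] := H1 _ e10.
have [D2 D20 HD2] := H2 _ e20.
have [D3 D30 HD3] := cg _ e30.
exists (Num.min (Num.min Dg D3) (Num.min D1 D2)).
  by rewrite !lt_min Dg0 D10 D20 D30.
move=> s; rewrite !lt_min => /andP[/andP[sg s3] /andP[s1 s2]].
have -> : f (z + s) * g (z + s) - f z * g z - (d * g z + f z * d') * s =
  (f (z + s) - f z - d * s) * g (z + s) + f z * (g (z + s) - g z - d' * s)
  + d * s * (g (z + s) - g z) by ring.
have a1 : nc ((f (z + s) - f z - d * s) * g (z + s)) <= e / 3 * nc s.
  rewrite ncM.
  have gb : nc (g (z + s)) <= nc (g z) + 1.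
    by rewrite -[g (z + s)](subrK (g z)) (le_trans (ncD _ _))// addrC lerD2l ltW// HDg.
  apply: le_trans (_ : (e / 3 / (nc (g z) + 1) * nc s) * (nc (g z) + 1) <= _).
    by apply: ler_pM; rewrite ?nc_ge0// HD1.
  by rewrite mulrAC divfK// gt_eqF.
have a2 : nc (f z * (g (z + s) - g z - d' * s)) <= e / 3 * nc s.
  rewrite ncM.
  apply: le_trans (_ : (nc (f z) + 1) * (e / 3 / (nc (f z) + 1) * nc s) <= _).
    by apply: ler_pM; rewrite ?nc_ge0 ?lerDl// HD2.
  by rewrite mulrA mulrCA mulfV ?mulr1// gt_eqF.
have a3 : nc (d * s * (g (z + s) - g z)) <= e / 3 * nc s.
  rewrite !ncM.
  apply: le_trans (_ : (nc d + 1) * nc s * (e / 3 / (nc d + 1)) <= _).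
    by apply: ler_pM; rewrite ?mulr_ge0 ?nc_ge0 ?ler_wpM2r ?nc_ge0 ?lerDl ?ltW// HD3.
  by rewrite mulrC mulrA divfK// gt_eqF.
apply: le_trans (ncD _ _) _; apply: le_trans (lerD (ncD _ _) (lexx _)) _.
lra.
Qed.

Lemma rderiv_cst0 (f : R -> R[i]) (a b : R) : a <= b ->
  (forall t, a <= t <= b -> rderiv f t 0) -> f a = f b.
Proof.
move=> ab H.
have K (g : R -> R) : (forall t : R, a <= t <= b -> is_derive t 1 g 0) -> g a = g b.
  move=> dg; apply/eqP; rewrite eq_sym -subr_eq0 -(@rint_FTC _ (fun=> 0))//.
    by rewrite /rint Rintegral_cst//= mul0r.
  by move=> x; exact: cvg_cst.
by apply: Cext; apply: (K (fun t => _ (f t))) => t tab; have /rderiv_ReIm[] := H _ tab.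
Qed.

End ComplexCalc.

(** * Compactness as existence of uniform radii *)

Section Compactness.
Variable R : realType.

Lemma toC_ReIm (z : R[i]) : toC (complex.Re z, complex.Im z) = z.
Proof. by case: z. Qed.

Lemma toCB (p q : R * R) : toC p - toC q = (p.1 - q.1) +i* (p.2 - q.2).
Proof. by []. Qed.

(** The only form in which compactness of discs is used: local radii can be replaced by one radius
    because [P] survives shrinking. The covering argument runs in [R * R], with the filter of small
    positive radii as the parameter. *)
Lemma disc_uniform (M : R) (P : R[i] -> R -> Prop) :
  (forall z (r r' : R), 0 < r' -> r' <= r -> P z r -> P z r') ->
  (forall z, nc z <= M -> exists e r : R, [/\ 0 < e, 0 < r & forall z', nc (z' - z) < e -> P z' r]) ->
  exists2 r, 0 < r & forall z, nc z <= M -> P z r.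
Proof.
move=> Pm Hloc.
have cK : compact (`[- M, M]%classic `*` `[- M, M]%classic : set (R * R)).
  by apply: compact_setX; exact: segment_compact.
have cB : compact ([set p | nc (toC p) <= M] : set (R * R)).
  apply: (@subclosed_compact _ _ (`[- M, M]%classic `*` `[- M, M]%classic)) => //.
    have -> : [set p : R * R | nc (toC p) <= M] = (fun p => nc (toC p)) @^-1` [set x | x <= M].
      by [].
    apply: preimage_closed; last exact: closed_le.
    move=> p _; rewrite /nc /toC /=.
    apply: (@continuous_comp _ _ _ (fun p : R * R => p.1 ^+ 2 + p.2 ^+ 2) (@Num.sqrt R)).
      apply: continuousD; (apply: (@continuous_comp _ _ _ _ (fun x : R => x ^+ 2)); last exact: exprn_continuous).
        exact: cvg_fst.
      exact: cvg_snd.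
    exact: sqrt_continuous.
  move=> p /= pM.
  split; rewrite /= in_itv/= -ler_norml.
    by rewrite (le_trans _ pM)// (nc_Re (toC p)).
  by rewrite (le_trans _ pM)// (nc_Im (toC p)).
have := (compact_near_coveringP _).1 cB.
move=> /(_ _ (0 : R)^'+ (fun r p => P (toC p) r) _).
have H : forall x : R * R, [set p | nc (toC p) <= M] x ->
  \forall x' \near x & i \near (0 : R)^'+, P (toC x') i.
  move=> p /= pM.
  have [e [r [e0 r0 He]]] := Hloc _ pM.
  near=> x' i => /=.
  apply: (Pm _ r) => //; first by near: i; exact: nbhs_right_le.
  apply: He; rewrite toCB.
  apply: le_lt_trans (nc_le _) _ => /=.
  have : ball p (e / 2) x' by near: x'; apply: nbhsx_ballx; rewrite divr_gt0.
  move=> [/= ]; rewrite /ball/= (distrC p.1) (distrC p.2) => h1 h2; lra.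
move=> /(_ H) {}H.
have [r /andP[r0 Hr]] : exists r, (0 < r) && `[< forall z, nc z <= M -> P z r >].
  near (0 : R)^'+ => r; exists r; apply/andP; split => //.
  apply/asboolP => z zM; rewrite -(toC_ReIm z).
  have : [set p | nc (toC p) <= M] `<=` (fun p => P (toC p) r) by near: r.
  by apply; rewrite /= toC_ReIm.
by exists r => //; exact/asboolP.
Unshelve. all: by end_near.
Qed.

(** The disc version applied to the real part; near a point whose real part lies outside the segment
    the property is vacuous. *)
Lemma segment_uniform (a b : R) (P : R -> R -> Prop) :
  (forall z (r r' : R), 0 < r' -> r' <= r -> P z r -> P z r') ->
  (forall z, a <= z <= b -> exists e r : R, [/\ 0 < e, 0 < r & forall z', a <= z' <= b -> `|z' - z| < e -> P z' r]) ->
  exists2 r, 0 < r & forall z, a <= z <= b -> P z r.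
Proof.
move=> Pm Hloc.
have [r r0 Hr] : exists2 r, 0 < r & forall z, nc z <= Num.max `|a| `|b| ->
    (a <= complex.Re z <= b -> P (complex.Re z) r).
  apply: disc_uniform => [z r r' r'0 r'r H /H|z _]; first exact: Pm.
  have [zab|] := boolP (a <= complex.Re z <= b).
    have [e [r [e0 r0 He]]] := Hloc _ zab.
    exists e, r; split => // z' zz' z'ab; apply: He => //.
    by apply: le_lt_trans zz'; rewrite -cReB nc_Re.
  rewrite negb_and -!ltNge => /orP[za|bz].
    exists (a - complex.Re z), 1; split; rewrite ?subr_gt0// => z' zz' /andP[az' _].
    have := le_lt_trans (nc_Re (z' - z)) zz'; rewrite cReB => /(le_lt_trans (ler_norm _)).
    by rewrite ltrD2r ltNge az'.
  exists (complex.Re z - b), 1; split; rewrite ?subr_gt0// => z' zz' /andP[_ z'b].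
  rewrite ncBC in zz'.
  have := le_lt_trans (nc_Re (z - z')) zz'; rewrite cReB => /(le_lt_trans (ler_norm _)).
  by rewrite ltrD2l ltrN2 ltNge z'b.
exists r => // z zab; apply: (Hr z%:C) => //.
rewrite ncC le_max; case/andP: zab => az zb.
have [z0|z0] := leP 0 z.
  by apply/orP; right; rewrite !ger0_norm// (le_trans z0).
by apply/orP; left; rewrite !ltr0_norm ?lerN2// (le_lt_trans az).
Qed.

End Compactness.

(** * Uniform first-order Taylor estimates *)

Section UniformTaylor.
Variables (R : realType) (B : set R[i]).
Implicit Types (f g : R[i] -> R[i]).

Lemma nc_mul_le (x y : R[i]) (a b : R) : nc x <= a -> nc y <= b -> nc (x * y) <= a * b.
Proof. by move=> xa yb; rewrite ncM ler_pM ?nc_ge0. Qed.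

Definition bdlip f := exists2 M : R, 0 <= M &
  (forall a, B a -> nc (f a) <= M) /\ (forall a b, B a -> B b -> nc (f b - f a) <= M * nc (b - a)).

Definition taylor2 f f' := exists2 M : R, 0 <= M &
  forall a b, B a -> B b -> nc (f b - f a - f' a * (b - a)) <= M * nc (b - a) ^+ 2.

(** A quantitative substitute for holomorphy. Asking for one quadratic remainder on all of [B] makes
    the class stable under products, inverses and square roots, and gives the construction of
    primitives the constants it needs. *)
Definition hol2 f f' := [/\ bdlip f, bdlip f' & taylor2 f f'].

Lemma bdlip_cst c : bdlip (fun=> c).
Proof.
exists (nc c); first exact: nc_ge0; split => // a b _ _.
by rewrite subrr nc0 mulr_ge0 ?nc_ge0.
Qed.

Lemma bdlipD f g : bdlip f -> bdlip g -> bdlip (fun z => f z + g z).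
Proof.
move=> [M M0 [fM fL]] [N N0 [gN gL]]; exists (M + N); first by rewrite addr_ge0.
split=> [a Ba|a b Ba Bb]; first by rewrite (le_trans (ncD _ _))// lerD ?fM ?gN.
rewrite (_ : _ - _ = (f b - f a) + (g b - g a)); last by ring.
by rewrite (le_trans (ncD _ _))// mulrDl lerD ?fL ?gL.
Qed.

Lemma bdlipM f g : bdlip f -> bdlip g -> bdlip (fun z => f z * g z).
Proof.
move=> [M M0 [fM fL]] [N N0 [gN gL]]; exists (M * N + M * N).
  by rewrite addr_ge0 ?mulr_ge0.
split=> [a Ba|a b Ba Bb].
  by rewrite ler_wpDl ?mulr_ge0// nc_mul_le ?fM ?gN.
rewrite (_ : _ - _ = (f b - f a) * g b + f a * (g b - g a)); last by ring.
rewrite (le_trans (ncD _ _))// [leRHS]mulrDl lerD//.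
  by rewrite mulrAC nc_mul_le ?fL ?gN.
by rewrite -mulrA nc_mul_le ?fM ?gL.
Qed.

Lemma bdlipV f (c : R) : 0 < c -> (forall a, B a -> c <= nc (f a)) -> bdlip f ->
  bdlip (fun z => (f z)^-1).
Proof.
move=> c0 fc [M M0 [fM fL]]; exists (c^-1 + M / c ^+ 2).
  by have cp := ltW c0; rewrite addr_ge0 ?invr_ge0 ?divr_ge0 ?exprn_ge0.
have f0 a : B a -> f a != 0 by move=> /fc ca; rewrite -nc_gt0 (lt_le_trans c0).
have iv a : B a -> nc (f a)^-1 <= c^-1.
  by move=> Ba; rewrite ncV lef_pV2 ?posrE ?fc// (lt_le_trans c0)// fc.
split=> [a Ba|a b Ba Bb].
  by rewrite ler_wpDr ?iv// divr_ge0 ?exprn_ge0// ltW.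
rewrite (_ : _ - _ = - ((f b - f a) * ((f a)^-1 * (f b)^-1))); last first.
  by field; rewrite !f0.
rewrite ncN [leRHS]mulrDl ler_wpDl ?mulr_ge0 ?nc_ge0 ?invr_ge0 ?(ltW c0)//.
rewrite mulrAC nc_mul_le ?fL// expr2 invfM nc_mul_le ?iv//.
Qed.

Lemma hol2_cst c : hol2 (fun=> c) (fun=> 0).
Proof.
split; [exact: bdlip_cst|exact: bdlip_cst|exists 0 => // a b _ _].
by rewrite subrr mul0r subr0 nc0 mul0r.
Qed.

Lemma hol2D f f' g g' : hol2 f f' -> hol2 g g' -> hol2 (fun z => f z + g z) (fun z => f' z + g' z).
Proof.
move=> [f1 f2 [M M0 fT]] [g1 g2 [N N0 gT]]; split; [exact: bdlipD|exact: bdlipD|].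
exists (M + N); first by rewrite addr_ge0.
move=> a b Ba Bb; rewrite (_ : _ - _ - _ =
  (f b - f a - f' a * (b - a)) + (g b - g a - g' a * (b - a))); last by ring.
by rewrite (le_trans (ncD _ _))// mulrDl lerD ?fT ?gT.
Qed.

Lemma hol2M f f' g g' : hol2 f f' -> hol2 g g' ->
  hol2 (fun z => f z * g z) (fun z => f' z * g z + f z * g' z).
Proof.
move=> [f1 f2 [M M0 fT]] [g1 g2 [N N0 gT]]; split; [exact: bdlipM|apply: bdlipD; exact: bdlipM|].
move: f1 f2 g1 g2 => [Mf Mf0 [fM fL]] [Mf' Mf'0 [f'M f'L]] [Mg Mg0 [gM gL]] [Mg' Mg'0 [g'M g'L]].
exists (M * Mg + Mf * N + Mf' * Mg); first by rewrite !addr_ge0 ?mulr_ge0.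
move=> a b Ba Bb; rewrite (_ : _ - _ - _ =
  (f b - f a - f' a * (b - a)) * g b + f a * (g b - g a - g' a * (b - a))
  + f' a * (g b - g a) * (b - a)); last by ring.
rewrite (le_trans (ncD _ _))// [leRHS]mulrDl lerD//; last first.
  rewrite expr2 (_ : _ * (_ * _) = (Mf' * (Mg * nc (b - a))) * nc (b - a)); last by ring.
  by rewrite !nc_mul_le ?f'M ?gL.
rewrite (le_trans (ncD _ _))// [leRHS]mulrDl lerD//.
  by rewrite mulrAC nc_mul_le ?fT ?gM.
by rewrite -mulrA nc_mul_le ?fM ?gT.
Qed.

Lemma hol2V f f' (c : R) : 0 < c -> (forall a, B a -> c <= nc (f a)) -> hol2 f f' ->
  hol2 (fun z => (f z)^-1) (fun z => - (f' z) * ((f z)^-1 * (f z)^-1)).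
Proof.
move=> c0 fc [f1 f2 [M M0 fT]].
have fV := bdlipV c0 fc f1.
split => //.
  apply: bdlipM; last exact: bdlipM.
  have [N N0 [h1 h2]] := f2; exists N => //; split => [a Ba|a b Ba Bb]; first by rewrite ncN h1.
  by rewrite opprK addrC ncBC h2.
have f0 a : B a -> f a != 0 by move=> /fc ca; rewrite -nc_gt0 (lt_le_trans c0).
move: fV f1 f2 => [V V0 [VM _]] [Mf Mf0 [fM fL]] [Mf' Mf'0 [f'M f'L]].
exists (M * (V * V) + Mf' * (Mf * (V * V * V))).
  by rewrite addr_ge0 ?mulr_ge0.
move=> a b Ba Bb; rewrite (_ : _ - _ - _ =
  - ((f b - f a - f' a * (b - a)) * ((f a)^-1 * (f b)^-1))
  + (f' a * ((f b - f a) * ((f a)^-1 * (f a)^-1 * (f b)^-1))) * (b - a)); last first.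
  by field; rewrite !f0.
rewrite (le_trans (ncD _ _))// [leRHS]mulrDl lerD//.
  by rewrite ncN mulrAC !nc_mul_le ?fT ?VM.
rewrite expr2 [leRHS]mulrA nc_mul_le//.
rewrite -[leRHS]mulrA nc_mul_le ?f'M// [leRHS]mulrAC !nc_mul_le ?fL ?VM//.
Qed.

(** A real part bounded below selects the branch: [s a + s b] stays away from 0, so
    [s b - s a = (f b - f a) / (s a + s b)] carries the estimates of [f] over to [s]. *)
Lemma hol2_sqrt f f' (s : R[i] -> R[i]) (c : R) : 0 < c -> (forall a, B a -> c <= complex.Re (s a)) ->
  (forall a, B a -> s a ^+ 2 = f a) -> hol2 f f' ->
  hol2 s (fun z => f' z * (2 * s z)^-1).
Proof.
move=> c0 sc sf [f1 f2 [M M0 fT]].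
have sp a b : B a -> B b -> c <= nc (s a + s b).
  move=> Ba Bb; rewrite (le_trans _ (nc_Re _))// (le_trans _ (ler_norm _))// cReD.
  by rewrite ler_wpDl ?sc// (le_trans (ltW c0))// sc.
have s2 a : B a -> c <= nc (2 * s a) by move=> Ba; rewrite mulr_natl mulr2n sp.
have s0 a : B a -> s a != 0.
  by move=> Ba; have := s2 _ Ba; apply: contraTneq => ->; rewrite mulr0 nc0 -ltNge.
have sp0 a b : B a -> B b -> s a + s b != 0.
  by move=> Ba Bb; have := sp _ _ Ba Bb; apply: contraTneq => ->; rewrite nc0 -ltNge.
have sB a b : B a -> B b -> s b - s a = (f b - f a) * (s a + s b)^-1.
  by move=> Ba Bb; rewrite -!sf//; field; rewrite sp0.
have iv a b : B a -> B b -> nc (s a + s b)^-1 <= c^-1.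
  by move=> Ba Bb; rewrite ncV lef_pV2 ?posrE ?sp// (lt_le_trans c0)// sp.
have ci0 : 0 <= c^-1 by rewrite invr_ge0 ltW.
have bs : bdlip s.
  have [N N0 [fN fL]] := f1; exists (1 + N + N * c^-1); first by rewrite !addr_ge0 ?mulr_ge0.
  split=> [a Ba|a b Ba Bb].
    rewrite ler_wpDr ?mulr_ge0//.
    have : nc (s a) ^+ 2 <= N by rewrite -ncX sf// fN.
    have := nc_ge0 (s a); nra.
  rewrite sB// ![leRHS]mulrDl (le_trans _ (_ : N * c^-1 * nc (b - a) <= _))//; last first.
    by rewrite ler_wpDl ?mulr_ge0 ?addr_ge0 ?nc_ge0.
  by rewrite mulrAC nc_mul_le ?fL ?iv.
split => //.
  apply: bdlipM => //; apply: (bdlipV c0) => //; apply: bdlipM => //; exact: bdlip_cst.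
move: f1 f2 bs => [Mf Mf0 [fM fL]] [Mf' Mf'0 [f'M f'L]] [Ms Ms0 [sM sL]].
exists (M * c^-1 + Mf' * (Ms * (c^-1 * c^-1))); first by rewrite !addr_ge0 ?mulr_ge0.
move=> a b Ba Bb; rewrite sB// (_ : _ - _ =
  (f b - f a - f' a * (b - a)) * (s a + s b)^-1
  - (f' a * ((s b - s a) * ((s a + s a)^-1 * (s a + s b)^-1))) * (b - a)); last first.
  by field; rewrite s0// sp0// -mulr2n -mulr_natl mulf_neq0// ?s0// pnatr_eq0.
rewrite (le_trans (ncB_le _ _))// [leRHS]mulrDl lerD//.
  by rewrite mulrAC nc_mul_le ?fT ?iv.
rewrite expr2 [leRHS]mulrA nc_mul_le//.
rewrite -[leRHS]mulrA nc_mul_le ?f'M// [leRHS]mulrAC !nc_mul_le ?sL ?iv//.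
Qed.

Lemma hol2_poly (M : R) (p : {poly R[i]}) : (forall a, B a -> nc a <= M) ->
  hol2 (fun z => p.[z]) (fun z => p^`().[z]).
Proof.
move=> BM.
have hid : hol2 id (fun=> 1).
  split; [|exact: bdlip_cst|].
    exists (Num.max 1 M); first by rewrite le_max ler01.
    split => [a /BM aM|a b _ _]; first by rewrite le_max aM orbT.
    by rewrite ler_peMl ?nc_ge0// le_max lexx.
  by exists 0 => // a b _ _; rewrite mul1r subrr nc0 mul0r.
elim/poly_ind: p => [|p c IH].
  rewrite (_ : (fun z => 0.[z]) = fun=> 0); last by apply/funext => z; rewrite horner0.
  rewrite (_ : (fun z => 0^`().[z]) = fun=> 0); first exact: hol2_cst.
  by apply/funext => z; rewrite deriv0 horner0.
rewrite (_ : (fun z => _.[z]) = fun z => p.[z] * z + c); last by apply/funext => z; rewrite !hornerE.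
rewrite (_ : (fun z => _.[z]) = fun z => p^`().[z] * z + p.[z] * 1 + 0); last first.
  by apply/funext => z; rewrite derivD derivM derivC derivX !hornerE.
apply: hol2D; last exact: hol2_cst.
exact: hol2M.
Qed.

End UniformTaylor.

Section Taylor.
Variable R : realType.

Lemma hol2_sub (A B : set R[i]) f f' : A `<=` B -> hol2 B f f' -> hol2 A f f'.
Proof.
move=> AB [[M M0 [h1 h2]] [N N0 [h3 h4]] [K K0 h5]]; split.
- by exists M => //; split=> *; [apply: h1|apply: h2]; exact: AB.
- by exists N => //; split=> *; [apply: h3|apply: h4]; exact: AB.
- by exists K => // *; apply: h5; exact: AB.
Qed.

Lemma taylor2_cderiv (z0 : R[i]) (r : R) f f' z : taylor2 (cball z0 r) f f' -> cball z0 r z ->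
  cderiv f z (f' z).
Proof.
move=> [M M0 H] zB e e0.
have d0 : 0 < r - nc (z - z0) by rewrite subr_gt0.
exists (Num.min (r - nc (z - z0)) (e / (M + 1))).
  by rewrite lt_min d0 divr_gt0// ltr_wpDl.
move=> k; rewrite lt_min => /andP[k1 k2].
have zk : cball z0 r (z + k).
  rewrite /cball/= addrAC (le_lt_trans (ncD _ _))// -ltrBrDl//.
have := H _ _ zB zk; rewrite (addrC z k) addrK => /le_trans; apply.
rewrite expr2 mulrA ler_wpM2r ?nc_ge0//.
have := ltW k2; rewrite ler_pdivlMr ?ltr_wpDl// => /(le_trans _); apply.
by rewrite mulrC ler_wpM2l ?nc_ge0// lerDl.
Qed.

Lemma bdlip_ccont (z0 : R[i]) (r : R) f z : bdlip (cball z0 r) f -> cball z0 r z -> ccont f z.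
Proof.
move=> [M M0 [_ H]] zB e e0.
have d0 : 0 < r - nc (z - z0) by rewrite subr_gt0.
exists (Num.min (r - nc (z - z0)) (e / (M + 1))).
  by rewrite lt_min d0 divr_gt0// ltr_wpDl.
move=> k; rewrite lt_min => /andP[k1 k2].
have zk : cball z0 r (z + k).
  rewrite /cball/= addrAC (le_lt_trans (ncD _ _))// -ltrBrDl//.
have := H _ _ zB zk; rewrite (addrC z k) addrK => /le_lt_trans; apply.
move: k2; rewrite ltr_pdivlMr ?ltr_wpDl//; apply: le_lt_trans.
by rewrite mulrC ler_wpM2l ?nc_ge0// lerDl.
Qed.

End Taylor.

Section ContinuousCurves.
Variable R : realType.
Implicit Types (f g : R -> R[i]) (A : set R).

Definition ctn f A := forall x, A x -> forall e : R, 0 < e ->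
  exists2 D : R, 0 < D & forall y, A y -> `|y - x| < D -> nc (f y - f x) < e.

Lemma ctn_Re f A : ctn f A -> {within A, continuous (fun t => complex.Re (f t))}.
Proof.
move=> H; apply: eps_within_continuous => x Ax e e0; have [D D0 HD] := H _ Ax _ e0.
by exists D => // y Ay yx; rewrite -cReB (le_lt_trans (nc_Re _))// HD.
Qed.

Lemma ctn_Im f A : ctn f A -> {within A, continuous (fun t => complex.Im (f t))}.
Proof.
move=> H; apply: eps_within_continuous => x Ax e e0; have [D D0 HD] := H _ Ax _ e0.
by exists D => // y Ay yx; rewrite -cImB (le_lt_trans (nc_Im _))// HD.
Qed.

Lemma ctn_cst c A : ctn (fun=> c) A.
Proof. by move=> x _ e e0; exists 1 => // y _ _; rewrite subrr nc0. Qed.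

Lemma ctn_id A : ctn (fun t => t%:C) A.
Proof. by move=> x _ e e0; exists e => // y _; rewrite -rmorphB ncC. Qed.

Lemma ctnD f g A : ctn f A -> ctn g A -> ctn (fun t => f t + g t) A.
Proof.
move=> H1 H2 x Ax e e0.
have e2 : 0 < e / 2 by rewrite divr_gt0.
have [D1 D10 h1] := H1 _ Ax _ e2; have [D2 D20 h2] := H2 _ Ax _ e2.
exists (Num.min D1 D2); first by rewrite lt_min D10.
move=> y Ay; rewrite lt_min => /andP[y1 y2].
rewrite opprD addrACA (le_lt_trans (ncD _ _))//.
by have := h1 _ Ay y1; have := h2 _ Ay y2; lra.
Qed.

Lemma ctnN f A : ctn f A -> ctn (fun t => - f t) A.
Proof.
move=> H1 x Ax e e0; have [D1 D10 h1] := H1 _ Ax _ e0.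
by exists D1 => // y Ay yx; rewrite -opprD ncN h1.
Qed.

Lemma ctnB f g A : ctn f A -> ctn g A -> ctn (fun t => f t - g t) A.
Proof. by move=> cf cg; apply: ctnD => //; exact: ctnN. Qed.

Lemma ctnM f g A : ctn f A -> ctn g A -> ctn (fun t => f t * g t) A.
Proof.
move=> H1 H2 x Ax e e0.
pose a := nc (f x) + 1; pose b := nc (g x) + 1.
have a0 : 0 < a by rewrite ltr_wpDl ?nc_ge0.
have b0 : 0 < b by rewrite ltr_wpDl ?nc_ge0.
have [D1 D10 h1] := H1 _ Ax _ (divr_gt0 (divr_gt0 e0 (ltr0n _ 2)) b0).
have [D2 D20 h2] := H2 _ Ax _ (divr_gt0 (divr_gt0 e0 (ltr0n _ 2)) a0).
have [D3 D30 h3] := H1 _ Ax _ ltr01.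
exists (Num.min D1 (Num.min D2 D3)); first by rewrite !lt_min D10 D20.
move=> y Ay; rewrite !lt_min => /and3P[y1 y2 y3].
rewrite (_ : _ - _ = (f y - f x) * g x + f y * (g y - g x)); last by ring.
have k1 : nc ((f y - f x) * g x) <= (e / 2 / b) * b.
  by apply: nc_mul_le; [exact/ltW/h1|rewrite lerDl].
have k2 : nc (f y * (g y - g x)) < a * (e / 2 / a).
  rewrite ncM; apply: le_lt_trans (_ : a * nc (g y - g x) < _).
    rewrite ler_wpM2r ?nc_ge0// -[f y](subrK (f x)) (le_trans (ncD _ _))//.
    by rewrite addrC lerD2l ltW// h3.
  by rewrite ltr_pM2l// h2.
apply: le_lt_trans (ncD _ _) _.
rewrite divfK ?gt_eqF// in k1; rewrite [ltRHS]mulrC divfK ?gt_eqF// in k2.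
lra.
Qed.

Lemma ctn_comp (f : R[i] -> R[i]) g A : ctn g A -> (forall x, A x -> ccont f (g x)) ->
  ctn (fun t => f (g t)) A.
Proof.
move=> H1 H2 x Ax e e0.
have [D D0 h] := H2 _ Ax _ e0; have [D1 D10 h1] := H1 _ Ax _ D0.
by exists D1 => // y Ay yx; have := h _ (h1 _ Ay yx); rewrite [g x + _]addrC subrK.
Qed.

Lemma ccontV (z : R[i]) : z != 0 -> ccont (fun z => z^-1) z.
Proof.
move=> z0; have c0 : 0 < nc z / 2 by rewrite divr_gt0// nc_gt0.
apply: (@bdlip_ccont _ z (nc z / 2)); last exact: cball_center.
apply: (bdlipV c0).
  move=> a; rewrite /cball/= => az; rewrite ncBC in az.
  by have := ncB_ge z a; lra.
exists (Num.max 1 (nc z + nc z / 2)); first by rewrite le_max ler01.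
split=> [a|a b _ _]; last by rewrite ler_peMl ?nc_ge0// le_max lexx.
rewrite /cball/= => az; rewrite le_max; apply/orP; right.
rewrite -[a](subrK z) (le_trans (ncD _ _))//; lra.
Qed.

Lemma ctnV f A : ctn f A -> (forall x, A x -> f x != 0) -> ctn (fun t => (f t)^-1) A.
Proof. by move=> H1 H2; apply: (ctn_comp H1) => x Ax; apply: ccontV; exact: H2. Qed.

Lemma rderiv_ctn f f' A : (forall t, A t -> rderiv f t (f' t)) -> ctn f A.
Proof.
move=> H x Ax e e0; have [D D0 HD] := rderiv_lip (H _ Ax).
have d0 : 0 < nc (f' x) + 1 by rewrite ltr_wpDl ?nc_ge0.
exists (Num.min D (e / (nc (f' x) + 1))); first by rewrite lt_min D0 divr_gt0.
move=> y _; rewrite lt_min => /andP[y1 y2].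
have := HD _ y1; rewrite [x + _]addrC subrK => /le_lt_trans; apply.
by rewrite mulrC -ltr_pdivlMr.
Qed.

Lemma ctn_sub f A B : A `<=` B -> ctn f B -> ctn f A.
Proof.
move=> AB H x Ax e e0; have [D D0 HD] := H _ (AB _ Ax) _ e0.
by exists D => // y /AB By; exact: HD.
Qed.

End ContinuousCurves.

Section RealIntegral.
Variable R : realType.
Implicit Types (f g : R -> R).

Lemma cont_integrable f (a b : R) : {within `[a, b], continuous f} ->
  lebesgue_measure.-integrable `[a, b] (EFin \o f).
Proof. by move=> cf; apply: continuous_compact_integrable => //; exact: segment_compact. Qed.

Lemma rintB f g (a b : R) : {within `[a, b], continuous f} -> {within `[a, b], continuous g} ->
  rint (fun x => f x - g x) a b = rint f a b - rint g a b.
Proof. by move=> cf cg; rewrite /rint RintegralB//; exact: cont_integrable. Qed.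

Lemma rint_eq f g (a b : R) : (forall x, a <= x <= b -> f x = g x) -> rint f a b = rint g a b.
Proof. by move=> fg; apply: eq_Rintegral => x; rewrite inE/= in_itv/=; exact: fg. Qed.

Lemma rint_bound f (a b c : R) : a <= b -> {within `[a, b], continuous f} ->
  (forall x, a <= x <= b -> `|f x| <= c) -> `|rint f a b| <= c * (b - a).
Proof.
move=> ab cf fc; have fi := cont_integrable cf.
rewrite /rint (le_trans (le_normr_Rintegral _ fi))//.
have -> : c * (b - a) = \int[lebesgue_measure]_(x in `[a, b]) (cst c x).
  by rewrite Rintegral_cst//= lebesgue_measure_itv/= lte_fin; move: ab; rewrite le_eqVlt => /predU1P[->|->]; rewrite ?ltxx ?subrr.
apply: le_Rintegral => //.
- exact: (integrable_norm fi).
- by apply: cont_integrable => x; exact: cvg_cst.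
Qed.

Lemma rderiv_FTC (F f : R -> R[i]) (a b : R) : a <= b ->
  (forall t, a <= t <= b -> rderiv F t (f t)) -> ctn f `[a, b] ->
  rint (fun t => complex.Re (f t)) a b = complex.Re (F b - F a) /\
  rint (fun t => complex.Im (f t)) a b = complex.Im (F b - F a).
Proof.
move=> ab dF cf; rewrite cReB cImB; split.
  apply: (rint_FTC (F := fun t => complex.Re (F t))) => //; last exact: ctn_Re.
  by move=> x xab; apply: rderiv_Re; exact: dF.
apply: (rint_FTC (F := fun t => complex.Im (F t))) => //; last exact: ctn_Im.
by move=> x xab; apply: rderiv_Im; exact: dF.
Qed.

End RealIntegral.

(** * Primitives and their local inversion *)

Section Primitive.
Variables (R : realType) (z0 : R[i]) (rho : R) (h h' : R[i] -> R[i]).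
Hypotheses (rho0 : 0 < rho) (hh : hol2 (cball z0 rho) h h').

Lemma segment_ball (t : R) z : cball z0 rho z -> 0 <= t <= 1 -> cball z0 rho (z0 + t%:C * (z - z0)).
Proof.
rewrite /cball/= => zB /andP[t0 t1]; rewrite addrC addKr ncM ncC ger0_norm//.
by rewrite (le_lt_trans _ zB)// ler_piMl ?nc_ge0.
Qed.

Let seg z (t : R) := h (z0 + t%:C * (z - z0)) * (z - z0).

Lemma ctn_bdlip_seg f z : bdlip (cball z0 rho) f -> cball z0 rho z ->
  ctn (fun t => f (z0 + t%:C * (z - z0))) `[0, 1].
Proof.
move=> bf zB; apply: ctn_comp.
  apply: ctnD; first exact: ctn_cst.
  by apply: ctnM; [exact: ctn_id|exact: ctn_cst].
move=> x; rewrite /= in_itv/= => x01; apply: bdlip_ccont bf _.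
exact: segment_ball.
Qed.

(** [W] integrates [h] along the segment from [z0]. In place of Cauchy's theorem, the first
    variation [phi] of the integrand in the direction k = b - a is recognised as the t-derivative of
    [t k h (z0 + t (a - z0))]; it integrates to [k h a], and what remains is quadratic in k. *)
Lemma primitive_exists : exists2 W, W z0 = 0 & taylor2 (cball z0 rho) W h.
Proof.
have [bh bh' [M M0 HT]] := hh.
have [M' M'0 [h'M _]] := bh'.
have cseg z : cball z0 rho z -> ctn (seg z) `[0, 1].
  by move=> zB; apply: ctnM; [exact: ctn_bdlip_seg|exact: ctn_cst].
pose W z := (rint (fun t => complex.Re (seg z t)) 0 1) +i* (rint (fun t => complex.Im (seg z t)) 0 1).
exists W.
  have s0 t : seg z0 t = 0 by rewrite /seg subrr mulr0.
  rewrite /W; apply: Cext => /=; rewrite (@rint_eq _ _ (fun=> 0)) ?/rint ?Rintegral_cst ?mul0r//.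
    by move=> x _; rewrite s0.
  by move=> x _; rewrite s0.
(* [M * rho] comes from the Taylor remainder of [h], [M'] from the bound on [h']; the factor 2 of
   the witness pays for treating real and imaginary parts separately. *)
pose K := M * rho + M'.
exists (2 * K) => [|a b aB bB]; first by rewrite mulr_ge0// addr_ge0// mulr_ge0// ltW.
pose k := b - a.
pose phi t := k * (h (z0 + t%:C * (a - z0)) + t%:C * (a - z0) * h' (z0 + t%:C * (a - z0))).
have cphi : ctn phi `[0, 1].
  apply: ctnM; first exact: ctn_cst.
  apply: ctnD; first exact: ctn_bdlip_seg.
  apply: ctnM; last exact: ctn_bdlip_seg.
  by apply: ctnM; [exact: ctn_id|exact: ctn_cst].
(* The redundant zeros and ones display the function as a composition of affine maps, as
   [cderiv_line] and [cderiv_affine] expect. *)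
have dphi (t : R) : 0 <= t <= 1 -> rderiv (fun t => (0 + k * (0 + t%:C * 1)) * h (z0 + (a - z0) * (0 + t%:C * 1))) t (phi t).
  move=> t01.
  have -> : phi t = (k * h (z0 + (a - z0) * (0 + t%:C * 1)) +
      (0 + k * (0 + t%:C * 1)) * (h' (z0 + (a - z0) * (0 + t%:C * 1)) * (a - z0))) * 1.
    by rewrite /phi !add0r !mulr1 [_ * t%:C]mulrC; ring.
  apply: (@cderiv_line _ (fun w => (0 + k * w) * h (z0 + (a - z0) * w))).
  apply: cderivM; first exact: cderiv_affine.
  apply: cderiv_comp; last exact: cderiv_affine.
  have [_ _ T] := hh; apply: (taylor2_cderiv T).
  by rewrite add0r mulr1 mulrC; exact: segment_ball.
have phi0 : (0 + k * (0 + (1 : R)%:C * 1)) * h (z0 + (a - z0) * (0 + (1 : R)%:C * 1)) -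
    (0 + k * (0 + (0 : R)%:C * 1)) * h (z0 + (a - z0) * (0 + (0 : R)%:C * 1)) = k * h a.
  by rewrite !mulr1 !add0r (rmorph1 (real_complex R)) (rmorph0 (real_complex R)) !mulr1 mulr0 mul0r subr0 [z0 + _]addrC subrK.
have [Ire Iim] := rderiv_FTC ler01 dphi cphi.
rewrite phi0 in Ire Iim.
pose psi t := seg b t - seg a t - phi t.
have cpsi : ctn psi `[0, 1] by apply: ctnB => //; apply: ctnB; exact: cseg.
have psib t : 0 <= t <= 1 -> nc (psi t) <= K * nc k ^+ 2.
  move=> t01.
  have aS := segment_ball aB t01; have bS := segment_ball bB t01.
  have -> : psi t = (h (z0 + t%:C * (b - z0)) - h (z0 + t%:C * (a - z0)) -
     h' (z0 + t%:C * (a - z0)) * ((z0 + t%:C * (b - z0)) - (z0 + t%:C * (a - z0)))) * (b - z0)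
     + h' (z0 + t%:C * (a - z0)) * (t%:C * (k * k)).
    by rewrite /psi /seg /phi /k; ring.
  rewrite (le_trans (ncD _ _))// [leRHS]mulrDl lerD//; last first.
    rewrite nc_mul_le// ?h'M// !ncM ncC expr2 ler_piMl ?mulr_ge0 ?nc_ge0//.
    by case/andP: t01 => t0 t1; rewrite ger0_norm.
  rewrite [leRHS]mulrAC nc_mul_le//; last exact: ltW.
  apply: (le_trans (HT _ _ aS bS)).
  rewrite ler_wpM2l// (_ : _ - _ = t%:C * k); last by rewrite /k; ring.
  rewrite ncM ncC exprMn ler_piMl ?exprn_ge0 ?nc_ge0//.
  by case/andP: t01 => t0 t1; rewrite ger0_norm// exprn_ile1.
have := rint_bound ler01 (ctn_Re cpsi) (c := K * nc k ^+ 2).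
have := rint_bound ler01 (ctn_Im cpsi) (c := K * nc k ^+ 2).
have cabRe : {within `[0, 1], continuous (fun t => complex.Re (seg b t) - complex.Re (seg a t))}.
  rewrite (_ : (fun _ => _) = fun t => complex.Re (seg b t - seg a t)); last by apply/funext => t; rewrite cReB.
  by apply: ctn_Re; apply: ctnB; exact: cseg.
have EqRe : rint (fun t => complex.Re (psi t)) 0 1 = complex.Re (W b - W a - h a * (b - a)).
  rewrite !cReB /= [h a * _]mulrC -Ire -rintB; try by apply: ctn_Re; exact: cseg.
  rewrite -rintB; [|exact: cabRe|exact: ctn_Re].
  by apply: rint_eq => x _; rewrite !cReB.
have cabIm : {within `[0, 1], continuous (fun t => complex.Im (seg b t) - complex.Im (seg a t))}.
  rewrite (_ : (fun _ => _) = fun t => complex.Im (seg b t - seg a t)); last by apply/funext => t; rewrite cImB.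
  by apply: ctn_Im; apply: ctnB; exact: cseg.
have EqIm : rint (fun t => complex.Im (psi t)) 0 1 = complex.Im (W b - W a - h a * (b - a)).
  rewrite !cImB /= [h a * _]mulrC -Iim -rintB; try by apply: ctn_Im; exact: cseg.
  rewrite -rintB; [|exact: cabIm|exact: ctn_Im].
  by apply: rint_eq => x _; rewrite !cImB.
rewrite EqRe EqIm subr0 mulr1 => hI hR.
rewrite (le_trans (nc_le _))//.
rewrite -mulrA mulr_natl mulr2n lerD//.
  by apply: hR => x x01; rewrite (le_trans (nc_Re _))// psib.
by apply: hI => x x01; rewrite (le_trans (nc_Im _))// psib.
Qed.

End Primitive.

Section Chart.
Variable R : realType.

(** If the infimum were not attained, the positive gap above it would be uniform by compactness, and
    the infimum could be raised. *)
Lemma disc_min (z : R[i]) (d : R) (phi : R[i] -> R) : 0 <= d -> (forall x, 0 <= phi x) ->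
  (forall x, nc (x - z) <= d -> forall e : R, 0 < e -> exists2 D : R, 0 < D &
     forall k, nc k < D -> nc (x + k - z) <= d -> `|phi (x + k) - phi x| < e) ->
  exists2 x, nc (x - z) <= d & forall y, nc (y - z) <= d -> phi x <= phi y.
Proof.
move=> d0 phi0 cphi.
pose A := [set phi x | x in [set x | nc (x - z) <= d]].
have A0 : A !=set0 by exists (phi z), z => //=; rewrite subrr nc0.
have lbA : has_lbound A by exists 0 => _ [x _ <-].
apply: contrapT => H.
have gt x : nc (x - z) <= d -> inf A < phi x.
  move=> xd; rewrite lt_neqAle; apply/andP; split; last by apply: ge_inf => //; exists x.
  apply/negP => /eqP E; apply: H; exists x => // y yd; rewrite -E.
  by apply: ge_inf => //; exists y.
have [r r0 Hr] : exists2 r : R, 0 < r & forall x, nc x <= nc z + d ->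
    (nc (x - z) <= d -> inf A + r <= phi x).
  apply: disc_uniform => [x r r' r'0 r'r h /h|x _].
    by apply: le_trans; rewrite lerD2l.
  have [xd|xd] := leP (nc (x - z)) d.
    have e0 : 0 < (phi x - inf A) / 2 by rewrite divr_gt0// subr_gt0 gt.
    have [D D0 HD] := cphi _ xd _ e0.
    exists D, ((phi x - inf A) / 2); split => // x' xx' x'd.
    have := HD _ xx'; rewrite [x + _]addrC subrK => /(_ x'd); rewrite ltr_norml => /andP[h1 h2]; lra.
  exists (nc (x - z) - d), 1; split => //; first by rewrite subr_gt0.
  move=> x' xx' x'd; have := nc_tri x x' z; rewrite (ncBC x x'); lra.
have : inf A + r <= inf A.
  apply: lb_le_inf => // _ [x /= xd <-]; apply: Hr => //.
  by rewrite -[x](subrK z) (le_trans (ncD _ _))// addrC lerD2l.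
by rewrite gerDl leNgt r0.
Qed.

Lemma chart_exists (z0 : R[i]) (rho : R) h h' : 0 < rho -> hol2 (cball z0 rho) h h' -> h z0 != 0 ->
  exists W rho' r0 m, [/\ [/\ 0 < rho', rho' <= rho, 0 < r0 & 0 < m], taylor2 (cball z0 rho') W h,
    forall a b, cball z0 rho' a -> cball z0 rho' b -> m * nc (b - a) <= nc (W b - W a),
    forall a, cball z0 rho' a -> m <= nc (h a) &
    forall z, cball z0 (rho' / 2) z -> forall w, nc w < r0 ->
      exists2 z', cball z0 rho' z' & W z' = W z + w].
Proof.
move=> rho0 hh h0.
have [W W0 [C C0 WT]] := primitive_exists rho0 hh.
have [[L L0 [_ hL]] _ _] := hh.
have a0 : 0 < nc (h z0) by rewrite nc_gt0.
pose m := nc (h z0) / 2.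
have m0 : 0 < m by rewrite divr_gt0.
(* On this radius [W b - W a] differs from [h z0 * (b - a)] by at most half of |h z0| |b - a|: 2 C
   accounts for the quadratic remainder over the diameter, L for the variation of [h]. *)
pose rho' := Num.min rho (m / (2 * C + L + 1)).
have K0 : 0 < 2 * C + L + 1 by rewrite ltr_wpDl ?addr_ge0 ?mulr_ge0.
have r'0 : 0 < rho' by rewrite lt_min rho0 divr_gt0.
have r'r : rho' <= rho by rewrite ge_min lexx.
have r'K : (2 * C + L) * rho' <= m.
  have : rho' <= m / (2 * C + L + 1) by rewrite ge_min lexx orbT.
  rewrite ler_pdivlMr// => /(le_trans _); apply.
  by rewrite mulrC ler_wpM2l ?(ltW r'0)// lerDl.
have sub : cball z0 rho' `<=` cball z0 rho by move=> x /= /lt_le_trans; exact.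
have hz a : cball z0 rho' a -> nc (h a - h z0) <= L * rho'.
  move=> aB; rewrite (le_trans (hL _ _ _ (sub _ aB)))//; first exact: cball_center.
  by rewrite ler_wpM2l// ltW.
have key a b : cball z0 rho' a -> cball z0 rho' b -> nc (W b - W a - h z0 * (b - a)) <= m * nc (b - a).
  move=> aB bB.
  rewrite (_ : _ - _ = (W b - W a - h a * (b - a)) + (h a - h z0) * (b - a)); last by ring.
  rewrite (le_trans (ncD _ _))// ncM.
  have := WT _ _ (sub _ aB) (sub _ bB).
  have := hz _ aB.
  have : nc (b - a) <= 2 * rho'.
    rewrite (le_trans (nc_tri b z0 a))//; move: aB bB; rewrite /cball/= (ncBC a) => /ltW + /ltW; lra.
  have := nc_ge0 (b - a); have := nc_ge0 (h a - h z0).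
  move: (nc (W b - _ - _)) (nc (b - a)) (nc (h a - h z0)) => X Y Z Z0 Y0 YL ZL XL.
  apply: (le_trans (lerD XL (ler_wpM2r Y0 ZL))).
  apply: (le_trans _ (ler_wpM2r Y0 r'K)).
  rewrite expr2 mulrA -mulrDl ler_wpM2r//.
  by have := ler_wpM2l C0 YL; lra.
have low a b : cball z0 rho' a -> cball z0 rho' b -> m * nc (b - a) <= nc (W b - W a).
  move=> aB bB; have := key _ _ aB bB.
  have := ncB_ge (h z0 * (b - a)) (W b - W a); rewrite (ncBC (h z0 * _)) ncM.
  rewrite (_ : nc (h z0) = 2 * m); last by rewrite /m; field.
  lra.
have hlow a : cball z0 rho' a -> m <= nc (h a).
  move=> aB; have := hz _ aB; have := ncB_ge (h z0) (h a); rewrite (ncBC (h z0)).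
  have : L * rho' <= m.
    apply: le_trans r'K; rewrite ler_wpM2r ?(ltW r'0)// lerDr mulr_ge0//.
  rewrite (_ : nc (h z0) = 2 * m); last by rewrite /m; field.
  lra.
(* The first Newton step from z then has length at most rho' / 4, half the radius [d] of the disc;
   as [T] contracts by one half, it maps the disc to itself. *)
pose r0 := m * rho' / 2.
exists W, rho', r0, m; split => //.
- by split => //; rewrite divr_gt0// mulr_gt0.
- by exists C => // a b aB bB; apply: WT; exact: sub.
move=> z zB w wr.
pose d := rho' / 4 * 2.
have d0 : 0 < d by rewrite mulr_gt0// divr_gt0.
pose T x := x - (W x - W z - w) / h z0.
pose phi x := nc (W x - W z - w).
have dB x : nc (x - z) <= d -> cball z0 rho' x.
  move=> xd; rewrite /cball/= (le_lt_trans (nc_tri x z z0))//.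
  by move: zB; rewrite /cball/=; rewrite /d in xd; lra.
have cphi x : nc (x - z) <= d -> forall e : R, 0 < e -> exists2 D : R, 0 < D &
     forall k, nc k < D -> nc (x + k - z) <= d -> `|phi (x + k) - phi x| < e.
  move=> xd e e0.
  have WT' : taylor2 (cball z0 rho') W h by exists C => // a b aB bB; apply: WT; exact: sub.
  have [D D0 HD] := cderiv_ccont (taylor2_cderiv WT' (dB _ xd)) e0.
  exists D => // k kD _; apply: le_lt_trans (HD _ kD).
  rewrite /phi ler_norml; apply/andP; split.
    rewrite lerNl opprB (le_trans (ncB_ge _ _))// ncBC.
    by rewrite le_eqVlt; apply/orP; left; apply/eqP; congr nc; ring.
  rewrite (le_trans (ncB_ge _ _))//.
  by rewrite le_eqVlt; apply/orP; left; apply/eqP; congr nc; ring.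
have [x xd xmin] := disc_min (ltW d0) (fun x => nc_ge0 _) cphi.
have m2 : nc (h z0) = 2 * m by rewrite /m; field.
have TT a b : cball z0 rho' a -> cball z0 rho' b -> 2 * nc (T b - T a) <= nc (b - a).
  move=> aB bB; have -> : T b - T a = - ((W b - W a - h z0 * (b - a)) / h z0).
    by rewrite /T; field.
  rewrite ncN ncM ncV m2 invfM mulrCA mulVKf// ?pnatr_eq0//.
  by rewrite ler_pdivrMr// [leRHS]mulrC; exact: key.
have TE a : 2 * m * nc (T a - a) = phi a.
  rewrite /T addrAC subrr add0r ncN ncM ncV -m2 mulrCA mulfV ?mulr1//.
  by rewrite nc_eq0.
have zB' : cball z0 rho' z by apply: dB; rewrite subrr nc0 ltW.
have Td : nc (T x - z) <= d.
  have := TT _ _ zB' (dB _ xd); have := nc_tri (T x) (T z) z.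
  have := TE z; rewrite /phi subrr sub0r ncN => Ez.
  have : nc (T z - z) <= d / 2.
    rewrite -(ler_pM2l (_ : 0 < 2 * m)) ?mulr_gt0// Ez (le_trans (ltW wr))//.
    by rewrite /r0 /d; lra.
  lra.
have h2 := TT _ _ (dB _ xd) (dB _ Td).
have h1 : phi x <= phi (T x) := xmin _ Td.
rewrite -!TE in h1.
have p0 : phi x = 0.
  rewrite -TE; have := nc_ge0 (T x - x); move: h1; rewrite ler_pM2l ?mulr_gt0//.
  move=> h1 h4; have -> : nc (T x - x) = 0 by lra.
  by rewrite mulr0.
exists x; first exact: dB.
by apply/eqP; rewrite -subr_eq0 opprD addrA -nc_eq0; apply/eqP.
Qed.

End Chart.

(** * The natural parameter of a quadratic differential *)

Section Charts.
Variable R : realType.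

(* [W] is a primitive of the branch [h] of the square root of [Rq], so that it maps horizontal
   trajectories to horizontal lines. *)
Definition chart (reg : set R[i]) (Rq : R[i] -> R[i]) (z0 : R[i])
    (W h h' : R[i] -> R[i]) (rho r0 m : R) : Prop :=
  [/\ [/\ 0 < rho, 0 < r0 & 0 < m], hol2 (cball z0 rho) h h', taylor2 (cball z0 rho) W h,
    (forall a b, cball z0 rho a -> cball z0 rho b -> m * nc (b - a) <= nc (W b - W a)) &
    [/\ (forall a, cball z0 rho a -> m <= nc (h a)),
      (forall a, cball z0 rho a -> reg a /\ h a ^+ 2 = Rq a) &
      (forall z, cball z0 (rho / 2) z -> forall w, nc w < r0 ->
        exists2 z', cball z0 rho z' & W z' = W z + w)]].

Lemma sqrtc_Re_ge (z : R[i]) : 2^-1 <= complex.Re z -> 2^-1 <= complex.Re (sqrtc z).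
Proof.
case: z => a b /= ab.
have a0 : 0 <= a by apply: le_trans ab; rewrite invr_ge0.
have bb : a <= Num.sqrt (a ^+ 2 + b ^+ 2).
  by rewrite -{1}(ger0_norm a0) -sqrtr_sqr ler_wsqrtr// lerDl sqr_ge0.
have h0 : 0 <= 2^-1 :> R by rewrite invr_ge0.
rewrite -[leLHS](ger0_norm h0) -sqrtr_sqr ler_wsqrtr//.
by rewrite expr2; lra.
Qed.

Variables (Q1 Q2 : {poly R[i]}).
Definition regular : set R[i] := [set z | Q1.[z] != 0 /\ Q2.[z] != 0].
Definition quad (z : R[i]) : R[i] := - (Q1.[z] / Q2.[z]).

(** Since -Q1/Q2 = -(Q1 Q2) / Q2^2, a root of the polynomial [g] divided by [Q2] suffices.
    Normalising to [g / g z0], which is close to 1 near [z0], keeps the principal root away from its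
    cut. *)
Lemma sqrt_exists z0 : regular z0 -> exists rho (h h' : R[i] -> R[i]),
  [/\ 0 < rho, hol2 (cball z0 rho) h h', h z0 != 0 &
    forall z, cball z0 rho z -> regular z /\ h z ^+ 2 = quad z].
Proof.
move=> [Q1z Q2z].
pose g := - (Q1 * Q2).
have g0 : g.[z0] != 0 by rewrite hornerN hornerM oppr_eq0 mulf_neq0.
have bnd (rho : R) : rho <= 1 -> forall a, cball z0 rho a -> nc a <= nc z0 + 1.
  move=> r1 a /= aB; rewrite -[a](subrK z0) (le_trans (ncD _ _))// addrC lerD2l.
  exact/ltW/(lt_le_trans aB).
have [bq _ _] := hol2_poly Q2 (bnd 1 (lexx _)).
have [bg _ _] := hol2_poly g (bnd 1 (lexx _)).
have c1 : cball z0 1 z0 by exact: cball_center.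
have q20 : 0 < nc Q2.[z0] by rewrite nc_gt0.
have g00 : 0 < nc g.[z0] by rewrite nc_gt0.
have [D1 D10 HD1] := bdlip_ccont bq c1 (divr_gt0 q20 (ltr0n _ 2)).
have [D2 D20 HD2] := bdlip_ccont bg c1 (divr_gt0 g00 (ltr0n _ 2)).
pose rho := Num.min 1 (Num.min D1 D2).
have r0 : 0 < rho by rewrite !lt_min ltr01 D10.
have r1 : rho <= 1 by rewrite ge_min lexx.
have qlow a : cball z0 rho a -> nc Q2.[z0] / 2 <= nc Q2.[a].
  rewrite /cball/= !lt_min => /and3P[_ a1 _].
  have := HD1 _ a1; rewrite [z0 + _]addrC subrK; have := ncB_ge Q2.[z0] Q2.[a].
  rewrite (ncBC Q2.[z0] Q2.[a]); lra.
have glow a : cball z0 rho a -> nc (g.[a] - g.[z0]) < nc g.[z0] / 2.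
  by rewrite /cball/= !lt_min => /and3P[_ _ a1]; have := HD2 _ a1; rewrite [z0 + _]addrC subrK.
pose s z := sqrtc (g.[z] / g.[z0]).
have sRe a : cball z0 rho a -> 2^-1 <= complex.Re (s a).
  move=> aB; apply: sqrtc_Re_ge.
  have : nc (g.[a] / g.[z0] - 1) <= 2^-1.
    rewrite (_ : _ - 1 = (g.[a] - g.[z0]) / g.[z0]); last by field.
    rewrite ncM ncV ler_pdivrMr// mulrC; exact/ltW/glow.
  move=> /(le_trans (nc_Re _)); rewrite cReB /= ler_norml => /andP[h _]; lra.
have hq := hol2_poly Q2 (bnd rho r1).
have hg := hol2_poly g (bnd rho r1).
have hs := hol2_sqrt (_ : 0 < 2^-1) sRe (fun a _ => sqr_sqrtc _) (hol2M hg (hol2_cst _ (g.[z0])^-1)).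
have {}hs := hs (ltac:(by rewrite invr_gt0)).
have hqi := hol2V (divr_gt0 q20 (ltr0n _ 2)) qlow hq.
have := hol2M (hol2_cst _ (sqrtc g.[z0])) (hol2M hs hqi).
set h := (fun z => sqrtc g.[z0] * _); set h' := (X in hol2 _ _ X) => hh.
have Q2n a : cball z0 rho a -> Q2.[a] != 0.
  by move=> aB; have := qlow _ aB; apply: contraTneq => ->; rewrite nc0 -ltNge divr_gt0.
have hsq a : cball z0 rho a -> regular a /\ h a ^+ 2 = quad a.
  move=> aB; have q2 := Q2n _ aB.
  have ga : g.[a] != 0.
    have := glow _ aB; apply: contraTneq => ->; rewrite sub0r ncN -leNgt; lra.
  split.
    split => //; apply: contraNneq ga => q1.
    by rewrite hornerN hornerM q1 mul0r oppr0.
  rewrite /h !exprMn !sqr_sqrtc /quad.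
  transitivity (g.[a] / Q2.[a] ^+ 2); first by field; rewrite g0 q2.
  by rewrite hornerN hornerM; field.
exists rho, h, h'; split => //.
have [[q1 _] hz] := hsq _ (cball_center z0 r0).
apply/eqP => h0; move: hz; rewrite h0 expr0n /quad /= => /esym/eqP.
by rewrite oppr_eq0 mulf_eq0 invr_eq0 (negbTE q1) (negbTE Q2z).
Qed.

Lemma quad_chart z0 : regular z0 -> exists W h h' rho r0 m, chart regular quad z0 W h h' rho r0 m.
Proof.
move=> /sqrt_exists[rho [h [h' [rho0 hh hz H]]]].
have [W [rho' [r0 [m [[r'0 r'r r00 m0] WT low hlow surj]]]]] := chart_exists rho0 hh hz.
have sub : cball z0 rho' `<=` cball z0 rho by move=> x /= /lt_le_trans; exact.
exists W, h, h', rho', r0, m; split => //; first exact: hol2_sub hh.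
by split => // a /sub /H.
Qed.

End Charts.

Section Singularities.
Variables (R : realType) (U1 U2 : {poly R[i]}).
Hypotheses (U10 : U1 != 0) (U20 : U2 != 0).

Local Notation g := (gcdp U1 U2).
Local Notation Q1 := (U1 %/ g).
Local Notation Q2 := (U2 %/ g).

Lemma gcd_neq0 : g != 0. Proof. by rewrite gcdp_eq0 (negbTE U10). Qed.
Lemma Q1g : Q1 * g = U1. Proof. by rewrite divpK// dvdp_gcdl. Qed.
Lemma Q2g : Q2 * g = U2. Proof. by rewrite divpK// dvdp_gcdr. Qed.
Lemma Q1_neq0 : Q1 != 0.
Proof. by apply: contraNneq U10 => E; rewrite -Q1g E mul0r. Qed.
Lemma Q2_neq0 : Q2 != 0.
Proof. by apply: contraNneq U20 => E; rewrite -Q2g E mul0r. Qed.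

(** The common factor contributes equally to both multiplicities, and the coprime cofactors never
    vanish together; the multiplicities therefore differ exactly where one cofactor vanishes. *)
Lemma sing_finE z : sing_fin U1 U2 z <-> ~ regular Q1 Q2 z.
Proof.
have cop : coprimep Q1 Q2 by rewrite coprimep_div_gcd// U10.
rewrite /sing_fin -[in mup z U1]Q1g -[in mup z U2]Q2g.
rewrite !mupM ?Q1_neq0 ?Q2_neq0 ?gcd_neq0// eqn_add2r.
have [r1|r1] := boolP (root Q1 z).
  have r2 := coprimep_root cop r1.
  rewrite [mup z Q2]mupNroot; last by rewrite /root.
  rewrite -lt0n -XsubC_dvd ?Q1_neq0// dvdp_XsubCl r1; split => // _ [].
  by rewrite (rootP r1) eqxx.
rewrite [mup z Q1]mupNroot// eq_sym -lt0n -XsubC_dvd ?Q2_neq0// dvdp_XsubCl.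
split=> [r2 [_ /negP]|H]; first by apply.
by apply/negPn/negP => r2; apply: H; split.
Qed.

End Singularities.

Section CcontOps.
Variable R : realType.
Implicit Types (f g : R[i] -> R[i]) (z : R[i]).

Lemma ccont_comp f g z : ccont f (g z) -> ccont g z -> ccont (fun w => f (g w)) z.
Proof.
move=> H1 H2 e e0; have [D D0 HD] := H1 _ e0; have [D1 D10 HD1] := H2 _ D0.
by exists D1 => // k /HD1/HD; rewrite [g z + _]addrC subrK.
Qed.

Lemma ccontM f g z : ccont f z -> ccont g z -> ccont (fun w => f w * g w) z.
Proof.
move=> H1 H2 e e0.
pose a := nc (f z) + 1; pose b := nc (g z) + 1.
have a0 : 0 < a by rewrite ltr_wpDl ?nc_ge0.
have b0 : 0 < b by rewrite ltr_wpDl ?nc_ge0.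
have [D1 D10 h1] := H1 _ (divr_gt0 (divr_gt0 e0 (ltr0n _ 2)) b0).
have [D2 D20 h2] := H2 _ (divr_gt0 (divr_gt0 e0 (ltr0n _ 2)) a0).
have [D3 D30 h3] := H1 _ ltr01.
exists (Num.min D1 (Num.min D2 D3)); first by rewrite !lt_min D10 D20.
move=> k; rewrite !lt_min => /and3P[y1 y2 y3].
rewrite (_ : _ - _ = (f (z + k) - f z) * g z + f (z + k) * (g (z + k) - g z)); last by ring.
have k1 : nc ((f (z + k) - f z) * g z) <= (e / 2 / b) * b.
  by apply: nc_mul_le; [exact/ltW/h1|rewrite lerDl].
have k2 : nc (f (z + k) * (g (z + k) - g z)) < a * (e / 2 / a).
  rewrite ncM; apply: le_lt_trans (_ : a * nc (g (z + k) - g z) < _).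
    rewrite ler_wpM2r ?nc_ge0// -[f (z + k)](subrK (f z)) (le_trans (ncD _ _))//.
    by rewrite addrC lerD2l ltW// h3.
  by rewrite ltr_pM2l// h2.
apply: le_lt_trans (ncD _ _) _.
rewrite divfK ?gt_eqF// in k1; rewrite [ltRHS]mulrC divfK ?gt_eqF// in k2.
lra.
Qed.

Lemma rderivB (f g : R -> R[i]) (t : R) d d' : rderiv f t d -> rderiv g t d' ->
  rderiv (fun s => f s - g s) t (d - d').
Proof.
move=> H1 H2 e e0; have e2 : 0 < e / 2 by rewrite divr_gt0.
have [D1 D10 h1] := H1 _ e2; have [D2 D20 h2] := H2 _ e2.
exists (Num.min D1 D2); first by rewrite lt_min D10.
move=> s; rewrite lt_min => /andP[s1 s2].
rewrite (_ : _ - _ - _ = (f (t + s) - f t - d * s%:C) - (g (t + s) - g t - d' * s%:C)); last by ring.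
by rewrite (le_trans (ncB_le _ _))//; have := h1 _ s1; have := h2 _ s2; lra.
Qed.

Lemma nc_sqr1 (z : R[i]) : z ^+ 2 = 1 -> nc z = 1.
Proof. by move=> E; apply/eqP; rewrite -sqrp_eq1 ?nc_ge0// -ncX E nc1. Qed.

Lemma sqr_eq_sign (x y : R[i]) : x ^+ 2 = y ^+ 2 -> nc (x - y) < 2 * nc y -> x = y.
Proof.
move=> /eqP; rewrite eqf_sqr => /orP[/eqP//|/eqP ->].
rewrite -opprD ncN (_ : y + y = (2 : R)%:C * y).
  by rewrite ncM ncC ger0_norm// ltxx.
by apply: Cext; rewrite ?cReD ?cReM ?cImD ?cImM /=; ring.
Qed.

Lemma sqr_gt0_real (x : R[i]) : 0 < x ^+ 2 -> complex.Im x = 0 /\ complex.Re x != 0.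
Proof.
case: x => a b; rewrite expr2 ltcE /= => /andP[/eqP h1 h2].
have {}h1 : a * b = 0 by lra.
have a0 : a != 0 by apply: contraTneq h2 => ->; rewrite -leNgt; nra.
by split => //; apply/eqP; move/eqP: h1; rewrite mulf_eq0 (negbTE a0).
Qed.

End CcontOps.

Section Flow.
Variable R : realType.
Variables (reg : set R[i]) (Rq : R[i] -> R[i]).

Definition copen (O : set R[i]) := forall w, O w -> exists2 d : R, 0 < d & cball w d `<=` O.
Definition cconvex (O : set R[i]) := forall w w' (t : R), O w -> O w' -> 0 <= t <= 1 ->
  O (w + t%:C * (w' - w)).

(* [F] is a local inverse of a chart: it maps horizontal lines to horizontal trajectories. *)
Definition sol (F F1 : R[i] -> R[i]) (O : set R[i]) := forall w, O w ->
  [/\ reg (F w), cderiv F w (F1 w), ccont F1 w & F1 w ^+ 2 * Rq (F w) = 1].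

Lemma sol_sub F F1 (A B : set R[i]) : A `<=` B -> sol F F1 B -> sol F F1 A.
Proof. by move=> AB H w /AB /H. Qed.

Lemma sol_neq0 F F1 O w : sol F F1 O -> O w -> F1 w != 0.
Proof.
move=> H /H[_ _ _] E; apply/eqP => F10; move: E; rewrite F10 expr0n mul0r => /esym/eqP.
by rewrite oner_eq0.
Qed.

Lemma nc_scale (t : R) (k : R[i]) : 0 <= t <= 1 -> nc (t%:C * k) <= nc k.
Proof. by move=> /andP[t0 t1]; rewrite ncM ncC ger0_norm// ler_piMl ?nc_ge0. Qed.

(** [h (F w) * F1 w] is a continuous function with square 1, hence locally constant; so [W] composed
    with [F] has constant derivative and is affine. *)
Lemma sol_local z0 W h h' rho r0 m F F1 O w : chart reg Rq z0 W h h' rho r0 m ->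
  copen O -> O w -> sol F F1 O -> cball z0 rho (F w) ->
  exists2 d : R, 0 < d & forall k, nc k < d -> [/\ O (w + k), cball z0 rho (F (w + k)),
    h (F (w + k)) * F1 (w + k) = h (F w) * F1 w & W (F (w + k)) = W (F w) + h (F w) * F1 w * k].
Proof.
move=> [[rho0 r00 m0] [bh bh' _] WT low [hlow hreg surj]] Oo Ow S Fw.
have [d0 d00 Od0] := Oo _ Ow.
have [_ dF cF1 _] := S _ Ow.
have eF : 0 < rho - nc (F w - z0) by rewrite subr_gt0.
have [D1 D10 HD1] := cderiv_ccont dF eF.
pose c u := h (F u) * F1 u.
have c2 u : O u -> cball z0 rho (F u) -> c u ^+ 2 = 1.
  by move=> Ou Fu; have [_ _ _] := S _ Ou; rewrite /c exprMn (hreg _ Fu).2 mulrC.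
have cc : ccont c w.
  apply: ccontM => //; apply: ccont_comp; last exact: cderiv_ccont dF.
  exact: bdlip_ccont bh _.
have [D2 D20 HD2] := cc _ (ltr0n R 2).
have c01 : nc (c w) = 1.
  by apply: nc_sqr1; exact: c2.
exists (Num.min d0 (Num.min D1 D2)); first by rewrite !lt_min d00 D10.
move=> k; rewrite !lt_min => /and3P[k0 k1 k2].
have B u : nc u <= nc k -> [/\ O (w + u), cball z0 rho (F (w + u)) & c (w + u) = c w].
  move=> uk.
  have Ou : O (w + u) by apply: Od0; rewrite /cball/= addrC addKr (le_lt_trans uk).
  have Fu : cball z0 rho (F (w + u)).
    rewrite /cball/= (le_lt_trans (nc_tri _ (F w) _))// -ltrBrDr.
    by apply: HD1; rewrite (le_lt_trans uk).
  split => //; apply: sqr_eq_sign; first by rewrite !c2.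
  by rewrite c01 mulr1 HD2// (le_lt_trans uk).
have [Ok Fk ck] := B k (lexx _); split => //.
have := @rderiv_cst0 _ (fun t => W (F (w + t%:C * k)) - (0 + t%:C * (c w * k))) 0 1 ler01.
rewrite (rmorph0 (real_complex R)) (rmorph1 (real_complex R)) !mul0r !addr0 subr0 !mul1r add0r => -> //.
  by rewrite subrK.
move=> t t01; have [Ot Ft ct] := B _ (nc_scale k t01).
rewrite -(subrr (c w * k)); apply: rderivB; last exact: rderiv_affine.
rewrite -ct /c; apply: (@cderiv_line _ (fun u => W (F u))); apply: (@cderiv_comp _ W F).
  exact: taylor2_cderiv WT _.
by have [] := S _ Ot.
Qed.

Hypothesis chartP : forall z0, reg z0 -> exists W h h' rho r0 m, chart reg Rq z0 W h h' rho r0 m.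

Lemma chart_inj z0 W h h' rho r0 m a b : chart reg Rq z0 W h h' rho r0 m ->
  cball z0 rho a -> cball z0 rho b -> W a = W b -> a = b.
Proof.
move=> [[_ _ m0] _ _ low _] aB bB E; have := low _ _ aB bB.
rewrite E subrr nc0 pmulr_rle0// => hle.
by apply/eqP; rewrite eq_sym -subr_eq0 -nc_eq0 eq_le hle nc_ge0.
Qed.

Lemma ccont_neq f (g : R[i] -> R[i]) w : ccont f w -> ccont g w -> f w != g w ->
  exists2 d : R, 0 < d & forall k, nc k < d -> f (w + k) != g (w + k).
Proof.
move=> cf cg fg.
have e0 : 0 < nc (f w - g w) / 2 by rewrite divr_gt0// nc_gt0 subr_eq0.
have [D1 D10 h1] := cf _ e0; have [D2 D20 h2] := cg _ e0.
exists (Num.min D1 D2); first by rewrite lt_min D10.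
move=> k; rewrite lt_min => /andP[k1 k2]; apply/eqP => E.
have := h1 _ k1; have := h2 _ k2; rewrite E.
have := nc_tri (f w) (g (w + k)) (g w); rewrite (ncBC (f w) (g (w + k))).
lra.
Qed.

(** Along the segment from [w0] to [w], agreement of values and derivatives persists because both
    solutions become the same affine map in a chart, and disagreement persists by continuity. *)
Lemma sol_unique F F1 G G1 O w0 w : copen O -> cconvex O -> sol F F1 O -> sol G G1 O ->
  O w0 -> O w -> F w0 = G w0 -> F1 w0 = G1 w0 -> F w = G w /\ F1 w = G1 w.
Proof.
move=> Oo Oc SF SG Ow0 Ow E0 E1.
pose P (t : R) := F (w0 + t%:C * (w - w0)) = G (w0 + t%:C * (w - w0)) /\
   F1 (w0 + t%:C * (w - w0)) = G1 (w0 + t%:C * (w - w0)).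
suff : P 1 by rewrite /P (rmorph1 (real_complex R)) mul1r [w0 + _]addrC subrK.
apply: (@locally_constant_01 _ P); last by rewrite /P (rmorph0 (real_complex R)) mul0r addr0.
move=> t t01; pose u := w0 + t%:C * (w - w0).
have Ou : O u by exact: Oc.
have near d : 0 < d -> exists2 e : R, 0 < e & forall s, 0 <= s <= 1 -> `|s - t| < e ->
    exists2 k, nc k < d & w0 + s%:C * (w - w0) = u + k.
  move=> d0; exists (d / (nc (w - w0) + 1)).
    by rewrite divr_gt0// ltr_wpDl ?nc_ge0.
  move=> s _; rewrite ltr_pdivlMr ?ltr_wpDl ?nc_ge0// => st.
  exists ((s - t)%:C * (w - w0)); last by rewrite /u (rmorphB (real_complex R)); ring.
  rewrite ncM ncC (le_lt_trans _ st)// ler_wpM2l// lerDl//.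
have [rF dF cF1 _] := SF _ Ou; have [rG dG cG1 _] := SG _ Ou.
have [[EF EF1]|N] := pselect (P t).
  have [W [h [h' [rho [r0 [m C]]]]]] := chartP rF.
  have [[rho0 r00 m0] _ _ _ [hlow _ _]] := C.
  have FB : cball (F u) rho (F u) by exact: cball_center.
  have GB : cball (F u) rho (G u) by rewrite -EF.
  have [d1 d10 L1] := sol_local C Oo Ou SF FB.
  have [d2 d20 L2] := sol_local C Oo Ou SG GB.
  have d0 : 0 < Num.min d1 d2 by rewrite lt_min d10.
  have [e e0 He] := near _ d0.
  exists e => // s s01 /(He _ s01) [k kd Ek]; split => // _.
  rewrite /P Ek; move: kd; rewrite lt_min => /andP[k1 k2].
  have [_ B1 s1 W1] := L1 _ k1; have [_ B2 s2 W2] := L2 _ k2.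
  have FG : F (u + k) = G (u + k) by apply: (chart_inj C) => //; rewrite W1 W2 EF EF1.
  split => //; have hn : h (F (u + k)) != 0 by rewrite -nc_gt0 (lt_le_trans m0)// hlow.
  by apply: (mulfI hn); rewrite s1 [in RHS]FG s2 EF EF1.
have [d d0 Hd] : exists2 d : R, 0 < d & forall k, nc k < d ->
    ~ (F (u + k) = G (u + k) /\ F1 (u + k) = G1 (u + k)).
  have [EF|NF] := eqVneq (F u) (G u).
    have [EF1|NF1] := eqVneq (F1 u) (G1 u); first by exfalso; apply: N.
    have [d d0 Hd] := ccont_neq cF1 cG1 NF1.
    by exists d => // k /Hd /eqP + [].
  have [d d0 Hd] := ccont_neq (cderiv_ccont dF) (cderiv_ccont dG) NF.
  by exists d => // k /Hd /eqP + [].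
have [e e0 He] := near _ d0.
exists e => // s s01 /(He _ s01) [k kd Ek]; split => // Ps.
by exfalso; apply: (Hd _ kd); rewrite -Ek.
Qed.

(** The solution inverts [W] along [W z + s w], where [s = h z * v] is a sign. Its disc of existence
    has the radius [r0] of the chart, independent of z and v; continuation along a trajectory rests
    on this uniformity. *)
Lemma chart_flow z0 W h h' rho r0 m z v : chart reg Rq z0 W h h' rho r0 m ->
  cball z0 (rho / 2) z -> v ^+ 2 * Rq z = 1 ->
  exists F F1, [/\ sol F F1 (cball 0 r0), F 0 = z, F1 0 = v &
    forall w, cball 0 r0 w -> cball z0 rho (F w) /\ W (F w) = W z + h z * v * w].
Proof.
move=> C zB v2.
have [[rho0 r00 m0] [bh bh' _] WT low [hlow hreg surj]] := C.
have zB' : cball z0 rho z.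
  by rewrite /cball/= (lt_trans zB)// ltr_pdivrMr// ltr_pMr// ltr1n.
pose s := h z * v.
have s2 : s ^+ 2 = 1 by rewrite exprMn (hreg _ zB').2 mulrC.
have s1 := nc_sqr1 s2.
have ex w : exists z', cball 0 r0 w -> cball z0 rho z' /\ W z' = W z + s * w.
  have [wB|?] := pselect (cball 0 r0 w); last by exists 0.
  have sw : nc (s * w) < r0 by rewrite ncM s1 mul1r -[w]subr0.
  by have [z' z'B E] := surj _ zB _ sw; exists z'.
pose F w := projT1 (cid (ex w)).
have FP w : cball 0 r0 w -> cball z0 rho (F w) /\ W (F w) = W z + s * w.
  by rewrite /F; case: (cid (ex w)).
have hn a : cball z0 rho a -> h a != 0.
  by move=> aB; rewrite -nc_gt0 (lt_le_trans m0)// hlow.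
have r0c w : cball 0 r0 w -> exists2 D : R, 0 < D & forall k, nc k < D -> cball 0 r0 (w + k).
  rewrite /cball/= subr0 => wr; exists (r0 - nc w); first by rewrite subr_gt0.
  by move=> k kD; rewrite subr0 (le_lt_trans (ncD _ _))// -ltrBrDl.
have FL w k : cball 0 r0 w -> cball 0 r0 (w + k) -> nc (F (w + k) - F w) <= nc k / m.
  move=> wB wkB; have [B1 W1] := FP _ wB; have [B2 W2] := FP _ wkB.
  rewrite ler_pdivlMr// mulrC (le_trans (low _ _ B1 B2))// W1 W2.
  by rewrite opprD addrACA subrr add0r -mulrBr addrAC subrr add0r ncM s1 mul1r.
have F0 : F 0 = z.
  have [B1 W1] := FP _ (cball_center 0 r00).
  by apply: (chart_inj C) => //; rewrite W1 mulr0 addr0.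
exists F, (fun w => s / h (F w)); split => //; last 1 first.
- by rewrite F0 /s mulrC mulKf// hn.
move=> w wB; have [B1 W1] := FP _ wB; have [D D0 HD] := r0c _ wB.
have cF : ccont F w.
  move=> e e0; exists (Num.min D (e * m)); first by rewrite lt_min D0 mulr_gt0.
  move=> k; rewrite lt_min => /andP[k1 k2]; rewrite (le_lt_trans (FL _ _ wB (HD _ k1)))//.
  by rewrite ltr_pdivrMr.
split.
- by have [] := hreg _ B1.
- have [K K0 HT] := WT.
  (* The remainder of [W] is at most K (|k| / m)^2, and dividing by |h| >= m costs one more factor
     m. *)
  move=> e e0; exists (Num.min D (e * m ^+ 3 / (K + 1))).
    by rewrite lt_min D0 divr_gt0 ?mulr_gt0 ?exprn_gt0// ltr_wpDl.
  move=> k; rewrite lt_min => /andP[k1 k2].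
  have [B2 W2] := FP _ (HD _ k1).
  have L := FL _ _ wB (HD _ k1).
  have := HT _ _ B1 B2; rewrite W1 W2.
  rewrite (_ : _ - _ - _ = - (h (F w) * (F (w + k) - F w - s / h (F w) * k))); last first.
    by field; exact: hn.
  rewrite ncN ncM => T.
  rewrite -(ler_pM2l m0) (le_trans (_ : _ <= nc (h (F w)) * nc (F (w + k) - F w - s / h (F w) * k)))//.
    by rewrite ler_wpM2r ?nc_ge0// hlow.
  rewrite (le_trans T)// (le_trans (_ : _ <= K * (nc k / m) ^+ 2))//.
    by rewrite ler_wpM2l// lerXn2r ?nnegrE ?nc_ge0 ?divr_ge0 ?nc_ge0 ?(ltW m0).
  move/ltW: k2; rewrite ler_pdivlMr ?ltr_wpDl// => k2.
  have k20 : nc k * K <= e * m ^+ 3.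
    by apply: le_trans k2; rewrite ler_wpM2l ?nc_ge0// lerDl.
  rewrite exprMn exprVn mulrA ler_pdivrMr ?exprn_gt0//.
  have := ler_wpM2r (nc_ge0 k) k20.
  by rewrite expr2 !exprS expr0 !mulr1; lra.
- apply: ccontM.
    by move=> e e0; exists 1 => // k _; rewrite subrr nc0.
  apply: (@ccont_comp _ (fun x => (h x)^-1) F) => //.
  exact: bdlip_ccont (bdlipV m0 hlow bh) _.
- rewrite expr_div_n s2 -(hreg _ B1).2 mul1r mulVf// expf_neq0// hn//.
Qed.

End Flow.

Section SolutionOps.
Variable R : realType.
Variables (reg : set R[i]) (Rq : R[i] -> R[i]).

Local Notation sol := (sol reg Rq).

Lemma ccont_affine (c s : R[i]) z : ccont (fun w => c + s * w) z.
Proof. exact: cderiv_ccont (cderiv_affine c s z). Qed.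

Lemma ccont_cst (c : R[i]) z : ccont (fun=> c) z.
Proof. by move=> e e0; exists 1 => // k _; rewrite subrr nc0. Qed.

Lemma sol_affine F F1 O (c s : R[i]) : s ^+ 2 = 1 -> sol F F1 O ->
  sol (fun w => F (c + s * w)) (fun w => F1 (c + s * w) * s) [set w | O (c + s * w)].
Proof.
move=> s2 S w Ow; have [rF dF cF1 E] := S _ Ow; split => //.
- by apply: (@cderiv_comp _ F) => //; exact: cderiv_affine.
- apply: ccontM; last exact: ccont_cst.
  by apply: ccont_comp => //; exact: ccont_affine.
- by rewrite exprMn s2 mulr1.
Qed.

Lemma copen_affine O (c s : R[i]) : copen O -> nc s = 1 -> copen [set w | O (c + s * w)].
Proof.
move=> Oo s1 w Ow; have [d d0 H] := Oo _ Ow; exists d => // w' ww'; apply: H.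
rewrite /cball/= (_ : _ - _ = s * (w' - w)); last by ring.
by rewrite ncM s1 mul1r.
Qed.

Lemma cconvex_affine O (c s : R[i]) : cconvex O -> cconvex [set w | O (c + s * w)].
Proof.
move=> Oc w w' t Ow Ow' t01 /=.
rewrite (_ : c + _ = c + s * w + t%:C * (c + s * w' - (c + s * w))); last by ring.
exact: Oc.
Qed.

Lemma copenI (A B : set R[i]) : copen A -> copen B -> copen (A `&` B).
Proof.
move=> Ao Bo w [/Ao[d d0 H] /Bo[d' d'0 H']]; exists (Num.min d d'); first by rewrite lt_min d0.
by move=> w'; rewrite /cball/= lt_min => /andP[h1 h2]; split; [apply: H|apply: H'].
Qed.

Lemma cconvexI (A B : set R[i]) : cconvex A -> cconvex B -> cconvex (A `&` B).
Proof. by move=> Ac Bc w w' t [? ?] [? ?] t01; split; [apply: Ac|apply: Bc]. Qed.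

Lemma copen_cball z (r : R) : copen (cball z r).
Proof.
move=> w wB; exists (r - nc (w - z)); first by rewrite subr_gt0.
by apply: cball_subset; rewrite addrC subrK.
Qed.

Lemma cconvex_cball z (r : R) : cconvex (cball z r).
Proof.
move=> w w' t; rewrite /cball/= => wB w'B /andP[t0 t1].
rewrite (_ : _ - z = (1 - t)%:C * (w - z) + t%:C * (w' - z)); last first.
  by rewrite (rmorphB (real_complex R)) (rmorph1 (real_complex R)); ring.
rewrite (le_lt_trans (ncD _ _))// !ncM !ncC !ger0_norm ?subr_ge0//.
have [->|tn0] := eqVneq t 0; first by rewrite subr0 mul1r mul0r addr0.
have tp : 0 < t by rewrite lt_neqAle eq_sym tn0.
rewrite (le_lt_trans (lerD (ler_wpM2l _ (ltW wB)) (lexx _))) ?subr_ge0//.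
by rewrite -[ltRHS]mul1r -[X in X * r](subrK t 1) [ltRHS]mulrDl ltrD2l ltr_pM2l.
Qed.

Definition crect (l eta : R) : set R[i] := [set w | `|complex.Re w| < l /\ `|complex.Im w| < eta].
Definition strip (r : R) : set R[i] := [set w | `|complex.Im w| < r].

Lemma copen_strip (r : R) : copen (strip r).
Proof.
move=> w wS; exists (r - `|complex.Im w|); first by rewrite subr_gt0.
move=> w'; rewrite /cball/strip/= => /(le_lt_trans (nc_Im _)); rewrite cImB => h.
have := ler_normB (complex.Im w') (- complex.Im w); rewrite opprK normrN.
rewrite -[complex.Im w'](subrK (complex.Im w)) => _.
by rewrite (le_lt_trans (ler_normD _ _))// -ltrBrDr.
Qed.

Lemma convex_abs (a b t r : R) : `|a| < r -> `|b| < r -> 0 <= t <= 1 -> `|a + t * (b - a)| < r.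
Proof.
rewrite !ltr_norml => /andP[a1 a2] /andP[b1 b2] /andP[t0 t1].
have E : a + t * (b - a) = (1 - t) * a + t * b by ring.
rewrite E; apply/andP; split.
  have [->|tn0] := eqVneq t 0; first by lra.
  have tp : 0 < t by rewrite lt_neqAle eq_sym tn0.
  by nra.
have [->|tn0] := eqVneq t 0; first by lra.
have tp : 0 < t by rewrite lt_neqAle eq_sym tn0.
by nra.
Qed.

Lemma Im_seg (t : R) (w w' : R[i]) : complex.Im (w + t%:C * (w' - w)) =
  complex.Im w + t * (complex.Im w' - complex.Im w).
Proof. by rewrite cImD cImM cImB /=; ring. Qed.
Lemma Re_seg (t : R) (w w' : R[i]) : complex.Re (w + t%:C * (w' - w)) =
  complex.Re w + t * (complex.Re w' - complex.Re w).
Proof. by rewrite cReD cReM cReB /=; ring. Qed.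

Lemma cconvex_strip (r : R) : cconvex (strip r).
Proof. by move=> w w' t; rewrite /strip/= Im_seg => *; exact: convex_abs. Qed.

Lemma cconvex_crect (l r : R) : cconvex (crect l r).
Proof.
by move=> w w' t [? ?] [? ?] t01; split; rewrite ?Im_seg ?Re_seg; exact: convex_abs.
Qed.

Lemma copen_crect (l r : R) : copen (crect l r).
Proof.
move=> w [wl wr]; exists (Num.min (l - `|complex.Re w|) (r - `|complex.Im w|)).
  by rewrite lt_min !subr_gt0 wl.
move=> w'; rewrite /cball/= lt_min => /andP[h1 h2]; split.
  rewrite -[complex.Re w'](subrK (complex.Re w)) (le_lt_trans (ler_normD _ _))// -ltrBrDr.
  by rewrite -cReB (le_lt_trans (nc_Re _)).
rewrite -[complex.Im w'](subrK (complex.Im w)) (le_lt_trans (ler_normD _ _))// -ltrBrDr.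
by rewrite -cImB (le_lt_trans (nc_Im _)).
Qed.

Lemma cderiv_near (f g : R[i] -> R[i]) w d : (exists2 D : R, 0 < D & forall k, nc k < D -> f (w + k) = g (w + k)) ->
  cderiv g w d -> cderiv f w d.
Proof.
move=> [D D0 E] H e e0; have [D1 D10 HD] := H _ e0.
exists (Num.min D D1); first by rewrite lt_min D0.
move=> k; rewrite lt_min => /andP[k1 k2].
have := E 0; rewrite addr0 nc0 => ->//.
by rewrite E// HD.
Qed.

Lemma ccont_near (f g : R[i] -> R[i]) w : (exists2 D : R, 0 < D & forall k, nc k < D -> f (w + k) = g (w + k)) ->
  ccont g w -> ccont f w.
Proof.
move=> [D D0 E] H e e0; have [D1 D10 HD] := H _ e0.
exists (Num.min D D1); first by rewrite lt_min D0.
move=> k; rewrite lt_min => /andP[k1 k2].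
have := E 0; rewrite addr0 nc0 => ->//.
by rewrite E// HD.
Qed.

Lemma sol_glue (T : Type) (P : T -> Prop) (G G1 : T -> R[i] -> R[i]) (O : T -> set R[i]) :
  (forall j, P j -> copen (O j) /\ sol (G j) (G1 j) (O j)) ->
  (forall i j w, P i -> P j -> O i w -> O j w -> G i w = G j w /\ G1 i w = G1 j w) ->
  exists F F1, sol F F1 [set w | exists2 j, P j & O j w] /\
    forall j w, P j -> O j w -> F w = G j w /\ F1 w = G1 j w.
Proof.
move=> H1 H2.
have ex w : exists zz : R[i] * R[i], forall j, P j -> O j w -> zz.1 = G j w /\ zz.2 = G1 j w.
  have [[j Pj Oj]|N] := pselect (exists2 j, P j & O j w).
    by exists (G j w, G1 j w) => i Pi Oi; exact: H2.
  by exists (0, 0) => j Pj Oj; exfalso; apply: N; exists j.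
pose F w := (projT1 (cid (ex w))).1; pose F1 w := (projT1 (cid (ex w))).2.
have FE j w : P j -> O j w -> F w = G j w /\ F1 w = G1 j w.
  by rewrite /F /F1; case: (cid (ex w)) => zz /= H Pj Oj; exact: H.
exists F, F1; split => // w [j Pj Oj].
have [Oo S] := H1 _ Pj; have [rG dG cG1 E] := S _ Oj.
have [d d0 Hd] := Oo _ Oj.
have near k : nc k < d -> O j (w + k) by move=> kd; apply: Hd; rewrite /cball/= addrC addKr.
have [-> ->] := FE _ _ Pj Oj; split => //.
  by apply: cderiv_near dG; exists d => // k /near /(FE _ _ Pj)[].
by apply: ccont_near cG1; exists d => // k /near /(FE _ _ Pj)[].
Qed.

Hypothesis chartP : forall z0, reg z0 -> exists W h h' rho r0 m, chart reg Rq z0 W h h' rho r0 m.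

(* If the derivatives were opposite, [F (w1 + w2 - w)] would be the same solution and
   [F1] would vanish at the midpoint. *)
Lemma sol_same_point F F1 O w1 w2 : copen O -> cconvex O -> sol F F1 O -> O w1 -> O w2 ->
  F w1 = F w2 -> F1 w1 = F1 w2.
Proof.
move=> Oo Oc S O1 O2 E.
have [r1 _ _ e1] := S _ O1; have [_ _ _ e2] := S _ O2.
have q0 : Rq (F w1) != 0.
  by apply: contra_eq_neq e1 => ->; rewrite mulr0 eq_sym oner_eq0.
have : F1 w1 ^+ 2 = F1 w2 ^+ 2 by apply: (mulIf q0); rewrite e1 E e2.
move=> /eqP; rewrite eqf_sqr => /orP[/eqP//|/eqP E1]; exfalso.
pose c := w1 + w2.
have n1 : (-1 : R[i]) ^+ 2 = 1 by rewrite sqrrN expr1n.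
have nn : nc (-1 : R[i]) = 1 by rewrite ncN nc1.
pose O' := O `&` [set w | O (c + -1 * w)].
have O'o : copen O' by apply: copenI => //; exact: copen_affine.
have O'c : cconvex O' by apply: cconvexI => //; exact: cconvex_affine.
have S1 : sol F F1 O' by apply: sol_sub S => w [].
have S2 := sol_sub (_ : O' `<=` _) (sol_affine (c := c) n1 S).
have {}S2 := S2 (fun w => @proj2 _ _).
have cw1 : c + -1 * w1 = w2 by rewrite /c; ring.
pose mid := w1 + (2^-1 : R)%:C * (w2 - w1).
have t01 : 0 <= (2^-1 : R) <= 1 by rewrite invr_ge0 ler0n invf_le1// ler1n.
have Om : O mid by exact: Oc.
have cm : c + -1 * mid = mid.
  rewrite /mid /c; have : (2^-1 : R)%:C + (2^-1 : R)%:C = 1.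
    by rewrite -(rmorphD (real_complex R)) -(rmorph1 (real_complex R)); congr (_ %:C); lra.
  move=> h; apply/eqP; rewrite -subr_eq0.
  rewrite (_ : _ - _ = (1 - ((2^-1)%:C + (2^-1)%:C)) * (w2 - w1)); last by ring.
  by rewrite h subrr mul0r.
have O'1 : O' w1 by split => //=; rewrite cw1.
have O'm : O' mid by split => //=; rewrite cm.
have [| |_ /eqP] := sol_unique chartP O'o O'c S1 S2 O'1 O'm.
- by rewrite cw1 E.
- by rewrite cw1 E1 mulrN1.
rewrite cm mulrN1 -subr_eq0 opprK -mulr2n -mulr_natr mulf_eq0.
rewrite (negbTE (sol_neq0 S Om)) /= => /eqP two0.
have : nc (2 : R[i]) = 0 by rewrite two0 nc0.
have -> : (2 : R[i]) = (2 : R)%:C by rewrite (rmorphMn (real_complex R) 2 1) (rmorph1 (real_complex R)).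
by rewrite ncC => /eqP; rewrite normr_eq0 pnatr_eq0.
Qed.

(** [sol_same_point] turns the coincidence of two values into a coincidence of derivatives, so
    uniqueness compares [F] with its translate on the intersection of their domains. *)
Lemma sol_translate F F1 O w1 w2 w : copen O -> cconvex O -> sol F F1 O -> O w1 -> O w2 ->
  F w1 = F w2 -> O w -> O (w + (w2 - w1)) ->
  F (w + (w2 - w1)) = F w /\ F1 (w + (w2 - w1)) = F1 w.
Proof.
move=> Oo Oc S O1 O2 E Ow Ow'.
pose c := w2 - w1.
have n1 : (1 : R[i]) ^+ 2 = 1 by rewrite expr1n.
pose O' := O `&` [set w | O (c + 1 * w)].
have O'o : copen O' by apply: copenI => //; apply: copen_affine => //; exact: nc1.
have O'c : cconvex O' by apply: cconvexI => //; exact: cconvex_affine.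
have S1 : sol F F1 O' by apply: sol_sub S => v [].
have S2 := sol_sub (_ : O' `<=` _) (sol_affine (c := c) n1 S).
have {}S2 := S2 (fun w => @proj2 _ _).
have cw1 : c + 1 * w1 = w2 by rewrite /c; ring.
have cw : c + 1 * w = w + (w2 - w1) by rewrite /c; ring.
have O'1 : O' w1 by split => //=; rewrite cw1.
have O'w : O' w by split => //=; rewrite cw.
have [| |] := sol_unique chartP O'o O'c S1 S2 O'1 O'w.
- by rewrite cw1 E.
- by rewrite cw1 mulr1; exact: (sol_same_point Oo Oc S).
- by rewrite cw mulr1.
Qed.

Lemma flow_uniform (K : set R[i]) (M : R) : (forall z, K z -> nc z <= M) ->
  (forall z, ~ K z -> exists2 e : R, 0 < e & forall z', nc (z' - z) < e -> ~ K z') ->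
  K `<=` reg -> exists2 r : R, 0 < r & forall z v, K z -> v ^+ 2 * Rq z = 1 ->
    exists F F1, [/\ sol F F1 (cball 0 r), F 0 = z & F1 0 = v].
Proof.
move=> KM Kc Kr.
have [r r0 Hr] : exists2 r : R, 0 < r & forall z, nc z <= M -> K z -> forall v, v ^+ 2 * Rq z = 1 ->
    exists F F1, [/\ sol F F1 (cball 0 r), F 0 = z & F1 0 = v].
  apply: disc_uniform => [z r r' r'0 r'r H Kz v v2|z _].
    have [F [F1 [S F0 F10]]] := H Kz _ v2; exists F, F1; split => //.
    by apply: sol_sub S => w /= /lt_le_trans; exact.
  have [Kz|nKz] := pselect (K z).
    have [W [h [h' [rho [r0 [m C]]]]]] := chartP (Kr _ Kz).
    have [[rho0 r00 m0] _ _ _ _] := C.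
    exists (rho / 2), r0; split; rewrite ?divr_gt0// => z' zz' _ v v2.
    have [F [F1 [S F0 F10 _]]] := chart_flow C zz' v2.
    by exists F, F1.
  have [e e0 He] := Kc _ nKz.
  by exists e, 1; split => // z' /He.
by exists r => // z v Kz; apply: Hr => //; exact: KM.
Qed.

End SolutionOps.

(** * Trajectories and solutions on strips *)

Section StripExistence.
Variable R : realType.
Variables (reg : set R[i]) (Rq : R[i] -> R[i]).

Local Notation sol := (sol reg Rq).

Definition harc (g : R -> R[i]) (I : set R) := forall t, I t ->
  exists d, [/\ rderiv g t d, reg (g t) & 0 < Rq (g t) * d ^+ 2].

(* The form in which [p] lying off [K_Psi] is used. *)
Definition bounded_arcs (p : R[i]) := reg p /\
  forall (I : set R) (g : R -> R[i]), open I -> is_interval I -> I 0 -> harc g I -> g 0 = p ->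
    (forall s, ~ reg s -> exists2 e : R, 0 < e & forall t, I t -> e <= nc (g t - s)) /\
    (exists M : R, forall t, I t -> nc (g t) <= M).

Hypothesis chartP : forall z0, reg z0 -> exists W h h' rho r0 m, chart reg Rq z0 W h h' rho r0 m.
Hypothesis finP : exists L : seq R[i], forall s, ~ reg s -> s \in L.

Lemma sol_arc F F1 O : sol F F1 O -> harc (fun x => F x%:C) [set x | O x%:C].
Proof.
move=> S t /S[rF dF _ E]; exists (F1 t%:C); split => //; last by rewrite mulrC E ltr01.
have := @cderiv_line _ F 0 1 t (F1 t%:C); rewrite add0r mulr1 => /(_ dF).
by rewrite mulr1; under eq_fun do rewrite add0r mulr1.
Qed.

(** Discs of the fixed radius r around all points of the central segment are glued. They cover a
    longer rectangle whose height depends on r only, so that repeated extension does not shrink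
    it. *)
Lemma sol_extend G G1 (l eta r : R) : 0 < l -> 0 < eta -> 0 < r -> sol G G1 (crect l eta) ->
  (forall x : R, `|x| < l -> exists B B1, [/\ sol B B1 (cball 0 r), B 0 = G x%:C & B1 0 = G1 x%:C]) ->
  exists F F1, [/\ sol F F1 (crect (l + r / 2) (r / 4)), F 0 = G 0 & F1 0 = G1 0].
Proof.
move=> l0 eta0 r0 S Hb.
pose T := (R * ((R[i] -> R[i]) * (R[i] -> R[i])))%type.
pose P (j : T) := [/\ `|j.1| < l, sol j.2.1 j.2.2 (cball 0 r), j.2.1 0 = G (j.1)%:C & j.2.2 0 = G1 (j.1)%:C].
pose H (j : T) w := j.2.1 (- (j.1)%:C + 1 * w).
pose H1 (j : T) w := j.2.2 (- (j.1)%:C + 1 * w) * 1.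
pose O (j : T) := [set w | cball 0 r (- (j.1)%:C + 1 * w)].
have n1 : (1 : R[i]) ^+ 2 = 1 by rewrite expr1n.
have Oo j : copen (O j) by apply: copen_affine; [exact: copen_cball|exact: nc1].
have Oc j : cconvex (O j) by apply: cconvex_affine; exact: cconvex_cball.
have SH j : P j -> sol (H j) (H1 j) (O j).
  by case=> _ Sj _ _; exact: (sol_affine (c := - (j.1)%:C) n1 Sj).
have crx (x : R) : `|x| < l -> crect l eta x%:C by move=> xl; split; rewrite /= ?normr0.
have Ox j : O j (j.1)%:C by rewrite /O /= mul1r addNr; exact: cball_center.
have agree j (y : R) : P j -> `|y| < l -> `|y - j.1| < r -> H j y%:C = G y%:C /\ H1 j y%:C = G1 y%:C.
  move=> Pj yl yr; have [jl Sj E0 E1] := Pj.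
  have Oy : O j y%:C.
    by rewrite /O /cball/= mul1r subr0 addrC -(rmorphB (real_complex R)) ncC.
  apply: (@sol_unique _ reg Rq chartP _ _ _ _ (O j `&` crect l eta) (j.1)%:C).
  - by apply: copenI => //; exact: copen_crect.
  - by apply: cconvexI => //; exact: cconvex_crect.
  - by apply: sol_sub (SH _ Pj) => w [].
  - by apply: sol_sub S => w [].
  - by split => //; exact: crx.
  - by split => //; exact: crx.
  - by rewrite /H mul1r addNr.
  - by rewrite /H1 mul1r addNr mulr1.
have [F [F1 [SF FE]]] : exists F F1, sol F F1 [set w | exists2 j, P j & O j w] /\
    forall j w, P j -> O j w -> F w = H j w /\ F1 w = H1 j w.
  apply: sol_glue => [j Pj|i j w Pi Pj Oi Oj]; first by split => //; exact: SH.
  have [il _ _ _] := Pi; have [jl _ _ _] := Pj.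
  (* Two overlapping discs are compared at the midpoint of their centres: it lies in both, and on
     the segment where both solutions agree with [G]. *)
  pose y := (i.1 + j.1) / 2.
  have ij : `|i.1 - j.1| < 2 * r.
    rewrite -ncC (rmorphB (real_complex R)) (_ : _ - _ = (- j.1%:C + 1 * w - 0) - (- i.1%:C + 1 * w - 0)); last by ring.
    by rewrite (le_lt_trans (ncB_le _ _))//; move: Oi Oj; rewrite /O/cball/=; lra.
  have yl : `|y| < l.
    rewrite (_ : y = i.1 + 2^-1 * (j.1 - i.1)); last by rewrite /y; field.
    by apply: convex_abs => //; rewrite invr_ge0 ler0n invf_le1// ler1n.
  have yi : `|y - i.1| < r.
    rewrite (_ : y - i.1 = - ((i.1 - j.1) / 2)); last by rewrite /y; field.
    by rewrite normrN normrM [`|2^-1|]ger0_norm ?invr_ge0// ltr_pdivrMr// mulrC.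
  have yj : `|y - j.1| < r.
    rewrite (_ : y - j.1 = (i.1 - j.1) / 2); last by rewrite /y; field.
    by rewrite normrM [`|2^-1|]ger0_norm ?invr_ge0// ltr_pdivrMr// mulrC.
  have Oyi : O i y%:C by rewrite /O /cball/= mul1r subr0 addrC -(rmorphB (real_complex R)) ncC.
  have Oyj : O j y%:C by rewrite /O /cball/= mul1r subr0 addrC -(rmorphB (real_complex R)) ncC.
  have [a1 a2] := agree _ _ Pi yl yi; have [b1 b2] := agree _ _ Pj yl yj.
  apply: (@sol_unique _ reg Rq chartP _ _ _ _ (O i `&` O j) y%:C) => //.
  - exact: copenI.
  - exact: cconvexI.
  - by apply: sol_sub (SH _ Pi) => v [].
  - by apply: sol_sub (SH _ Pj) => v [].
  - by rewrite a1 b1.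
  - by rewrite a2 b2.
exists F, F1.
have ex (x : R) : `|x| < l -> exists2 j, P j & j.1 = x.
  by move=> xl; have [B [B1 [SB B0 B10]]] := Hb _ xl; exists (x, (B, B1)).
have [j0 Pj0 E0] : exists2 j, P j & j.1 = 0 by apply: ex; rewrite normr0.
have [|f1 f2] := FE j0 0 Pj0.
  by have := Ox j0; rewrite E0 (rmorph0 (real_complex R)).
have a0 : `|0 : R| < l by rewrite normr0.
have a1 : `|0 - j0.1| < r by rewrite E0 subr0 normr0.
have [g1 g2] := agree j0 0 Pj0 a0 a1.
rewrite (rmorph0 (real_complex R)) in g1 g2.
split; [|by rewrite f1|by rewrite f2].
apply: sol_sub SF => w [wl wr].
(* Rescaling the real part into the open segment moves it by at most r / 2. *)
pose x := complex.Re w * (l / (l + r / 2)).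
have lr0 : 0 < l + r / 2 by rewrite addr_gt0// divr_gt0.
have xl : `|x| < l.
  rewrite /x normrM [X in _ * X]gtr0_norm ?divr_gt0// mulrA ltr_pdivrMr// mulrC ltr_pM2l//.
have [j Pj Ej] := ex _ xl; exists j => //.
rewrite /O/cball/= Ej mul1r subr0 (le_lt_trans (nc_le _))// cReD cImD cReN cImN /= oppr0 add0r.
have : `|- x + complex.Re w| <= r / 2.
  rewrite (_ : - x + _ = complex.Re w * ((r / 2) / (l + r / 2))); last first.
    by rewrite /x; field; rewrite gt_eqF// addr_gt0// mulr_gt0.
  rewrite normrM [X in _ * X]gtr0_norm ?divr_gt0// mulrA ler_pdivrMr// mulrC.
  by rewrite ler_wpM2l ?divr_ge0 ?ltW.
by move: wr; lra.
Qed.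

(** All rectangle solutions with the given initial data are glued. The image of the real axis is
    then a horizontal arc through p, so it stays in a compact set [K] of regular points, on which
    solutions exist on discs of one radius r. Every rectangle can thus be lengthened by r / 2 at
    height r / 4, and the union contains a strip. *)
Lemma strip_exists p v : bounded_arcs p -> v ^+ 2 * Rq p = 1 ->
  exists (r : R) F F1, [/\ 0 < r, sol F F1 (strip r), F 0 = p & F1 0 = v].
Proof.
move=> [rp bp] v2.
pose T := ((R * R) * ((R[i] -> R[i]) * (R[i] -> R[i])))%type.
pose O (j : T) := crect j.1.1 j.1.2.
pose P (j : T) := [/\ 0 < j.1.1, 0 < j.1.2, sol j.2.1 j.2.2 (O j), j.2.1 0 = p & j.2.2 0 = v].
have O0 j : P j -> O j 0 by case=> *; split; rewrite /= normr0.
have [F [F1 [SF FE]]] : exists F F1, sol F F1 [set w | exists2 j, P j & O j w] /\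
    forall j w, P j -> O j w -> F w = j.2.1 w /\ F1 w = j.2.2 w.
  apply: (@sol_glue _ reg Rq T P (fun j => j.2.1) (fun j => j.2.2) O) => [j [_ _ Sj _ _]|i j w Pi Pj Oi Oj].
    by split => //; exact: copen_crect.
  have [_ _ Si i0 i1] := Pi; have [_ _ Sj j0 j1] := Pj.
  apply: (@sol_unique _ reg Rq chartP _ _ _ _ (O i `&` O j) 0) => //.
  - by apply: copenI; exact: copen_crect.
  - by apply: cconvexI; exact: cconvex_crect.
  - by apply: sol_sub Si => u [].
  - by apply: sol_sub Sj => u [].
  - by split; exact: O0.
  - by rewrite i0 j0.
  - by rewrite i1 j1.
have [j0 Pj0] : exists j, P j.
  have [W [h [h' [rho [r0 [m C]]]]]] := chartP rp.
  have [[rho0 r00 m0] _ _ _ _] := C.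
  have pB : cball p (rho / 2) p by apply: cball_center; rewrite divr_gt0.
  have [G [G1 [S G0 G10 _]]] := chart_flow C pB v2.
  exists ((r0 / 2, r0 / 2), (G, G1)); split; rewrite /= ?divr_gt0//.
  apply: sol_sub S => w [/= wl wr]; rewrite /cball/= subr0 (le_lt_trans (nc_le _))//; lra.
pose I := [set x : R | [set w | exists2 j, P j & O j w] x%:C].
have Io : open I.
  rewrite openE => x [j Pj [/= xl xr]].
  have e0 : 0 < j.1.1 - `|x| by rewrite subr_gt0.
  apply/nbhs_ballP; exists (j.1.1 - `|x|) => //= y; rewrite /ball/= distrC => yx.
  exists j => //; split => //=.
  by rewrite -[y](subrK x) (le_lt_trans (ler_normD _ _))// -ltrBrDr.
have Ii : is_interval I.
  move=> x y [i Pi [/= xi1 xi2]] [j Pj [/= yj1 yj2]] z /andP[xz zy].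
  have [z0|z0] := leP 0 z.
    exists j => //; split => //=; rewrite ger0_norm//.
    by rewrite (le_lt_trans zy)// (le_lt_trans (ler_norm _)).
  exists i => //; split => //=; rewrite ltr0_norm//.
  by move: xi1; rewrite ltr_norml => /andP[h _]; lra.
have I0 : I 0 by exists j0 => //; exact: O0.
have gp : F 0%:C = p by have [-> _] := FE _ _ Pj0 (O0 _ Pj0); have [] := Pj0.
have [bs [M bM]] := bp _ _ Io Ii I0 (sol_arc SF) gp.
have [L HL] := finP.
(* The singular points lie in a finite list, so their distances to the arc have a common positive
   lower bound. *)
have [e e0 He] : exists2 e : R, 0 < e & forall s t, s \in L -> ~ reg s -> I t -> e <= nc (F t%:C - s).
  elim: L {HL} => [|a L [e e0 IH]]; first by exists 1.
  have [ra|na] := pselect (reg a).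
    by exists e => // s t; rewrite inE => /predU1P[->//|]; exact: IH.
  have [e' e'0 H'] := bs _ na.
  exists (Num.min e e'); first by rewrite lt_min e0.
  move=> s t; rewrite inE => /predU1P[-> _ It|sL ns It]; first by rewrite ge_min H'// orbT.
  by rewrite ge_min IH.
pose K := [set z | nc z <= M /\ forall s, ~ reg s -> e <= nc (z - s)].
have KI t : I t -> K (F t%:C) by move=> It; split=> [|s ns]; [exact: bM|apply: He => //; exact: HL].
have Kr : K `<=` reg.
  move=> z [_ Kz]; apply: contrapT => nz; have := Kz _ nz.
  by rewrite subrr nc0 leNgt e0.
have Kc z : ~ K z -> exists2 e : R, 0 < e & forall z', nc (z' - z) < e -> ~ K z'.
  move=> nK; have [zM|zM] := leP (nc z) M; last first.
    exists (nc z - M); rewrite ?subr_gt0// => z' zz' [z'M _].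
    have := ncB_ge z z'; rewrite (ncBC z); lra.
  have [s ns sz] : exists2 s, ~ reg s & nc (z - s) < e.
    apply: contrapT => H; apply: nK; split => // s ns; rewrite leNgt; apply/negP => sz.
    by apply: H; exists s.
  exists (e - nc (z - s)); rewrite ?subr_gt0// => z' zz' [_ /(_ _ ns)].
  have := nc_tri z' z s; lra.
have [r r0 Hr] := @flow_uniform _ reg Rq chartP K M (fun z => @proj1 _ _) Kc Kr.
have ext j : P j -> exists2 j', P j' & j'.1 = (j.1.1 + r / 2, r / 4).
  move=> Pj; have [l0 eta0 Sj E0 E1] := Pj.
  have [x xl|G [G1 [SG G0 G10]]] := sol_extend l0 eta0 r0 Sj.
    have Ojx : O j x%:C by split; rewrite /= ?normr0.
    have [f1 f2] := FE _ _ Pj Ojx.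
    have Ix : I x by exists j.
    have [_ _ _ Ex] := Sj _ Ojx.
    by apply: Hr => //; rewrite -f1; exact: KI.
  exists ((j.1.1 + r / 2, r / 4), (G, G1)) => //; split; rewrite /= ?divr_gt0 ?addr_gt0 ?divr_gt0//.
    by rewrite G0.
  by rewrite G10.
have extn n : exists2 j, P j & j.1.2 = r / 4 /\ r / 2 * n%:R <= j.1.1.
  elim: n => [|n [j Pj [j1 j2]]].
    have [j Pj Ej] := ext _ Pj0; have [l0 _ _ _ _] := Pj.
    by exists j => //; rewrite mulr0 ltW// Ej.
  have [j' Pj' Ej] := ext _ Pj; exists j' => //; rewrite Ej; split => //=.
  by rewrite -(natr1 n) mulrDr mulr1 lerD2r.
exists (r / 4), F, F1; split; rewrite ?divr_gt0//; last first.
- by have [_ ->] := FE _ _ Pj0 (O0 _ Pj0); have [] := Pj0.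
apply: sol_sub SF => w wS.
have [n Hn] : exists n : nat, `|complex.Re w| / (r / 2) < n%:R.
  by exists (Num.truncn (`|complex.Re w| / (r / 2))).+1; exact: truncnS_gt.
have [j Pj [j1 j2]] := extn n; exists j => //; split; rewrite /= ?j1//.
by apply: lt_le_trans j2; rewrite mulrC -ltr_pdivrMr// divr_gt0.
Qed.

End StripExistence.

Section RealAux.
Variable R : realType.

Lemma is_derive0_eq (f : R -> R) (a b : R) : a <= b ->
  (forall t : R, a <= t <= b -> is_derive t 1 f 0) -> f a = f b.
Proof.
move=> ab df; apply/eqP; rewrite eq_sym -subr_eq0 -(@rint_FTC _ (fun=> 0))//.
  by rewrite /rint Rintegral_cst//= mul0r.
by move=> x; exact: cvg_cst.
Qed.

Lemma segment_cluster (a b : R) (t : nat -> R) : (forall n, a <= t n <= b) ->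
  exists2 x, a <= x <= b & forall e : R, 0 < e -> forall N : nat, exists2 n, (N <= n)%N & `|t n - x| < e.
Proof.
move=> tab; apply: contrapT => H.
have loc x : a <= x <= b -> exists2 e : R, 0 < e & exists N : nat, forall n, (N <= n)%N -> e <= `|t n - x|.
  move=> xab; apply: contrapT => H2; apply: H; exists x => // e e0 N.
  apply: contrapT => H3; apply: H2; exists e => //; exists N => n Nn.
  by rewrite leNgt; apply/negP => te; apply: H3; exists n.
(* One parameter r encodes both the distance and, through [r^-1], the index from which it holds;
   this makes the property monotone in r. *)
have [r r0 Hr] : exists2 r : R, 0 < r & forall x, a <= x <= b ->
    forall n : nat, r^-1 <= n%:R -> r <= `|t n - x|.
  apply: segment_uniform => [x r r' r'0 r'r h n rn|x xab].
    apply: (le_trans r'r); apply: h; apply: le_trans rn.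
    by rewrite lef_pV2// posrE (lt_le_trans r'0).
  have [e e0 [N HN]] := loc _ xab.
  exists (e / 2), (Num.min (e / 2) N.+1%:R^-1); split; rewrite ?divr_gt0//.
    by rewrite lt_min divr_gt0//= invr_gt0 ltr0n.
  move=> x' _ xx' n.
  set r := Num.min _ _ => rn.
  have r0 : 0 < r by rewrite lt_min divr_gt0//= invr_gt0 ltr0n.
  have Nn : (N <= n)%N.
    have : N.+1%:R <= n%:R :> R.
      apply: le_trans rn; rewrite -[leLHS]invrK lef_pV2 ?posrE ?invr_gt0 ?ltr0n//.
      by rewrite ge_min lexx orbT.
    by rewrite ler_nat => /ltnW.
  have := HN _ Nn; have := ler_distD x' (t n) x; rewrite /r ge_min => h1 h2.
  by apply/orP; left; lra.
have := Hr _ (tab (Num.truncn r^-1).+1) (Num.truncn r^-1).+1 (ltW (truncnS_gt _)).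
by rewrite subrr normr0 leNgt r0.
Qed.

Lemma C_add_real (a b : R[i]) : complex.Im a = complex.Im b ->
  a = b + (complex.Re a - complex.Re b)%:C.
Proof. by case: a b => a1 a2 [b1 b2] /= ->; apply: Cext => /=; ring. Qed.

End RealAux.

Section ClosedTrajectories.
Variable R : realType.
Variables (reg : set R[i]) (Rq : R[i] -> R[i]).
Hypothesis chartP : forall z0, reg z0 -> exists W h h' rho r0 m, chart reg Rq z0 W h h' rho r0 m.

Local Notation sol := (sol reg Rq).
Local Notation harc := (harc reg Rq).

Lemma rderiv_near (g : R -> R[i]) (t e : R) d : rderiv g t d -> 0 < e ->
  exists2 D : R, 0 < D & forall s : R, `|s| < D -> nc (g (t + s) - g t) < e.
Proof.
move=> H e0; have [D D0 HD] := rderiv_lip H.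
have d0 : 0 < nc d + 1 by rewrite ltr_wpDl ?nc_ge0.
exists (Num.min D (e / (nc d + 1))); first by rewrite lt_min D0 divr_gt0.
move=> s; rewrite lt_min => /andP[s1 s2].
by rewrite (le_lt_trans (HD _ s1))// mulrC -ltr_pdivlMr.
Qed.

(** As h^2 = [Rq], positivity of [Rq (g t) * d ^+ 2] forces [h (g t) * d] to be real: in a chart an
    arc moves horizontally. *)
Lemma arc_local z0 W h h' rho r0 m (g : R -> R[i]) I (t : R) : chart reg Rq z0 W h h' rho r0 m ->
  (exists2 D : R, 0 < D & forall s : R, `|s| < D -> I (t + s)) -> harc g I -> cball z0 rho (g t) ->
  exists2 d : R, 0 < d & forall s : R, `|s| < d ->
    [/\ I (t + s), cball z0 rho (g (t + s)) & complex.Im (W (g (t + s))) = complex.Im (W (g t))].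
Proof.
move=> [[rho0 r00 m0] _ WT low [hlow hreg surj]] [D D0 HD] ag gB.
have It : I t by rewrite -[t]addr0; apply: HD; rewrite normr0.
have [d0 [dg _ _]] := ag _ It.
have e0 : 0 < rho - nc (g t - z0) by rewrite subr_gt0.
have [D1 D10 HD1] := rderiv_near dg e0.
have gB' s : `|s| < D1 -> cball z0 rho (g (t + s)).
  move=> sD; rewrite /cball/= (le_lt_trans (nc_tri _ (g t) _))// -ltrBrDr.
  exact: HD1.
exists (Num.min D D1); first by rewrite lt_min D0.
move=> s; rewrite lt_min => /andP[s1 s2]; split; [exact: HD|exact: gB'|].
have dI u : `|u| <= `|s| -> is_derive (t + u) 1 (fun x => complex.Im (W (g x))) 0.
  move=> us; have Iu : I (t + u) by apply: HD; exact: le_lt_trans s1.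
  have Bu : cball z0 rho (g (t + u)) by apply: gB'; exact: le_lt_trans s2.
  have [d [dgu _ pos]] := ag _ Iu.
  have [|im0 _] := @sqr_gt0_real _ (h (g (t + u)) * d).
    by rewrite exprMn (hreg _ Bu).2.
  rewrite -im0; apply: rderiv_Im; apply: cderiv_rderiv_comp dgu.
  exact: taylor2_cderiv WT Bu.
have [s0|s0] := leP 0 s.
  apply/esym; apply: (@is_derive0_eq _ (fun x => complex.Im (W (g x)))); first by rewrite lerDl.
  move=> u /andP[u1 u2]; rewrite -[u](subrK t) addrC; apply: dI.
  by rewrite !ger0_norm// ?subr_ge0// lerBlDl.
apply: (@is_derive0_eq _ (fun x => complex.Im (W (g x)))); first by rewrite gerDl ltW.
move=> u /andP[u1 u2]; rewrite -[u](subrK t) addrC; apply: dI.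
by rewrite (ltr0_norm s0) ler0_norm ?subr_le0// lerN2 lerBrDl.
Qed.

(** The derivative of an arc is not assumed continuous, so [g] is not inverted. Its linear
    approximation at t - s and t + s brackets every nearby value of the real part of [W], and the
    intermediate value theorem supplies the parameter. *)
Lemma arc_cover z0 W h h' rho r0 m (g : R -> R[i]) I (t : R) : chart reg Rq z0 W h h' rho r0 m ->
  (exists2 D : R, 0 < D & forall s : R, `|s| < D -> I (t + s)) -> harc g I -> cball z0 rho (g t) ->
  exists2 eta : R, 0 < eta & forall xi : R, `|xi| < eta ->
    exists s, [/\ I (t + s), cball z0 rho (g (t + s)) & W (g (t + s)) = W (g t) + xi%:C].
Proof.
move=> C HI ag gB.
have [d d0 Hd] := arc_local C HI ag gB.
have [[rho0 r00 m0] _ WT low [hlow hreg surj]] := C.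
have It : I t by have [] := Hd 0; rewrite ?normr0// addr0.
have dW s : `|s| < d -> exists c, rderiv (fun x => W (g x)) (t + s) c /\ complex.Re c != 0.
  move=> sd; have [Is Bs _] := Hd _ sd; have [c [dg _ pos]] := ag _ Is.
  exists (h (g (t + s)) * c); split.
    by apply: cderiv_rderiv_comp dg; exact: taylor2_cderiv WT Bs.
  by have [|] := @sqr_gt0_real _ (h (g (t + s)) * c); rewrite // exprMn (hreg _ Bs).2.
have [c [dc c0]] := dW 0 (ltac:(by rewrite normr0)); rewrite addr0 in dc.
pose f x := complex.Re (W (g x)).
pose a := complex.Re c.
have df : is_derive t 1 f a by exact: rderiv_Re dc.
have a0 : 0 < `|a| by rewrite normr_gt0.
have [D D0 HD] := is_derive_eps df (divr_gt0 a0 (ltr0n _ 2)).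
pose s := Num.min d D / 2.
have mn0 : 0 < Num.min d D by rewrite lt_min d0.
have s0 : 0 < s by rewrite divr_gt0.
have sm : s < Num.min d D by rewrite ltr_pdivrMr// ltr_pMr// ltr1n.
have [sd sD] : s < d /\ s < D by move: sm; rewrite lt_min => /andP.
exists (`|a| / 2 * s); first by rewrite mulr_gt0// divr_gt0.
move=> xi xiE.
have cf : {within `[t - s, t + s], continuous f}.
  have ex x : `[t - s, t + s]%classic x -> exists c, rderiv (fun x => W (g x)) x c.
    rewrite /= in_itv/= => /andP[x1 x2].
    have [|c' [dc' _]] := dW (x - t).
      by rewrite (le_lt_trans _ sd)// ler_norml; apply/andP; split; lra.
    by exists c'; move: dc'; rewrite addrC subrK.
  apply: (@ctn_Re _ (fun x => W (g x))).
  pose df' x := if pselect (`[t - s, t + s]%classic x) is left p then projT1 (cid (ex x p)) else 0.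
  apply: (@rderiv_ctn _ _ df') => x xs; rewrite /df'; case: pselect => // p.
  by case: (cid _).
have h1 : `|f (t + s) - f t - s * a| <= `|a| / 2 * s.
  by have := HD s; rewrite gtr0_norm//; apply.
have h2 : `|f (t - s) - f t - - s * a| <= `|a| / 2 * s.
  by have := HD (- s); rewrite normrN gtr0_norm//; apply.
have ts : t - s <= t + s by lra.
have mm : Num.min (f (t - s)) (f (t + s)) <= f t + xi <= Num.max (f (t - s)) (f (t + s)).
  rewrite ge_min le_max; move: h1 h2 xiE.
  have [a1|a1] := leP 0 a.
    rewrite (ger0_norm a1) !ler_norml ltr_norml => /andP[e1 e2] /andP[e3 e4] /andP[e5 e6].
    have ? : 0 <= a * s by rewrite mulr_ge0// ltW.
    by apply/andP; split; apply/orP; [left|right]; nra.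
  rewrite (ltr0_norm a1) !ler_norml ltr_norml => /andP[e1 e2] /andP[e3 e4] /andP[e5 e6].
  by apply/andP; split; apply/orP; [right|left]; nra.
have [u uI fu] := IVT ts cf mm.
exists (u - t).
have [|I1 B1 im] := Hd (u - t).
  move: uI; rewrite in_itv/= => /andP[u1 u2].
  by rewrite (le_lt_trans _ sd)// ler_norml; apply/andP; split; lra.
split => //; apply: Cext; last by rewrite im cImD /= addr0.
by rewrite addrC subrK cReD /= -/(f t) -fu.
Qed.

Definition closed_traj (g : R -> R[i]) (T : R) :=
  [/\ 0 < T, harc g setT & forall t, g (t + T) = g t].

Lemma closed_reduce g T t : closed_traj g T -> exists2 t', 0 <= t' <= T & g t' = g t.
Proof.
move=> [T0 _ gT].
have gn n t' : g (t' + n%:R * T) = g t'.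
  elim: n => [|n IH]; first by rewrite mul0r addr0.
  by rewrite -natr1 mulrDl mul1r addrA gT.
have pos x : 0 <= x -> exists2 t', 0 <= t' <= T & g t' = g x.
  move=> x0; pose n := Num.truncn (x / T).
  have := truncn_itv (divr_ge0 x0 (ltW T0)); rewrite -/n => /andP[n1 n2].
  exists (x - n%:R * T); last by rewrite -(gn n) subrK.
  move: n1 n2; rewrite ler_pdivlMr// ltr_pdivrMr// -natr1 mulrDl mul1r => n1 n2.
  by apply/andP; split; lra.
pose n := (Num.truncn (- t / T)).+1.
have nT : - t < n%:R * T by rewrite -ltr_pdivrMr//; exact: truncnS_gt.
have [|t' t'T E] := pos (t + n%:R * T); first by lra.
by exists t' => //; rewrite E gn.
Qed.

Lemma closed_dist g T s : closed_traj g T -> (forall t, g t != s) ->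
  exists2 r : R, 0 < r & forall t, r <= nc (g t - s).
Proof.
move=> cg gs; have [T0 ag _] := cg.
have [r r0 Hr] : exists2 r : R, 0 < r & forall t, 0 <= t <= T -> r <= nc (g t - s).
  apply: segment_uniform => [t r r' _ r'r|t _]; first exact: le_trans.
  have [d [dg _ _]] := ag t I.
  have v0 : 0 < nc (g t - s) / 2 by rewrite divr_gt0// nc_gt0 subr_eq0.
  have [D D0 HD] := rderiv_near dg v0.
  exists D, (nc (g t - s) / 2); split => // t' _ /HD.
  rewrite [t + _]addrC subrK => h.
  have := nc_tri (g t) (g t') s; rewrite (ncBC (g t) (g t')); lra.
exists r => // t; have [t' t'T <-] := closed_reduce t cg.
exact: Hr.
Qed.

Lemma closed_bounded g T : closed_traj g T -> exists M : R, forall t, nc (g t) <= M.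
Proof.
move=> cg; have [T0 ag _] := cg.
have [r r0 Hr] : exists2 r : R, 0 < r & forall t, 0 <= t <= T -> nc (g t) <= r^-1.
  apply: segment_uniform => [t r r' r'0 r'r h|t _].
    by apply: le_trans h _; rewrite lef_pV2// posrE (lt_le_trans r'0).
  have [d [dg _ _]] := ag t I.
  have [D D0 HD] := rderiv_near dg ltr01.
  exists D, (nc (g t) + 1)^-1; split => //; first by rewrite invr_gt0 ltr_wpDl ?nc_ge0.
  move=> t' _ /HD; rewrite [t + _]addrC subrK invrK => h.
  by rewrite -[g t'](subrK (g t)) (le_trans (ncD _ _))// addrC lerD2l ltW.
by exists r^-1 => t; have [t' t'T <-] := closed_reduce t cg; exact: Hr.
Qed.

(** The parameters at which [b] meets the closed trajectory form an open set by [arc_cover]; their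
    complement is open because the trajectory is compact and so has positive distance from any other
    point. *)
Lemma arc_stays (g : R -> R[i]) (T : R) (b : R -> R[i]) (I : set R) : closed_traj g T -> open I -> is_interval I -> I 0 -> harc b I ->
  (exists t, b 0 = g t) -> forall t, I t -> exists t', b t = g t'.
Proof.
move=> cg Io Ii I0 ab b0 t It.
have [T0 ag gT] := cg.
pose P (x : R) := exists t', b (x * t) = g t'.
suff : P 1 by rewrite /P mul1r.
apply: (@locally_constant_01 _ P); last by rewrite /P mul0r.
move=> x /andP[x0 x1].
have Ix : I (x * t).
  have [t0|t0] := leP 0 t.
    by apply: (Ii 0 t) => //; rewrite mulr_ge0// ler_piMl.
  by apply: (Ii t 0) => //; apply/andP; split; nra.
have HI : exists2 D : R, 0 < D & forall s : R, `|s| < D -> I (x * t + s).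
  have := Io; rewrite openE => /(_ _ Ix) /nbhs_ballP[D /= D0 HD].
  by exists D => // s sD; apply: HD; rewrite /ball/= opprD addrA subrr sub0r normrN.
have near D : 0 < D -> exists2 e : R, 0 < e & forall y, `|y - x| < e -> exists2 s, `|s| < D & y * t = x * t + s.
  move=> D0; have t1 : 0 < `|t| + 1 by rewrite ltr_wpDl.
  exists (D / (`|t| + 1)); first by rewrite divr_gt0.
  move=> y; rewrite ltr_pdivlMr// => yx; exists ((y - x) * t); last by ring.
  by rewrite normrM (le_lt_trans _ yx)// ler_wpM2l// lerDl.
have [d [db rb _]] := ab _ Ix.
have HT t1 : exists2 D : R, 0 < D & forall s : R, `|s| < D -> [set: R] (t1 + s) by exists 1.
have [[t1 E1]|N] := pselect (P x).
  have [W [h [h' [rho [r0 [m C]]]]]] := chartP rb.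
  have [[rho0 r00 m0] _ WT _ _] := C.
  have bB : cball (b (x * t)) rho (b (x * t)) by exact: cball_center.
  have gB : cball (b (x * t)) rho (g t1) by rewrite -E1.
  have [d1 d10 H1] := arc_local C HI ab bB.
  have [eta eta0 H2] := arc_cover C (HT t1) ag gB.
  have dWb := cderiv_rderiv_comp (taylor2_cderiv WT bB) db.
  have [d2 d20 H3] := rderiv_near dWb eta0.
  have d0 : 0 < Num.min d1 d2 by rewrite lt_min d10.
  have [e e0 He] := near _ d0; exists e => // y y01 /He [s]; rewrite lt_min => /andP[s1 s2] Es.
  split=> _; first by exists t1.
  rewrite /P Es.
  have [_ B1 im] := H1 _ s1.
  have xs : `|complex.Re (W (b (x * t + s))) - complex.Re (W (b (x * t)))| < eta.
    by rewrite -cReB (le_lt_trans (nc_Re _))// H3.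
  have [s' [_ B2 W2]] := H2 _ xs.
  exists (t1 + s'); apply: (chart_inj C) => //; rewrite W2 -E1.
  exact: C_add_real.
have [|r r0 Hr] := @closed_dist g T (b (x * t)) cg.
  by move=> t1; apply/eqP => E; apply: N; exists t1.
have [D D0 HD] := rderiv_near db r0.
have [e e0 He] := near _ D0; exists e => // y y01 /He [s sD Es].
split => // -[t1]; rewrite Es => E; exfalso.
by have := HD _ sD; rewrite E ltNge Hr.
Qed.

Lemma closed_bounded_arcs g T : closed_traj g T -> bounded_arcs reg Rq (g 0).
Proof.
move=> cg; have [T0 ag gT] := cg.
have rg t : reg (g t) by have [d []] := ag t I.
split => // J b Jo Ji J0 ab b0.
have st : forall t, J t -> exists t', b t = g t'.
  by apply: (arc_stays cg Jo Ji J0 ab); exists 0.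
split=> [s ns|].
  have [|r r0 Hr] := @closed_dist g T s cg.
    by move=> t; apply/eqP => E; apply: ns; rewrite -E.
  by exists r => // t /st[t' ->].
have [M HM] := closed_bounded cg.
by exists M => t /st[t' ->].
Qed.

(** Recurrence on a compact curve: the points F(w1 + n) stay on the closed trajectory, so two of
    them, with n < k, lie on one horizontal line of a chart at a small distance [xi]. Then F(w1 + k)
    = F(w1 + n + s xi) with s = 1 or s = -1, and k - n - s xi is a period of [F] by
    [sol_translate]. *)
Lemma sol_periodic F F1 (r : R) w1 g T : sol F F1 (strip r) -> strip r w1 -> closed_traj g T ->
  F w1 = g 0 -> exists2 T' : R, 0 < T' & forall w, strip r w ->
    F (w + T'%:C) = F w /\ F1 (w + T'%:C) = F1 w.
Proof.
move=> S w1r cg E0; have [T0 ag gT] := cg.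
have n1 : (1 : R[i]) ^+ 2 = 1 by rewrite expr1n.
have stripD w (x : R) : strip r w -> strip r (w + x%:C).
  by rewrite /strip/= cImD /= addr0.
have S1 := sol_affine (c := w1) n1 S.
have Sb := sol_arc S1.
have fT : [set x : R | [set w | strip r (w1 + 1 * w)] x%:C] = setT.
  by apply/seteqP; split => // x _ /=; rewrite mul1r; exact: stripD.
rewrite fT in Sb.
have st x : exists t', F (w1 + x%:C) = g t'.
  have /= := @arc_stays g T _ setT cg openT (fun _ _ _ _ _ _ => I) I Sb _ x I.
  by rewrite !mul1r; apply; exists 0; rewrite (rmorph0 (real_complex R)) addr0.
have st' (n : nat) : exists2 t', 0 <= t' <= T & F (w1 + (n%:R : R)%:C) = g t'.
  have [t' E] := st n%:R; have [t'' t''T E'] := closed_reduce t' cg.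
  by exists t'' => //; rewrite E' E.
pose t n := projT1 (cid2 (st' n)).
have tT n : 0 <= t n <= T by rewrite /t; case: cid2.
have tE n : F (w1 + (n%:R : R)%:C) = g (t n) by rewrite /t; case: cid2.
have [u _ Hu] := segment_cluster tT.
have [du [dgu ru _]] := ag u I.
have [W [h [h' [rho [r0 [m C]]]]]] := chartP ru.
have [[rho0 r00 m0] _ WT _ [_ hreg _]] := C.
have gB : cball (g u) rho (g u) by exact: cball_center.
have HT : exists2 D : R, 0 < D & forall s : R, `|s| < D -> [set: R] (u + s) by exists 1.
have [d1 d10 H1] := arc_local C HT ag gB.
(* [r0] keeps the shift inside the local flow, [r - |Im w1|] inside the strip, and 1 makes the
   resulting period positive. *)
pose mu := Num.min (Num.min r0 (r - `|complex.Im w1|)) 1.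
have mu0 : 0 < mu by rewrite !lt_min r00 subr_gt0 ltr01 w1r.
have dWg := cderiv_rderiv_comp (taylor2_cderiv WT gB) dgu.
have [d2 d20 H2] := rderiv_near dWg (divr_gt0 mu0 (ltr0n _ 2)).
have [d3 d30 H3] := rderiv_near dgu (divr_gt0 rho0 (ltr0n _ 2)).
pose d := Num.min d1 (Num.min d2 d3).
have d0 : 0 < d by rewrite !lt_min d10 d20.
have [n _ Hn] := Hu _ d0 0%N.
have [k nk Hk] := Hu _ d0 n.+1.
have ub x : u + (x - u) = x by rewrite addrC subrK.
move: Hn Hk; rewrite !lt_min => /and3P[n1' n2 n3] /and3P[k1 k2 k3].
have := H1 _ n1'; rewrite ub => -[_ Bn In].
have := H1 _ k1; rewrite ub => -[_ Bk Ik].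
have := H2 _ n2; rewrite ub => Wn.
have := H2 _ k2; rewrite ub => Wk.
have := H3 _ n3; rewrite ub => Bn2.
pose xi := complex.Re (W (g (t k)) - W (g (t n))).
have Wxi : W (g (t k)) = W (g (t n)) + xi%:C.
  by rewrite /xi cReB; apply: C_add_real; rewrite Ik In.
have xim : `|xi| < mu.
  rewrite (le_lt_trans (nc_Re _))// (le_lt_trans (nc_tri _ (W (g u)) _))//.
  by rewrite (ncBC (W (g u))); lra.
pose wn := w1 + (n%:R : R)%:C.
have Sn : strip r wn by exact: stripD.
have [_ _ _ En] := S _ Sn.
have vE : F1 wn ^+ 2 * Rq (g (t n)) = 1 by rewrite -tE.
have [G [G1 [SG G0 G10 HG]]] := chart_flow C Bn2 vE.
pose s := h (g (t n)) * F1 wn.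
have s2 : s ^+ 2 = 1 by rewrite exprMn (hreg _ Bn).2 mulrC.
have s1 := nc_sqr1 s2.
(* The sign records whether [F] runs along the trajectory with or against the chart; being real, it
   leaves the shift [s * xi] horizontal. *)
have [b sb] : exists b : R, s = b%:C.
  move/eqP: s2; rewrite -(expr1n _ 2) eqf_sqr => /orP[/eqP ->|/eqP ->].
    by exists 1; rewrite (rmorph1 (real_complex R)).
  by exists (-1); rewrite (rmorphN (real_complex R)) (rmorph1 (real_complex R)).
have xB : cball 0 mu (s * xi%:C).
  by rewrite /cball/= subr0 ncM s1 mul1r ncC.
have sub1 : cball 0 mu `<=` cball 0 r0.
  by move=> w /= /lt_le_trans; apply; rewrite !ge_min lexx.
have sub2 : cball 0 mu `<=` [set w | strip r (wn + 1 * w)].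
  move=> w; rewrite /cball/= subr0 mul1r /strip/= /wn !cImD /= addr0 => wm.
  rewrite (le_lt_trans (ler_normD _ _))// -ltrBrDl (le_lt_trans (nc_Im _))//.
  by rewrite (lt_le_trans wm)// !ge_min lexx orbT.
have [||EG _] := @sol_unique _ reg Rq chartP _ _ _ _ (cball 0 mu) 0 (s * xi%:C)
  (@copen_cball _ 0 mu) (@cconvex_cball _ 0 mu) (sol_sub sub1 SG)
  (sol_sub sub2 (sol_affine (c := wn) n1 S)) (cball_center 0 mu0) xB.
- by rewrite G0 mulr0 addr0 -tE.
- by rewrite G10 mulr0 addr0 mulr1.
have Fk : F (wn + s * xi%:C) = F (w1 + (k%:R : R)%:C).
  rewrite -[s * _]mul1r -EG tE.
  have [BG WG] := HG _ (sub1 _ xB).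
  apply: (chart_inj C) => //; rewrite WG Wxi -/s mulrA.
  by rewrite -expr2 s2 mul1r.
pose c := k%:R - n%:R - b * xi.
have cE : (w1 + (k%:R : R)%:C) - (wn + s * xi%:C) = c%:C.
  by rewrite /wn /c sb !(rmorphB (real_complex R)) (rmorphM (real_complex R)); ring.
have b1 : `|b| = 1 by rewrite -ncC -sb.
have c0 : 0 < c.
  have h1 : (1 : R) <= k%:R - n%:R by rewrite lerBrDl natr1 ler_nat.
  have : `|b * xi| < 1 by rewrite normrM b1 mul1r (lt_le_trans xim)// ge_min lexx orbT.
  by rewrite ltr_norml /c => /andP[_ h2]; lra.
exists c => // w wr.
have Sn' : strip r (wn + s * xi%:C) by rewrite sb -(rmorphM (real_complex R)); exact: stripD.
have Sk : strip r (w1 + (k%:R : R)%:C) by exact: stripD.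
have := @sol_translate _ reg Rq chartP F F1 (strip r) _ _ w (@copen_strip _ r) (@cconvex_strip _ r) S Sn' Sk Fk wr.
by rewrite cE; apply; exact: stripD.
Qed.

End ClosedTrajectories.

(** * Winding numbers of the levels of a periodic strip *)

Section Loops.
Variable R : realType.

Lemma cderivV (z : R[i]) : z != 0 -> cderiv (fun z => z^-1) z (- (z^-1 * z^-1)).
Proof.
move=> z0; have c0 : 0 < nc z / 2 by rewrite divr_gt0// nc_gt0.
have low a : cball z (nc z / 2) a -> nc z / 2 <= nc a.
  rewrite /cball/= => az; rewrite ncBC in az.
  by have := ncB_ge z a; lra.
have bnd a : cball z (nc z / 2) a -> nc a <= nc z + nc z / 2.
  rewrite /cball/= => az; rewrite -[a](subrK z) (le_trans (ncD _ _))//; lra.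
have h := hol2_poly 'X bnd.
have hi : hol2 (cball z (nc z / 2)) id (fun=> 1).
  move: h; rewrite (_ : (fun z => 'X.[z]) = id); last by apply/funext => x; rewrite hornerX.
  by rewrite (_ : (fun z => _.[z]) = fun=> 1)//; apply/funext => x; rewrite derivX hornerC.
have [_ _ T] := hol2V c0 low hi.
by have := taylor2_cderiv T (cball_center z c0); rewrite mulN1r.
Qed.

Lemma rderivM (f g : R -> R[i]) (t : R) d d' : rderiv f t d -> rderiv g t d' ->
  rderiv (fun s => f s * g s) t (d * g t + f t * d').
Proof.
move=> /rderiv_ReIm[f1 f2] /rderiv_ReIm[g1 g2]; apply/rderiv_ReIm; split.
  rewrite (_ : (fun s => _) = (fun s => complex.Re (f s)) * (fun s => complex.Re (g s))
     - (fun s => complex.Im (f s)) * (fun s => complex.Im (g s))); last first.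
    by apply/funext => s; rewrite cReM.
  apply: is_derive_eq; rewrite cReD !cReM !/GRing.scale /=.
  move: (complex.Re (f t)) (complex.Im (f t)) (complex.Re (g t)) (complex.Im (g t)) (complex.Re d)
    (complex.Im d) (complex.Re d') (complex.Im d').
  by move=> a1 a2 b1 b2 c1 c2 d1 d2; ring.
rewrite (_ : (fun s => _) = (fun s => complex.Re (f s)) * (fun s => complex.Im (g s))
     + (fun s => complex.Im (f s)) * (fun s => complex.Re (g s))); last first.
  by apply/funext => s; rewrite cImM.
apply: (is_derive_eq (is_deriveD (is_deriveM f1 g2) (is_deriveM f2 g1))).
rewrite cImD !cImM !/GRing.scale /=.
move: (complex.Re (f t)) (complex.Im (f t)) (complex.Re (g t)) (complex.Im (g t)) (complex.Re d)
    (complex.Im d) (complex.Re d') (complex.Im d').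
by move=> a1 a2 b1 b2 c1 c2 d1 d2; ring.
Qed.

Lemma rderivV (f : R -> R[i]) (t : R) d : rderiv f t d -> f t != 0 ->
  rderiv (fun s => (f s)^-1) t (- ((f t)^-1 * (f t)^-1) * d).
Proof. by move=> df f0; apply: (cderiv_rderiv_comp (cderivV f0) df). Qed.

Lemma is_derive_arg (f : R -> R[i]) (t : R) d : rderiv f t d -> 0 < complex.Re (f t) ->
  is_derive t 1 (fun s => atan (complex.Im (f s) / complex.Re (f s))) (complex.Im (d / f t)).
Proof.
move=> /rderiv_ReIm[f1 f2] f0.
have dV : is_derive t 1 (fun s => (complex.Re (f s))^-1) (- (complex.Re (f t)) ^- 2 *: complex.Re d).
  by apply: is_deriveV; rewrite gt_eqF.
have dM : is_derive t 1 (fun s => complex.Im (f s) / complex.Re (f s))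
   (complex.Im (f t) *: (- (complex.Re (f t)) ^- 2 *: complex.Re d) + (complex.Re (f t))^-1 *: complex.Im d).
  exact: (is_deriveM f2 dV).
have := is_derive1_comp (is_derive1_atan _) dM.
move=> /is_derive_eq; apply.
rewrite cImM cReV cImV nc_sqr /GRing.scale/=.
move: f0; case: (f t) => u v /= u0; case: d {f1 f2 dV dM} => a b /=.
have u0' : u != 0 by rewrite gt_eqF.
have n0 : u ^+ 2 + v ^+ 2 != 0 by rewrite gt_eqF// ltr_pwDl ?exprn_gt0 ?sqr_ge0.
have -> : 1 + (v / u) ^+ 2 = (u ^+ 2 + v ^+ 2) / u ^+ 2 by field.
by rewrite invf_div; field; rewrite n0.
Qed.

(** The argument of Rouche's theorem: [g / f] stays in the disc of radius 1 around 1, where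
    [atan (Im / Re)] is a single-valued argument, and over the closed loop its total change is 0. *)
Lemma winding_eq (f g f' g' : R -> R[i]) (T : R) : 0 <= T ->
  (forall t, 0 <= t <= T -> rderiv f t (f' t)) -> (forall t, 0 <= t <= T -> rderiv g t (g' t)) ->
  ctn f' `[0, T] -> ctn g' `[0, T] -> f T = f 0 -> g T = g 0 ->
  (forall t, 0 <= t <= T -> nc (g t - f t) < nc (f t)) ->
  rint (fun t => complex.Im (f' t / f t)) 0 T = rint (fun t => complex.Im (g' t / g t)) 0 T.
Proof.
move=> T0 df dg cf' cg' fT gT fg.
have f0 t : 0 <= t <= T -> f t != 0.
  by move=> /fg; apply: contraTneq => ->; rewrite nc0 -leNgt nc_ge0.
have g0 t : 0 <= t <= T -> g t != 0.
  by move=> /fg; apply: contraTneq => ->; rewrite sub0r ncN ltxx.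
have df' t : `[0, T]%classic t -> rderiv f t (f' t) by rewrite /= in_itv/=; exact: df.
have dg' t : `[0, T]%classic t -> rderiv g t (g' t) by rewrite /= in_itv/=; exact: dg.
have cf := rderiv_ctn df'; have cg := rderiv_ctn dg'.
have cF : ctn (fun t => f' t / f t) `[0, T].
  by apply: ctnM => //; apply: ctnV => // x; rewrite /= in_itv/=; exact: f0.
have cG : ctn (fun t => g' t / g t) `[0, T].
  by apply: ctnM => //; apply: ctnV => // x; rewrite /= in_itv/=; exact: g0.
pose A s := atan (complex.Im (g s / f s) / complex.Re (g s / f s)).
have AT : A T - A 0 = 0 by rewrite /A fT gT subrr.
apply/eqP; rewrite eq_sym -subr_eq0 -rintB; [|exact: ctn_Im|exact: ctn_Im].
apply/eqP; transitivity (A T - A 0); last exact: AT.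
apply: rint_FTC => //; last first.
  rewrite (_ : (fun _ => _) = fun t => complex.Im (g' t / g t - f' t / f t)).
    by apply: ctn_Im; exact: ctnB.
  by apply/funext => t; rewrite cImB.
move=> t t01.
have -> : complex.Im (g' t / g t) - complex.Im (f' t / f t) =
   complex.Im ((g' t * (f t)^-1 + g t * (- ((f t)^-1 * (f t)^-1) * f' t)) / (g t / f t)).
  by rewrite -cImB; congr complex.Im; field; rewrite f0// g0.
apply: is_derive_arg.
  by apply: rderivM; [exact: dg|apply: rderivV; [exact: df|exact: f0]].
have : nc (g t / f t - 1) < 1.
  rewrite (_ : _ - 1 = (g t - f t) / f t); last by field; exact: f0.
  by rewrite ncM ncV ltr_pdivrMr ?mul1r ?fg// nc_gt0 f0.
by move=> /(le_lt_trans (nc_Re _)); rewrite cReB /= ltr_norml => /andP[h _]; lra.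
Qed.

End Loops.

Section SegmentMin.
Variable R : realType.

Lemma segment_min (f : R -> R) (a b : R) : a <= b -> {within `[a, b], continuous f} ->
  exists2 x, a <= x <= b & forall y, a <= y <= b -> f x <= f y.
Proof.
move=> ab cf; have [x xab H] := EVT_min ab cf.
by exists x; [move: xab; rewrite in_itv|move=> y yab; apply: H; rewrite in_itv].
Qed.

Lemma ctn_nc (f : R -> R[i]) A : ctn f A -> {within A, continuous (fun t => nc (f t))}.
Proof.
move=> H; apply: eps_within_continuous => x Ax e e0; have [D D0 HD] := H _ Ax _ e0.
exists D => // y Ay yx; rewrite (le_lt_trans _ (HD _ Ay yx))//.
rewrite ler_norml; apply/andP; split; last exact: ncB_ge.
by rewrite lerNl opprB (le_trans (ncB_ge _ _))// ncBC.
Qed.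

End SegmentMin.

Section PeriodicStrip.
Variable R : realType.
Variables (reg : set R[i]) (Rq : R[i] -> R[i]).
Hypothesis chartP : forall z0, reg z0 -> exists W h h' rho r0 m, chart reg Rq z0 W h h' rho r0 m.
Local Notation sol := (sol reg Rq).

Lemma sol_locally_injective F F1 O w : copen O -> sol F F1 O -> O w ->
  exists2 d : R, 0 < d & forall k1 k2, nc k1 < d -> nc k2 < d -> F (w + k1) = F (w + k2) -> k1 = k2.
Proof.
move=> Oo S Ow; have [rF _ _ E] := S _ Ow.
have [W [h [h' [rho [r0 [m C]]]]]] := chartP rF.
have [[rho0 r00 m0] _ _ _ [hlow _ _]] := C.
have FB := cball_center (F w) rho0.
have [d d0 H] := sol_local C Oo Ow S FB.
exists d => // k1 k2 /H[_ _ _ W1] /H[_ _ _ W2] EF.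
have s0 : h (F w) * F1 w != 0.
  rewrite mulf_neq0//; last exact: (sol_neq0 S Ow).
  by rewrite -nc_gt0 (lt_le_trans m0)// hlow.
by move: W2; rewrite -EF W1 => /addrI /(mulfI s0).
Qed.

Lemma sol_locally_open F F1 O w (e : R) : copen O -> sol F F1 O -> O w -> 0 < e ->
  exists2 d : R, 0 < d & forall z, nc (z - F w) < d -> exists2 k, nc k < e & F (w + k) = z.
Proof.
move=> Oo S Ow e0; have [rF _ _ E] := S _ Ow.
have [W [h [h' [rho [r0 [m C]]]]]] := chartP rF.
have [[rho0 r00 m0] _ WT _ [hlow hreg _]] := C.
have FB := cball_center (F w) rho0.
have [d d0 H] := sol_local C Oo Ow S FB.
have s2 : (h (F w) * F1 w) ^+ 2 = 1 by rewrite exprMn (hreg _ FB).2 mulrC.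
have s1 := nc_sqr1 s2.
have de0 : 0 < Num.min d e by rewrite lt_min d0.
have [D D0 HD] := cderiv_ccont (taylor2_cderiv WT FB) de0.
exists (Num.min rho D); first by rewrite lt_min rho0.
move=> z; rewrite lt_min => /andP[z1 z2].
pose k := (W z - W (F w)) * (h (F w) * F1 w).
have kd : nc k < Num.min d e.
  by rewrite ncM s1 mulr1; have := HD _ z2; rewrite [F w + _]addrC subrK.
move: kd; rewrite lt_min => /andP[kd ke]; exists k => //.
have [_ B _ Wk] := H _ kd.
apply: (chart_inj C) => //; rewrite Wk /k mulrCA -expr2 s2 mulr1.
by rewrite addrC subrK.
Qed.

Variables (F F1 : R[i] -> R[i]) (r T : R).
Hypotheses (r0 : 0 < r) (T0 : 0 < T) (SF : sol F F1 (strip r)).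
Hypothesis per : forall w, strip r w -> F (w + T%:C) = F w /\ F1 (w + T%:C) = F1 w.

Lemma stripD w (x : R) : strip r w -> strip r (w + x%:C).
Proof. by rewrite /strip/= cImD /= addr0. Qed.

Lemma per_nat n w : strip r w -> F (w + (n%:R * T)%:C) = F w /\ F1 (w + (n%:R * T)%:C) = F1 w.
Proof.
move=> wr; elim: n => [|n [IH1 IH2]]; first by rewrite mul0r (rmorph0 (real_complex R)) addr0.
rewrite -natr1 mulrDl mul1r (rmorphD (real_complex R)) addrA.
by have [-> ->] := per (stripD (n%:R * T) wr).
Qed.

Lemma per_reduce x y : `|y| < r -> exists2 x', 0 <= x' <= T &
  F (x' +i* y) = F (x +i* y) /\ F1 (x' +i* y) = F1 (x +i* y).
Proof.
move=> yr.
have st (u : R) : strip r (u +i* y) by [].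
have E (u v : R) : (u +i* y) + v%:C = (u + v) +i* y by apply: Cext; rewrite ?cReD ?cImD /= ?addr0.
have pos u : 0 <= u -> exists2 x', 0 <= x' <= T &
    F (x' +i* y) = F (u +i* y) /\ F1 (x' +i* y) = F1 (u +i* y).
  move=> u0; pose n := Num.truncn (u / T).
  have := truncn_itv (divr_ge0 u0 (ltW T0)); rewrite -/n => /andP[n1 n2].
  exists (u - n%:R * T).
    move: n1 n2; rewrite ler_pdivlMr// ltr_pdivrMr// -natr1 mulrDl mul1r => n1 n2.
    by apply/andP; split; lra.
  by have [e1 e2] := per_nat n (st (u - n%:R * T)); rewrite -e1 -e2 E subrK.
pose n := (Num.truncn (- x / T)).+1.
have nT : - x < n%:R * T by rewrite -ltr_pdivrMr//; exact: truncnS_gt.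
have [|x' x'T [e1 e2]] := pos (x + n%:R * T); first by lra.
exists x' => //; rewrite e1 e2 -E.
exact: per_nat.
Qed.

Lemma F_cont w (e : R) : strip r w -> 0 < e -> exists2 d : R, 0 < d & forall w', nc (w' - w) < d ->
  nc (F w' - F w) < e.
Proof.
move=> wr e0; have [_ dF _ _] := SF wr; have [d d0 H] := cderiv_ccont dF e0.
by exists d => // w' /H; rewrite [w + _]addrC subrK.
Qed.

(* Compactness in the two base points turns local injectivity and [sol_translate] into
   disjointness of the levels of a thinner strip. *)
Lemma levels_disjoint : exists2 r' : R, 0 < r' <= r & forall x1 y1 x2 y2, `|y1| < r' -> `|y2| < r' ->
  F (x1 +i* y1) = F (x2 +i* y2) -> y1 = y2.
Proof.
have st0 (x : R) : strip r x%:C by rewrite /strip/= normr0.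
have loc (x1 x2 : R) : exists2 e : R, 0 < e & forall w1 w2, nc (w1 - x1%:C) < e -> nc (w2 - x2%:C) < e ->
    F w1 = F w2 -> complex.Im w1 = complex.Im w2.
  have [E|N] := eqVneq (F x1%:C) (F x2%:C).
    have [d d0 Hd] := sol_locally_injective (@copen_strip _ r) SF (st0 x2).
    exists (Num.min d r); first by rewrite lt_min d0.
    move=> w1 w2; rewrite !lt_min => /andP[a1 a2] /andP[b1 b2] EF.
    have w1r : strip r w1.
      by rewrite /strip/=; have := le_lt_trans (nc_Im _) a2; rewrite cImB /= subr0.
    have := @sol_translate _ reg Rq chartP F F1 (strip r) x1%:C x2%:C w1 (@copen_strip _ r) (@cconvex_strip _ r) SF (st0 x1) (st0 x2) E w1r.
    rewrite -(rmorphB (real_complex R)) => /(_ (stripD _ w1r))[Et _].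
    have := Hd (w1 - x1%:C) (w2 - x2%:C) a1 b1.
    have -> : x2%:C + (w1 - x1%:C) = w1 + (x2 - x1)%:C by rewrite (rmorphB (real_complex R)); ring.
    rewrite Et [x2%:C + _]addrC subrK => /(_ EF) /(congr1 (@complex.Im R)).
    by rewrite !cImB /= !subr0.
  have e0 : 0 < nc (F x1%:C - F x2%:C) / 2 by rewrite divr_gt0// nc_gt0 subr_eq0.
  have [d1 d10 H1] := F_cont (st0 x1) e0; have [d2 d20 H2] := F_cont (st0 x2) e0.
  exists (Num.min d1 d2); first by rewrite lt_min d10.
  move=> w1 w2; rewrite !lt_min => /andP[a1 _] /andP[_ b2] EF; exfalso.
  have h1 := H1 _ a1; have h2 := H2 _ b2; have := nc_tri (F x1%:C) (F w1) (F x2%:C).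
  rewrite (ncBC (F x1%:C) (F w1)); rewrite EF in h1 *; lra.
have loc1 (x1 : R) : exists2 e : R, 0 < e & forall x2, 0 <= x2 <= T -> forall w1 w2, nc (w1 - x1%:C) < e -> nc (w2 - x2%:C) < e ->
    F w1 = F w2 -> complex.Im w1 = complex.Im w2.
  apply: segment_uniform => [x s s' _ s's H w1 w2 a1 a2|x2 _].
    by apply: H; [exact: lt_le_trans s's|exact: lt_le_trans s's].
  have [e e0 H] := loc x1 x2.
  exists (e / 2), (e / 2); split; rewrite ?divr_gt0// => x2' _ xx w1 w2 a1 a2.
  apply: H; first by lra.
  rewrite (le_lt_trans (nc_tri _ x2'%:C _))// -(rmorphB (real_complex R)) ncC; lra.
have [e e0 H] : exists2 e : R, 0 < e & forall x1, 0 <= x1 <= T -> forall x2, 0 <= x2 <= T -> forall w1 w2, nc (w1 - x1%:C) < e -> nc (w2 - x2%:C) < e ->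
    F w1 = F w2 -> complex.Im w1 = complex.Im w2.
  apply: segment_uniform => [x s s' _ s's H x2 x2T w1 w2 a1 a2|x1 _].
    by apply: (H x2) => //; [exact: lt_le_trans s's|exact: lt_le_trans s's].
  have [e e0 H] := loc1 x1.
  exists (e / 2), (e / 2); split; rewrite ?divr_gt0// => x1' _ xx x2 x2T w1 w2 a1 a2.
  apply: (H x2) => //; last by lra.
  rewrite (le_lt_trans (nc_tri _ x1'%:C _))// -(rmorphB (real_complex R)) ncC; lra.
exists (Num.min e r); first by rewrite lt_min e0 r0/= ge_min lexx orbT.
move=> x1 y1 x2 y2; rewrite !lt_min => /andP[y1e y1r] /andP[y2e y2r] E.
have [a1 a1T [E1 _]] := per_reduce x1 y1r.
have [a2 a2T [E2 _]] := per_reduce x2 y2r.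
have d (a b : R) : nc ((a +i* b) - a%:C) = `|b|.
  rewrite (_ : _ - _ = 0 +i* b); last by apply: Cext; rewrite ?cReB ?cImB /= ?subrr ?subr0.
  by rewrite ncE /= expr0n add0r sqrtr_sqr.
by apply: (H a1 a1T a2 a2T (a1 +i* y1) (a2 +i* y2)); rewrite ?d// E1 E2.
Qed.

Lemma rderiv_level y x : `|y| < r -> rderiv (fun s => F (s +i* y)) x (F1 (x +i* y)).
Proof.
move=> yr; have [_ dF _ _] := SF (yr : strip r (x +i* y)).
have E (s : R) : (0 +i* y) + s%:C * 1 = s +i* y by apply: Cext; rewrite mulr1 ?cReD ?cImD /= ?add0r ?addr0.
have := @cderiv_line _ F (0 +i* y) 1 x (F1 (x +i* y)); rewrite E mulr1 => /(_ dF).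
by under eq_fun do rewrite E.
Qed.

Lemma rderiv_vert y x : `|y| < r -> rderiv (fun s => F (x +i* s)) y (F1 (x +i* y) * 'i).
Proof.
move=> yr; have [_ dF _ _] := SF (yr : strip r (x +i* y)).
have E (s : R) : x%:C + s%:C * 'i = x +i* s.
  by apply: Cext; rewrite ?cReD ?cImD ?cReM ?cImM /= ?mulr0 ?mul0r ?mulr1 ?subrr ?add0r ?addr0.
have := @cderiv_line _ F x%:C 'i y (F1 (x +i* y)); rewrite E => /(_ dF).
by under eq_fun do rewrite E.
Qed.

Lemma ctn_F1_level y A : `|y| < r -> ctn (fun s => F1 (s +i* y)) A.
Proof.
move=> yr; apply: (@ctn_comp _ F1 (fun s => s +i* y)) => [|x _].
  move=> x _ e e0; exists e => // s _ sx.
  by rewrite (_ : _ - _ = (s - x)%:C) ?ncC//; apply: Cext; rewrite ?cReB ?cImB /= ?subrr.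
by have [] := SF (yr : strip r (x +i* y)).
Qed.

Lemma ctn_F1_vert x (A : set R) : (forall y, A y -> `|y| < r) -> ctn (fun s => F1 (x +i* s)) A.
Proof.
move=> Ar; apply: (@ctn_comp _ F1 (fun s => x +i* s)) => [|y Ay].
  move=> y _ e e0; exists e => // s _ sx.
  rewrite (_ : _ - _ = 'i * (s - y)%:C) ?ncM ?nci ?ncC ?mul1r//.
  by apply: Cext; rewrite ?cReB ?cImB ?cReM ?cImM /=; ring.
by have [] := SF (Ar _ Ay : strip r (x +i* y)).
Qed.

(* [2 * pi] times the winding number around [q] of the closed level of height [y]. *)
Definition wind (y : R) (q : R[i]) : R :=
  rint (fun x => complex.Im (F1 (x +i* y) / (F (x +i* y) - q))) 0 T.

Lemma rderiv_subc (f : R -> R[i]) (t : R) d q : rderiv f t d -> rderiv (fun s => f s - q) t d.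
Proof.
move=> df; rewrite -[d]subr0; apply: rderivB => //.
by move=> e e0; exists 1 => // s _; rewrite subrr mul0r subr0 nc0 mulr_ge0// ltW.
Qed.

Lemma wind_eq y q y' q' : `|y| < r -> `|y'| < r ->
  (forall x, 0 <= x <= T -> nc ((F (x +i* y') - q') - (F (x +i* y) - q)) < nc (F (x +i* y) - q)) ->
  wind y q = wind y' q'.
Proof.
move=> yr y'r H.
have EF z : `|z| < r -> F (T +i* z) = F (0 +i* z).
  move=> zr; have [<- _] := per (zr : strip r (0 +i* z)); congr F.
  by apply: Cext; rewrite ?cReD ?cImD /= ?add0r ?addr0.
apply: (@winding_eq _ (fun x => F (x +i* y) - q) (fun x => F (x +i* y') - q')) => //.
- exact: ltW.
- by move=> t _; apply: rderiv_subc; exact: rderiv_level.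
- by move=> t _; apply: rderiv_subc; exact: rderiv_level.
- exact: ctn_F1_level.
- exact: ctn_F1_level.
- by rewrite EF.
- by rewrite EF.
Qed.

Lemma level_dist y q : `|y| < r -> (forall x, F (x +i* y) != q) ->
  exists2 m : R, 0 < m & forall x, 0 <= x <= T -> m <= nc (F (x +i* y) - q).
Proof.
move=> yr Hq.
have cF : ctn (fun x => F (x +i* y) - q) `[0, T].
  by apply: (@rderiv_ctn _ _ (fun x => F1 (x +i* y))) => t _; apply: rderiv_subc; exact: rderiv_level.
have [x0 _ Hx] := segment_min (ltW T0) (ctn_nc cF).
by exists (nc (F (x0 +i* y) - q)) => //; rewrite nc_gt0 subr_eq0.
Qed.

Lemma wind_loc y q : `|y| < r -> (forall x, F (x +i* y) != q) -> exists2 e : R, 0 < e &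
  forall y' q', `|y' - y| < e -> nc (q' - q) < e -> wind y' q' = wind y q.
Proof.
move=> yr Hq; have [m m0 Hm] := level_dist yr Hq.
have nn (a b c d : R) : nc ((a +i* b) - (c +i* d)) <= `|a - c| + `|b - d|.
  by rewrite (le_trans (nc_le _)).
have [e e0 He] : exists2 e : R, 0 < e & forall x, 0 <= x <= T -> forall y', `|y' - y| < e ->
    nc (F (x +i* y') - F (x +i* y)) < m / 2.
  apply: segment_uniform => [x s s' _ s's H y' yy|x _].
    by apply: H; exact: lt_le_trans s's.
  have [d d0 Hd] := F_cont (yr : strip r (x +i* y)) (divr_gt0 m0 (ltr0n _ 4)).
  exists (d / 2), (d / 2); split; rewrite ?divr_gt0// => x' _ xx y' yy.
  have h1 : nc (F (x' +i* y') - F (x +i* y)) < m / 4.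
    by apply: Hd; rewrite (le_lt_trans (nn _ _ _ _))//; lra.
  have h2 : nc (F (x' +i* y) - F (x +i* y)) < m / 4.
    by apply: Hd; rewrite (le_lt_trans (nn _ _ _ _))// subrr normr0; lra.
  have := nc_tri (F (x' +i* y')) (F (x +i* y)) (F (x' +i* y)).
  rewrite (ncBC (F (x +i* y))); lra.
exists (Num.min (r - `|y|) (Num.min e (m / 2))).
  by rewrite !lt_min subr_gt0 yr e0 divr_gt0.
move=> y' q'; rewrite !lt_min => /and3P[y1 y2 _] /and3P[_ _ q3].
have y'r : `|y'| < r.
  by rewrite -[y'](subrK y) (le_lt_trans (ler_normD _ _))// -ltrBrDr.
apply/esym/wind_eq => // x xT.
rewrite (_ : _ - _ = (F (x +i* y') - F (x +i* y)) - (q' - q)); last by ring.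
rewrite (le_lt_trans (ncB_le _ _))//.
by have := He _ xT _ y2; have := Hm _ xT; lra.
Qed.

(** Homotopy invariance: level and point may move together as long as the point stays off the
    level. *)
Lemma wind_const (yt : R -> R) (qt : R -> R[i]) :
  (forall t, 0 <= t <= 1 -> `|yt t| < r /\ forall x, F (x +i* yt t) != qt t) ->
  (forall t, 0 <= t <= 1 -> forall e : R, 0 < e -> exists2 d : R, 0 < d & forall s, 0 <= s <= 1 ->
     `|s - t| < d -> `|yt s - yt t| < e /\ nc (qt s - qt t) < e) ->
  wind (yt 1) (qt 1) = wind (yt 0) (qt 0).
Proof.
move=> H1 H2.
apply: (@locally_constant_01 _ (fun t => wind (yt t) (qt t) = wind (yt 0) (qt 0))) => //.
move=> t t01; have [yr Hq] := H1 _ t01.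
have [e e0 He] := wind_loc yr Hq.
have [d d0 Hd] := H2 _ t01 _ e0.
by exists d => // s s01 /(Hd _ s01)[a b]; rewrite (He _ _ a b).
Qed.

Lemma wind_far y : `|y| < r -> exists M : R, forall q, M < nc q -> wind y q = 0 /\ forall x, F (x +i* y) != q.
Proof.
move=> yr.
have cF : ctn (fun x => F (x +i* y)) `[0, T].
  by apply: (@rderiv_ctn _ _ (fun x => F1 (x +i* y))) => t _; exact: rderiv_level.
have cn : {within `[0, T], continuous (fun x => - nc (F (x +i* y)))}.
  by move=> x; apply: continuousN; exact: (ctn_nc cF).
have [x0 _ Hx] := segment_min (ltW T0) cn.
exists (nc (F (x0 +i* y))) => q qM.
have qF x : 0 <= x <= T -> nc (F (x +i* y)) < nc q.
  by move=> /Hx; rewrite lerN2 => /le_lt_trans; apply.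
split; last first.
  move=> x; have [x' x'T [<- _]] := per_reduce x yr.
  by apply: contraTneq (qF _ x'T) => ->; rewrite ltxx.
have EF : F (T +i* y) = F (0 +i* y).
  have [<- _] := per (yr : strip r (0 +i* y)); congr F.
  by apply: Cext; rewrite ?cReD ?cImD /= ?add0r ?addr0.
rewrite /wind -(@winding_eq _ (fun=> - q) _ (fun=> 0)) //.
- rewrite (@rint_eq _ _ (fun=> 0)); last by move=> x _; rewrite mul0r.
  by rewrite /rint Rintegral_cst// mul0r.
- exact: ltW.
- by move=> t _ e e0; exists 1 => // s _; rewrite subrr mul0r subr0 nc0 mulr_ge0// ltW.
- by move=> t _; apply: rderiv_subc; exact: rderiv_level.
- exact: ctn_cst.
- exact: ctn_F1_level.
- by rewrite EF.
- by move=> t tT; rewrite opprK subrK ncN qF.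
Qed.

Variable r' : R.
Hypotheses (r'0 : 0 < r') (r'r : r' <= r).
Hypothesis disj : forall x1 y1 x2 y2, `|y1| < r' -> `|y2| < r' -> F (x1 +i* y1) = F (x2 +i* y2) -> y1 = y2.

(** During linear motion from the first pair of heights to the second, the difference of the two
    heights keeps its sign; as levels of different heights are disjoint, the moving point never
    meets the moving level. *)
Lemma wind_sides (y1 z1 x1 y2 z2 x2 : R) : `|y1| < r' -> `|z1| < r' -> `|y2| < r' -> `|z2| < r' ->
  (y1 < z1 /\ y2 < z2) \/ (z1 < y1 /\ z2 < y2) ->
  wind y2 (F (x2 +i* z2)) = wind y1 (F (x1 +i* z1)).
Proof.
move=> y1r z1r y2r z2r side.
pose yt t := y1 + t * (y2 - y1); pose zt t := z1 + t * (z2 - z1).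
pose w1 := x1 +i* z1; pose w2 := x2 +i* z2.
pose wt (t : R) := w1 + t%:C * (w2 - w1).
have wtE t : wt t = (x1 + t * (x2 - x1)) +i* zt t.
  by apply: Cext; rewrite ?Re_seg ?Im_seg.
have ytr t : 0 <= t <= 1 -> `|yt t| < r' by exact: convex_abs.
have ztr t : 0 <= t <= 1 -> `|zt t| < r' by exact: convex_abs.
have Y1 : yt 1 = y2 by rewrite /yt; ring.
have Y0 : yt 0 = y1 by rewrite /yt; ring.
have W1 : wt 1 = w2 by rewrite /wt (rmorph1 (real_complex R)); ring.
have W0 : wt 0 = w1 by rewrite /wt (rmorph0 (real_complex R)); ring.
have := @wind_const yt (fun t => F (wt t)); rewrite Y1 Y0 W1 W0; apply=> t t01.
  split; first exact: lt_le_trans (ytr _ t01) r'r.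
  move=> x; rewrite -/(wt t) wtE; apply/eqP => /disj -/(_ (ytr _ t01) (ztr _ t01)).
  rewrite /yt /zt; case/andP: t01 => t0 t1.
  by case: side => -[a b]; have [->|tn0] := eqVneq t 0; have : 0 <= t * (z2 - y2) \/ 0 <= t * (y2 - z2); nra.
move=> e e0.
have st : strip r (wt t) by rewrite wtE; exact: lt_le_trans (ztr _ t01) r'r.
have [d d0 Hd] := F_cont st e0.
pose K := `|y2 - y1| + nc (w2 - w1) + 1.
have K0 : 0 < K by rewrite ltr_wpDl// addr_ge0// nc_ge0.
exists (Num.min (e / K) (d / K)); first by rewrite lt_min !divr_gt0.
move=> s _; rewrite lt_min !ltr_pdivlMr// => /andP[a b]; split.
  rewrite (_ : _ - _ = (s - t) * (y2 - y1)); last by rewrite /yt; ring.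
  by rewrite normrM (le_lt_trans _ a)// ler_wpM2l// /K -addrA lerDl addr_ge0// nc_ge0.
apply: Hd; rewrite /wt (_ : _ - _ = (s - t)%:C * (w2 - w1)); last first.
  by rewrite (rmorphB (real_complex R)); ring.
rewrite ncM ncC (le_lt_trans _ b)// ler_wpM2l// /K.
by have := normr_ge0 (y2 - y1); lra.
Qed.

(** From q one can walk straight towards the nearest point p of the level without meeting the level.
    Close to p the walk enters the image of the strip, on one of the two sides of the level, and
    there [wind_sides] gives [nL] or [nR]. A far point has winding number 0, so one of these two is
    0 and the other is [a]. *)
Lemma wind_values : exists a : R, forall y q, `|y| < r' -> (forall x, F (x +i* y) != q) ->
  wind y q = 0 \/ wind y q = a.
Proof.
have h0 : 0 < r' / 2 by rewrite divr_gt0.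
have hr : `|r' / 2| < r' by rewrite gtr0_norm//; lra.
have hrN : `|- (r' / 2)| < r' by rewrite normrN.
pose nR := wind (- (r' / 2)) (F (0 +i* (r' / 2))).
pose nL := wind (r' / 2) (F (0 +i* - (r' / 2))).
have val y q : `|y| < r' -> (forall x, F (x +i* y) != q) -> wind y q = nL \/ wind y q = nR.
  move=> yr' Hq; have yr : `|y| < r by exact: lt_le_trans r'r.
  have cF : ctn (fun x => F (x +i* y) - q) `[0, T].
    by apply: (@rderiv_ctn _ _ (fun x => F1 (x +i* y))) => t _; apply: rderiv_subc; exact: rderiv_level.
  have [x0 _ Hx0] := segment_min (ltW T0) (ctn_nc cF).
  have Hx x : nc (F (x0 +i* y) - q) <= nc (F (x +i* y) - q).
    by have [x' x'T [<- _]] := per_reduce x yr; exact: Hx0.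
  pose p := F (x0 +i* y).
  have pq : 0 < nc (p - q) by rewrite nc_gt0 subr_eq0 /p Hq.
  have e0 : 0 < r' - `|y| by rewrite subr_gt0.
  have [d d0 Hd] := sol_locally_open (@copen_strip _ r) SF (yr : strip r (x0 +i* y)) e0.
  (* The bound 1/2 keeps the end of the walk strictly between q and p; the other bound brings it
     within [d] of p, where the strip covers. *)
  pose u := Num.min (2^-1) (d / 2 / nc (p - q)).
  have u0 : 0 < u by rewrite lt_min invr_gt0 ltr0n !divr_gt0.
  have u1 : u < 1 by rewrite gt_min invf_lt1// ltr1n.
  pose tau := 1 - u.
  have tau01 : 0 < tau < 1 by rewrite /tau; lra.
  pose qt (t : R) := q + (t * tau)%:C * (p - q).
  have off t : 0 <= t <= 1 -> forall x, F (x +i* y) != qt t.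
    move=> /andP[t0 t1] x; apply/eqP => E.
    have := Hx x; rewrite E /qt [q + _]addrC addrK ncM ncC leNgt.
    rewrite gtr_pMl//; case/andP: tau01 => a b.
    have tt : 0 <= t * tau by rewrite mulr_ge0// ltW.
    rewrite (ger0_norm tt); move/negP; apply; nra.
  have W1 : wind y (qt 1) = wind y (qt 0).
    apply: (@wind_const (fun=> y) qt) => t t01; first by split => // x; exact: off.
    move=> e e0'; exists (e / nc (p - q)); first by rewrite divr_gt0.
    move=> s _; rewrite ltr_pdivlMr// => st; rewrite subrr normr0; split => //.
    rewrite (_ : _ - _ = ((s - t) * tau)%:C * (p - q)); last first.
      by rewrite /qt mulrBl (rmorphB (real_complex R)); ring.
    rewrite ncM ncC normrM mulrAC (le_lt_trans _ st)// ler_piMr ?mulr_ge0 ?nc_ge0//.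
    by case/andP: tau01 => a b; rewrite gtr0_norm// ltW.
  have qt0 : qt 0 = q by rewrite /qt mul0r (rmorph0 (real_complex R)) mul0r addr0.
  have [|k kd Ek] := Hd (qt 1).
    rewrite -/p (_ : _ - _ = - (u%:C * (p - q))); last first.
      by rewrite /qt mul1r /tau (rmorphB (real_complex R)) (rmorph1 (real_complex R)); ring.
    rewrite ncN ncM ncC gtr0_norm// -ltr_pdivlMr//.
    rewrite gt_min; apply/orP; right; rewrite ltr_pM2r ?invr_gt0//; lra.
  have wE : (x0 +i* y) + k = (x0 + complex.Re k) +i* (y + complex.Im k).
    by apply: Cext; rewrite ?cReD ?cImD.
  rewrite wE in Ek.
  have zr : `|y + complex.Im k| < r'.
    by rewrite (le_lt_trans (ler_normD _ _))// -ltrBrDl (le_lt_trans (nc_Im _)).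
  rewrite -qt0 -W1 -Ek.
  have [lt|gt|E] := ltgtP (complex.Im k) 0.
  - left; apply: wind_sides => //; right; split; last by rewrite gtrDl.
    by rewrite (@lt_trans _ _ 0) ?oppr_lt0.
  - right; apply: wind_sides => //; left; split; last by rewrite ltrDl.
    by rewrite (@lt_trans _ _ 0) ?oppr_lt0.
  - exfalso; have := off 1; rewrite ler01 lexx => /(_ isT (x0 + complex.Re k)).
    by rewrite -Ek E addr0 eqxx.
have [M HM] := wind_far (ltac:(by rewrite normr0) : `|0 : R| < r).
have [|w0 Hq] := HM (`|M| + 1)%:C.
  by rewrite ncC ger0_norm ?addr_ge0// ltr_pwDr// ler_norm.
have := val 0 (`|M| + 1)%:C; rewrite normr0 w0 => /(_ r'0 Hq)[E|E].
  by exists nR => y q yr Hy; rewrite {1}E; exact: val.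
by exists nL => y q yr Hy; rewrite {1}E; have [] := val y q yr Hy; [right|left].
Qed.

End PeriodicStrip.

Lemma meas_le d (T : measurableType d) (R : realType) (nu : {measure set T -> \bar R}) (A B : set T) :
  measurable A -> measurable B -> A `<=` B -> (nu A <= nu B)%E.
Proof. by move=> mA mB AB; apply: le_measure; rewrite ?inE. Qed.

(** * Measures on the plane *)

Section PlaneMeasurability.
Variable R : realType.
Local Notation P2 := (R * R)%type.

Lemma measurable_ball2 (p : P2) (e : R) : measurable (ball p e : set P2).
Proof.
have -> : ball p e = ball p.1 e `*` ball p.2 e by apply/seteqP; split => -[].
by apply: measurableX; exact: measurable_ball.
Qed.

Lemma open_measurable2 (O : set P2) : open O -> measurable O.
Proof.
move=> oO; pose Q (i : rat * rat * nat) : P2 * R := ((ratr i.1.1, ratr i.1.2), i.2.+1%:R^-1).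
pose B (i : rat * rat * nat) : set P2 := if `[< ball (Q i).1 (Q i).2 `<=` O >] then ball (Q i).1 (Q i).2 else set0.
have -> : O = \bigcup_i B i.
  apply/seteqP; split => [p Op|p [i _]]; last by rewrite /B; case: asboolP => // + Bp; exact.
  have /nbhs_ballP[e /= e0 eO] : nbhs p O by apply: open_nbhs_nbhs.
  have [n n0 ne] : exists2 n : nat, (0 < n)%N & n%:R^-1 < e / 2 :> R.
    exists (Num.truncn (e / 2)^-1).+1 => //.
    by rewrite -[ltRHS]invrK ltf_pV2 ?posrE ?invr_gt0 ?divr_gt0 ?ltr0n// truncnS_gt.
  have n1 : 0 < n%:R^-1 :> R by rewrite invr_gt0 ltr0n.
  have [a /andP[]] : exists a : rat, p.1 - n%:R^-1 < ratr a < p.1 + n%:R^-1.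
    by have [a] := @rat_in_itvoo R (p.1 - n%:R^-1) (p.1 + n%:R^-1) ltac:(lra); rewrite in_itv; exists a.
  have [b /andP[]] : exists b : rat, p.2 - n%:R^-1 < ratr b < p.2 + n%:R^-1.
    by have [b] := @rat_in_itvoo R (p.2 - n%:R^-1) (p.2 + n%:R^-1) ltac:(lra); rewrite in_itv; exists b.
  move=> b1 b2 a1 a2; exists (a, b, n.-1) => //; rewrite /B; case: asboolP => [_|].
    rewrite /Q/= prednK//; split; rewrite /ball/= ltr_distl; apply/andP; split; lra.
  case=> q; rewrite /Q/= prednK// => -[]; rewrite /ball/= => q1 q2; apply: eO; split; rewrite /ball/=.
    by move: q1; rewrite !ltr_distl => /andP[? ?]; apply/andP; split; lra.
  by move: q2; rewrite !ltr_distl => /andP[? ?]; apply/andP; split; lra.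
apply: countable_bigcupT_measurable => [|i]; first exact: countableP.
by rewrite /B; case: asboolP => _ //; exact: measurable_ball2.
Qed.

(* A majorant of [1 / |p - q|], infinite on the diagonal, whose integral over a ball can be computed termwise. *)
Definition kap (p q : P2) : \bar R :=
  (1 + \sum_(k <oo) ((2 ^+ k.+1)%:E * (\1_(ball q (2 ^- k)) p)%:E))%E.

Lemma kap_term_ge0 (p q : P2) k : (0 <= (2 ^+ k.+1)%:E * (\1_(ball q (2 ^- k : R) : set P2) p)%:E :> \bar R)%E.
Proof. by rewrite -EFinM lee_fin mulr_ge0// exprn_ge0. Qed.

Lemma kap_ge0 (p q : P2) : (0 <= kap p q)%E.
Proof. by rewrite adde_ge0// nneseries_ge0// => k _ _; exact: kap_term_ge0. Qed.

Lemma kap_ge (p q : P2) (c : R) : c * nc (toC p - toC q) <= 1 -> (c%:E <= kap p q)%E.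
Proof.
move=> cpq; have [c1|c1] := leP c 1.
  rewrite (@le_trans _ _ 1%E) ?lee_fin//; apply: leeDl; apply: nneseries_ge0 => k _ _.
  exact: kap_term_ge0.
have ex : exists k, c <= 2 ^+ k.+1.
  exists (Num.truncn c).+1; rewrite (le_trans (ltW (truncnS_gt c)))//.
  by rewrite -natrX ler_nat ltnW// (@ltn_trans (Num.truncn c).+2)// ltn_expl.
have [k kc kmin] := ex_minnP ex.
have kc' : 2 ^+ k < c.
  by case: k kc kmin => [|k] kc kmin; rewrite ?expr0// ltNge; apply/negP => /kmin; rewrite ltnn.
have d0 : nc (toC p - toC q) < 2 ^- k.
  have c0 : 0 < c by apply: lt_trans c1.
  apply: (@le_lt_trans _ _ c^-1); first by rewrite -[leRHS]mul1r ler_pdivlMr// mulrC.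
  by rewrite ltf_pV2 ?posrE// exprn_gt0.
have bp : ball q (2 ^- k : R) p.
  split; apply: le_lt_trans d0; rewrite distrC.
    by have := nc_Re (toC p - toC q); rewrite cReB.
  by have := nc_Im (toC p - toC q); rewrite cImB.
rewrite /kap (@le_trans _ _ (\sum_(i < k.+1) ((2 ^+ i.+1)%:E * (\1_(ball q (2 ^- i : R) : set P2) p)%:E)))%E//.
  rewrite big_ord_recr/= indicE mem_set// mule1 (@le_trans _ _ (2 ^+ k.+1)%:E) ?lee_fin//.
  by rewrite leeDr// sume_ge0// => i _; exact: kap_term_ge0.
rewrite -[leLHS]add0e leeD ?lee_fin//.
rewrite -(big_mkord xpredT (fun i => (2 ^+ i.+1)%:E * (\1_(ball q (2 ^- i : R) : set P2) p)%:E)%E).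
by apply: nneseries_lim_ge => i _ _; exact: kap_term_ge0.
Qed.

Lemma measurable_kap d (T : measurableType d) (f g : T -> P2) :
  measurable_fun setT f -> measurable_fun setT g -> measurable_fun setT (fun t => kap (f t) (g t) : \bar R).
Proof.
move=> /measurable_fun_pairP[f1 f2] /measurable_fun_pairP[g1 g2].
apply: emeasurable_funD => //; apply: ge0_emeasurable_sum => [k x _ _|k _]; first exact: kap_term_ge0.
apply: emeasurable_funM => //; apply/measurable_EFinP.
rewrite (_ : (fun x => _) = \1_[set x | ball (g x) (2 ^- k : R) (f x)]); last first.
  by apply/funext => x; rewrite !indicE; congr ((_ : bool)%:R); apply/idP/idP; rewrite !inE.
apply: measurable_indic.
have -> : [set x | ball (g x) (2 ^- k : R) (f x)] =
  (fun x => `|(g x).1 - (f x).1|) @^-1` `]-oo, 2 ^- k[ `&` (fun x => `|(g x).2 - (f x).2|) @^-1` `]-oo, 2 ^- k[.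
  by apply/seteqP; split => x [/=]; rewrite ?in_itv/= => ? ?; split; rewrite //= in_itv.
apply: measurableI; rewrite -[X in measurable X]setTI.
  by apply: (measurableT_comp (@normr_measurable _ setT)) => //; exact: measurable_funB.
by apply: (measurableT_comp (@normr_measurable _ setT)) => //; exact: measurable_funB.
Qed.

Lemma lebC_ball (q : P2) (e : R) : 0 <= e -> lebC (ball q e) = (4 * e ^+ 2)%:E.
Proof.
move=> e0; have -> : ball q e = ball q.1 e `*` ball q.2 e by apply/seteqP; split => -[].
rewrite /lebC product_measure1E; [|exact: measurable_ball..].
apply: etrans (congr2 mule (lebesgue_measure_ball _ e0) (lebesgue_measure_ball _ e0)) _.
by rewrite -EFinM; congr EFin; ring.
Qed.

Lemma measurable_kap_term (B : set P2) (q : P2) k :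
  measurable_fun B (fun p => (2 ^+ k.+1)%:E * (\1_(ball q (2 ^- k : R) : set P2) p)%:E : \bar R)%E.
Proof.
apply: measurable_funTS; apply: emeasurable_funM; first exact: measurable_cst.
by apply/measurable_EFinP; apply: measurable_indic; exact: measurable_ball2.
Qed.

Lemma kap_int (B : set P2) (q : P2) : measurable B ->
  (\int[@lebC R]_(p in B) kap p q <= lebC B + 16%:E)%E.
Proof.
move=> mB; rewrite ge0_integralD//; last 2 first.
- by move=> p _; rewrite nneseries_ge0// => k _ _; exact: kap_term_ge0.
- apply: ge0_emeasurable_sum => [k x _ _|k _]; first exact: kap_term_ge0.
  by apply: measurable_kap_term.
rewrite integral_cst// mul1e leeD2l//.
rewrite integral_nneseries//; last by move=> k; exact: measurable_kap_term.
(* The term of index k contributes at most 2^(k+1) * 4 * 4^(-k) = 16 / 2^(k+1), and these sum to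
   16. *)
apply: le_trans (epsilon_trick0 xpredT (ler0n _ 16)); apply: lee_nneseries => [k _ _|k _].
  by apply: integral_ge0 => p _; exact: kap_term_ge0.
have mk : measurable_fun B (fun p => (\1_(ball q (2 ^- k : R) : set P2) p)%:E : \bar R).
  apply: measurable_funTS; apply/measurable_EFinP; apply: measurable_indic; exact: measurable_ball2.
rewrite ge0_integralZl//.
rewrite integral_indic//; last exact: measurable_ball2.
apply: (@le_trans _ _ ((2 ^+ k.+1)%:E * lebC (ball q (2 ^- k : R)))%E).
  rewrite lee_pmul2l// ?lte_fin ?exprn_gt0//; apply: le_measure; rewrite ?inE//.
    by apply: measurableI => //; exact: measurable_ball2.
  exact: measurable_ball2.
rewrite lebC_ball ?invr_ge0 ?exprn_ge0// -EFinM lee_fin natrX exprS.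
by rewrite le_eqVlt; apply/orP; left; apply/eqP; field; rewrite expf_neq0.
Qed.

End PlaneMeasurability.

(* [lebC] lives on the product of two copies of [measurableTypeR R]; [lebP] is the same measure
   on [R * R] with its default measurable structure. *)
Section LebesguePlane.
Variable R : realType.
Local Notation P2 := (R * R)%type.
Local Notation TT := (measurableTypeR R * measurableTypeR R)%type.

Let idP : TT -> P2 := id.
Let measurable_idP : measurable_fun setT idP. Proof. by move=> _ A mA; rewrite setTI. Qed.
Definition lebP : {measure set P2 -> \bar R}.
Proof.
pose m := pushforward (@lebC R) idP : {measure set P2 -> \bar R}.
exact: (m measurable_idP).
Defined.

Lemma lebPE (A : set P2) : lebP A = lebC A. Proof. by []. Qed.

Lemma int_lebP (D : set P2) (f : P2 -> \bar R) : measurable D -> measurable_fun setT f ->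
  (forall p, 0 <= f p)%E -> (\int[lebP]_(p in D) f p = \int[@lebC R]_(p in D) f p)%E.
Proof.
by move=> mD mf f0; rewrite (ge0_integral_pushforward measurable_idP)//; apply: measurable_funTS.
Qed.

End LebesguePlane.

(** * Regularity of finite Borel measures on the plane *)

Section Regularity.
Variable R : realType.
Local Notation P2 := (R * R)%type.

Lemma closed_measurable2 (F : set P2) : closed F -> measurable F.
Proof. by move=> /closed_openC/open_measurable2/measurableC; rewrite setCK. Qed.

Section FiniteMeasure.
Variable nu : {measure set P2 -> \bar R}.
Hypothesis fin : (nu setT < +oo)%E.

Lemma finite_meas (A : set P2) : measurable A -> (nu A < +oo)%E.
Proof. by move=> mA; apply: le_lt_trans fin; apply: meas_le. Qed.

Lemma shrinking_small (E : (set P2)^nat) (e : R) : (forall n, measurable (E n)) ->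
  nonincreasing_seq E -> \bigcap_n E n = set0 -> 0 < e -> exists n, (nu (E n) < e%:E)%E.
Proof.
move=> mE dE E0 e0.
have := @nonincreasing_cvg_mu _ _ _ nu E (finite_meas (mE _)) mE (bigcapT_measurable mE) dE.
rewrite E0 measure0 => /fine_cvgP[_ /cvgrPdist_lt/(_ _ e0)] [n _ /(_ n (leqnn n))].
rewrite /= sub0r normrN ger0_norm ?fine_ge0// => H; exists n.
by rewrite -(@fineK _ (nu (E n))) ?lte_fin// ge0_fin_numE// finite_meas.
Qed.

Definition regular_set (E : set P2) := forall e : R, 0 < e ->
  exists V F, [/\ open V, closed F, F `<=` E, E `<=` V & (nu (V `\` F) < e%:E)%E].

Lemma regular_setC E : regular_set E -> regular_set (~` E).
Proof.
move=> H e e0; have [V [F [oO cF FE EO OF]]] := H _ e0.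
exists (~` F), (~` V); split; [exact: closed_openC|exact: open_closedC|exact: subsetC|exact: subsetC|].
by rewrite setDE setCK setIC -setDE.
Qed.

Lemma regular_set_bigcup (E : (set P2)^nat) : (forall n, regular_set (E n)) -> regular_set (\bigcup_n E n).
Proof.
move=> H e e0.
have e2 n : 0 < e / 2 / (2 ^ n.+1)%:R by rewrite !divr_gt0// ltr0n expn_gt0.
have [V HO] := choice (fun n => H n _ (e2 n)).
have [F HF] := choice HO.
have oO n : open (V n) by case: (HF n).
have cF n : closed (F n) by case: (HF n).
have mO n : measurable (V n) by apply: open_measurable2.
have mF n : measurable (F n) by apply: closed_measurable2.
pose D n := (\bigcup_k F k) `\` \big[setU/set0]_(k < n) F k.
have mD n : measurable (D n) by apply: measurableD; [exact: bigcupT_measurable|exact: bigsetU_measurable].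
have [n nD] : exists n, (nu (D n) < (e / 2)%:E)%E.
  apply: shrinking_small => //; last by rewrite divr_gt0.
    apply/nonincreasing_seqP => n; apply/subsetPset => x [xF nx]; split => // xn; apply: nx.
    by rewrite big_ord_recr; left.
  apply/seteqP; split => // x /= xD; have [[k _ Fk] _] := xD 0%N I.
  have [_] := xD k.+1 I; apply; rewrite big_ord_recr; by right.
exists (\bigcup_k V k), (\big[setU/set0]_(k < n) F k); split.
- exact: bigcup_open.
- by apply: closed_bigsetU => i _; exact: cF.
- move=> x; rewrite -bigcup_mkord => -[k _ Fk]; exists k => //.
  by have [_ _ + _ _] := HF k; exact.
- by move=> x [k _ Ek]; exists k => //; have [_ _ _ + _] := HF k; exact.
have sub : (\bigcup_k V k) `\` \big[setU/set0]_(k < n) F k `<=` (\bigcup_k (V k `\` F k)) `|` D n.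
  move=> x [[k _ Ok] nF]; have [Fx|nFx] := pselect ((\bigcup_k F k) x); first by right.
  by left; exists k => //; split => // Fk; apply: nFx; exists k.
have mOF k : measurable (V k `\` F k) by apply: measurableD.
have mU : measurable (\bigcup_k (V k `\` F k)) by apply: bigcupT_measurable.
apply: (@le_lt_trans _ _ (nu ((\bigcup_k (V k `\` F k)) `|` D n))).
  have m1 : measurable ((\bigcup_k V k) `\` \big[setU/set0]_(k < n) F k).
    by apply: measurableD; [exact: bigcupT_measurable|exact: bigsetU_measurable].
  exact: meas_le m1 (measurableU _ _ mU (mD n)) sub.
apply: le_lt_trans (measureU2 _ mU (mD n)) _.
rewrite [e in X in (_ < X)%E](splitr e) EFinD lee_ltD//.
  by rewrite ge0_fin_numE// finite_meas.
apply: le_trans (@measure_sigma_subadditive _ _ _ nu _ (fun k => V k `\` F k) mOF mU (@subset_refl _ _)) _.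
apply: le_trans (epsilon_trick0 xpredT (_ : 0 <= e / 2)); last by rewrite divr_ge0// ltW.
apply: lee_nneseries => // k _; apply: ltW; by case: (HF k).
Qed.

Lemma regular_preimage (f : P2 -> R) (A : set R) : continuous f -> measurable A ->
  regular_set (f @^-1` A).
Proof.
move=> cf; have -> : @measurable _ R = <<s @RGenOInfty.G R >> by exact: RGenOInfty.measurableE.
suff : <<s @RGenOInfty.G R >> `<=` [set A | regular_set (f @^-1` A)] by apply.
apply: smallest_sub.
  split.
  - move=> e e0; exists set0, set0; rewrite preimage_set0; split; [exact: open0|exact: closed0|by []|by []|].
    by rewrite set0D measure0 lte_fin.
  - by move=> B rB; rewrite setTD/= preimage_setC; exact: regular_setC.
  - by move=> B rB; rewrite /= preimage_bigcup; exact: regular_set_bigcup.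
move=> _ [a ->] e e0 /=.
pose F n := f @^-1` `[a + n.+1%:R^-1, +oo[%classic.
have cF n : closed (F n) by move/continuous_closedP: cf; apply; exact: interval_closed.
have oO : open (f @^-1` `]a, +oo[%classic) by move/continuousP: cf; apply; exact: interval_open.
have [n Hn] : exists n, (nu (f @^-1` `]a, +oo[%classic `\` F n) < e%:E)%E.
  apply: shrinking_small => //.
  - by move=> n; apply: measurableD; [exact: open_measurable2|exact: closed_measurable2].
  - apply/nonincreasing_seqP => n; apply/subsetPset => x [/= xa nx]; split => // xn; apply: nx.
    move: xn; rewrite /F/= !in_itv/= !andbT; apply: le_trans; rewrite lerD2l.
    by rewrite lef_pV2 ?posrE ?ltr0n// ler_nat.
  - apply/seteqP; split => // x /= xD.
    have [/= + _] := xD 0%N I; rewrite in_itv/= andbT => ax.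
    have [_] := xD (Num.truncn (f x - a)^-1) I; apply; rewrite /F/= in_itv/= andbT.
    rewrite addrC -lerBrDr -[leRHS]invrK lef_pV2 ?posrE ?invr_gt0 ?subr_gt0//.
    by rewrite ltW// truncnS_gt.
exists (f @^-1` `]a, +oo[%classic), (F n); split => // x; rewrite /F/= !in_itv/= !andbT.
by apply: lt_le_trans; rewrite ltrDl invr_gt0.
Qed.

(** Regular sets form a sigma-algebra containing the preimages of measurable sets under continuous
    functions; the two coordinate projections generate the rest. *)
Lemma finite_measure_regular (E : set P2) : measurable E -> regular_set E.
Proof.
suff : measurable `<=` regular_set by apply.
apply: smallest_sub.
  split.
  - move=> e e0; exists set0, set0; split; [exact: open0|exact: closed0|by []|by []|].
    by rewrite set0D measure0 lte_fin.
  - by move=> B rB; rewrite setTD; exact: regular_setC.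
  - by move=> B rB; exact: regular_set_bigcup.
move=> _ [|] [A mA <-]; rewrite setTI; apply: regular_preimage => //.
  by move=> p; exact: cvg_fst.
by move=> p; exact: cvg_snd.
Qed.

End FiniteMeasure.
End Regularity.

(** * Comparison of measures on dyadic squares *)

Section DyadicComparison.
Variable R : realType.
Local Notation P2 := (R * R)%type.
Local Notation leb := (@lebP R).

Definition dy (n : nat) (p : P2) : int * int := (Num.floor (2 ^+ n * p.1), Num.floor (2 ^+ n * p.2)).
Definition dysq (n : nat) (c : int * int) : set P2 := [set p | dy n p = c].

Lemma floor2 (n : nat) (x y : R) : Num.floor (2 ^+ n.+1 * x) = Num.floor (2 ^+ n.+1 * y) ->
  Num.floor (2 ^+ n * x) = Num.floor (2 ^+ n * y).
Proof.
move=> H; set i := Num.floor (2 ^+ n * y).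
have /andP[i1 i2] := floor_itv (2 ^+ n * y).
have m1 : (2 * i <= Num.floor (2 ^+ n.+1 * y)) .
  by rewrite floor_ge_int exprS -mulrA intrM ler_pM2l.
have m2 : (Num.floor (2 ^+ n.+1 * y) < 2 * (i + 1)).
  by rewrite floor_lt_int exprS -mulrA intrM ltr_pM2l.
rewrite -H in m1 m2.
apply: floor_def; apply/andP; split.
  by move: m1; rewrite floor_ge_int exprS -mulrA intrM ler_pM2l.
by move: m2; rewrite floor_lt_int exprS -mulrA intrM ltr_pM2l.
Qed.

Lemma dy_refine n p q : dy n.+1 p = dy n.+1 q -> dy n p = dy n q.
Proof. by case=> /floor2 e1 /floor2 e2; rewrite /dy e1 e2. Qed.

Lemma dy1E n (i : int) : [set x : R | Num.floor (2 ^+ n * x) = i] =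
  `[i%:~R / 2 ^+ n, (i + 1)%:~R / 2 ^+ n[%classic.
Proof.
apply/seteqP; split => x /=; rewrite in_itv/= ler_pdivrMr ?exprn_gt0// ltr_pdivlMr ?exprn_gt0// ![x * _]mulrC.
  by move=> <-; exact: floor_itv.
exact: floor_def.
Qed.

Lemma dysqE n c : dysq n c = [set x : R | Num.floor (2 ^+ n * x) = c.1] `*` [set x : R | Num.floor (2 ^+ n * x) = c.2].
Proof. rewrite /dysq /dy; apply/seteqP; case: c => i j; split => -[x y] /=; first by case=> -> ->.
by case=> /= -> ->. Qed.

Lemma measurable_dysq n c : measurable (dysq n c).
Proof. by rewrite dysqE !dy1E; apply: measurableX; exact: measurable_itv. Qed.

Lemma lebC_dysq n c : leb (dysq n c) = ((2 ^- n) ^+ 2)%:E.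
Proof.
have E (i : int) : lebesgue_measure (`[i%:~R / 2 ^+ n, (i + 1)%:~R / 2 ^+ n[%classic : set R) = (2 ^- n)%:E.
  rewrite lebesgue_measure_itv/= lte_fin ltr_pM2r ?invr_gt0 ?exprn_gt0// ltr_int ltrDl ltr01.
  by rewrite -EFinB -mulrBl intrD addrAC subrr add0r mul1r.
rewrite dysqE !dy1E lebPE /lebC product_measure1E; [|exact: measurable_itv..].
by apply: etrans (congr2 mule (E _) (E _)) _; rewrite -EFinM expr2.
Qed.

Lemma dysq_ball n p q : dy n p = dy n q -> ball p (2 ^- n : R) q.
Proof.
have H (x y : R) : Num.floor (2 ^+ n * x) = Num.floor (2 ^+ n * y) -> `|x - y| < 2 ^- n.
  move=> E; have := floor_itv (2 ^+ n * x); have := floor_itv (2 ^+ n * y); rewrite -E intrD.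
  move=> /andP[a b] /andP[c d]; rewrite -[ltRHS]mul1r ltr_pdivlMr ?exprn_gt0//.
  by rewrite -[X in _ * X]ger0_norm ?exprn_ge0// -normrM mulrBl ltr_distl; apply/andP; split; lra.
by case=> e1 e2; split; exact: H.
Qed.

Section OpenComparison.
Variables (nu lam : {measure set P2 -> \bar R}) (C : R).
Hypothesis C0 : 0 <= C.
Hypothesis nuC : forall n c, (nu (dysq n c) <= C%:E * lam (dysq n c))%E.

(** The half-open squares of level n contained in [V] are countable and disjoint, so the bound adds
    up over them; their unions increase to [V] because squares refine. *)
Lemma le_open_dyadic (V : set P2) : open V -> (nu V <= C%:E * lam V)%E.
Proof.
move=> oV; pose A n k : set P2 :=
  if (pickle_inv k : option (int * int)) is Some c then
    (if `[< dysq n c `<=` V >] then dysq n c else set0) else set0.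
have mA n k : measurable (A n k).
  by rewrite /A; case: pickle_inv => [c|]//; case: asboolP => // _; exact: measurable_dysq.
have tA n : trivIset setT (A n).
  apply/trivIsetP => i j _ _ /eqP ij; apply/seteqP; split => // p; rewrite /A.
  case ei : pickle_inv => [c|]; case ej : pickle_inv => [c'|] => -[]//.
  case: asboolP => // _; case: asboolP => // _; rewrite /dysq/= => e1 e2; apply: ij.
  have := pickle_invK (T := (int * int)%type) i; rewrite ei/= => <-.
  by have := pickle_invK (T := (int * int)%type) j; rewrite ej/= => <-; rewrite -e1 e2.
pose W n := \bigcup_k A n k.
have mW n : measurable (W n) by exact: bigcupT_measurable.
have WE n p : W n p <-> dysq n (dy n p) `<=` V.
  split=> [[k _]|H].
    by rewrite /A; case: pickle_inv => [c|]//; case: asboolP => // + E; rewrite /dysq/= in E *; rewrite E.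
  exists (pickle (dy n p)); first by [].
  by rewrite /A pickleK_inv (asboolT H).
have WV n : W n `<=` V by move=> p /WE; apply.
have sW : nondecreasing_seq W.
  apply/nondecreasing_seqP => n; apply/subsetPset => p /WE H; apply/WE => q /dy_refine Hq; exact: H.
have UW : \bigcup_n W n = V.
  apply/seteqP; split=> [p [n _]|p Vp]; first exact: WV.
  have /nbhs_ballP[e /= e0 eV] : nbhs p V by apply: open_nbhs_nbhs.
  have [n ne] : exists n : nat, 2 ^- n < e.
    exists (Num.truncn e^-1).+1; rewrite -[ltRHS]invrK ltf_pV2 ?posrE ?invr_gt0 ?exprn_gt0//.
    by rewrite (lt_trans (truncnS_gt _))// -natrX ltr_nat ltn_expl.
  exists n => //; apply/WE => q Hq; apply: eV; apply: le_ball (ltW ne) _ _.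
  by apply: dysq_ball; rewrite Hq.
have nuW n : (nu (W n) <= C%:E * lam V)%E.
  apply: (@le_trans _ _ (C%:E * lam (W n))%E); last first.
    by apply: lee_pmul => //; rewrite ?lee_fin//; apply: meas_le => //; exact: open_measurable2.
  have -> : nu (W n) = (\sum_(k <oo) nu (A n k))%E by exact: (@measure_semi_bigcup _ _ _ nu _ (mA n) (tA n) (mW n)).
  have -> : lam (W n) = (\sum_(k <oo) lam (A n k))%E by exact: (@measure_semi_bigcup _ _ _ lam _ (mA n) (tA n) (mW n)).
  rewrite -nneseriesZl//; apply: lee_nneseries => // k _.
  rewrite /A; case: pickle_inv => [c|]; last by rewrite !measure0 mule0.
  by case: asboolP => _; rewrite ?measure0 ?mule0.
have := nondecreasing_cvg_mu (mu := nu) mW (bigcupT_measurable W mW) sW.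
rewrite UW => /cvg_lim <-//; apply: lime_le; last by apply: nearW => n; exact: nuW.
apply: ereal_nondecreasing_is_cvgn; apply/nondecreasing_seqP => n; apply: meas_le => //.
by apply/subsetPset; apply: sW.
Qed.

End OpenComparison.

(** [E] is enclosed in an open set with little excess for the majorising measure, to which the open
    comparison applies with constant 1; the reverse inequality is symmetric. *)
Lemma measure_eq_dyadic (nu lam : {measure set P2 -> \bar R}) (E : set P2) :
  (nu setT < +oo)%E -> (lam setT < +oo)%E ->
  (forall n c, nu (dysq n c) = lam (dysq n c)) -> measurable E -> nu E = lam E.
Proof.
have H (m1 m2 : {measure set P2 -> \bar R}) : (m2 setT < +oo)%E ->
    (forall n c, m1 (dysq n c) = m2 (dysq n c)) -> measurable E -> (m1 E <= m2 E)%E.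
  move=> fin eqd mE; apply/lee_addgt0Pr => e e0.
  have [V [F [oV cF FE EV VF]]] := finite_measure_regular fin mE e0.
  have mV := open_measurable2 oV.
  apply: (@le_trans _ _ (m1 V)); first exact: meas_le.
  apply: (@le_trans _ _ (m2 V)).
    rewrite -[leRHS]mul1e; apply: le_open_dyadic => // n c.
    by rewrite eqd mul1e.
  have -> : V = E `|` (V `\` E) by rewrite setDE setUIr setUv setIT; apply/esym/setUidr.
  rewrite measureU//; last 2 first.
  - exact: measurableD.
  - by apply/seteqP; split => // p [? []].
  apply: leeD2l; apply: le_trans (ltW VF); apply: meas_le; first exact: measurableD.
    by apply: measurableD => //; exact: closed_measurable2.
  by move=> p [Vp nE]; split => // /FE.
move=> f1 f2 eqd mE; apply/eqP; rewrite eq_le !H//.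
Qed.

Section Comparison.
Variables (nu : {measure set P2 -> \bar R}) (C : R).
Hypothesis C0 : 0 <= C.
Hypothesis nuC : forall n c, (nu (dysq n c) <= (C * (2 ^- n) ^+ 2)%:E)%E.

Let le_open_lebC (V : set P2) : open V -> (nu V <= C%:E * leb V)%E.
Proof. by apply: le_open_dyadic => // n c; rewrite lebC_dysq -EFinM. Qed.

(** Outer regularity is available for finite measures, so Lebesgue measure is first restricted to
    the ball that carries [nu]. *)
Lemma le_meas_lebC (M : R) (E : set P2) : nu (~` ball (0, 0) M) = 0%E -> measurable E ->
  (nu E <= C%:E * leb E)%E.
Proof.
pose BM : set P2 := ball (0, 0) M; rewrite -/BM => nuM mE.
have mB : measurable BM by exact: measurable_ball2.
have [M0|M0] := leP M 0.
  rewrite (@le_trans _ _ 0%E) ?mule_ge0 ?lee_fin// -nuM; apply: meas_le => //; first exact: measurableC.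
  by move=> p _ [/= H _]; have := le_lt_trans (normr_ge0 _) H; rewrite ltNge M0.
pose lm : {measure set P2 -> \bar R} := mrestr leb mB.
have fin : (lm setT < +oo)%E by rewrite /lm/= /mrestr setTI lebPE (lebC_ball _ (ltW M0)) ltry.
apply/lee_addgt0Pr => e e0.
have e1 : 0 < e / (C + 1) by rewrite divr_gt0// ltr_wpDl.
have [V [F [oV cF FE EV VF]]] := finite_measure_regular fin mE e1.
have mV := open_measurable2 oV.
have -> : nu E = nu (E `&` BM).
  rewrite -[in LHS](setIT E) -(setUv (BM)) setIUr measureU//; last 3 first.
  - exact: measurableI.
  - by apply: measurableI => //; exact: measurableC.
  - by apply/seteqP; split => // p [[_ +] [_ +]].
  rewrite [X in (_ + X)%E](_ : _ = 0%E) ?adde0//.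
  by apply: subset_measure0 nuM => //; [apply: measurableI => //; exact: measurableC|exact: measurableC].
have oVB : open (V `&` BM) by apply: openI => //; exact: ball_open.
apply: (@le_trans _ _ (nu (V `&` BM))).
  apply: meas_le; [exact: measurableI|exact: measurableI|].
  by move=> p [/EV].
apply: le_trans (le_open_lebC oVB) _.
have : (leb (V `&` BM) <= leb E + (e / (C + 1))%:E)%E.
  have -> : V `&` BM = (E `&` BM) `|` ((V `\` E) `&` BM).
    apply/seteqP; split=> [p [Vp Bp]|p [[/EV]|[[]]]]//.
    by have [Ep|nEp] := pselect (E p); [left|right].
  rewrite measureU//; last 3 first.
  - exact: measurableI.
  - by apply: measurableI => //; exact: measurableD.
  - by apply/seteqP; split => // p [[? _] [[]]].
  apply: leeD; first by apply: meas_le => //; exact: measurableI.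
  apply: le_trans (ltW VF); rewrite /lm/= /mrestr; apply: meas_le => //.
  - by apply: measurableI => //; exact: measurableD.
  - by apply: measurableI => //; apply: measurableD => //; exact: closed_measurable2.
  - by move=> p [[Vp nE] Bp]; split => //; split => // /FE.
move=> H; apply: (@le_trans _ _ (C%:E * (leb E + (e / (C + 1))%:E))%E).
  by apply: lee_pmul => //; rewrite lee_fin.
rewrite ge0_muleDr//; last by rewrite lee_fin ltW.
apply: leeD2l; rewrite -EFinM lee_fin mulrCA ler_piMr ?ltW//.
by rewrite ltr_pdivrMr ?ltr_wpDl// mul1r ltrDl.
Qed.

End Comparison.

(** A change-of-variables inequality without Jacobian. The part of [B] sent to a dyadic square of
    side 2^(-n) lies in a ball of area 4 L^2 4^(-n), so the image of Lebesgue measure on [B] is at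
    most 4 L^2 times Lebesgue measure. *)
Lemma integral_lip_inverse (phi : P2 -> P2) (B : set P2) (L M : R) : measurable_fun setT phi ->
  measurable B -> 0 < L -> (forall w, B w -> ball (0, 0) M (phi w)) ->
  (forall w1 w2 (d : R), B w1 -> B w2 -> ball (phi w1) d (phi w2) -> ball w1 (L * d) w2) ->
  forall g : P2 -> \bar R, measurable_fun setT g -> (forall p, 0 <= g p)%E ->
    (\int[leb]_(w in B) g (phi w) <= (4 * L ^+ 2)%:E * \int[leb]_p g p)%E.
Proof.
move=> mphi mB L0 phiM lip g mg g0.
have mpre (A : set P2) : measurable A -> measurable (phi @^-1` A).
  by move=> mA; rewrite -[X in measurable X]setTI; exact: mphi.
pose lB : {measure set P2 -> \bar R} := mrestr leb mB.
have C0 : 0 <= 4 * L ^+ 2 by rewrite mulr_ge0// sqr_ge0.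
pose nu0 := pushforward lB phi : {measure set P2 -> \bar R}.
pose nu : {measure set P2 -> \bar R} := nu0 mphi.
have nuE A : nu A = leb (phi @^-1` A `&` B) by [].
have nuC n c : (nu (dysq n c) <= (4 * L ^+ 2 * (2 ^- n) ^+ 2)%:E)%E.
  rewrite nuE; have [->|/set0P[w [pw Bw]]] := eqVneq (phi @^-1` dysq n c `&` B) set0.
    by rewrite measure0 lee_fin mulr_ge0// sqr_ge0.
  apply: (@le_trans _ _ (leb (ball w (L * 2 ^- n)))).
    apply: meas_le; first by apply: measurableI => //; apply: mpre; exact: measurable_dysq.
      exact: measurable_ball2.
    move=> w' [pw' Bw']; apply: lip => //; apply: dysq_ball.
    by rewrite /dysq/= in pw pw'; rewrite pw pw'.
  rewrite lebPE lebC_ball; first by rewrite exprMn mulrA.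
  by rewrite mulr_ge0 ?invr_ge0 ?exprn_ge0// ltW.
have nuM : nu (~` ball (0, 0) M) = 0%E.
  by rewrite nuE (_ : _ `&` _ = set0) ?measure0//; apply/seteqP; split => // w [nb /phiM].
have H A : measurable A -> (nu A <= mscale (NngNum C0) leb A)%E.
  by move=> mA; apply: le_meas_lebC nuC _ _ nuM mA.
have Hi := ge0_le_measure_integral H (@measurableT _ _) g0 mg.
have Es : (\int[mscale (NngNum C0) leb]_p g p = (4 * L ^+ 2)%:E * \int[leb]_p g p)%E.
  by apply: ge0_integral_mscale.
rewrite Es in Hi.
have Ep : (\int[nu]_p g p = \int[lB]_w g (phi w))%E.
  by apply: (@ge0_integral_pushforward _ _ _ _ _ phi mphi lB setT g).
rewrite Ep in Hi; apply: le_trans Hi.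
have mgp : measurable_fun setT (fun w => g (phi w)) by exact: measurableT_comp.
have Er : (\int[leb]_(w in B) g (phi w) = \int[lB]_(w in B) g (phi w))%E.
  by apply: eq_measure_integral => A mA AB; rewrite /lB/= /mrestr setIidl.
by rewrite Er; exact: (@ge0_subset_integral _ _ _ lB _ _ mB measurableT _ mgp (fun w _ => g0 _) (@subsetT _ B)).
Qed.

End DyadicComparison.

Lemma int_patch1 d (T : measurableType d) (R : realType) (m : {measure set T -> \bar R}) (D : set T)
  (g : T -> \bar R) : (\int[m]_(x in D) g x = \int[m]_x (g x * (\1_D x)%:E))%E.
Proof. by rewrite integral_mkcond epatch_indic. Qed.

Lemma int_Zl d (T : measurableType d) (R : realType) (m : {measure set T -> \bar R}) (c : R)
  (g : T -> \bar R) : 0 <= c -> measurable_fun setT g -> (forall x, 0 <= g x)%E ->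
  (\int[m]_x (c%:E * g x) = c%:E * \int[m]_x g x)%E.
Proof. by move=> c0 mg g0; rewrite ge0_integralZl// lee_fin. Qed.

Lemma int_Zr d (T : measurableType d) (R : realType) (m : {measure set T -> \bar R}) (c : R)
  (g : T -> \bar R) : 0 <= c -> measurable_fun setT g -> (forall x, 0 <= g x)%E ->
  (\int[m]_x (g x * c%:E) = \int[m]_x g x * c%:E)%E.
Proof. by move=> c0 mg g0; rewrite ge0_integralZr// lee_fin. Qed.

Lemma int_le d (T : measurableType d) (R : realType) (m : {measure set T -> \bar R}) (D : set T)
  (f g : T -> \bar R) : measurable D -> measurable_fun setT f -> measurable_fun setT g ->
  (forall x, 0 <= f x)%E -> (forall x, D x -> f x <= g x)%E ->
  (\int[m]_(x in D) f x <= \int[m]_(x in D) g x)%E.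
Proof.
move=> mD mf mg f0 fg; apply: ge0_le_integral => //; exact: measurable_funTS.
Qed.

Section TonelliOn.
Local Open Scope ereal_scope.
Context d1 d2 (T1 : measurableType d1) (T2 : measurableType d2) (R : realType).
Variables (m1 : {sigma_finite_measure set T1 -> \bar R}) (m2 : {sigma_finite_measure set T2 -> \bar R}).
Variables (f : T1 -> T2 -> \bar R).
Hypothesis mf : measurable_fun setT (fun p : T1 * T2 => f p.1 p.2).
Hypothesis f0 : forall x y, 0 <= f x y.

Lemma measurable_int_snd : measurable_fun setT (fun x => \int[m2]_y f x y).
Proof. exact: (@measurable_fun_fubini_tonelli_F _ _ _ _ _ m2 _ mf). Qed.

Lemma measurable_int_fst : measurable_fun setT (fun y => \int[m1]_x f x y).
Proof. exact: (@measurable_fun_fubini_tonelli_G _ _ _ _ _ m1 _ mf). Qed.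

Lemma tonelli_on (D : set T1) : measurable D ->
  \int[m1]_(x in D) \int[m2]_y f x y = \int[m2]_y \int[m1]_(x in D) f x y.
Proof.
move=> mD.
have mI : measurable_fun setT (fun p : T1 * T2 => (\1_D p.1)%:E : \bar R).
  by apply/measurable_EFinP; apply: (measurableT_comp (measurable_indic mD)); exact: measurable_fst.
have mg : measurable_fun setT (fun p : T1 * T2 => f p.1 p.2 * (\1_D p.1)%:E) by exact: emeasurable_funM.
have g0 (p : T1 * T2) : 0 <= f p.1 p.2 * (\1_D p.1)%:E by rewrite mule_ge0// lee_fin.
rewrite int_patch1.
under eq_integral => x _.
  rewrite -ge0_integralZr//; last by exact: (measurableT_comp mf (pair1_measurable x)).
  over.
rewrite (fubini_tonelli (m1 := m1) (m2 := m2) _ mg g0).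
by apply: eq_integral => y _; rewrite [RHS]int_patch1.
Qed.

Lemma finite_int_ae d (T : measurableType d) (m : {measure set T -> \bar R}) (D : set T) (g : T -> \bar R) :
  measurable D -> measurable_fun D g -> (forall x, 0 <= g x) -> \int[m]_(x in D) g x < +oo ->
  {ae m, forall x, D x -> g x < +oo}.
Proof.
move=> mD mg g0 fin; have ig : m.-integrable D g.
  apply/integrableP; split => //; apply: le_lt_trans fin; apply: ge0_le_integral => //.
    exact: measurableT_comp.
  by move=> x _; rewrite gee0_abs.
have := integrable_ae mD ig; apply: filterS => x H Dx.
by move: (H Dx); rewrite ge0_fin_numE.
Qed.

End TonelliOn.

(** * Cauchy transforms and potentials *)

Section CauchyMeasurable.
Variable R : realType.
Local Notation P2 := (R * R)%type.

Definition mfC d (T : measurableType d) (f : T -> R[i]) :=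
  measurable_fun setT (fun t => complex.Re (f t)) /\ measurable_fun setT (fun t => complex.Im (f t)).

Lemma measurable_invr : measurable_fun setT (fun x : R => x^-1).
Proof.
have -> : (fun x : R => x^-1) = (fun x => if 0 <= x then x `^ (-1) else - (- x) `^ (-1)).
  apply/funext => x; case: ifPn => x0; first by rewrite powR_inv1.
  by rewrite powR_inv1 ?invrN ?opprK// oppr_ge0 ltW// ltNge.
apply: measurable_fun_ifT; [exact: measurable_fun_ler|exact: measurable_powR|].
by apply: measurable_funN; apply: measurableT_comp (measurable_powR _) _; exact: oppr_measurable.
Qed.

Section Maps.
Context d (T : measurableType d).
Implicit Types f g : T -> R[i].

Lemma mfC_cst c : mfC (fun _ : T => c).
Proof. by split; exact: measurable_cst. Qed.

Lemma mfCB f g : mfC f -> mfC g -> mfC (fun t => f t - g t).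
Proof.
move=> [f1 f2] [g1 g2]; split; [under eq_fun do rewrite cReB|under eq_fun do rewrite cImB];
  exact: measurable_funB.
Qed.

Lemma mfCM f g : mfC f -> mfC g -> mfC (fun t => f t * g t).
Proof.
move=> [f1 f2] [g1 g2]; split; [under eq_fun do rewrite cReM|under eq_fun do rewrite cImM].
  by apply: measurable_funB; exact: measurable_funM.
by apply: measurable_funD; exact: measurable_funM.
Qed.

Lemma mfCV f : mfC f -> mfC (fun t => (f t)^-1).
Proof.
move=> [f1 f2]; have mn : measurable_fun setT (fun t => (nc (f t) ^+ 2)^-1).
  apply: measurableT_comp measurable_invr _; under eq_fun do rewrite nc_sqr.
  by apply: measurable_funD; exact: measurable_funX.
split; [under eq_fun do rewrite cReV|under eq_fun do rewrite cImV].
  exact: measurable_funM.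
by apply: measurable_funN; exact: measurable_funM.
Qed.

Lemma mfC_toC (f : T -> P2) : measurable_fun setT f -> mfC (fun t => toC (f t)).
Proof. by move=> /measurable_fun_pairP[]. Qed.

Lemma mfC_pair f : mfC f -> measurable_fun setT (fun t => (complex.Re (f t), complex.Im (f t)) : P2).
Proof. by move=> [f1 f2]; exact: measurable_fun_pair. Qed.

End Maps.

Lemma mfC_comp d d' (T : measurableType d) (T' : measurableType d') (f : T -> R[i]) (g : T' -> T) :
  mfC f -> measurable_fun setT g -> mfC (fun t => f (g t)).
Proof. by move=> [f1 f2] mg; split; [exact: (measurableT_comp f1)|exact: (measurableT_comp f2)]. Qed.

Lemma cauchy_kernelE (z : R[i]) (q : P2) : 1 / (z - toC q) = (z - toC q)^-1.
Proof. by rewrite mul1r. Qed.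

Variable mu : {finite_measure set P2 -> \bar R}.

Lemma measurable_integral_snd d (T : measurableType d) (k : T -> P2 -> R) :
  measurable_fun setT (fun p : T * P2 => k p.1 p.2) ->
  measurable_fun setT (fun t => Rintegral mu setT (k t)).
Proof.
move=> mk; rewrite /Rintegral.
apply: (measurableT_comp (fine_measurable (@measurableT _ _))).
under eq_fun => t do rewrite integralE.
have mE : measurable_fun setT (fun p : T * P2 => (k p.1 p.2)%:E) by exact/measurable_EFinP.
apply: emeasurable_funB.
  apply: (@measurable_int_snd _ _ _ _ _ mu (fun t q => (fun x => (k t x)%:E)^\+%E q)) => //.
  by apply: eq_measurable_fun (measurable_funepos mE) => p _; rewrite !funeposE.
apply: (@measurable_int_snd _ _ _ _ _ mu (fun t q => (fun x => (k t x)%:E)^\-%E q)) => //.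
by apply: eq_measurable_fun (measurable_funeneg mE) => p _; rewrite !funenegE.
Qed.

Lemma mfC_kernel d (T : measurableType d) (f : T -> R[i]) : mfC f ->
  mfC (fun p : T * P2 => (f p.1 - toC p.2)^-1).
Proof.
move=> mf; apply: mfCV; apply: mfCB; first exact: mfC_comp.
by apply: mfC_toC.
Qed.

Lemma mfC_cauchy d (T : measurableType d) (f : T -> R[i]) : mfC f -> mfC (fun t => Defs.cauchy mu (f t)).
Proof.
move=> /mfC_kernel[m1 m2]; split; rewrite /Defs.cauchy/=; apply: measurable_integral_snd.
  by rewrite /cauchy_re; under eq_fun do rewrite cauchy_kernelE.
by rewrite /cauchy_im; under eq_fun do rewrite cauchy_kernelE.
Qed.

End CauchyMeasurable.

Section CauchyIntegral.
Variable R : realType.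
Local Notation P2 := (R * R)%type.
Variable mu : {finite_measure set P2 -> \bar R}.

Definition toP (z : R[i]) : P2 := (complex.Re z, complex.Im z).

Lemma toPK z : toC (toP z) = z. Proof. exact: toC_ReIm. Qed.

Lemma toCK (p : P2) : toP (toC p) = p. Proof. by case: p. Qed.

Lemma kap_inv (z : R[i]) (q : P2) : ((nc (z - toC q)^-1)%:E <= kap (toP z) q)%E.
Proof.
apply: kap_ge; rewrite toPK ncV; have [->|n0] := eqVneq (nc (z - toC q)) 0; first by rewrite mulr0.
by rewrite mulVf.
Qed.

(** Majorises the integral of 1/|z - q| against [mu]: where it is finite the Cauchy integral
    converges absolutely, and where it is integrable along a curve Fubini applies to the kernel. *)
Definition pot (z : R[i]) : \bar R := (\int[mu]_q kap (toP z) q)%E.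

Lemma pot_ge0 z : (0 <= pot z)%E.
Proof. by apply: integral_ge0 => q _; exact: kap_ge0. Qed.

Lemma measurable_pot d (T : measurableType d) (f : T -> R[i]) : mfC f ->
  measurable_fun setT (fun t => pot (f t)).
Proof.
move=> mf; apply: measurable_int_snd => [|t q]; last exact: kap_ge0.
apply: measurable_kap => //; apply: (measurableT_comp (mfC_pair mf)).
exact: measurable_fst.
Qed.

Lemma measurable_cauchy_Re (z c : R[i]) : measurable_fun setT (fun q : P2 => complex.Re (c * (z - toC q)^-1)).
Proof.
have [] // := @mfCM R _ P2 (fun=> c) (fun q => (z - toC q)^-1).
by apply: mfCV; apply: mfCB; [exact: mfC_cst|exact: mfC_toC].
Qed.

Lemma integrable_cauchy_Re z c : (pot z < +oo)%E ->
  mu.-integrable setT (EFin \o (fun q : P2 => complex.Re (c * (z - toC q)^-1))).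
Proof.
move=> fin; apply/integrableP; split; first by apply/measurable_EFinP; exact: measurable_cauchy_Re.
apply: (@le_lt_trans _ _ ((nc c)%:E * pot z)%E); last first.
  by rewrite lte_mul_pinfty// lee_fin nc_ge0.
have mk : measurable_fun setT (fun q => kap (toP z) q : \bar R) by apply: measurable_kap.
rewrite /pot -ge0_integralZl//; last 2 first.
- by move=> q _; exact: kap_ge0.
- by rewrite lee_fin nc_ge0.
apply: ge0_le_integral => //.
- by apply: measurableT_comp => //; apply/measurable_EFinP; exact: measurable_cauchy_Re.
- by apply: emeasurable_funM.
move=> q _; rewrite /= (@le_trans _ _ (nc (c * (z - toC q)^-1))%:E)//.
  by rewrite lee_fin nc_Re.
by rewrite ncM EFinM lee_wpmul2l ?lee_fin ?nc_ge0// kap_inv.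
Qed.

Lemma cauchy_linear z c : (pot z < +oo)%E ->
  Rintegral mu setT (fun q : P2 => complex.Re (c * (z - toC q)^-1)) = complex.Re (Defs.cauchy mu z * c).
Proof.
move=> fin; have i1 := integrable_cauchy_Re 1 fin; have i2 := integrable_cauchy_Re (- 'i) fin.
have E1 : cauchy_re z = (fun q : P2 => complex.Re (1 * (z - toC q)^-1)) by [].
have E2 : cauchy_im z = (fun q : P2 => complex.Re (- 'i * (z - toC q)^-1)).
  by apply/funext => q; rewrite /cauchy_im mul1r mulNr cReN cReM /=; ring.
rewrite cReM /Defs.cauchy E1 E2 /=.
rewrite -!RintegralZr//.
have i1' := integrableZr (@measurableT _ _) (complex.Re c) i1.
have i2' := integrableZr (@measurableT _ _) (complex.Im c) i2.
rewrite -RintegralB//; apply: eq_Rintegral => q _.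
by rewrite mul1r mulNr cReN !cReM /=; ring.
Qed.

Section Curve.
Variables (a b M : R) (f h : R -> R[i]).
Hypotheses (mf : mfC f) (mh : mfC h) (hM : forall t, a <= t <= b -> nc (h t) <= M).
Hypothesis fin : (\int[lebesgue_measure]_(t in `[a, b]) pot (f t) < +oo)%E.

Let leb := @lebesgue_measure R.
Let k (t : R) (q : P2) := complex.Re (h t * (f t - toC q)^-1).
Let kk (p : R * P2) : \bar R := (k p.1 p.2 * \1_(`[a, b] : set R) p.1)%:E.

Let M0 : 0 <= Num.max M 0. Proof. by rewrite le_max lexx orbT. Qed.

Let mkk : measurable_fun setT kk.
Proof.
apply/measurable_EFinP; apply: measurable_funM.
  have [] // := @mfCM R _ (R * P2)%type (fun p => h p.1) (fun p => (f p.1 - toC p.2)^-1).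
    by apply: mfC_comp => //; exact: measurable_fst.
  exact: mfC_kernel.
by apply: (measurableT_comp (measurable_indic (measurable_itv `[a, b]))); exact: measurable_fst.
Qed.

Let kk_le t q : (`|kk (t, q)| <= (Num.max M 0)%:E * kap (toP (f t)) q * (\1_(`[a, b] : set R) t)%:E)%E.
Proof.
rewrite /kk/= indicE; case: (boolP (t \in _)) => tab; last by rewrite mulr0 normr0 mule0.
rewrite mulr1 mule1 (@le_trans _ _ (nc (h t * (f t - toC q)^-1))%:E) ?lee_fin ?nc_Re//.
have H : nc (h t) <= Num.max M 0.
  by move: tab; rewrite inE/= in_itv/= => tab; rewrite le_max hM.
rewrite ncM EFinM; apply: lee_pmul; rewrite ?lee_fin ?nc_ge0//; exact: kap_inv.
Qed.

Let int_kk : (leb \x mu)%E.-integrable setT kk.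
Proof.
apply/integrable12ltyP; first exact: mkk.
have mp : measurable_fun setT (fun t => pot (f t)) by exact: measurable_pot.
have mk2 : measurable_fun setT (fun p : R * P2 => kap (toP (f p.1)) p.2 : \bar R).
  by apply: measurable_kap => //; apply: (measurableT_comp (mfC_pair mf)); exact: measurable_fst.
have mI : measurable_fun setT (fun t : R => (\1_(`[a, b] : set R) t)%:E : \bar R).
  by apply/measurable_EFinP; exact: measurable_indic.
have pI0 (t : R) : (0 <= pot (f t) * (\1_(`[a, b] : set R) t)%:E)%E by rewrite mule_ge0 ?pot_ge0 ?lee_fin.
have mpI : measurable_fun setT (fun t => pot (f t) * (\1_(`[a, b] : set R) t)%:E)%E by apply: emeasurable_funM.
have mak : measurable_fun setT (fun p => `|kk p|)%E by exact: measurableT_comp.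
apply: (@le_lt_trans _ _ (\int[leb]_t ((Num.max M 0)%:E * (pot (f t) * (\1_(`[a, b] : set R) t)%:E)))%E); last first.
  by rewrite (@int_Zl _ _ _ leb _ _ M0 mpI pI0) -int_patch1 lte_mul_pinfty// lee_fin.
apply: int_le => //.
- by apply: (@measurable_int_snd _ _ _ _ _ mu (fun t q => `|kk (t, q)|)%E).
- by apply: emeasurable_funM.
- by move=> t; apply: integral_ge0.
move=> t _.
have mkt : measurable_fun setT (fun q => kap (toP (f t)) q : \bar R) by apply: measurable_kap.
have kt0 q : (0 <= kap (toP (f t)) q :> \bar R)%E by exact: kap_ge0.
have I0 : 0 <= \1_(`[a, b] : set R) t :> R by [].
have mkI : measurable_fun setT (fun q => kap (toP (f t)) q * (\1_(`[a, b] : set R) t)%:E)%E by apply: emeasurable_funM.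
rewrite /pot -(int_Zr _ I0 mkt kt0) -(int_Zl _ M0 mkI); last by move=> q; rewrite mule_ge0 ?kap_ge0 ?lee_fin.
apply: int_le => //.
- exact: (measurableT_comp mak (pair1_measurable t)).
- by apply: emeasurable_funM.
by move=> q _; rewrite muleA kk_le.
Qed.

Lemma curve_fiber (t : R) : (`[a, b]%classic t -> pot (f t) < +oo)%E ->
  (\int[mu]_q kk (t, q) = (complex.Re (Defs.cauchy mu (f t) * h t) * \1_(`[a, b] : set R) t)%:E)%E.
Proof.
move=> ft; rewrite /kk/= indicE; case: (boolP (t \in _)) => tab; last first.
  by rewrite mulr0; under eq_integral do rewrite mulr0; rewrite integral0.
rewrite mulr1; have {}ft : (pot (f t) < +oo)%E by apply: ft; rewrite inE in tab.
under eq_integral do rewrite mulr1.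
rewrite -cauchy_linear// /Rintegral fineK//; apply: integrable_fin_num => //.
exact: integrable_cauchy_Re.
Qed.

Let mC : mfC (fun t => Defs.cauchy mu (f t) * h t).
Proof. by apply: mfCM => //; exact: mfC_cauchy. Qed.

Let mCI : measurable_fun setT (fun t => (complex.Re (Defs.cauchy mu (f t) * h t) * \1_(`[a, b] : set R) t)%:E).
Proof.
apply/measurable_EFinP; apply: measurable_funM; first by case: mC.
exact: measurable_indic.
Qed.

Let ae_fiber : ae_eq leb setT (fun t => \int[mu]_q kk (t, q))%E
  (fun t => (complex.Re (Defs.cauchy mu (f t) * h t) * \1_(`[a, b] : set R) t)%:E).
Proof.
have mp : measurable_fun `[a, b]%classic (fun t => pot (f t)) by apply: measurable_funTS; exact: measurable_pot.
have := finite_int_ae (m := leb) (measurable_itv `[a, b]) mp (fun t => pot_ge0 (f t)) fin.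
by apply: filterS => t ft _; exact: curve_fiber.
Qed.

Lemma curve_Re_integrable : leb.-integrable `[a, b] (EFin \o (fun t => complex.Re (Defs.cauchy mu (f t) * h t))).
Proof.
have /integrableP[mF finF] := integrable_fubini_F int_kk.
apply/integrableP; split; first by apply: measurable_funTS; apply/measurable_EFinP; case: mC.
rewrite int_patch1; apply: le_lt_trans finF; rewrite le_eqVlt; apply/orP; left; apply/eqP.
have mI : measurable_fun setT (fun t : R => (\1_(`[a, b] : set R) t)%:E : \bar R).
  by apply/measurable_EFinP; exact: measurable_indic.
have mA : measurable_fun setT (fun t => `|(complex.Re (Defs.cauchy mu (f t) * h t))%:E|)%E.
  by apply: measurableT_comp => //; apply/measurable_EFinP; case: mC.
apply: ge0_ae_eq_integral => //.
- exact: emeasurable_funM mA mI.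
- exact: measurableT_comp mF.
apply: filterS ae_fiber => t H _; rewrite /fubini_F H// EFinM abseM; congr (_ * _)%E.
by rewrite /= ger0_norm.
Qed.

(** Fubini for the kernel on the product of the parameter interval and the plane. Finiteness of the
    integral of [pot] along the curve bounds the absolute integral, since [h] is bounded there. *)
Lemma curve_Re : 
  mu.-integrable setT (EFin \o (fun q => rint (fun t => k t q) a b)) /\
  rint (fun t => complex.Re (Defs.cauchy mu (f t) * h t)) a b =
  Rintegral mu setT (fun q => rint (fun t => k t q) a b).
Proof.
have Gq q : rint (fun t => k t q) a b = fine (\int[leb]_t kk (t, q)).
  rewrite /rint /Rintegral; congr fine; rewrite [LHS]int_patch1; apply: eq_integral => t _.
  by rewrite /kk EFinM.
have mG := measurable_fubini_G int_kk.
have mak : measurable_fun setT (fun p => `|kk p|)%E by exact: measurableT_comp.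
have iG : mu.-integrable setT (fun q => \int[leb]_t kk (t, q))%E.
  apply/integrableP; split; first exact: mG.
  apply: le_lt_trans ((integrable21ltyP leb mu mkk).1 int_kk).
  apply: int_le => //.
  - by apply: measurableT_comp.
  - by apply: (@measurable_int_fst _ _ _ _ _ leb (fun t q => `|kk (t, q)|)%E).
  - by move=> q _; apply: le_abse_integral => //; exact: (measurableT_comp mkk (pair2_measurable q)).
have mfG : measurable_fun setT (fun q => fine (\int[leb]_t kk (t, q))) by apply: measurableT_comp => //; exact: fine_measurable.
have ifG : mu.-integrable setT (EFin \o (fun q => fine (\int[leb]_t kk (t, q)))).
  apply: le_integrable iG => //; first by apply/measurable_EFinP.
  by move=> q _ /=; case: (\int[_]_t _)%E => [r||] //=; rewrite ?normr0 ?leey.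
have -> : (fun q => rint (fun t => k t q) a b) = (fun q => fine (\int[leb]_t kk (t, q))).
  by apply/funext.
split => //; rewrite /rint /Rintegral; congr fine; rewrite [LHS]int_patch1.
transitivity (\int[leb]_t \int[mu]_q kk (t, q))%E.
  under eq_integral do rewrite -EFinM.
  apply: (ae_eq_integral (mu := leb) (D := setT) (fun t => \int[mu]_q kk (t, q))%E).
  - exact: measurableT.
  - exact: mCI.
  - exact: measurable_fubini_F int_kk.
  by apply: filterS ae_fiber => t H /H ->.
rewrite (Fubini int_kk); apply: ae_eq_integral => //; first exact/measurable_EFinP.
by have := integrable_ae measurableT iG; apply: filterS => q H /H /fineK ->.
Qed.

End Curve.
End CauchyIntegral.

Section CurveAvoidance.
Variable R : realType.
Local Notation P2 := (R * R)%type.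

Lemma rderiv_lipschitz (f f' : R -> R[i]) (a b M s t : R) :
  (forall t, a <= t <= b -> rderiv f t (f' t)) -> ctn f' `[a, b] ->
  (forall t, a <= t <= b -> nc (f' t) <= M) -> a <= s <= b -> a <= t <= b ->
  nc (f s - f t) <= 2 * M * `|s - t|.
Proof.
move=> df cf fM.
suff H s1 t1 : a <= s1 -> s1 <= t1 -> t1 <= b -> nc (f t1 - f s1) <= 2 * M * (t1 - s1).
  move=> /andP[s1 s2] /andP[t1 t2]; have [st|ts] := leP s t.
    by rewrite ncBC distrC ger0_norm ?subr_ge0// H.
  by rewrite gtr0_norm ?subr_gt0//; apply: H => //; exact: ltW.
move=> as1 st tb.
have sub x : s1 <= x <= t1 -> a <= x <= b.
  by move=> /andP[x1 x2]; rewrite (le_trans as1)// (le_trans x2).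
have csub : ctn f' `[s1, t1] by apply: ctn_sub cf => x; rewrite /= !in_itv/=; exact: sub.
have [E1 E2] := rderiv_FTC st (fun x xst => df _ (sub _ xst)) csub.
apply: le_trans (nc_le _) _; rewrite -E1 -E2.
rewrite [leRHS](_ : _ = M * (t1 - s1) + M * (t1 - s1)); last by ring.
apply: lerD; apply: rint_bound => //; [exact: ctn_Re| |exact: ctn_Im|] => x /sub xab.
  by apply: le_trans (nc_Re _) _; exact: fM.
by apply: le_trans (nc_Im _) _; exact: fM.
Qed.

Lemma is_derive_ln_shift (s c t : R) : s ^+ 2 = 1 -> 0 < s * (t - c) ->
  is_derive t 1 (fun x => s * ln (s * (x - c))) (s * (t - c))^-1.
Proof.
move=> s1 tc.
have H1 : is_derive (s * (t - c)) 1 (@ln R) (s * (t - c))^-1 by exact: is_derive1_ln.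
have H2 : is_derive t 1 (fun x : R => s * (x - c)) s.
  apply: eps_is_derive => e e0; exists 1 => // u _.
  have -> : s * (t + u - c) - s * (t - c) - u * s = 0 by ring.
  by rewrite normr0 mulr_ge0// ltW.
have H3 : is_derive t 1 (fun x => ln (s * (x - c))) ((s * (t - c))^-1 * s) by have := is_derive1_comp (H1 : is_derive ((fun x : R => s * (x - c)) t) 1 _ _) H2.
apply: is_derive_eq (is_deriveZ s H3) _.
by rewrite /GRing.scale/= mulrCA -expr2 s1 mulr1.
Qed.

Lemma int_inv_shift (s c lo hi : R) : s ^+ 2 = 1 -> lo <= hi -> (forall t, lo <= t <= hi -> 0 < s * (t - c)) ->
  (\int[@lebesgue_measure R]_(t in `[lo, hi]) ((s * (t - c))^-1)%:E =
   (s * ln (s * (hi - c)) - s * ln (s * (lo - c)))%:E)%E.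
Proof.
move=> s1 lh pos.
have cf : {within `[lo, hi], continuous (fun t => (s * (t - c))^-1)}.
  have c1 : ctn (fun t : R => s%:C * (t%:C - c%:C)) `[lo, hi].
    by apply: ctnM; [exact: ctn_cst|apply: ctnB; [exact: ctn_id|exact: ctn_cst]].
  have E t : s%:C * (t%:C - c%:C) = (s * (t - c))%:C by rewrite (rmorphM (real_complex R)) (rmorphB (real_complex R)).
  have c2 : ctn (fun t : R => (s%:C * (t%:C - c%:C))^-1) `[lo, hi].
    apply: ctnV c1 _ => t; rewrite /= in_itv/= => /pos p0.
    by rewrite E -nc_gt0 ncC normr_gt0 gt_eqF.
  apply: eps_within_continuous => x Ax e e0; have [D D0 HD] := c2 _ Ax _ e0.
  exists D => // y Ay yx; have := HD _ Ay yx.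
  rewrite !E -!(fmorphV (real_complex R)) -(rmorphB (real_complex R)) /= ncC.
  by [].
have dF x : lo <= x <= hi -> is_derive x 1 (fun x => s * ln (s * (x - c))) (s * (x - c))^-1.
  by move=> xlh; apply: is_derive_ln_shift => //; exact: pos.
rewrite -(@rint_FTC R _ (fun x => s * ln (s * (x - c))) lo hi lh dF cf).
by rewrite /rint /Rintegral fineK//; apply: integrable_fin_num => //; exact: cont_integrable.
Qed.

Variable mu : {finite_measure set P2 -> \bar R}.

(** If the curve passes through q at time t0, then [kap] along it is at least 1 / (L |t - t0|),
    which is not integrable at t0. By Tonelli such q form a [mu]-null set. *)
Lemma curve_avoids (a b L : R) (f : R -> R[i]) : a < b -> mfC f -> 0 < L ->
  (forall s t, a <= s <= b -> a <= t <= b -> nc (f s - f t) <= L * `|s - t|) ->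
  (\int[lebesgue_measure]_(t in `[a, b]) pot mu (f t) < +oo)%E ->
  {ae mu, forall q, forall t, a <= t <= b -> f t != toC q}.
Proof.
move=> ab mf L0 lip.
have mk2 : measurable_fun setT (fun p : R * P2 => kap (toP (f p.1)) p.2 : \bar R).
  by apply: measurable_kap => //; apply: (measurableT_comp (mfC_pair mf)); exact: measurable_fst.
rewrite (@tonelli_on _ _ _ _ _ (@lebesgue_measure R) mu (fun t q => kap (toP (f t)) q) mk2)//; last first.
  by move=> t q; exact: kap_ge0.
move=> fin.
have m3 : measurable_fun setT (fun q => \int[lebesgue_measure]_(t in `[a, b]) kap (toP (f t)) q)%E.
  under eq_fun do rewrite int_patch1.
  apply: (@measurable_int_fst _ _ _ _ _ (@lebesgue_measure R) (fun t q => kap (toP (f t)) q * (\1_(`[a, b] : set R) t)%:E)%E).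
    apply: emeasurable_funM => //; apply/measurable_EFinP.
    by apply: (measurableT_comp (measurable_indic (measurable_itv `[a, b]))); exact: measurable_fst.
  by move=> t q; rewrite mule_ge0 ?kap_ge0 ?lee_fin.
have g0 (q : P2) : (0 <= \int[lebesgue_measure]_(t in `[a, b]) kap (toP (f t)) q)%E.
  by apply: integral_ge0 => t _; exact: kap_ge0.
have := finite_int_ae (m := mu) measurableT m3 g0 fin; apply: filterS => q /(_ I) finq t0 t0ab.
apply/negP => /eqP ftq.
have mkq : measurable_fun setT (fun t => kap (toP (f t)) q : \bar R).
  by apply: measurable_kap => //; exact: mfC_pair.
(* The sign s selects the side of t0; at least one side has positive length, even if t0 is an end
   point. *)
have key (s lo hi : R) : s ^+ 2 = 1 -> a <= lo -> hi <= b -> lo <= hi -> (forall t, lo <= t <= hi -> 0 < s * (t - t0)) ->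
    ((L^-1 * (s * ln (s * (hi - t0)) - s * ln (s * (lo - t0))))%:E <=
     \int[lebesgue_measure]_(t in `[a, b]) kap (toP (f t)) q)%E.
  move=> s1 alo hib lh pos.
  have sub : `[lo, hi]%classic `<=` `[a, b]%classic.
    by move=> x; rewrite /= !in_itv/= => /andP[x1 x2]; rewrite (le_trans alo)// (le_trans x2).
  apply: (@le_trans _ _ (\int[lebesgue_measure]_(t in `[lo, hi]) kap (toP (f t)) q)%E); last first.
    by apply: ge0_subset_integral => //; [exact: measurable_funTS|move=> x _; exact: kap_ge0].
  have mi : measurable_fun setT (fun t : R => ((s * (t - t0))^-1)%:E).
    apply/measurable_EFinP; apply: measurableT_comp (@measurable_invr R) _.
    by apply: measurable_funM => //; exact: measurable_funB.
  rewrite EFinM -(int_inv_shift s1 lh pos) -ge0_integralZl//; last 3 first.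
  - exact: measurable_funTS.
  - by move=> t; rewrite /= in_itv/= => /pos p0; rewrite lee_fin invr_ge0 ltW.
  - by rewrite lee_fin invr_ge0 ltW.
  apply: ge0_le_integral => //.
  - by move=> t; rewrite /= in_itv/= => /pos p0; rewrite mule_ge0 ?lee_fin ?invr_ge0 ?ltW.
  - by apply: measurable_funTS; exact: emeasurable_funM.
  - exact: measurable_funTS.
  move=> t tlh; have := sub _ tlh; rewrite /= in_itv/= => tab.
  move: tlh; rewrite /= in_itv/= => /pos p0.
  rewrite -EFinM -invfM; apply: kap_ge; rewrite toPK -ftq ler_pdivrMl ?(mulr_gt0 L0 p0)// mulr1.
  apply: le_trans (lip _ _ tab t0ab) _; rewrite ler_pM2l// -[leRHS]gtr0_norm// normrM.
  have -> : `|s| = 1 by apply/eqP; rewrite -(@eqrXn2 _ 2)// ?expr1n ?real_normK ?num_real ?s1.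
  by rewrite mul1r.
have [r finE] : exists r : R, (\int[lebesgue_measure]_(t in `[a, b]) kap (toP (f t)) q)%E = r%:E.
  by exists (fine (\int[lebesgue_measure]_(t in `[a, b]) kap (toP (f t)) q)%E); rewrite fineK// ge0_fin_numE.
rewrite finE in key.
have r0 : 0 <= r by rewrite -lee_fin -finE.
(* Leaving out a fraction [E] of the interval next to t0 makes the logarithmic lower bound equal to
   r + 1, which exceeds the supposed value r. *)
pose E := expR (- (L * (r + 1))).
have E0 : 0 < E by exact: expR_gt0.
have E1 : E < 1 by rewrite -expR0 ltr_expR oppr_lt0 mulr_gt0// ltr_wpDl.
have lnE d : 0 < d -> ln (d * E) = ln d - L * (r + 1) by move=> d0; rewrite lnM ?posrE// expRK.
move: t0ab => /andP[at0 t0b].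
have [t0b'|bt0] := ltP t0 b.
  have d0 : 0 < b - t0 by rewrite subr_gt0.
  have dE : (b - t0) * E < b - t0 by rewrite gtr_pMr.
  have dE0 := mulr_gt0 d0 E0.
  have pos t : t0 + (b - t0) * E <= t <= b -> 0 < 1 * (t - t0) by move=> /andP[? ?]; lra.
  have := key 1 (t0 + (b - t0) * E) b (expr1n _ _) ltac:(lra) (lexx _) ltac:(lra) pos.
  have -> : L^-1 * (1 * ln (1 * (b - t0)) - 1 * ln (1 * (t0 + (b - t0) * E - t0))) = r + 1.
    rewrite !mul1r (_ : t0 + (b - t0) * E - t0 = (b - t0) * E); last by ring.
    by rewrite lnE//; field; rewrite gt_eqF.
  by rewrite lee_fin; lra.
have d0 : 0 < t0 - a by rewrite subr_gt0 (lt_le_trans ab).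
have dE : (t0 - a) * E < t0 - a by rewrite gtr_pMr.
have dE0 := mulr_gt0 d0 E0.
have pos t : a <= t <= t0 - (t0 - a) * E -> 0 < -1 * (t - t0) by move=> /andP[? ?]; lra.
have := key (-1) a (t0 - (t0 - a) * E) ltac:(by rewrite sqrrN expr1n) (lexx _) ltac:(lra) ltac:(lra) pos.
have -> : L^-1 * (-1 * ln (-1 * (t0 - (t0 - a) * E - t0)) - -1 * ln (-1 * (a - t0))) = r + 1.
  rewrite (_ : -1 * (t0 - (t0 - a) * E - t0) = (t0 - a) * E); last by ring.
  rewrite (_ : -1 * (a - t0) = t0 - a); last by ring.
  by rewrite lnE//; field; rewrite gt_eqF.
by rewrite lee_fin; lra.
Qed.

End CurveAvoidance.

Section CurveFubini.
Variable R : realType.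
Local Notation P2 := (R * R)%type.
Variable mu : {finite_measure set P2 -> \bar R}.
Local Notation leb := (@lebesgue_measure R).

Lemma mfC_extend (f : R -> R[i]) (a b : R) : ctn f `[a, b] ->
  exists2 g : R -> R[i], mfC g & forall t, a <= t <= b -> g t = f t.
Proof.
move=> cf; pose g t := if a <= t <= b then f t else 0; exists g; last by move=> t tab; rewrite /g tab.
have H (u : R[i] -> R) : u 0 = 0 -> {within `[a, b], continuous (fun t => u (f t))} ->
    measurable_fun setT (fun t => u (g t)).
  move=> u0 cu; have -> : (fun t => u (g t)) = (fun t => u (f t)) \_ `[a, b].
    apply/funext => t; rewrite patchE /g; case: ifPn => tab.
      by rewrite mem_set//= in_itv.
    by rewrite memNset//= in_itv/= (negbTE tab).
  apply/(measurable_restrictT _ (measurable_itv `[a, b])).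
  exact: (subspace_continuous_measurable_fun (measurable_itv `[a, b]) cu).
by split; apply: H => //; [exact: ctn_Re|exact: ctn_Im].
Qed.

Lemma int_pot_eq (f g : R -> R[i]) (a b : R) : (forall t, a <= t <= b -> g t = f t) ->
  (\int[leb]_(t in `[a, b]) pot mu (g t) = \int[leb]_(t in `[a, b]) pot mu (f t))%E.
Proof.
by move=> gf; apply: eq_integral => t; rewrite inE/= in_itv/= => tab; rewrite gf.
Qed.

Lemma ctn_bounded (f : R -> R[i]) (a b : R) : a <= b -> ctn f `[a, b] ->
  exists2 M : R, 0 < M & forall t, a <= t <= b -> nc (f t) <= M.
Proof.
move=> ab /ctn_nc cf; have [x xab Hx] := EVT_max ab cf.
exists (nc (f x) + 1); first by rewrite ltr_wpDl ?nc_ge0.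
by move=> t tab; rewrite (le_trans (Hx _ _))//; lra.
Qed.

Variables (a b : R) (f f' : R -> R[i]).
Hypotheses (ab : a < b) (df : forall t, a <= t <= b -> rderiv f t (f' t)) (cf' : ctn f' `[a, b]).
Hypothesis fin : (\int[leb]_(t in `[a, b]) pot mu (f t) < +oo)%E.

Let cf : ctn f `[a, b].
Proof. by apply: (@rderiv_ctn _ f f') => t; rewrite /= in_itv/=; exact: df. Qed.

Lemma curve_disjoint : {ae mu, forall q, forall t, a <= t <= b -> f t != toC q}.
Proof.
have [g mg gf] := mfC_extend cf.
have [M M0 fM] := ctn_bounded (ltW ab) cf'.
have L0 : 0 < 2 * M by rewrite mulr_gt0.
have lip s t : a <= s <= b -> a <= t <= b -> nc (g s - g t) <= 2 * M * `|s - t|.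
  by move=> sab tab; rewrite !gf//; exact: (rderiv_lipschitz df cf').
have fin' : (\int[leb]_(t in `[a, b]) pot mu (g t) < +oo)%E by rewrite (int_pot_eq gf).
have := curve_avoids ab mg L0 lip fin'.
by apply: filterS => q H t tab; rewrite -gf// H.
Qed.

(** The constant c chooses the component of the contour integral: 1 gives its real part and [- 'i]
    its imaginary part. *)
Lemma curve_fubini c :
  [/\ leb.-integrable `[a, b] (EFin \o (fun t => complex.Re (Defs.cauchy mu (f t) * (c * f' t)))),
    mu.-integrable setT (EFin \o (fun q => rint (fun t => complex.Re (c * f' t * (f t - toC q)^-1)) a b)) &
    rint (fun t => complex.Re (Defs.cauchy mu (f t) * (c * f' t))) a b =
    Rintegral mu setT (fun q => rint (fun t => complex.Re (c * f' t * (f t - toC q)^-1)) a b)].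
Proof.
have ch : ctn (fun t => c * f' t) `[a, b] by apply: ctnM => //; exact: ctn_cst.
have [g mg gf] := mfC_extend cf; have [h mh hf] := mfC_extend ch.
have [M M0 fM] := ctn_bounded (ltW ab) ch.
have hM t : a <= t <= b -> nc (h t) <= M by move=> tab; rewrite hf// fM.
have fin' : (\int[leb]_(t in `[a, b]) pot mu (g t) < +oo)%E.
  by rewrite (int_pot_eq gf).
have i1 := curve_Re_integrable mg mh hM fin'.
have [i2 E] := curve_Re mg mh hM fin'.
have E1 t : a <= t <= b -> complex.Re (Defs.cauchy mu (g t) * h t) = complex.Re (Defs.cauchy mu (f t) * (c * f' t)).
  by move=> tab; rewrite gf// hf.
have E2 : (fun q : P2 => rint (fun t => complex.Re (h t * (g t - toC q)^-1)) a b) =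
    (fun q => rint (fun t => complex.Re (c * f' t * (f t - toC q)^-1)) a b).
  by apply/funext => q; apply: rint_eq => t tab; rewrite gf// hf.
rewrite E2 in i2 E; split => //.
  apply: eq_integrable i1 => // t; rewrite inE/= in_itv/= => tab.
  by rewrite E1.
by rewrite -E; apply: rint_eq => t tab; rewrite E1.
Qed.

End CurveFubini.

Section LogDerivative.
Variable R : realType.

Lemma is_derive_lnnc (f : R -> R[i]) (t : R) d : rderiv f t d -> f t != 0 ->
  is_derive t 1 (fun s => ln (nc (f s) ^+ 2)) (2 * complex.Re (d / f t)).
Proof.
move=> df f0.
have n0 : 0 < nc (f t) ^+ 2 by rewrite exprn_gt0// nc_gt0.
have dR := rderiv_Re df; have dI := rderiv_Im df.
have H1 : is_derive t 1 (fun s => nc (f s) ^+ 2)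
    (2 * (complex.Re (f t) * complex.Re d + complex.Im (f t) * complex.Im d)).
  have -> : (fun s => nc (f s) ^+ 2) = (fun s => complex.Re (f s)) * (fun s => complex.Re (f s)) +
      (fun s => complex.Im (f s)) * (fun s => complex.Im (f s)).
    by apply/funext => s; rewrite nc_sqr !expr2.
  apply: is_derive_eq (is_deriveD (is_deriveM dR dR) (is_deriveM dI dI)) _.
  by rewrite /GRing.scale/=; ring.
have H2 : is_derive (nc (f t) ^+ 2) 1 (@ln R) (nc (f t) ^+ 2)^-1 by exact: is_derive1_ln.
have H3 := is_derive1_comp (H2 : is_derive ((fun s => nc (f s) ^+ 2) t) 1 _ _) H1.
apply: is_derive_eq H3 _.
by rewrite cReM cReV cImV; field; rewrite ?expf_neq0 ?gt_eqF ?nc_gt0.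
Qed.

Lemma rint_logderiv (f f' : R -> R[i]) (a b : R) : a <= b ->
  (forall t, a <= t <= b -> rderiv f t (f' t)) -> ctn f' `[a, b] ->
  (forall t, a <= t <= b -> f t != 0) ->
  rint (fun t => complex.Re (f' t / f t)) a b = (ln (nc (f b) ^+ 2) - ln (nc (f a) ^+ 2)) / 2.
Proof.
move=> ab df cf' f0.
have cf : ctn f `[a, b] by apply: (@rderiv_ctn _ f f') => t; rewrite /= in_itv/=; exact: df.
have c1 : ctn (fun t => f' t / f t) `[a, b].
  by apply: ctnM => //; apply: ctnV => // t; rewrite /= in_itv/=; exact: f0.
have H t : a <= t <= b -> is_derive t 1 (fun s => ln (nc (f s) ^+ 2) / 2) (complex.Re (f' t / f t)).
  move=> tab; have := is_derive_lnnc (df _ tab) (f0 _ tab) => H.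
  have -> : (fun s => ln (nc (f s) ^+ 2) / 2) = 2^-1 *: (fun s => ln (nc (f s) ^+ 2)).
    by apply/funext => s; rewrite mulrC.
  by apply: is_derive_eq (is_deriveZ _ H) _; rewrite /GRing.scale/= mulKf.
by rewrite (rint_FTC ab H (ctn_Re c1)); ring.
Qed.

End LogDerivative.

(** * Integrability along almost every line *)

Section GoodLines.
Variable R : realType.
Local Notation P2 := (R * R)%type.
Local Notation leb := (@lebesgue_measure R).

Lemma good_lines (g : P2 -> \bar R) (A B : set R) : measurable A -> measurable B ->
  measurable_fun setT g -> (forall p, 0 <= g p)%E -> (\int[@lebC R]_(p in A `*` B) g p < +oo)%E ->
  {ae leb, forall x, A x -> (\int[leb]_(y in B) g (x, y) < +oo)%E} /\
  {ae leb, forall y, B y -> (\int[leb]_(x in A) g (x, y) < +oo)%E}.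
Proof.
move=> mA mB mg g0; rewrite int_patch1 => fin.
have mI : measurable_fun setT (fun p => (\1_(A `*` B) p)%:E : \bar R).
  by apply/measurable_EFinP; apply: measurable_indic; exact: measurableX.
pose k (p : P2) := (g p * (\1_(A `*` B) p)%:E)%E.
have mk : measurable_fun setT k by exact: emeasurable_funM.
have k0 p : (0 <= k p)%E by rewrite mule_ge0 ?lee_fin.
have indE x y : \1_(A `*` B) (x, y) = \1_A x * \1_B y :> R.
  by rewrite !indicE in_setX -natrM mulnb.
split.
- have F1 : (\int[leb]_x \int[leb]_y k (x, y) < +oo)%E.
    by rewrite -(fubini_tonelli1 (m1 := leb) (m2 := leb) k).
  have m1 : measurable_fun setT (fun x => \int[leb]_y k (x, y))%E.
    exact: (measurable_fun_fubini_tonelli_F (m2 := leb) k).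
  have g1 x : (0 <= \int[leb]_y k (x, y))%E by apply: integral_ge0.
  have := finite_int_ae (m := leb) measurableT m1 g1 F1.
  apply: filterS => x /(_ I) H Ax; rewrite int_patch1; move: H.
  rewrite /k; congr (_ < _)%E; apply: eq_integral => y _.
  by rewrite indE indicE mem_set// mul1r.
- have F2 : (\int[leb]_y \int[leb]_x k (x, y) < +oo)%E.
    by rewrite -(fubini_tonelli2 (m1 := leb) (m2 := leb) k).
  have m2 : measurable_fun setT (fun y => \int[leb]_x k (x, y))%E.
    exact: (measurable_fun_fubini_tonelli_G (m1 := leb) k).
  have g2 y : (0 <= \int[leb]_x k (x, y))%E by apply: integral_ge0.
  have := finite_int_ae (m := leb) measurableT m2 g2 F2.
  apply: filterS => y /(_ I) H By; rewrite int_patch1; move: H.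
  rewrite /k; congr (_ < _)%E; apply: eq_integral => x _.
  by rewrite indE [\1_B y]indicE mem_set// mulr1.
Qed.

Lemma int_union (g : P2 -> \bar R) (A B : set P2) : measurable A -> measurable B ->
  measurable_fun setT g -> (forall p, 0 <= g p)%E ->
  (\int[@lebC R]_(p in A) g p < +oo)%E -> (\int[@lebC R]_(p in B) g p < +oo)%E ->
  (\int[@lebC R]_(p in A `|` B) g p < +oo)%E.
Proof.
move=> mA mB mg g0 fA fB.
have mBA : measurable (B `\` A) by exact: measurableD.
have -> : A `|` B = A `|` (B `\` A).
  apply/seteqP; split=> p [Ap|Bp]; [by left| |by left|by case: Bp; right].
  by have [Ap|nAp] := pselect (A p); [left|right].
rewrite ge0_integral_setU//; last 2 first.
- by apply: measurable_funTS.
- by apply/disj_set2P; apply/seteqP; split => // x [Ax []].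
rewrite lte_add_pinfty//; apply: le_lt_trans fB.
by apply: ge0_subset_integral => //; exact: measurable_funTS.
Qed.

(** Compactness is applied with a set as the varying parameter, along the filter generated by
    enlarging measurable sets of finite integral; this replaces the choice of a finite subcover. *)
Lemma compact_int (g : P2 -> \bar R) (K : set P2) : measurable_fun setT g -> (forall p, 0 <= g p)%E ->
  compact K -> (forall p, K p -> exists2 e : R, 0 < e & (\int[@lebC R]_(p in ball p e) g p < +oo)%E) ->
  measurable K -> (\int[@lebC R]_(p in K) g p < +oo)%E.
Proof.
move=> mg g0 cK loc mK.
pose fin (A : set P2) := measurable A /\ (\int[@lebC R]_(p in A) g p < +oo)%E.
pose F : set_system (set P2) := fun S => exists2 A0, fin A0 & forall A, fin A -> A0 `<=` A -> S A.
have FF : Filter F.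
  split.
  - by exists set0 => //; split => //; rewrite integral_set0.
  - move=> S1 S2 [A1 [m1 f1] H1] [A2 [m2 f2] H2]; exists (A1 `|` A2).
      by split; [exact: measurableU|exact: int_union].
    by move=> A fA sub; split; [apply: H1|apply: H2] => // x Ax; apply: sub; [left|right].
  - by move=> S1 S2 sub [A0 f0 H]; exists A0 => // A fA A0A; apply: sub; exact: H.
have H : forall x, K x -> \forall x' \near x & A \near F, (A : set P2) x'.
  move=> x /loc[e e0 fe]; exists (ball x e, [set A | ball x e `<=` A]) => /=.
    split; first exact: nbhsx_ballx.
    by exists (ball x e) => //; split => //; exact: measurable_ball2.
  by move=> [x' A] [/= bx sub]; exact: sub.
have [A0 [mA0 fA0] sub] := (compact_near_coveringP _).1 cK _ F (fun (A : set P2) x => A x) FF H.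
have KA : K `<=` A0 by apply: (sub A0 (conj mA0 fA0)).
apply: le_lt_trans fA0; apply: ge0_subset_integral => //; exact: measurable_funTS.
Qed.

End GoodLines.

Section PatchMeasurable.
Variable R : realType.
Local Notation P2 := (R * R)%type.

Lemma copen_open (D : set R[i]) : copen D -> open [set p : P2 | D (toC p)].
Proof.
move=> oD; rewrite openE => p Dp; have [d d0 Hd] := oD _ Dp.
apply/nbhs_ballP; exists (d / 2) => /=; first by rewrite divr_gt0.
move=> q [/= b1 b2]; apply: Hd; rewrite /cball/= toCB.
move: b1 b2; rewrite /ball/= (distrC p.1) (distrC p.2) => b1 b2.
by apply: le_lt_trans (nc_le _) _ => /=; lra.
Qed.

Lemma mfC_patch (D : set R[i]) (f : R[i] -> R[i]) : copen D -> (forall z, D z -> ccont f z) ->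
  mfC (fun p : P2 => if `[< D (toC p) >] then f (toC p) else 0).
Proof.
move=> oD cf; have oD' := copen_open oD; have mD := open_measurable2 oD'.
have H (u : R[i] -> R) : u 0 = 0 -> (forall z w, `|u z - u w| <= nc (z - w)) ->
    measurable_fun setT (fun p : P2 => u (if `[< D (toC p) >] then f (toC p) else 0)).
  move=> u0 lu.
  have -> : (fun p : P2 => u (if `[< D (toC p) >] then f (toC p) else 0)) =
      (fun p => u (f (toC p))) \_ [set p | D (toC p)].
    by apply/funext => p; rewrite patchE; case: asboolP => Dp; [rewrite mem_set|rewrite memNset].
  apply/(measurable_restrictT _ mD).
  apply: (measurability _ (RGenOpens.measurableE R)).
  move=> _ [_ [a [b ->] <-]]; apply: open_measurable2; rewrite openE => p [Dp /=].
  rewrite in_itv/= => /andP[ua ub].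
  have m0 : 0 < Num.min (u (f (toC p)) - a) (b - u (f (toC p))) by rewrite lt_min !subr_gt0 ua.
  have [d d0 Hd] := cf _ Dp _ m0; have [d' d'0 Hd'] := oD _ Dp.
  apply/nbhs_ballP; exists (Num.min d d' / 2) => /=; first by rewrite divr_gt0// lt_min d0.
  move=> q [/= b1 b2].
  have qp : nc (toC q - toC p) < Num.min d d'.
    move: b1 b2; rewrite /ball/= (distrC p.1) (distrC p.2) toCB => b1 b2.
    by apply: le_lt_trans (nc_le _) _ => /=; lra.
  move: qp; rewrite lt_min => /andP[q1 q2].
  split; first exact: Hd'.
  have := Hd _ q1; rewrite [toC p + _]addrC subrK => /(le_lt_trans (lu _ _)).
  by rewrite lt_min ltr_distl /= in_itv/= => /andP[/andP[h1 h2] h3]; apply/andP; split;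
    have := ltr_distlC; move: h3; rewrite ltr_distl => /andP[]; lra.
split; apply: H => // z w; first by rewrite -cReB; exact: nc_Re.
by rewrite -cImB; exact: nc_Im.
Qed.

Lemma ball2_nc (p q : P2) (d : R) : ball p d q -> nc (toC q - toC p) < 2 * d.
Proof.
move=> [/= b1 b2]; move: b1 b2; rewrite /ball/= (distrC p.1) (distrC p.2) toCB => b1 b2.
by apply: le_lt_trans (nc_le _) _ => /=; lra.
Qed.

Lemma nc_ball2 (p q : P2) (d : R) : nc (toC q - toC p) < d -> ball p d q.
Proof.
move=> H; split; rewrite /ball/= distrC; apply: le_lt_trans H.
  by have := nc_Re (toC q - toC p); rewrite toCB.
by have := nc_Im (toC q - toC p); rewrite toCB.
Qed.

End PatchMeasurable.

Section AlmostEverywhere.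
Context d (T : measurableType d) (R : realType) (m : {measure set T -> \bar R}).

Lemma ae_imp (P Q : T -> Prop) : (forall x, P x -> Q x) -> {ae m, forall x, P x} -> {ae m, forall x, Q x}.
Proof. by move=> PQ; apply: filterS. Qed.

Lemma ae_and (P Q : T -> Prop) : {ae m, forall x, P x} -> {ae m, forall x, Q x} ->
  {ae m, forall x, P x /\ Q x}.
Proof. by move=> aP aQ; apply: filterI. Qed.

Lemma ae_all (P : T -> Prop) : (forall x, P x) -> {ae m, forall x, P x}.
Proof. by move=> H; apply: aeW. Qed.

End AlmostEverywhere.

Section IntervalAverages.
Variable R : realType.
Local Notation leb := (@lebesgue_measure R).

Lemma ae_itv_exists (G : set R) (c d : R) : c < d -> {ae leb, forall y, c < y < d -> G y} ->
  exists2 y, c < y < d & G y.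
Proof.
move=> cd [N [mN N0 sub]]; apply: contrapT => H.
have : (leb `]c, d[%classic <= leb N)%E.
  apply: meas_le => // y; rewrite /= in_itv/= => ycd; apply: sub => /= Gy.
  by apply: H; exists y => //; exact: Gy.
rewrite [X in (_ <= X)%E]N0 lebesgue_measure_itv/= lte_fin cd -EFinB lee_fin; lra.
Qed.

(** Lebesgue differentiation: at almost every y with v y < 0 the primitive strictly decreases
    between nearby points below and above y. As [G] has full measure, both points can be taken in
    [G], where the integral is known to be nonnegative. *)
Lemma ae_ge0_of_intervals (v : R -> R) (c d : R) (G : set R) : c < d ->
  leb.-integrable `[c, d] (EFin \o v) -> {ae leb, forall y, c < y < d -> G y} ->
  (forall y1 y2, c < y1 < d -> c < y2 < d -> y1 < y2 -> G y1 -> G y2 -> 0 <= rint v y1 y2) ->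
  {ae leb, forall y, c < y < d -> 0 <= v y}.
Proof.
move=> cd iv aeG Hv.
(* Extension by 0 makes the function integrable on the whole line, as the differentiation theorem
   requires. *)
pose w := v \_ `[c, d].
have iw : leb.-integrable setT (EFin \o w).
  have -> : EFin \o w = (EFin \o v) \_ `[c, d].
    by apply/funext => x; rewrite /w/= !patchE; case: ifP.
  have E := @integrable_mkcond _ _ _ leb `[c, d]%classic (EFin \o v) (measurable_itv `[c, d]).
  exact: E.1 iv.
have iwS A : measurable A -> leb.-integrable A (EFin \o w) by move=> mA; apply: integrableS iw.
have locw : locally_integrable setT w by apply: open_integrable_locally => //; exact: openT.
have := FTC1 (a := -oo%O) (fun y => iwS _ (measurable_itv _)) locw => /=.
apply: ae_imp => y /(_ (ltNyr _))[dV V'] ycd; rewrite leNgt; apply/negP => v0.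
move: dV V'; set V := (X in derivable X) => dV V'.
have wv t : c <= t <= d -> w t = v t by move=> tcd; rewrite /w patchE mem_set//= in_itv.
have ycd' : c <= y <= d by case/andP: ycd => ? ?; apply/andP; split; exact: ltW.
have VD : 'D_1 V y = v y by rewrite -derive1E [LHS]V' wv.
have := DeriveDef dV VD.
move=> /is_derive_eps/(_ (- v y / 2)); rewrite divr_gt0 ?oppr_gt0// => /(_ isT)[D D0 HD].
move/andP: ycd => [cy yd].
have [y1 /andP[y11 y12] G1] : exists2 y1, Num.max c (y - D) < y1 < y & G y1.
  apply: ae_itv_exists; first by rewrite gt_max cy; lra.
  by apply: ae_imp aeG => x Gx; rewrite gt_max => /andP[/andP[? ?] ?]; apply: Gx; lra.
have [y2 /andP[y21 y22] G2] : exists2 y2, y < y2 < Num.min d (y + D) & G y2.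
  apply: ae_itv_exists; first by rewrite lt_min yd; lra.
  by apply: ae_imp aeG => x Gx; rewrite lt_min => /andP[? /andP[? ?]]; apply: Gx; lra.
move: y11 y22; rewrite gt_max lt_min => /andP[cy1 Dy1] /andP[y2d y2D].
have := Hv y1 y2 ltac:(lra) ltac:(lra) ltac:(lra) G1 G2.
have -> : rint v y1 y2 = V y2 - V y1.
  rewrite /V Rintegral_itvB//; last 2 first.
  - exact: iwS.
  - by rewrite bnd_simp; lra.
  rewrite (Rintegral_itv_obnd_cbnd (r := y1)).
    by apply: eq_Rintegral => x; rewrite inE/= in_itv/= => /andP[? ?]; rewrite wv//; lra.
  exact: iwS.
have := HD (y1 - y); rewrite [y + _]addrC subrK => /(_ ltac:(rewrite ltr_norml; lra)).
have := HD (y2 - y); rewrite [y + _]addrC subrK => /(_ ltac:(rewrite ltr_norml; lra)).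
have -> : `|y2 - y| = y2 - y by rewrite gtr0_norm ?subr_gt0.
have -> : `|y1 - y| = y - y1 by rewrite ltr0_norm ?subr_lt0// opprB.
rewrite !ler_norml => /andP[a1 a2] /andP[b1 b2] V12.
have : v y * (y2 - y1) < 0 by rewrite nmulr_rlt0//; lra.
lra.
Qed.

End IntervalAverages.

Section SigmaFinitePlane.
Variable R : realType.
Local Notation P2 := (R * R)%type.

Lemma sigma_finite_lebP : sigma_finite setT (@lebP R).
Proof.
exists (fun n => ball ((0, 0) : P2) n%:R) => [|n].
  apply/seteqP; split => // p _; exists (Num.truncn (Num.max `|p.1| `|p.2|)).+1 => //.
  have := truncnS_gt (Num.max `|p.1| `|p.2|); rewrite gt_max => /andP[h1 h2].
  by split; rewrite /ball/= sub0r normrN.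
split; first exact: measurable_ball2.
by rewrite lebPE lebC_ball ?ltry.
Qed.

Definition lebS : {sigma_finite_measure set P2 -> \bar R} :=
  HB.pack (Measure.sort (@lebP R)) (Measure_isSigmaFinite.Build _ _ _ (@lebP R) sigma_finite_lebP).

Lemma int_lebS (D : set P2) (f : P2 -> \bar R) : measurable D -> measurable_fun setT f ->
  (forall p, 0 <= f p)%E -> (\int[lebS]_(p in D) f p = \int[@lebC R]_(p in D) f p)%E.
Proof. exact: int_lebP. Qed.

End SigmaFinitePlane.

Section Dominating.
Variable R : realType.
Local Notation P2 := (R * R)%type.
Variable mu : {finite_measure set P2 -> \bar R}.

(* As [g] is infinite on [N], every line on which [g] is integrable meets [N] in a null set. *)
Definition dominates (N : set P2) (g : P2 -> \bar R) :=
  [/\ measurable_fun setT g, (forall p, 0 <= g p)%E, (forall p, pot mu (toC p) <= g p)%E,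
    (forall p, (g p < +oo)%E -> ~ N p) & forall q (e : R), (\int[@lebC R]_(p in ball q e) g p < +oo)%E].

Lemma mu_fin : (mu setT < +oo)%E.
Proof. by rewrite -ge0_fin_numE// fin_num_measure. Qed.

Lemma pot_int (B : set P2) : measurable B -> (lebC B < +oo)%E ->
  (\int[@lebC R]_(p in B) pot mu (toC p) < +oo)%E.
Proof.
move=> mB Bfin; have mp : measurable_fun setT (fun p : P2 => pot mu (toC p)).
  by apply: measurable_pot; exact: mfC_toC.
rewrite -int_lebS//; last by move=> p; exact: pot_ge0.
rewrite /pot; under eq_integral do under eq_integral do rewrite toCK.
have mk : measurable_fun setT (fun p : P2 * P2 => kap p.1 p.2 : \bar R).
  by apply: measurable_kap.
rewrite (@tonelli_on _ _ _ _ _ (lebS R) mu (fun p q => kap p q) mk)//; last first.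
  by move=> p q; exact: kap_ge0.
apply: (@le_lt_trans _ _ (\int[mu]_q (lebC B + 16%:E))%E); last first.
  have B16 : (lebC B + 16%:E)%E \is a fin_num by rewrite fin_numD ge0_fin_numE// Bfin.
  rewrite integral_cst//; apply: lte_mul_pinfty => //; first exact: adde_ge0.
  exact: mu_fin.
apply: int_le => //.
- under eq_fun do rewrite int_patch1.
  apply: (@measurable_int_fst _ _ _ _ _ (lebS R) (fun p q => kap p q * (\1_B p)%:E)%E).
    apply: emeasurable_funM => //; apply/measurable_EFinP.
    by apply: (measurableT_comp (measurable_indic mB)); exact: measurable_fst.
  by move=> t q; rewrite mule_ge0 ?kap_ge0 ?lee_fin.
- by move=> q; apply: integral_ge0 => p _; exact: kap_ge0.
- move=> q _; rewrite int_lebS//; last by move=> p; exact: kap_ge0.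
    exact: kap_int.
  by apply: measurable_kap.
Qed.

Lemma dominating_exists (N : set P2) : (@lebC R).-negligible N -> exists g, dominates N g.
Proof.
(* By the convention that infinity times 0 is 0, [h] is infinite exactly on the null set [B], and
   its integral is 0. *)
move=> [B [mB B0 NB]]; pose h p : \bar R := (+oo * (\1_B p)%:E)%E.
have mI : measurable_fun setT (fun p : P2 => (\1_B p)%:E : \bar R).
  by apply/measurable_EFinP; exact: measurable_indic.
have mh : measurable_fun setT h by apply: emeasurable_funM.
have h0 p : (0 <= h p)%E by rewrite mule_ge0 ?lee_fin.
have mp : measurable_fun setT (fun p : P2 => pot mu (toC p)).
  by apply: measurable_pot; exact: mfC_toC.
have p0 p : (0 <= pot mu (toC p))%E by exact: pot_ge0.
exists (fun p => pot mu (toC p) + h p)%E; split.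
- exact: emeasurable_funD.
- by move=> p; exact: adde_ge0.
- by move=> p; rewrite leeDl.
- move=> p gp Np; move: gp; rewrite /h indicE mem_set; last exact: NB.
  by rewrite mule1 addey ?ltxx//; rewrite gt_eqF// (lt_le_trans _ (p0 p))// ltNye.
- move=> q e; have mb := measurable_ball2 q e.
  rewrite ge0_integralD//; [|exact: measurable_funTS|exact: measurable_funTS].
  rewrite [X in (_ + X)%E](_ : _ = 0%E).
    rewrite adde0; apply: pot_int => //.
    have [e0|e0] := leP 0 e; first by rewrite lebC_ball// ltry.
    have -> : ball q e = set0 :> set P2.
      apply/seteqP; split => // p [/= b1 _].
      by have := lt_trans (le_lt_trans (normr_ge0 _) b1) e0; rewrite ltxx.
    by rewrite [lebC _](measure0 (@lebP R)).
  rewrite ge0_integralZl//; last exact: measurable_funTS.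
  rewrite integral_indic// [X in (_ * X)%E](_ : _ = 0%E) ?mule0//.
  have : (@lebP R (B `&` ball q e) <= @lebP R B)%E by apply: meas_le => //; exact: measurableI.
  by rewrite !lebPE B0 => H; apply/eqP; rewrite eq_le H measure_ge0.
Qed.

End Dominating.

Section BoxSign.
Variable R : realType.
Local Notation P2 := (R * R)%type.
Local Notation leb := (@lebesgue_measure R).

Lemma sqrN1_Re_Im (z : R[i]) : z ^+ 2 = -1 -> complex.Re z = 0 /\ (complex.Im z = 1 \/ complex.Im z = -1).
Proof.
move=> /eqP; have -> : (-1 : R[i]) = 'i ^+ 2 by rewrite sqr_i.
by rewrite eqf_sqr => /orP[/eqP ->|/eqP ->] /=; [split => //; left|rewrite oppr0; split => //; right].
Qed.

Lemma slice_integral (v : R -> R) (a b : R) : measurable_fun setT v -> (forall x, `|v x| <= 1) ->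
  (\int[leb]_x (v x * \1_(`[a, b] : set R) x)%:E = (rint v a b)%:E)%E.
Proof.
move=> mv v1; under eq_integral do rewrite EFinM; rewrite -int_patch1.
rewrite /rint /Rintegral fineK//; apply: integrable_fin_num => //.
apply: measurable_bounded_integrable => //.
- by rewrite /= lebesgue_measure_itv/=; case: ifP; rewrite ?ltry.
- exact: measurable_funTS.
- exists 1; split; first exact: real1.
  by move=> M M1 x _; rewrite /= (le_trans (v1 _))// ltW.
Qed.

Lemma int_cst_itv (c a b : R) : a <= b ->
  (\int[leb]_x (c * \1_(`[a, b] : set R) x)%:E = (c * (b - a))%:E)%E.
Proof.
move=> ab; under eq_integral do rewrite EFinM; rewrite -int_patch1 integral_cst//.
rewrite /= lebesgue_measure_itv/= lte_fin; move: ab; rewrite le_eqVlt => /predU1P[->|->]; last by rewrite -EFinB.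
by rewrite ltxx mule0 subrr mulr0.
Qed.

(** The integral of [S] over the box is c0 T when columns are integrated first, and an integral of
    nonnegative row integrals in the other order. *)
Lemma box_sign (S : P2 -> R) (T y1 y2 c0 : R) : measurable_fun setT S -> (forall p, `|S p| <= 1) ->
  0 < T -> y1 < y2 ->
  {ae leb, forall x, 0 <= x <= T -> rint (fun y => S (x, y)) y1 y2 = c0} ->
  {ae leb, forall y, y1 <= y <= y2 -> 0 <= rint (fun x => S (x, y)) 0 T} -> 0 <= c0.
Proof.
move=> mS S1 T0 y12 Hx Hy.
pose k (p : P2) : \bar R := (S p * (\1_(`[0, T] : set R) p.1 * \1_(`[y1, y2] : set R) p.2))%:E.
have mI1 : measurable_fun setT (fun p : P2 => \1_(`[0, T] : set R) p.1 : R).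
  by apply: (measurableT_comp (measurable_indic (measurable_itv `[0, T]))); exact: measurable_fst.
have mI2 : measurable_fun setT (fun p : P2 => \1_(`[y1, y2] : set R) p.2 : R).
  by apply: (measurableT_comp (measurable_indic (measurable_itv `[y1, y2]))); exact: measurable_snd.
have mk : measurable_fun setT k by apply/measurable_EFinP; apply: measurable_funM => //; exact: measurable_funM.
have kx x : (\int[leb]_y k (x, y) = (rint (fun y => S (x, y)) y1 y2 * \1_(`[0, T] : set R) x)%:E)%E.
  rewrite /k/= indicE; case: (boolP (x \in _)) => _.
    under eq_integral do rewrite mul1r; rewrite mulr1; apply: slice_integral => //.
    exact: (measurableT_comp mS (pair1_measurable x)).
  by under eq_integral do rewrite mul0r mulr0; rewrite integral0 mulr0.
have ky y : (\int[leb]_x k (x, y) = (rint (fun x => S (x, y)) 0 T * \1_(`[y1, y2] : set R) y)%:E)%E.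
  rewrite /k/= [\1_(`[y1, y2] : set R) y]indicE; case: (boolP (y \in _)) => _.
    under eq_integral do rewrite mulr1; rewrite mulr1; apply: slice_integral => //.
    exact: (measurableT_comp mS (pair2_measurable y)).
  by under eq_integral do rewrite mulr0 mulr0; rewrite integral0 mulr0.
have ik : (leb \x leb)%E.-integrable setT k.
  apply/integrable12ltyP; first exact: mk.
  have mak : measurable_fun setT (fun p => `|k p|)%E by exact: measurableT_comp.
  apply: (@le_lt_trans _ _ (\int[leb]_x ((y2 - y1) * \1_(`[0, T] : set R) x)%:E)%E); last first.
    by rewrite int_cst_itv ?ltry// ltW.
  apply: int_le => //.
  - apply: (@measurable_int_snd _ _ _ _ _ leb (fun x y => `|k (x, y)|)%E) => [|x y]; last exact: abse_ge0.
    by apply: eq_measurable_fun mak => -[].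
  - by apply/measurable_EFinP; apply: measurable_funM => //; exact: measurable_indic.
  - by move=> x; apply: integral_ge0.
  move=> x _; rewrite (_ : (y2 - y1) * \1_(`[0, T] : set R) x = \1_(`[0, T] : set R) x * (y2 - y1)); last by rewrite mulrC.
  rewrite -(int_cst_itv _ (ltW y12)); apply: int_le => //.
  - exact: (measurableT_comp mak (pair1_measurable x)).
  - by apply/measurable_EFinP; apply: measurable_funM => //; exact: measurable_indic.
  move=> y _; rewrite lee_fin normrM -[leRHS]mul1r; apply: ler_pM; rewrite ?normr_ge0//.
  by rewrite ger0_norm ?mulr_ge0.
have := Fubini ik.
have -> : (\int[leb]_x \int[leb]_y k (x, y) = (c0 * T)%:E)%E.
  transitivity (\int[leb]_x (c0 * \1_(`[0, T] : set R) x)%:E)%E.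
    apply: (ae_eq_integral (mu := leb) (D := setT) (fun x => (c0 * \1_(`[0, T] : set R) x)%:E)) => //.
    - exact: measurable_fubini_F ik.
    - by apply/measurable_EFinP; apply: measurable_funM => //; exact: measurable_indic.
    apply: ae_imp Hx => x H _; rewrite kx indicE; case: (boolP (x \in _)); last by rewrite !mulr0.
    by rewrite inE/= in_itv/= => /H ->.
  by rewrite int_cst_itv ?subr0// ltW.
move=> E; rewrite -(pmulr_lge0 _ T0) -lee_fin E.
rewrite (_ : (\int[leb]_y \int[leb]_x k (x, y) = \int[leb]_y `|\int[leb]_x k (x, y)|)%E).
  by apply: integral_ge0.
apply: (ae_eq_integral (mu := leb) (D := setT)) => //.
- exact: measurable_fubini_G ik.
- by apply: measurableT_comp => //; exact: measurable_fubini_G ik.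
apply: ae_imp Hy => y H _; rewrite ky gee0_abs// lee_fin indicE.
by case: (boolP (y \in _)); [rewrite inE/= in_itv/= => /H; rewrite mulr1|rewrite mulr0].
Qed.

End BoxSign.

Section AlmostEverywhereIntegrals.
Context d (T : measurableType d) (R : realType) (m : {measure set T -> \bar R}).

Lemma Rintegral_ae_eq (D : set T) (f g : T -> R) : measurable D -> measurable_fun D f -> measurable_fun D g ->
  {ae m, forall x, D x -> f x = g x} -> Rintegral m D f = Rintegral m D g.
Proof.
move=> mD mf mg fg; congr fine; apply: ae_eq_integral => //; [exact/measurable_EFinP|exact/measurable_EFinP|].
by apply: ae_imp fg => x H /H ->.
Qed.

Lemma Rintegral_ae_ge0 (f : T -> R) : measurable_fun setT f ->
  {ae m, forall x, 0 <= f x} -> 0 <= Rintegral m setT f.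
Proof.
move=> mf f0; rewrite (@Rintegral_ae_eq setT f (fun x => `|f x|))//.
- by apply: Rintegral_ge0.
- exact: measurableT_comp.
- by apply: ae_imp f0 => x fx _; rewrite ger0_norm.
Qed.

Lemma integrable_measurable (D : set T) (f : T -> R) : m.-integrable D (EFin \o f) -> measurable_fun D f.
Proof. by move=> /measurable_int/measurable_EFinP. Qed.

End AlmostEverywhereIntegrals.

Lemma curve_log (R : realType) (mu : {finite_measure set (R * R)%type -> \bar R}) (f f' : R -> R[i]) (a b : R) : a < b ->
  (forall t, a <= t <= b -> rderiv f t (f' t)) -> ctn f' `[a, b] ->
  (\int[@lebesgue_measure R]_(t in `[a, b]) pot mu (f t) < +oo)%E ->
  {ae mu, forall q, rint (fun t => complex.Re (1 * f' t * (f t - toC q)^-1)) a b =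
    (ln (nc (f b - toC q) ^+ 2) - ln (nc (f a - toC q) ^+ 2)) / 2}.
Proof.
move=> ab df cf' fin; apply: ae_imp (curve_disjoint ab df cf' fin) => q H.
rewrite -(@rint_logderiv _ (fun t => f t - toC q) f' a b (ltW ab)) => [|t tab||t tab].
- by apply: rint_eq => t _; rewrite mul1r.
- by apply: rderiv_subc; exact: df.
- exact: cf'.
- by rewrite subr_eq0; exact: H.
Qed.

Lemma null_slices (R : realType) (B : set (R * R)) : measurable B ->
  {ae @lebesgue_measure R, forall x, {ae @lebesgue_measure R, forall y, ~ B (x, y)}} -> @lebC R B = 0%E.
Proof.
move=> mB aeB.
have mx : measurable_fun setT (fun x => @lebesgue_measure R (xsection B x)).
  exact: measurable_fun_xsection.
rewrite /lebC /product_measure1 (ae_eq_integral (cst 0%E) (mu := @lebesgue_measure R) (D := setT))//.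
  by rewrite integral0.
apply: ae_imp aeB => x [N [mN N0 sub]] _.
apply/eqP; rewrite eq_le measure_ge0 andbT/= -[X in (_ <= X)%E]N0.
apply: meas_le => //; first exact: measurable_xsection.
by move=> y; rewrite /xsection/= inE => Bxy; apply: sub => /= /(_ Bxy).
Qed.

(** * The Cauchy transform on a periodic strip *)

Section StripCauchy.
Variable R : realType.
Local Notation P2 := (R * R)%type.
Local Notation leb := (@lebesgue_measure R).
Variables (reg : set R[i]) (Rq : R[i] -> R[i]).
Hypothesis chartP : forall z0, reg z0 -> exists W h h' rho r0 m, chart reg Rq z0 W h h' rho r0 m.
Local Notation sol := (sol reg Rq).
Variables (F F1 : R[i] -> R[i]) (r T : R).
Hypotheses (r0 : 0 < r) (T0 : 0 < T) (SF : sol F F1 (strip r)).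
Hypothesis per : forall w, strip r w -> F (w + T%:C) = F w /\ F1 (w + T%:C) = F1 w.

(** Extended by 0 off the strip, because the Fubini lemmas ask for maps measurable on the whole
    plane. *)
Let Ft (p : P2) : P2 := toP (if `[< strip r (toC p) >] then F (toC p) else 0).
Let F1t (p : P2) : R[i] := if `[< strip r (toC p) >] then F1 (toC p) else 0.

Let mFt' : mfC (fun p : P2 => toC (Ft p)).
Proof.
have := @mfC_patch R (strip r) F (@copen_strip R r) (fun z zs => cderiv_ccont (let: And4 _ d _ _ := SF zs in d)).
by have -> : (fun p : P2 => toC (Ft p)) = (fun p => if `[< strip r (toC p) >] then F (toC p) else 0)
  by apply/funext => p; rewrite /Ft toPK.
Qed.

Let mF1t : mfC F1t.
Proof. exact: (@mfC_patch R (strip r) F1 (@copen_strip R r) (fun z zs => let: And4 _ _ c _ := SF zs in c)). Qed.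

Let mFt : measurable_fun setT Ft.
Proof. by have := mfC_pair mFt'; under eq_fun do rewrite -/(toP _) toCK. Qed.

Variable g : P2 -> \bar R.
Hypotheses (mg : measurable_fun setT g) (g0 : forall p, (0 <= g p)%E).
Hypothesis gint : forall q (e : R), (\int[@lebC R]_(p in ball q e) g p < +oo)%E.

Let gF p := g (Ft p).
Let mgF : measurable_fun setT gF. Proof. exact: measurableT_comp. Qed.
Let gF0 p : (0 <= gF p)%E. Proof. exact: g0. Qed.

(* [F] is locally bi-Lipschitz because [W (F w)] is affine in [w] for every chart [W]. *)
Lemma gF_local (p : P2) : `|p.2| < r ->
  exists2 e : R, 0 < e & (\int[@lebC R]_(q in ball p e) gF q < +oo)%E.
Proof.
move=> pr; have [rp _ _ _] := SF (pr : strip r (toC p)).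
have [W [h [h' [rho [s0 [m ch]]]]]] := chartP rp.
have [[rho0 _ m0] [[Mh Mh0 [hM _]] _ _] [MW MW0 WT] _ [_ hreg _]] := ch.
have [d d0 Hd] := sol_local ch (@copen_strip R r) (pr : strip r (toC p)) SF (cball_center _ rho0).
have c1 : nc (h (F (toC p)) * F1 (toC p)) = 1.
  apply: nc_sqr1; rewrite exprMn mulrC (hreg _ (cball_center _ rho0)).2.
  by have [_ _ _] := SF (pr : strip r (toC p)).
(* A Lipschitz constant of [W] on the chart: the bound of [h], plus the quadratic remainder over the
   diameter 2 rho; the 1 makes it positive. *)
pose K := Mh + MW * (2 * rho) + 1.
have K0 : 0 < K by rewrite ltr_wpDl// addr_ge0// mulr_ge0// mulr_ge0// ltW.
have WL a b : cball (F (toC p)) rho a -> cball (F (toC p)) rho b -> nc (W b - W a) <= K * nc (b - a).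
  move=> aB bB; have := WT _ _ aB bB.
  have ab : nc (b - a) <= 2 * rho.
    rewrite (le_trans (nc_tri _ (F (toC p)) _))// [X in _ + X]ncBC.
    by move: aB bB; rewrite /cball/=; lra.
  have -> : W b - W a = (W b - W a - h a * (b - a)) + h a * (b - a) by rewrite subrK.
  rewrite addrK => H; apply: le_trans (ncD _ _) _; rewrite ncM.
  have h1 : nc (h a) * nc (b - a) <= Mh * nc (b - a) by rewrite ler_wpM2r ?nc_ge0// hM.
  have h2 : MW * nc (b - a) ^+ 2 <= MW * (2 * rho) * nc (b - a).
    by rewrite -mulrA ler_wpM2l// expr2 ler_wpM2r ?nc_ge0.
  have := nc_ge0 (b - a); rewrite /K; nra.
pose B : set P2 := ball p (d / 2); pose M := nc (F (toC p)) + rho.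
have mB : measurable B by exact: measurable_ball2.
have Bk q : B q -> nc (toC q - toC p) < d by move=> /ball2_nc; rewrite mulrC divfK.
have BF q : B q -> [/\ Ft q = toP (F (toC q)), cball (F (toC p)) rho (F (toC q)) &
    W (F (toC q)) = W (F (toC p)) + h (F (toC p)) * F1 (toC p) * (toC q - toC p)].
  move=> Bq; have := Hd _ (Bk _ Bq); rewrite [toC p + _]addrC subrK => -[sq cq _ wq]; split => //.
  by rewrite /Ft asboolT.
have FM w : B w -> ball (0, 0) M (Ft w).
  move=> /BF[-> cq _]; apply: nc_ball2; rewrite toPK.
  rewrite (_ : toC (0, 0) = 0)// subr0 -[F (toC w)](subrK (F (toC p))) (le_lt_trans (ncD _ _))//.
  by rewrite addrC ltrD2l.
have lip w1 w2 (e : R) : B w1 -> B w2 -> ball (Ft w1) e (Ft w2) -> ball w1 (2 * K * e) w2.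
  move=> B1 B2; have [-> q1 e1] := BF _ B1; have [-> q2 e2] := BF _ B2.
  move=> /ball2_nc; rewrite !toPK => Fe; apply: nc_ball2.
  have := WL _ _ q1 q2; rewrite e1 e2 opprD addrACA subrr add0r -mulrBr ncM c1 mul1r.
  rewrite opprB addrA subrK => /le_lt_trans; apply.
  by rewrite [2 * K]mulrC -mulrA ltr_pM2l.
exists (d / 2); first by rewrite divr_gt0.
pose g' q := (g q * (\1_(ball (0, 0) M : set P2) q)%:E)%E.
have mI : measurable_fun setT (fun p : P2 => (\1_(ball (0, 0) M : set P2) p)%:E : \bar R).
  by apply/measurable_EFinP; apply: measurable_indic; exact: measurable_ball2.
have mg' : measurable_fun setT g' by exact: emeasurable_funM.
have g'0 q : (0 <= g' q)%E by rewrite mule_ge0 ?lee_fin.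
have K2 : 0 < 2 * K by rewrite mulr_gt0.
have := integral_lip_inverse mFt mB K2 FM lip mg' g'0.
rewrite int_lebP//; last exact: measurableT_comp.
rewrite int_lebP// => H.
have -> : (\int[@lebC R]_(q in ball p (d / 2)) gF q = \int[@lebC R]_(q in B) g' (Ft q))%E.
  by apply: eq_integral => q; rewrite inE => Bq; rewrite /g' indicE mem_set ?mule1//; exact: FM.
apply: (le_lt_trans H); apply: lte_mul_pinfty => //.
  by rewrite lee_fin mulr_ge0// sqr_ge0.
by have := gint (0, 0) M; rewrite int_patch1.
Qed.

Variable mu : {finite_measure set P2 -> \bar R}.
Hypothesis gpot : forall p, (pot mu (toC p) <= g p)%E.
Hypothesis gsq : forall z, (g (toP z) < +oo)%E -> reg z -> Defs.cauchy mu z ^+ 2 = - Rq z.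

Lemma pot_curve (D : set R) (u : R -> P2) : measurable D -> measurable_fun setT u ->
  (forall t, D t -> `|(u t).2| < r) -> (\int[leb]_(t in D) gF (u t) < +oo)%E ->
  (\int[leb]_(t in D) pot mu (F (toC (u t))) < +oo)%E.
Proof.
move=> mD muu ur; apply: le_lt_trans.
have -> : (\int[leb]_(t in D) pot mu (F (toC (u t))) = \int[leb]_(t in D) pot mu (toC (Ft (u t))))%E.
  by apply: eq_integral => t; rewrite inE => /ur utr; rewrite /Ft asboolT// toPK.
apply: int_le => //.
- by apply: (measurable_pot mu); exact: (mfC_comp mFt').
- exact: (measurableT_comp mgF muu).
- by move=> t; exact: pot_ge0.
Qed.

Let st (p : P2) : R := complex.Im (Defs.cauchy mu (toC (Ft p)) * F1t p).
(* The Cauchy transform pulled back to the strip is ['i] times this sign, see [sheetE]. *)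
Definition sheet (p : P2) : R := if 0 < st p then 1 else -1.

Let mst : measurable_fun setT st.
Proof. by have [] := mfCM (mfC_cauchy mu mFt') mF1t. Qed.

Lemma measurable_sheet : measurable_fun setT sheet.
Proof.
apply: measurable_fun_ifT; [|exact: measurable_cst|exact: measurable_cst].
exact: measurable_fun_ltr.
Qed.

Lemma sheet_norm p : `|sheet p| = 1.
Proof. by rewrite /sheet; case: ifP; rewrite ?normrN1 ?normr1. Qed.

Lemma sheetE (p : P2) : `|p.2| < r -> (gF p < +oo)%E ->
  Defs.cauchy mu (F (toC p)) * F1 (toC p) = 'i * (sheet p)%:C.
Proof.
move=> pr gp; have [rp _ _ E] := SF (pr : strip r (toC p)).
have E1 : Ft p = toP (F (toC p)) by rewrite /Ft asboolT.
have sq : (Defs.cauchy mu (F (toC p)) * F1 (toC p)) ^+ 2 = -1.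
  by rewrite exprMn gsq// -?E1// mulNr mulrC E.
have stE : st p = complex.Im (Defs.cauchy mu (F (toC p)) * F1 (toC p)).
  by rewrite /st E1 toPK /F1t asboolT.
have [R0 I1] := sqrN1_Re_Im sq.
rewrite /sheet stE; case: I1 => I1; rewrite I1 ?ltr01 ?ltr0N1.
  by apply: Cext; rewrite ?R0 ?I1 /= ; ring.
by apply: Cext; rewrite ?R0 ?I1 /= ; ring.
Qed.

Variables (r' a : R).
Hypotheses (r'0 : 0 < r') (r'r : r' <= r).
Hypothesis Hwind : forall y q, `|y| < r' -> (forall x, F (x +i* y) != q) ->
  wind F F1 T y q = 0 \/ wind F F1 T y q = a.

(** If a = 0, the winding numbers all vanish and the inequality of [level_sheet] holds with either
    sign. *)
Definition wsign : R := if 0 <= a then 1 else -1.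

Variable r2 : R.
Hypotheses (r20 : 0 < r2) (r2r' : r2 < r').

Let r2r : r2 < r. Proof. exact: lt_le_trans r'r. Qed.
Let inr y : - r2 <= y <= r2 -> `|y| < r.
Proof. by move=> y2; rewrite (le_lt_trans _ r2r)// ler_norml. Qed.

(* Positivity of [mu] enters here: the integral is a [mu]-average of winding numbers, which all have the sign of [a]. *)
Lemma level_sheet y : - r2 <= y <= r2 -> (\int[leb]_(x in `[0%R, T]) gF (x, y) < +oo)%E ->
  0 <= wsign * rint (fun x => sheet (x, y)) 0 T.
Proof.
move=> y2 fin; have yr := inr y2.
have mu1 : measurable_fun setT (fun x : R => (x, y) : P2) by exact: pair2_measurable.
have finp := pot_curve (measurable_itv `[0, T]) mu1 (fun x _ => yr) fin.
have df t : 0 <= t <= T -> rderiv (fun x => F (x +i* y)) t (F1 (t +i* y)).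
  by move=> _; exact: (rderiv_level SF).
have cf' : ctn (fun x => F1 (x +i* y)) `[0, T] by exact: (ctn_F1_level SF yr).
(* With this constant the left integrand is Re (-i * i s) = s, and the kernel integrates to the
   winding number. *)
have [i1 i2 E] := curve_fubini T0 df cf' finp (- 'i).
have av := curve_disjoint T0 df cf' finp.
have mgy : measurable_fun setT (fun x => gF (x, y)) by exact: (measurableT_comp mgF mu1).
have aefin := finite_int_ae (m := leb) (measurable_itv `[0, T]) (measurable_funTS mgy) (fun x => gF0 (x, y)) fin.
have -> : rint (fun x => sheet (x, y)) 0 T = Rintegral mu setT (fun q => wind F F1 T y (toC q)).
  have -> : (fun q : P2 => wind F F1 T y (toC q)) =
     (fun q => rint (fun t => complex.Re (- 'i * F1 (t +i* y) * (F (t +i* y) - toC q)^-1)) 0 T).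
    apply/funext => q; apply: rint_eq => t _.
    by rewrite -mulrA mulNr cReN cReM/=; ring.
  rewrite -E; apply: Rintegral_ae_eq => //.
  - by apply: measurable_funTS; exact: (measurableT_comp measurable_sheet mu1).
  - exact: integrable_measurable i1.
  apply: ae_imp aefin => x H xD; have := sheetE (p := (x, y)) yr (H xD).
  rewrite mulrCA => ->; rewrite mulrA mulNr -expr2 sqr_i opprK mul1r.
  by [].
have -> : (fun q : P2 => wind F F1 T y (toC q)) = (fun q => rint (fun t => complex.Re (- 'i * F1 (t +i* y) * (F (t +i* y) - toC q)^-1)) 0 T).
  apply/funext => q; apply: rint_eq => t _.
  by rewrite -mulrA mulNr cReN cReM/=; ring.
rewrite -(RintegralZl _ _ i2)//; apply: Rintegral_ae_ge0.
  by apply: measurable_funM => //; exact: integrable_measurable i2.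
apply: ae_imp av => q H.
have yr' : `|y| < r' by rewrite (le_lt_trans _ r2r')// ler_norml.
have Hq x : F (x +i* y) != toC q.
  by have [x' x'T [<- _]] := per_reduce T0 per x yr; exact: H.
have -> : rint (fun t => complex.Re (- 'i * F1 (t +i* y) * (F (t +i* y) - toC q)^-1)) 0 T = wind F F1 T y (toC q).
  by apply: rint_eq => t _; rewrite -mulrA mulNr cReN cReM/=; ring.
rewrite /wsign; have [->|->] := Hwind yr' Hq; first by rewrite mulr0.
by case: (leP 0 a) => a0; rewrite ?mul1r// mulN1r oppr_ge0 ltW.
Qed.

(* As [ln |F - q|] is single valued, only the real part of the contour integral of [F1 / (F - q)]
   vanishes when the rectangle winds around [q]. *)
Lemma vert_rect x1 x2 y1 y2 : x1 < x2 -> y1 < y2 -> - r2 <= y1 -> y2 <= r2 ->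
  (\int[leb]_(x in `[x1, x2]) gF (x, y1) < +oo)%E -> (\int[leb]_(x in `[x1, x2]) gF (x, y2) < +oo)%E ->
  (\int[leb]_(y in `[y1, y2]) gF (x1, y) < +oo)%E -> (\int[leb]_(y in `[y1, y2]) gF (x2, y) < +oo)%E ->
  rint (fun y => sheet (x1, y)) y1 y2 = rint (fun y => sheet (x2, y)) y1 y2.
Proof.
move=> x12 y12 y1r y2r h1 h2 v1 v2.
(* With constant 1, a horizontal side gives Re (i s) = 0, while a vertical side, whose tangent has a
   further factor i, gives -s. In both cases the kernel integrates to an increment of ln |F - q|. *)
have hor y : - r2 <= y <= r2 -> (\int[leb]_(x in `[x1, x2]) gF (x, y) < +oo)%E ->
    exists I : P2 -> R, [/\ mu.-integrable setT (EFin \o I), Rintegral mu setT I = 0 &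
    {ae mu, forall q, I q = (ln (nc (F (x2 +i* y) - toC q) ^+ 2) - ln (nc (F (x1 +i* y) - toC q) ^+ 2)) / 2}].
  move=> y2' fin; have yr := inr y2'.
  have mu1 : measurable_fun setT (fun x : R => (x, y) : P2) by exact: pair2_measurable.
  have finp := pot_curve (measurable_itv `[x1, x2]) mu1 (fun x _ => yr) fin.
  have df t : x1 <= t <= x2 -> rderiv (fun x => F (x +i* y)) t (F1 (t +i* y)).
    by move=> _; exact: (rderiv_level SF).
  have cf' : ctn (fun x => F1 (x +i* y)) `[x1, x2] by exact: (ctn_F1_level SF yr).
  have [i1 i2 E] := curve_fubini x12 df cf' finp 1.
  have mgy : measurable_fun setT (fun x => gF (x, y)) by exact: (measurableT_comp mgF mu1).
  have aefin := finite_int_ae (m := leb) (measurable_itv `[x1, x2]) (measurable_funTS mgy) (fun x => gF0 (x, y)) fin.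
  eexists; split; [exact: i2| |exact: (curve_log x12 df cf' finp)].
  rewrite -E /rint (@Rintegral_ae_eq _ _ _ _ _ _ (fun=> 0))//.
  - by rewrite /Rintegral integral0.
  - exact: integrable_measurable i1.
  apply: ae_imp aefin => x H xD; have := sheetE (p := (x, y)) yr (H xD).
  by rewrite mul1r => ->; rewrite cReM/= mul0r mulr0 subrr.
have ver x : (\int[leb]_(y in `[y1, y2]) gF (x, y) < +oo)%E ->
    exists I : P2 -> R, [/\ mu.-integrable setT (EFin \o I), Rintegral mu setT I = - rint (fun y => sheet (x, y)) y1 y2 &
    {ae mu, forall q, I q = (ln (nc (F (x +i* y2) - toC q) ^+ 2) - ln (nc (F (x +i* y1) - toC q) ^+ 2)) / 2}].
  move=> fin.
  have yr y : y1 <= y <= y2 -> `|y| < r by move=> /andP[a1 a2]; apply: inr; rewrite (le_trans y1r)// (le_trans a2).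
  have mu1 : measurable_fun setT (fun y : R => (x, y) : P2) by exact: pair1_measurable.
  have yr' (y : R) : `[y1, y2]%classic y -> `|y| < r by rewrite /= in_itv/=; exact: yr.
  have finp := pot_curve (measurable_itv `[y1, y2]) mu1 yr' fin.
  have df t : y1 <= t <= y2 -> rderiv (fun y => F (x +i* y)) t (F1 (x +i* t) * 'i).
    by move=> /yr; exact: (rderiv_vert SF).
  have cf' : ctn (fun y => F1 (x +i* y) * 'i) `[y1, y2].
    by apply: ctnM; [exact: (ctn_F1_vert SF x yr')|exact: ctn_cst].
  have [i1 i2 E] := curve_fubini y12 df cf' finp 1.
  have mgy : measurable_fun setT (fun y => gF (x, y)) by exact: (measurableT_comp mgF mu1).
  have aefin := finite_int_ae (m := leb) (measurable_itv `[y1, y2]) (measurable_funTS mgy) (fun y => gF0 (x, y)) fin.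
  eexists; split; [exact: i2| |exact: (curve_log y12 df cf' finp)].
  have msh := measurableT_comp measurable_sheet mu1.
  have ish : leb.-integrable `[y1, y2] (EFin \o (fun y => sheet (x, y))).
    apply: measurable_bounded_integrable => //.
    - by rewrite /= lebesgue_measure_itv/=; case: ifP; rewrite ?ltry.
    - exact: measurable_funTS.
    - exists 1; split; first exact: real1.
      by move=> M M1 y _ /=; rewrite sheet_norm ltW.
  rewrite -E /rint -mulN1r -RintegralZl//.
  apply: Rintegral_ae_eq => //.
  - exact: integrable_measurable i1.
  - by apply: measurable_funM => //; exact: measurable_funTS.
  apply: ae_imp aefin => y H yD; have := sheetE (p := (x, y)) (yr' _ yD) (H yD).
  by rewrite mul1r mulrA => ->; rewrite mulrAC -expr2 sqr_i !cReM/=; ring.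
have [H1 [iH1 eH1 aH1]] := hor y1 ltac:(lra) h1; have [H2 [iH2 eH2 aH2]] := hor y2 ltac:(lra) h2.
have [V1 [iV1 eV1 aV1]] := ver x1 v1; have [V2 [iV2 eV2 aV2]] := ver x2 v2.
(* Both differences equal the alternating sum of ln |F - q| over the four corners. *)
have : Rintegral mu setT (fun q => V2 q - V1 q) = Rintegral mu setT (fun q => H2 q - H1 q).
  apply: Rintegral_ae_eq => //.
  - by apply: measurable_funB; [exact: integrable_measurable iV2|exact: integrable_measurable iV1].
  - by apply: measurable_funB; [exact: integrable_measurable iH2|exact: integrable_measurable iH1].
  apply: ae_imp (ae_and (ae_and aH1 aH2) (ae_and aV1 aV2)) => q [[-> ->] [-> ->]] _.
  by field.
have := RintegralB measurableT iV2 iV1; rewrite eV1 eV2 => ->.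
have := RintegralB measurableT iH2 iH1; rewrite eH1 eH2 subrr => -> /eqP.
by rewrite opprK addrC subr_eq0 => /eqP.
Qed.

Let sh_int m (u : R -> P2) c d : measurable_fun setT u -> leb.-integrable `[c, d] (EFin \o (fun t => m * sheet (u t))).
Proof.
move=> muu; apply: measurable_bounded_integrable => //.
- by rewrite /= lebesgue_measure_itv/=; case: ifP; rewrite ?ltry.
- by apply: measurable_funTS; apply: measurable_funM => //; exact: (measurableT_comp measurable_sheet muu).
- exists `|m|; split; first exact: normr_real.
  by move=> M M1 y _ /=; rewrite normrM sheet_norm mulr1 ltW.
Qed.

Let sh_rint m (u : R -> P2) c d : measurable_fun setT u ->
  rint (fun t => m * sheet (u t)) c d = m * rint (fun t => sheet (u t)) c d.
Proof.
move=> muu; rewrite /rint RintegralZl//.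
by have := sh_int 1 c d muu; under [X in _.-integrable _ (EFin \o X)]funext do rewrite mul1r.
Qed.

Lemma wsign_norm : `|wsign| = 1.
Proof. by rewrite /wsign; case: ifP; rewrite ?normrN1 ?normr1. Qed.

Lemma wsignK x : `|x| = 1 -> 0 <= wsign * x -> x = wsign.
Proof.
rewrite /wsign; case: ifP => _; first by rewrite mul1r => x1 /ger0_norm <-.
by rewrite mulN1r oppr_ge0 => x1 /ler0_norm; rewrite x1 => ->; rewrite opprK.
Qed.

Let box_fin : (\int[@lebC R]_(p in `[0%R, T] `*` `[(- r2)%R, r2]) gF p < +oo)%E.
Proof.
apply: compact_int => //.
- by apply: compact_setX; exact: segment_compact.
- by move=> [x y] [_ /= yr]; apply: gF_local; apply: inr; move: yr; rewrite in_itv.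
- exact: measurableX.
Qed.

Let mono (h : R -> \bar R) (c d c' d' : R) : measurable_fun setT h -> (forall x, 0 <= h x)%E -> c <= c' -> d' <= d ->
    (\int[leb]_(t in `[c, d]) h t < +oo)%E -> (\int[leb]_(t in `[c', d']) h t < +oo)%E.
Proof.
move=> mh h0 cc dd; apply: le_lt_trans; apply: ge0_subset_integral => //; first exact: measurable_funTS.
by move=> t /=; rewrite !in_itv/= => /andP[a1 a2]; apply/andP; split; lra.
Qed.

Let vert (u v y1 y2 : R) : 0 <= u <= T -> 0 <= v <= T -> - r2 < y1 < r2 -> - r2 < y2 < r2 -> y1 < y2 ->
  (\int[leb]_(x in `[0%R, T]) gF (x, y1) < +oo)%E -> (\int[leb]_(x in `[0%R, T]) gF (x, y2) < +oo)%E ->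
  (\int[leb]_(y in `[(- r2)%R, r2]) gF (u, y) < +oo)%E -> (\int[leb]_(y in `[(- r2)%R, r2]) gF (v, y) < +oo)%E ->
  rint (fun y => sheet (u, y)) y1 y2 = rint (fun y => sheet (v, y)) y1 y2.
Proof.
have H (u' v' : R) : 0 <= u' <= T -> 0 <= v' <= T -> - r2 < y1 < r2 -> - r2 < y2 < r2 -> y1 < y2 -> u' < v' ->
  (\int[leb]_(x in `[0%R, T]) gF (x, y1) < +oo)%E -> (\int[leb]_(x in `[0%R, T]) gF (x, y2) < +oo)%E ->
  (\int[leb]_(y in `[(- r2)%R, r2]) gF (u', y) < +oo)%E -> (\int[leb]_(y in `[(- r2)%R, r2]) gF (v', y) < +oo)%E ->
  rint (fun y => sheet (u', y)) y1 y2 = rint (fun y => sheet (v', y)) y1 y2.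
  move=> /andP[u0 _] /andP[_ vT] /andP[y1a y1b] /andP[y2a y2b] y12 uv G1 G2 Vu Vv.
  have mgV x : measurable_fun setT (fun y => gF (x, y)) by exact: (measurableT_comp mgF (pair1_measurable x)).
  have mgH y : measurable_fun setT (fun x => gF (x, y)) by exact: (measurableT_comp mgF (pair2_measurable y)).
  apply: vert_rect => //; first exact: ltW; first exact: ltW.
  - by apply: mono G1; rewrite ?u0 ?vT.
  - by apply: mono G2; rewrite ?u0 ?vT.
  - by apply: mono Vu => //; exact: ltW.
  - by apply: mono Vv => //; exact: ltW.
move=> uT vT y1r y2r y12 G1 G2 Vu Vv; have [uv|uv|->//] := ltgtP u v; first exact: H.
by symmetry; exact: H.
Qed.

(** On a fixed good column, the integral of the sign over a segment with good end heights equals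
    that of almost every other column; [box_sign] thus makes it nonnegative after multiplication by
    [wsign], and [ae_ge0_of_intervals] localises this. Values of modulus 1 leave only [wsign]. *)
Lemma strip_sheet : {ae leb, forall x, 0 <= x <= T -> {ae leb, forall y, - r2 < y < r2 -> sheet (x, y) = wsign}}.
Proof.
have mu1 x : measurable_fun setT (fun y : R => (x, y) : P2) by exact: pair1_measurable.
have mu2 y : measurable_fun setT (fun x : R => (x, y) : P2) by exact: pair2_measurable.
have [gV gH] := good_lines (measurable_itv `[0%R, T]) (measurable_itv `[- r2, r2]) mgF gF0 box_fin.
have mgV x : measurable_fun setT (fun y => gF (x, y)) by exact: (measurableT_comp mgF (mu1 x)).
have mgH y : measurable_fun setT (fun x => gF (x, y)) by exact: (measurableT_comp mgF (mu2 y)).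
pose G y := (\int[leb]_(x in `[0%R, T]) gF (x, y) < +oo)%E.
have aeG : {ae leb, forall y, - r2 < y < r2 -> G y}.
  by apply: ae_imp gH => y H /andP[e1 e2]; apply: H; rewrite /= in_itv/= (ltW e1) ltW.
have aeV : {ae leb, forall x, 0 <= x <= T -> (\int[leb]_(y in `[(- r2)%R, r2]) gF (x, y) < +oo)%E}.
  by apply: ae_imp gV => x H xT; apply: H; rewrite /= in_itv.
apply: ae_imp (aeV) => x1 Hx1 x1T; have V1 := Hx1 x1T.
have rr : - r2 < r2 by apply: lt_trans r20; rewrite oppr_lt0.
have H : {ae leb, forall y, - r2 < y < r2 -> 0 <= wsign * sheet (x1, y)}.
  apply: (@ae_ge0_of_intervals _ _ _ _ G) => //; first exact: sh_int.
  move=> y1 y2 y1r y2r y12 G1 G2; rewrite (sh_rint wsign y1 y2 (mu1 x1)).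
  have mS : measurable_fun setT (fun p => wsign * sheet p).
    by apply: measurable_funM => //; exact: measurable_sheet.
  apply: (box_sign mS _ T0 y12).
  - by move=> p; rewrite normrM wsign_norm sheet_norm mulr1.
  - apply: ae_imp (aeV) => x2 Hx2 x2T; have V2 := Hx2 x2T.
    rewrite (sh_rint wsign y1 y2 (mu1 x2)); apply: (f_equal (fun t => wsign * t)).
    exact: vert.
  - apply: ae_imp gH => y H y2'; rewrite (sh_rint wsign 0 T (mu2 y)); apply: level_sheet.
      by case/andP: y2' => e1 e2; case/andP: y1r => e3 _; case/andP: y2r => _ e4; rewrite (le_trans (ltW e3))// (le_trans e2)// ltW.
    case/andP: y2' => e1 e2; case/andP: y1r => e3 _; case/andP: y2r => _ e4.
    by apply: H; rewrite /= in_itv/= (le_trans (ltW e3))// (le_trans e2)// ltW.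
by apply: ae_imp H => y H yr; apply: wsignK; [exact: sheet_norm|exact: H].
Qed.

Lemma strip_cauchy : {ae @lebC R, forall p, 0 <= p.1 <= T -> `|p.2| < r2 ->
  Defs.cauchy mu (F (toC p)) * F1 (toC p) = 'i * wsign%:C}.
Proof.
pose D : set P2 := `[0%R, T] `*` `](- r2)%R, r2[.
have mD : measurable D by exact: measurableX.
pose N1 : set P2 := D `&` [set p | sheet p != wsign].
pose N2 : set P2 := D `&` [set p | gF p = +oo%E].
have mN1 : measurable N1.
  apply: measurableI => //.
  have -> : [set p | sheet p != wsign] = sheet @^-1` (~` [set wsign]) by apply/seteqP; split=> p /=; [move/eqP|move/eqP].
  by rewrite -[X in measurable X]setTI; apply: measurable_sheet => //; exact: measurableC.
have mN2 : measurable N2.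
  by apply: measurableI => //; have := mgF measurableT (emeasurable_set1 +oo%E); rewrite setTI.
have n1 : @lebC R N1 = 0%E.
  apply: null_slices => //; apply: ae_imp strip_sheet => x H.
  have [xT|xT] := boolP (0 <= x <= T); last by apply: ae_all => y [[/= ]]; rewrite in_itv/= (negbTE xT).
  apply: ae_imp (H xT) => y Hy [[_ /=]]; rewrite in_itv/= => /Hy ->.
  by rewrite eqxx.
have n2 : @lebC R N2 = 0%E.
  apply: null_slices => //.
  have [gV _] := good_lines (measurable_itv `[0%R, T]) (measurable_itv `[- r2, r2]) mgF gF0 box_fin.
  apply: ae_imp gV => x H.
  have [xT|xT] := boolP (0 <= x <= T); last by apply: ae_all => y [[/= ]]; rewrite in_itv/= (negbTE xT).
  have xT' : `[0%R, T]%classic x by rewrite /= in_itv.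
  have mgV : measurable_fun setT (fun y => gF (x, y)) by exact: (measurableT_comp mgF (pair1_measurable x)).
  have := finite_int_ae (m := leb) (measurable_itv `[- r2, r2]) (measurable_funTS mgV) (fun y => gF0 (x, y)) (H xT').
  apply: ae_imp => y Hy [[_ /= yr]] goo; have : (gF (x, y) < +oo)%E.
    by apply: Hy; move: yr; rewrite /= !in_itv/= => /andP[? ?]; apply/andP; split; exact: ltW.
  by rewrite goo.
exists (N1 `|` N2); split.
- exact: measurableU.
- apply/eqP; rewrite eq_le measure_ge0 andbT (le_trans (measureU2 (lebC (R := R)) mN1 mN2))//.
  by rewrite [X in (X + _ <= _)%E]n1 [X in (_ + X <= _)%E]n2 adde0.
move=> p /= /not_implyP[pT /not_implyP[pr neq]].
have Dp : D p by split; rewrite /= in_itv//=; rewrite -ltr_norml.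
have [goo|gfin] := eqVneq (gF p) +oo%E; first by right.
left; split => //=; apply/eqP => E; apply: neq; rewrite -E; apply: sheetE; first exact: lt_trans r2r.
by rewrite ltey.
Qed.

End StripCauchy.

(** [integral_lip_inverse] for an indicator; it carries the exceptional null set from the strip back
    to the plane. *)
Lemma null_lip_preimage (R : realType) (phi : R * R -> R * R) (B N : set (R * R)) (L M : R) : measurable_fun setT phi ->
  measurable B -> 0 < L -> (forall w, B w -> ball (0, 0) M (phi w)) ->
  (forall w1 w2 (d : R), B w1 -> B w2 -> ball (phi w1) d (phi w2) -> ball w1 (L * d) w2) ->
  measurable N -> @lebC R N = 0%E -> measurable (B `&` phi @^-1` N) /\ @lebC R (B `&` phi @^-1` N) = 0%E.
Proof.
move=> mphi mB L0 phiM lip mN N0.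
have mpre : measurable (phi @^-1` N) by rewrite -[X in measurable X]setTI; exact: mphi.
have mI : measurable (B `&` phi @^-1` N) by exact: measurableI.
split => //.
have mi : measurable_fun setT (fun p : R * R => (\1_N p)%:E : \bar R).
  by apply/measurable_EFinP; exact: measurable_indic.
have := integral_lip_inverse mphi mB L0 phiM lip mi (fun p => ltac:(by rewrite lee_fin)).
rewrite int_lebP//; last exact: (measurableT_comp mi mphi).
rewrite int_lebP//.
have -> : (\int[@lebC R]_p (\1_N p)%:E = 0)%E by rewrite integral_indic// setIT; exact: N0.
rewrite mule0.
have -> : (fun w => (\1_N (phi w))%:E) = (fun w => (\1_(phi @^-1` N) w)%:E : \bar R).
  by apply/funext => w; rewrite !indicE; congr (_ _)%:E; apply/idP/idP; rewrite !inE.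
rewrite integral_indic// setIC => H; apply/eqP; rewrite eq_le measure_ge0 andbT; exact: H.
Qed.

Section LocalCauchy.
Variable R : realType.
Local Notation P2 := (R * R)%type.
Variables (reg : set R[i]) (Rq : R[i] -> R[i]).
Hypothesis chartP : forall z0, reg z0 -> exists W h h' rho r0 m, chart reg Rq z0 W h h' rho r0 m.
Hypothesis finP : exists L : seq R[i], forall s, ~ reg s -> s \in L.

Definition on_closed (z : R[i]) := exists g T, closed_traj reg Rq g T /\ g 0 = z.
Hypothesis dense_closed : {ae @lebC R, forall p, on_closed (toC p)}.

Definition solves (mu : {finite_measure set P2 -> \bar R}) :=
  {ae @lebC R, forall p, reg (toC p) -> Defs.cauchy mu (toC p) ^+ 2 = - Rq (toC p)}.

Lemma closed_near z (d : R) : 0 < d -> exists2 z', on_closed z' & nc (z' - z) < d.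
Proof.
move=> d0; have [N [mN N0 sub]] := dense_closed.
apply: contrapT => H.
have : (@lebC R (ball (toP z) (d / 2)) <= @lebC R N)%E.
  apply: meas_le => //; first exact: measurable_ball2.
  move=> q /ball2_nc; rewrite toPK mulrC divfK// => qd; apply: sub => /= oc.
  by apply: H; exists (toC q).
have d2 : 0 < d / 2 by rewrite divr_gt0.
rewrite [X in (_ <= X)%E]N0 lebC_ball; last exact: ltW.
by rewrite lee_fin leNgt mulr_gt0// exprn_gt0.
Qed.

(** The number [a] of [wind_values] depends on the strip alone, so [H] and its primitive [V] are
    fixed before any measure is considered; hence the order of quantifiers. *)
Lemma local_cauchy p : bounded_arcs reg Rq p -> exists e H V, [/\ 0 < e,
  (forall z, cball p e z -> cderiv V z (H z)), (forall z, cball p e z -> ccont H z) &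
  forall mu, solves mu -> {ae @lebC R, forall q, cball p e (toC q) -> Defs.cauchy mu (toC q) = H (toC q)}].
Proof.
move=> bp; have rp := bp.1.
have [W [h [h' [rho [s0 [m ch]]]]]] := chartP rp.
have [[rho0 _ m0] [hbl _ _] WT Wm [hm hreg _]] := ch.
have cp := cball_center p rho0.
have hp0 : h p != 0 by rewrite -nc_gt0 (lt_le_trans m0)// hm.
have v2 : (h p)^-1 ^+ 2 * Rq p = 1 by rewrite -(hreg _ cp).2 -exprMn mulVf ?expr1n.
have [r [G [G1 [r0 SG G0 _]]]] := strip_exists chartP finP bp v2.
have st0 : strip r 0 by rewrite /strip/= normr0.
have [T T0 perG] : exists2 T : R, 0 < T & forall w, strip r w -> G (w + T%:C) = G w /\ G1 (w + T%:C) = G1 w.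
  have [d d0 Hd] := sol_locally_open chartP (@copen_strip R r) SG st0 r0.
  have [z [g [T [cg gz]]] zp] := closed_near p d0.
  have [k kr Gk] := Hd z ltac:(by rewrite G0); rewrite add0r in Gk.
  by apply: (sol_periodic chartP SG _ cg (w1 := k)); [exact: le_lt_trans (nc_Im k) kr|rewrite gz].
(* [strip_cauchy] speaks of 0 <= x <= T; translating by half a period puts p at x = T / 2, in the
   interior of that range. *)
pose c : R[i] := - (T / 2)%:C.
pose F w := G (c + 1 * w); pose F1 w := G1 (c + 1 * w) * 1.
have stc w : strip r (c + 1 * w) = strip r w by rewrite /strip/= mul1r cImD /= oppr0 add0r.
have SF : sol reg Rq F F1 (strip r).
  have := sol_affine (c:=c) (expr1n _ 2) SG; move=> S w ws; apply: S; by rewrite /= stc.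
have per w : strip r w -> F (w + T%:C) = F w /\ F1 (w + T%:C) = F1 w.
  move=> ws; rewrite /F /F1 !mul1r addrA; have ws' : strip r (c + w) by have := stc w; rewrite mul1r => ->.
  by have [-> ->] := perG _ ws'.
pose w0 : R[i] := (T / 2)%:C.
have w0s : strip r w0 by rewrite /strip/= normr0.
have Fw0 : F w0 = p by rewrite /F /c /w0 mul1r addrC subrr.
have [r' /andP[r'0 r'r] disj] := levels_disjoint chartP r0 T0 SF per.
have [a Ha] := wind_values chartP r0 T0 SF per r'0 r'r disj.
have r20 : 0 < r' / 2 by rewrite divr_gt0.
have r2r' : r' / 2 < r' by lra.
have cF : cball p rho (F w0) by rewrite Fw0.
have [d d0 Hd] := sol_local ch (@copen_strip R r) w0s SF cF.
pose c1 := h (F w0) * F1 w0.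
have c12 : c1 ^+ 2 = 1.
  by rewrite exprMn mulrC (hreg _ cF).2; have [_ _ _] := SF _ w0s.
have nc1 := nc_sqr1 c12.
pose eps := Num.min d (Num.min (r' / 2) (T / 2)).
have eps0 : 0 < eps by rewrite !lt_min d0 r20 divr_gt0.
have [e e0 He] := sol_locally_open chartP (@copen_strip R r) SF w0s eps0.
(* From C F1 = i [wsign a] and F1 c1 h = 1 one gets C = i ([wsign a]) c1 h. *)
pose c2 : R[i] := 'i * (wsign a)%:C * c1.
exists (Num.min e rho), (fun z => c2 * h z), (fun z => c2 * W z).
have sub z : cball p (Num.min e rho) z -> nc (z - F w0) < e /\ cball p rho z.
  by rewrite /cball/= lt_min Fw0 => /andP[].
have dV b z : cball p rho z -> cderiv (fun z => b * W z) z (b * h z).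
  move=> zr; have dW := taylor2_cderiv WT zr.
  have := @cderiv_comp _ (fun w => 0 + b * w) W z b (h z) (cderiv_affine 0 b (W z)) dW.
  by under eq_fun do rewrite add0r.
split.
- by rewrite lt_min e0.
- by move=> z /sub[_ zr]; exact: dV.
- move=> z /sub[_ zr]; apply: ccontM; [exact: ccont_cst|exact: bdlip_ccont hbl zr].
move=> mu smu.
have [g [mg g0 gpot gN gint]] := dominating_exists mu smu.
have gsq z : (g (toP z) < +oo)%E -> reg z -> Defs.cauchy mu z ^+ 2 = - Rq z.
  by move=> /gN /contrapT /=; rewrite toPK.
have [N [mN N0 Nsub]] := strip_cauchy chartP T0 SF per mg g0 gint gpot gsq r'r Ha r20 r2r'.
(* The local inverse of [F] at p, read off from W(F(w0 + k)) = W p + c1 k and the fact that c1 is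
   its own inverse. *)
pose psi (q : P2) : P2 :=
  toP (if `[< cball p rho (toC q) >] then w0 + c1 * (W (toC q) - W p) else 0).
have mpsi : measurable_fun setT psi.
  have cW z : cball p rho z -> ccont (fun z => w0 + c1 * (W z - W p)) z.
    move=> zr; have -> : (fun z => w0 + c1 * (W z - W p)) = (fun z => (w0 - c1 * W p) + 1 * (c1 * W z)).
      by apply/funext => x; rewrite mulrBr mul1r; ring.
    apply: (@ccont_comp _ (fun x => w0 - c1 * W p + 1 * x) (fun z => c1 * W z)); first exact: ccont_affine.
    by apply: cderiv_ccont; exact: dV.
  have mf := mfC_patch (@copen_cball R p rho) cW.
  by have := mfC_pair mf.
pose Bs : set P2 := [set q | cball p (Num.min e rho) (toC q)].
have mBs : measurable Bs by apply: open_measurable2; apply: copen_open; exact: copen_cball.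
have key q : Bs q -> exists2 k, nc k < eps & [/\ toC q = F (w0 + k), toC (psi q) = w0 + k &
    F1 (w0 + k) * (c1 * h (toC q)) = 1].
  move=> /sub[qe qr]; have [k ke Fk] := He _ qe; exists k => //.
  have kd : nc k < d by move: ke; rewrite lt_min => /andP[].
  have [_ _ hF WF] := Hd _ kd; split => //.
    rewrite /psi asboolT// toPK -Fk WF -/c1 Fw0; congr (_ + _).
    by rewrite addrC addKr mulrA -expr2 c12 mul1r.
  by rewrite -Fk mulrC -mulrA hF -/c1 -expr2.
have psiM q : Bs q -> ball (0, 0) (nc w0 + eps) (psi q).
  move=> /key[k ke [_ pk _]]; apply: nc_ball2; rewrite pk (_ : toC (0, 0) = 0)// subr0.
  by rewrite (le_lt_trans (ncD _ _))// ltrD2l.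
(* 1 / m comes from the lower bound m |b - a| <= |W b - W a|, and 2 from comparing the modulus with
   the sup-norm balls of the product. *)
have L0 : 0 < 2 / m by rewrite divr_gt0.
have lip q1 q2 (b : R) : Bs q1 -> Bs q2 -> ball (psi q1) b (psi q2) -> ball q1 (2 / m * b) q2.
  move=> /sub[_ q1r] /sub[_ q2r] /ball2_nc; rewrite /psi !asboolT// !toPK => H; apply: nc_ball2.
  have := Wm _ _ q1r q2r; rewrite mulrAC ltr_pdivlMr// [_ * m]mulrC => /le_lt_trans; apply.
  have E : w0 + c1 * (W (toC q2) - W p) - (w0 + c1 * (W (toC q1) - W p)) = c1 * (W (toC q2) - W (toC q1)).
    by rewrite opprD addrACA subrr add0r -mulrBr opprB addrA subrK.
  by move: H; rewrite E (ncM c1) nc1 mul1r.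
have [mZ Z0] := null_lip_preimage mpsi mBs L0 psiM lip mN N0.
exists (Bs `&` psi @^-1` N); split => //.
move=> q /= /not_implyP[qB neq]; split => //; apply: contrapT => nN; apply: neq.
have [k ke [qF pk hF]] := key q qB.
have E : 0 <= (psi q).1 <= T -> `|(psi q).2| < r' / 2 ->
    Defs.cauchy mu (F (toC (psi q))) * F1 (toC (psi q)) = 'i * (wsign a)%:C.
  by move: (contra_not (@Nsub (psi q)) nN) => /contrapT.
move: E; rewrite pk -qF -[psi q]toCK pk (_ : (toP (w0 + k)).1 = T / 2 + complex.Re k); last by rewrite /= cReD.
rewrite (_ : (toP (w0 + k)).2 = complex.Im k); last by rewrite /= cImD /= add0r.
have [kd kr kT] : [/\ nc k < d, nc k < r' / 2 & nc k < T / 2] by move: ke; rewrite !lt_min => /and3P[].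
have kRe := nc_Re k; have kIm := nc_Im k.
move=> E.
have {}E : Defs.cauchy mu (toC q) * F1 (w0 + k) = 'i * (wsign a)%:C.
  apply: E; last exact: le_lt_trans kIm kr.
  by move: kRe; rewrite ler_norml => /andP[k1 k2]; move: kT k1 k2; clear => *; apply/andP; split; lra.
by rewrite -[LHS]mulr1 -hF mulrA E /c2; ring.
Qed.

End LocalCauchy.

Lemma Rintegral_comb d (T : measurableType d) (R : realType) (m : {measure set T -> \bar R})
  (f1 f2 f3 f4 g : T -> R) (k : R) : m.-integrable setT (EFin \o f1) -> m.-integrable setT (EFin \o f2) ->
  m.-integrable setT (EFin \o f3) -> m.-integrable setT (EFin \o f4) -> m.-integrable setT (EFin \o g) ->
  {ae m, forall x, f1 x - f2 x + (f3 x - f4 x) = k * g x} ->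
  Rintegral m setT f1 - Rintegral m setT f2 + (Rintegral m setT f3 - Rintegral m setT f4) = k * Rintegral m setT g.
Proof.
move=> i1 i2 i3 i4 ig H.
have i12 := integrableB measurableT i1 i2; have i34 := integrableB measurableT i3 i4.
rewrite -(RintegralB measurableT i1 i2) -(RintegralB measurableT i3 i4) -(RintegralD measurableT i12 i34).
rewrite -(RintegralZl k measurableT ig); apply: Rintegral_ae_eq => //.
- exact: integrable_measurable (integrableD measurableT i12 i34).
- exact: measurable_funM (measurable_cst k) (integrable_measurable ig).
by apply: ae_imp H => x -> _.
Qed.

(** * Recovering a measure from its Cauchy transform *)

Section Contour.
Variable R : realType.
Local Notation P2 := (R * R)%type.
Local Notation leb := (@lebesgue_measure R).

(** If k = 0, both sides are 0 because x / 0 = 0; points collinear with a side of the rectangle thus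
    follow the same formula. *)
Lemma rint_arctan (k s a b : R) : a <= b ->
  rint (fun t => k / (k ^+ 2 + (t - s) ^+ 2)) a b = atan ((b - s) / k) - atan ((a - s) / k).
Proof.
move=> ab; have [->|k0] := eqVneq k 0.
  rewrite !invr0 !mulr0 subrr /rint; under eq_Rintegral do rewrite mul0r.
  by rewrite /Rintegral integral0.
have D (x : R) : is_derive x 1 (fun t => atan ((t - s) / k)) (k / (k ^+ 2 + (x - s) ^+ 2)).
  have d1 : is_derive x 1 (fun t => (t - s) / k) (k^-1).
    apply: is_derive_eq; rewrite /GRing.scale/=; ring.
  have := is_derive1_comp (is_derive1_atan _) d1; move=> /is_derive_eq; apply.
  have n0 : k ^+ 2 + (x - s) ^+ 2 != 0 by rewrite gt_eqF// ltr_pwDl ?sqr_ge0// exprn_even_gt0.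
  have -> : 1 + ((x - s) / k) ^+ 2 = (k ^+ 2 + (x - s) ^+ 2) / k ^+ 2 by field.
  by rewrite /GRing.scale/= invf_div; field; rewrite n0.
apply: (@rint_FTC _ _ (fun t => atan ((t - s) / k))) => //.
apply: continuous_subspaceT => x; apply: cvgM; first exact: cvg_cst.
apply: cvgV.
  by rewrite gt_eqF// ltr_pwDl ?sqr_ge0// exprn_even_gt0.
apply: cvgD; first exact: cvg_cst.
by apply: cvgM; (apply: cvgB; [exact: cvg_id|exact: cvg_cst]).
Qed.

Lemma atan_inv (x : R) : 0 < x -> atan x + atan x^-1 = pi / 2.
Proof.
move=> x0.
have t0 : 0 < atan x by rewrite -[ltLHS]atan0; exact: lt_atan.
have t1 := atan_ltpi2 x.
have E : tan (pi / 2 - atan x) = x^-1.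
  rewrite -opprB tanN /tan sinBpihalf cosBpihalf mulNr opprK -invf_div.
  by have := atanK x; rewrite /tan => ->.
have : atan (tan (pi / 2 - atan x)) = pi / 2 - atan x.
  by apply: tanK; rewrite in_itv/=; apply/andP; split; have := pi_gt0 R; lra.
by rewrite E => ->; rewrite addrC subrK.
Qed.

(* Also valid if [x = 0] or [y = 0], because division by zero gives [0]. *)
Lemma atan_swap (x y : R) : atan (x / y) + atan (y / x) = pi / 2 * (Num.sg x * Num.sg y).
Proof.
wlog x0 : x y / 0 <= x.
  move=> H; have [x0|x0] := leP 0 x; first exact: H.
  have := H (- x) y; rewrite oppr_ge0 (ltW x0) => /(_ isT); rewrite mulNr invrN mulrN !atanN sgrN mulNr mulrN.
  by move/(f_equal (fun z => - z)); rewrite opprD !opprK.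
wlog y0 : x y x0 / 0 <= y.
  move=> H; have [y0|y0] := leP 0 y; first exact: H.
  have := H x (- y) x0; rewrite oppr_ge0 (ltW y0) => /(_ isT); rewrite mulNr invrN mulrN !atanN sgrN mulrN mulrN.
  by move/(f_equal (fun z => - z)); rewrite opprD !opprK.
move: x0; rewrite le_eqVlt => /predU1P[<-|x0]; first by rewrite mul0r invr0 mulr0 atan0 sgr0 !mul0r mulr0 addr0.
move: y0; rewrite le_eqVlt => /predU1P[<-|y0]; first by rewrite mul0r invr0 mulr0 atan0 sgr0 !mulr0 addr0.
by rewrite !gtr0_sg// !mulr1 -(atan_inv (divr_gt0 x0 y0)) invf_div.
Qed.

Definition rect (a b c d : R) : set P2 := `]a, b[ `*` `]c, d[.

Lemma measurable_rect a b c d : measurable (rect a b c d).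
Proof. exact: measurableX. Qed.

(** The product is 4 inside the rectangle and 0 outside. On the boundary some sign is 0 and the
    product is 1 or 2; the last hypothesis excludes this case. *)
Lemma sg_rect (A B C D : R) (r : bool) : A < B -> C < D -> r = [&& A < 0, 0 < B, C < 0 & 0 < D] ->
  (A <= 0 <= B -> C <= 0 <= D -> [&& A < 0, 0 < B, C < 0 & 0 < D]) ->
  (Num.sg B - Num.sg A) * (Num.sg D - Num.sg C) = 4 * r%:R.
Proof.
move=> AB CD -> H.
have [A0|A0] := ltP 0 A.
  by rewrite (gtr0_sg A0) (gtr0_sg (lt_trans A0 AB)) subrr mul0r ltNge (ltW A0) mulr0.
have [B0|B0] := ltP B 0.
  by rewrite (ltr0_sg B0) (ltr0_sg (lt_trans AB B0)) subrr mul0r [0 < B]ltNge (ltW B0) andbF mulr0.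
have [C0|C0] := ltP 0 C.
  by rewrite (gtr0_sg C0) (gtr0_sg (lt_trans C0 CD)) subrr mulr0 [C < 0]ltNge (ltW C0) !andbF mulr0.
have [D0|D0] := ltP D 0.
  by rewrite (ltr0_sg D0) (ltr0_sg (lt_trans CD D0)) subrr mulr0 [0 < D]ltNge (ltW D0) !andbF mulr0.
have := H; rewrite A0 B0 C0 D0 => /(_ isT isT) /and4P[h1 h2 h3 h4].
rewrite (ltr0_sg h1) (gtr0_sg h2) (ltr0_sg h3) (gtr0_sg h4) h1 h2 h3 h4/=; ring.
Qed.

Lemma rderiv_horizontal (y t : R) : rderiv (fun x => x +i* y) t 1.
Proof.
move=> e e0; exists 1; first exact: ltr01.
move=> s _; rewrite (_ : _ - _ = 0); first by rewrite nc0 mulr_ge0// ltW.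
by apply: Cext; rewrite ?cReD ?cImD ?mul1r /=; ring.
Qed.

Lemma rderiv_vertical (x t : R) : rderiv (fun y => x +i* y) t 'i.
Proof.
move=> e e0; exists 1; first exact: ltr01.
move=> s _; rewrite (_ : _ - _ = 0); first by rewrite nc0 mulr_ge0// ltW.
by apply: Cext; rewrite !(cReD, cImD, cReM, cImM) /=; ring.
Qed.

Lemma horizontal_arctan (a b c : R) (q : P2) : a <= b ->
  rint (fun t => complex.Re (- 'i * 1 * ((t +i* c) - toC q)^-1)) a b =
  atan ((a - q.1) / (c - q.2)) - atan ((b - q.1) / (c - q.2)).
Proof.
move=> ab; transitivity (rint (fun t => - (c - q.2) / ((- (c - q.2)) ^+ 2 + (t - q.1) ^+ 2)) a b).
  apply: rint_eq => t _; rewrite mulr1 cReM cReV cImV nc_sqr !cReD !cImD /= sqrrN.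
  by rewrite [X in _ = _ / X]addrC; ring.
by rewrite rint_arctan// invrN !mulrN !atanN opprK addrC.
Qed.

Lemma vertical_arctan (c d a : R) (q : P2) : c <= d ->
  rint (fun t => complex.Re (- 'i * 'i * ((a +i* t) - toC q)^-1)) c d =
  atan ((d - q.2) / (a - q.1)) - atan ((c - q.2) / (a - q.1)).
Proof.
move=> cd; rewrite -rint_arctan//.
by apply: rint_eq => t _; rewrite mulNr -expr2 sqr_i opprK mul1r cReV nc_sqr !cReD !cImD /=.
Qed.

Variable mu : {finite_measure set P2 -> \bar R}.

Definition hside (a b c : R) := rint (fun x => complex.Re (Defs.cauchy mu (x +i* c) * (- 'i * 1))) a b.
Definition vside (c d a : R) := rint (fun y => complex.Re (Defs.cauchy mu (a +i* y) * (- 'i * 'i))) c d.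

Definition hgood (a b c : R) := (\int[leb]_(x in `[a, b]) pot mu (x +i* c) < +oo)%E.
Definition vgood (c d a : R) := (\int[leb]_(y in `[c, d]) pot mu (a +i* y) < +oo)%E.

(** For [mu]-almost every q, no side passes through q. The four sides then give eight arctangents,
    which [atan_swap] pairs at the corners into signs; the kernel integrates to 2 pi inside and 0
    outside, and [curve_fubini] integrates this against [mu]. *)
Lemma rect_formula (a b c d : R) : a < b -> c < d ->
  hgood a b c -> hgood a b d -> vgood c d a -> vgood c d b ->
  hside a b c - hside a b d + (vside c d b - vside c d a) = 2 * pi * fine (mu (rect a b c d)).
Proof.
move=> ab cd hc hd va vb.
have dh y t : a <= t <= b -> rderiv (fun x => x +i* y) t 1 by move=> _; exact: rderiv_horizontal.
have dv x t : c <= t <= d -> rderiv (fun y => x +i* y) t 'i by move=> _; exact: rderiv_vertical.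
have ch : ctn (fun=> 1 : R[i]) `[a, b] by exact: ctn_cst.
have cv : ctn (fun=> 'i : R[i]) `[c, d] by exact: ctn_cst.
have [_ ic Ec] := curve_fubini ab (dh c) ch hc (- 'i).
have [_ id Ed] := curve_fubini ab (dh d) ch hd (- 'i).
have [_ ia Ea] := curve_fubini cd (dv a) cv va (- 'i).
have [_ ib Eb] := curve_fubini cd (dv b) cv vb (- 'i).
have ac := curve_disjoint ab (dh c) ch hc; have ad := curve_disjoint ab (dh d) ch hd.
have aa := curve_disjoint cd (dv a) cv va; have ab' := curve_disjoint cd (dv b) cv vb.
rewrite /hside Ec Ed /vside Ea Eb.
have mr := measurable_rect a b c d.
have mi : measurable_fun setT (\1_(rect a b c d) : P2 -> R) by exact: measurable_indic.
have ir : mu.-integrable setT (EFin \o (\1_(rect a b c d) : P2 -> R)).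
  apply: (measurable_bounded_integrable measurableT (mu_fin mu) mi).
  exists 1; split; first exact: real1.
  by move=> M M1 q _ /=; rewrite indicE; case: (_ \in _); rewrite ?normr1 ?normr0 ltW// (lt_trans ltr01).
have -> : fine (mu (rect a b c d)) = Rintegral mu setT (\1_(rect a b c d) : P2 -> R).
  by rewrite /Rintegral integral_indic// setIT.
apply: Rintegral_comb => //.
apply: ae_imp (ae_and (ae_and ac ad) (ae_and aa ab')) => q [[qc qd] [qa qb]].
rewrite !horizontal_arctan ?ltW// !vertical_arctan ?ltW//.
have A1 : a - q.1 < b - q.1 by rewrite ltrD2r.
have C1 : c - q.2 < d - q.2 by rewrite ltrD2r.
have Er : (q \in rect a b c d) = [&& a - q.1 < 0, 0 < b - q.1, c - q.2 < 0 & 0 < d - q.2].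
  rewrite !subr_lt0 !subr_gt0 andbA; apply/idP/idP; rewrite inE /rect/= !in_itv/=; first by case=> -> ->.
  by move=> /andP[-> ->].
have := sg_rect A1 C1 Er; rewrite indicE => H.
have h1 := atan_swap (b - q.1) (d - q.2); have h2 := atan_swap (a - q.1) (d - q.2).
have h3 := atan_swap (b - q.1) (c - q.2); have h4 := atan_swap (a - q.1) (c - q.2).
have {}H : (Num.sg (b - q.1) - Num.sg (a - q.1)) * (Num.sg (d - q.2) - Num.sg (c - q.2)) = 4 * (q \in rect a b c d)%:R.
  apply: H; rewrite !subr_le0 !subr_ge0 !subr_lt0 !subr_gt0 => /andP[a1 a2] /andP[c1 c2].
  have [q1 q2] : a <= q.1 <= b /\ c <= q.2 <= d by rewrite a1 a2 c1 c2.
  have nc' := qc _ q1; have nd := qd _ q1; have na := qa _ q2; have nb := qb _ q2.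
  rewrite !lt_neqAle a1 a2 c1 c2 !andbT; apply/and4P; split.
  - by apply: contra na => /eqP ->; case: (q).
  - by apply: contra nb => /eqP <-; case: (q).
  - by apply: contra nc' => /eqP ->; case: (q).
  - by apply: contra nd => /eqP <-; case: (q).
transitivity (pi / 2 * (4 * (q \in rect a b c d)%:R) : R); last by field.
rewrite -H; move: h1 h2 h3 h4.
set t1 := atan _; set t2 := atan _; set t3 := atan _; set t4 := atan _.
set t5 := atan _; set t6 := atan _; set t7 := atan _; set t8 := atan _ => h1 h2 h3 h4.
transitivity ((t1 + t2) - (t3 + t4) - (t5 + t6) + (t7 + t8)); first by ring.
by rewrite h1 h2 h3 h4; ring.
Qed.

End Contour.

Section GoodRectangles.
Variable R : realType.
Local Notation P2 := (R * R)%type.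
Local Notation leb := (@lebesgue_measure R).

Lemma rect_subset (a b c d a' b' c' d' : R) : a <= a' -> b' <= b -> c <= c' -> d' <= d ->
  rect a' b' c' d' `<=` rect a b c d.
Proof.
move=> aa bb cc dd [x y] [/=]; rewrite !in_itv/= => /andP[x1 x2] /andP[y1 y2].
by split => /=; rewrite in_itv/=; apply/andP; split; lra.
Qed.

Lemma inv_lt (e : R) : 0 < e -> exists n : nat, n.+1%:R^-1 < e.
Proof.
move=> e0; exists (Num.truncn e^-1); rewrite -[ltRHS]invrK ltf_pV2 ?posrE ?invr_gt0//.
exact: truncnS_gt.
Qed.

(** The slightly smaller rectangles [S n] increase to the given one, and between each of them and
    the limit fits a rectangle whose sides lie on good lines. *)
Lemma rect_le (mu : {measure set P2 -> \bar R}) (GV GH : set R) (a b c d : R) (K : \bar R) : a < b -> c < d ->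
  {ae leb, forall x, a < x < b -> GV x} -> {ae leb, forall y, c < y < d -> GH y} ->
  (forall a' b' c' d', a < a' -> a' < b' -> b' < b -> c < c' -> c' < d' -> d' < d ->
    GV a' -> GV b' -> GH c' -> GH d' -> (mu (rect a' b' c' d') <= K)%E) ->
  (mu (rect a b c d) <= K)%E.
Proof.
move=> ab cd aV aH HK.
pose S (n : nat) := rect (a + n.+1%:R^-1) (b - n.+1%:R^-1) (c + n.+1%:R^-1) (d - n.+1%:R^-1).
have mS n : measurable (S n) by exact: measurable_rect.
have i0 (n : nat) : 0 < n.+1%:R^-1 :> R by rewrite invr_gt0 ltr0n.
have sS : nondecreasing_seq S.
  apply/nondecreasing_seqP => n; apply/subsetPset; have : n.+2%:R^-1 <= n.+1%:R^-1 :> R.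
    by rewrite lef_pV2 ?posrE ?ltr0n// ler_nat.
  by rewrite /S; move: (n.+2%:R^-1 : R) (n.+1%:R^-1 : R) => u v h; apply: rect_subset; lra.
have US : \bigcup_n S n = rect a b c d.
  apply/seteqP; split=> [p [n _]|].
    by apply: rect_subset; rewrite ?lerDl ?gerBl ltW.
  move=> [x y] [/=]; rewrite !in_itv/= => /andP[x1 x2] /andP[y1 y2].
  have [n n1] : exists n : nat, n.+1%:R^-1 < Num.min (Num.min (x - a) (b - x)) (Num.min (y - c) (d - y)).
    by apply: inv_lt; rewrite !lt_min !subr_gt0 x1 x2 y1 y2.
  move: n1; rewrite !lt_min => /andP[/andP[n1 n2] /andP[n3 n4]]; exists n => //; rewrite /S.
  move: (n.+1%:R^-1 : R) n1 n2 n3 n4 => u n1 n2 n3 n4.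
  by split; rewrite /= in_itv/=; apply/andP; split; lra.
have side (u v e : R) (G : set R) : u < v -> 0 < e -> {ae leb, forall x, u < x < v -> G x} ->
    exists u' v', [/\ u < u', u' < v', v' < v & [/\ G u', G v', u' <= u + e & v - e <= v']].
  move=> uv e0 aG; pose m := (u + v) / 2; have um : u < m by rewrite /m; lra.
  have mv : m < v by rewrite /m; lra.
  have [u' /andP[u1 u2] Gu] : exists2 x, u < x < Num.min m (u + e) & G x.
    apply: ae_itv_exists; first by rewrite lt_min um ltrDl.
    apply: ae_imp aG => x H /andP[x1]; rewrite lt_min => /andP[x2 _]; apply: H.
    by rewrite x1 (lt_trans x2).
  have [v' /andP[v1 v2] Gv] : exists2 x, Num.max m (v - e) < x < v & G x.
    apply: ae_itv_exists; first by rewrite gt_max mv gtrBl.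
    apply: ae_imp aG => x H /andP[]; rewrite gt_max => /andP[x1 _ x2]; apply: H.
    by rewrite x2 (lt_trans um).
  move: u2 v1; rewrite lt_min gt_max => /andP[u2 u3] /andP[v1 v3].
  exists u', v'; split => //; first exact: lt_trans v1.
  by split => //; exact: ltW.
have SK n : (mu (S n) <= K)%E.
  have [a' [b' [a1 a2 a3 [Ga Gb a4 a5]]]] := side _ _ _ _ ab (i0 n) aV.
  have [c' [d' [c1 c2 c3 [Gc Gd c4 c5]]]] := side _ _ _ _ cd (i0 n) aH.
  apply: le_trans (HK a' b' c' d' a1 a2 a3 c1 c2 c3 Ga Gb Gc Gd).
  by apply: meas_le => //; [exact: measurable_rect|exact: rect_subset].
have := nondecreasing_cvg_mu (mu := mu) mS (bigcupT_measurable S mS) sS.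
rewrite US => /cvg_lim <-//; apply: lime_le; last by apply: nearW => n; exact: SK.
apply: ereal_nondecreasing_is_cvgn; apply/nondecreasing_seqP => n; apply: meas_le => //.
by apply/subsetPset; apply: sS.
Qed.

(** Passes from open rectangles to the shape of dyadic squares: only the left and lower sides are
    moved outwards, and finiteness allows decreasing limits. *)
Lemma half_open_eq (mu nu : {measure set P2 -> \bar R}) (a b c d : R) :
  (mu setT < +oo)%E -> (nu setT < +oo)%E -> a < b -> c < d ->
  (forall a b c d : R, a < b -> c < d -> mu (rect a b c d) = nu (rect a b c d)) ->
  mu (`[a, b[ `*` `[c, d[) = nu (`[a, b[ `*` `[c, d[).
Proof.
move=> fm fn ab cd H.
pose S (n : nat) := rect (a - n.+1%:R^-1) b (c - n.+1%:R^-1) d.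
have mS n : measurable (S n) by exact: measurable_rect.
have i0 (n : nat) : 0 < n.+1%:R^-1 :> R by rewrite invr_gt0 ltr0n.
have sS : nonincreasing_seq S.
  apply/nonincreasing_seqP => n; apply/subsetPset; have : n.+2%:R^-1 <= n.+1%:R^-1 :> R.
    by rewrite lef_pV2 ?posrE ?ltr0n// ler_nat.
  by rewrite /S; move: (n.+2%:R^-1 : R) (n.+1%:R^-1 : R) => u v h; apply: rect_subset; lra.
have IS : \bigcap_n S n = `[a, b[ `*` `[c, d[.
  apply/seteqP; split=> [[x y] h|[x y] [/=] + + n _].
    have hn n : [/\ a - n.+1%:R^-1 < x, x < b, c - n.+1%:R^-1 < y & y < d].
      by have [] := h n I; rewrite /= !in_itv/= => /andP[-> ->] /andP[-> ->].
    have [_ x2 _ y2] := hn 0%N.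
    split; rewrite /= in_itv/= ?x2 ?y2 andbT leNgt; apply/negP => xa.
      have [n n1] : exists n : nat, n.+1%:R^-1 < a - x by apply: inv_lt; rewrite subr_gt0.
      by have [h1 _ _ _] := hn n; move: (n.+1%:R^-1 : R) n1 h1 => u; lra.
    have [n n1] : exists n : nat, n.+1%:R^-1 < c - y by apply: inv_lt; rewrite subr_gt0.
    by have [_ _ h1 _] := hn n; move: (n.+1%:R^-1 : R) n1 h1 => u; lra.
  rewrite !in_itv/= => /andP[x1 x2] /andP[y1 y2]; have := i0 n.
  by rewrite /S; move: (n.+1%:R^-1 : R) => u u0; split; rewrite /= in_itv/=; apply/andP; split; lra.
have lim (m : {measure set P2 -> \bar R}) : (m setT < +oo)%E ->
    m (\bigcap_n S n) = limn (fun n => m (S n)).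
  move=> fin; apply/esym/cvg_lim => //.
  by apply: nonincreasing_cvg_mu => //; [exact: finite_meas|exact: bigcapT_measurable].
rewrite -IS !lim//; congr (limn _); apply/funext => n; apply: H; have := i0 n; move: (n.+1%:R^-1 : R) => u u0; lra.
Qed.

Lemma measure_eq_rect (mu nu : {measure set P2 -> \bar R}) (E : set P2) :
  (mu setT < +oo)%E -> (nu setT < +oo)%E ->
  (forall a b c d : R, a < b -> c < d -> mu (rect a b c d) = nu (rect a b c d)) -> measurable E -> mu E = nu E.
Proof.
move=> fm fn H mE; apply: measure_eq_dyadic => // n k.
rewrite dysqE !dy1E; apply: half_open_eq => //.
  by rewrite ltr_pM2r ?invr_gt0 ?exprn_gt0// ltr_int ltrDl.
by rewrite ltr_pM2r ?invr_gt0 ?exprn_gt0// ltr_int ltrDl.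
Qed.

Definition vfin (M : R) (g : P2 -> \bar R) (x : R) := (\int[leb]_(y in `[(- M)%R, M]) g (x, y) < +oo)%E.
Definition hfin (M : R) (g : P2 -> \bar R) (y : R) := (\int[leb]_(x in `[(- M)%R, M]) g (x, y) < +oo)%E.

Lemma fin_lines (M : R) (g : P2 -> \bar R) : measurable_fun setT g -> (forall p, 0 <= g p)%E ->
  (forall q (e : R), (\int[@lebC R]_(p in ball q e) g p < +oo)%E) ->
  {ae leb, forall x, - M <= x <= M -> vfin M g x} /\ {ae leb, forall y, - M <= y <= M -> hfin M g y}.
Proof.
move=> mg g0 gint.
have fin : (\int[@lebC R]_(p in `[(- M)%R, M] `*` `[(- M)%R, M]) g p < +oo)%E.
  apply: le_lt_trans (gint (0, 0) (M + 1)); apply: ge0_subset_integral => //.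
  - exact: measurableX.
  - exact: measurable_ball2.
  - exact: measurable_funTS.
  move=> [x y] [/=]; rewrite !in_itv/= => /andP[x1 x2] /andP[y1 y2].
  by split; rewrite /ball/= sub0r normrN ltr_norml; apply/andP; split; lra.
have [aV aH] := good_lines (measurable_itv `[(- M)%R, M]) (measurable_itv `[(- M)%R, M]) mg g0 fin.
by split; [apply: ae_imp aV|apply: ae_imp aH] => t H tM; apply: H; rewrite /= in_itv.
Qed.

Section DominatedRectangle.
Variables (mu : {finite_measure set P2 -> \bar R}) (N : set P2) (g : P2 -> \bar R) (M : R).
Hypotheses (mg : measurable_fun setT g) (g0 : forall p, (0 <= g p)%E).
Hypothesis gpot : forall p, (pot mu (toC p) <= g p)%E.
Hypothesis gN : forall p, (g p < +oo)%E -> ~ N p.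

Let side_fin (u : R -> P2) (a b : R) : measurable_fun setT u -> - M <= a -> b <= M ->
  (\int[leb]_(t in `[(- M)%R, M]) g (u t) < +oo)%E -> (\int[leb]_(t in `[a, b]) g (u t) < +oo)%E.
Proof.
move=> mu' aM bM; apply: le_lt_trans; apply: ge0_subset_integral => //.
  by apply: measurable_funTS; exact: measurableT_comp.
by move=> t /=; rewrite !in_itv/= => /andP[? ?]; apply/andP; split; lra.
Qed.

Let side_pot (u : R -> P2) (a b : R) : measurable_fun setT u -> - M <= a -> b <= M ->
  (\int[leb]_(t in `[(- M)%R, M]) g (u t) < +oo)%E -> (\int[leb]_(t in `[a, b]) pot mu (toC (u t)) < +oo)%E.
Proof.
move=> mu' aM bM fin; apply: le_lt_trans (side_fin mu' aM bM fin); apply: int_le => //.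
- by apply: (measurable_pot mu); apply: mfC_toC.
- exact: measurableT_comp.
- by move=> t; exact: pot_ge0.
Qed.

Let side_ae (u : R -> P2) (a b : R) : measurable_fun setT u -> - M <= a -> b <= M ->
  (\int[leb]_(t in `[(- M)%R, M]) g (u t) < +oo)%E -> {ae leb, forall t, `[a, b]%classic t -> ~ N (u t)}.
Proof.
move=> mu' aM bM fin; have mgu : measurable_fun setT (fun t => g (u t)) by exact: measurableT_comp.
have := finite_int_ae (m := leb) (measurable_itv `[a, b]) (measurable_funTS mgu) (fun t => g0 (u t)) (side_fin mu' aM bM fin).
by apply: ae_imp => t H /H; exact: gN.
Qed.

Let mx y : measurable_fun setT (fun x : R => (x, y) : P2). Proof. exact: pair2_measurable. Qed.
Let my x : measurable_fun setT (fun y : R => (x, y) : P2). Proof. exact: pair1_measurable. Qed.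

Lemma fin_hgood (a b c : R) : - M <= a -> b <= M -> hfin M g c -> hgood mu a b c.
Proof. exact: side_pot (mx c). Qed.

Lemma fin_vgood (c d a : R) : - M <= c -> d <= M -> vfin M g a -> vgood mu c d a.
Proof. exact: side_pot (my a). Qed.

Variable K : R[i] -> R[i].

Lemma hside_eq (a b c : R) : a < b -> - M <= a -> b <= M -> hfin M g c ->
  (forall x, a <= x <= b -> ~ N (x, c) -> Defs.cauchy mu (x +i* c) = K (x +i* c)) ->
  measurable_fun `[a, b] (fun x => complex.Re (K (x +i* c) * (- 'i * 1))) ->
  hside mu a b c = rint (fun x => complex.Re (K (x +i* c) * (- 'i * 1))) a b.
Proof.
move=> ab aM bM fin E mK.
have dh t : a <= t <= b -> rderiv (fun x => x +i* c) t 1 by move=> _; exact: rderiv_horizontal.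
have ch : ctn (fun=> 1 : R[i]) `[a, b] by exact: ctn_cst.
have [i1 _ _] := curve_fubini ab dh ch (fin_hgood aM bM fin) (- 'i).
apply: Rintegral_ae_eq => //; first exact: integrable_measurable i1.
by apply: ae_imp (side_ae (mx c) aM bM fin) => x H xab; rewrite E//; exact: H.
Qed.

Lemma vside_eq (c d a : R) : c < d -> - M <= c -> d <= M -> vfin M g a ->
  (forall y, c <= y <= d -> ~ N (a, y) -> Defs.cauchy mu (a +i* y) = K (a +i* y)) ->
  measurable_fun `[c, d] (fun y => complex.Re (K (a +i* y) * (- 'i * 'i))) ->
  vside mu c d a = rint (fun y => complex.Re (K (a +i* y) * (- 'i * 'i))) c d.
Proof.
move=> cd cM dM fin E mK.
have dv t : c <= t <= d -> rderiv (fun y => a +i* y) t 'i by move=> _; exact: rderiv_vertical.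
have cv : ctn (fun=> 'i : R[i]) `[c, d] by exact: ctn_cst.
have [i1 _ _] := curve_fubini cd dv cv (fin_vgood cM dM fin) (- 'i).
apply: Rintegral_ae_eq => //; first exact: integrable_measurable i1.
by apply: ae_imp (side_ae (my a) cM dM fin) => y H ycd; rewrite E//; exact: H.
Qed.

End DominatedRectangle.

Lemma abs_sum_bounds (a b c d : R) (M := `|a| + `|b| + `|c| + `|d|) :
  [/\ - M <= a, b <= M, - M <= c & d <= M].
Proof.
have aa := ler_norm (- a); have bb := ler_norm b; have cc := ler_norm (- c); have dd := ler_norm d.
rewrite !normrN in aa cc.
have := normr_ge0 a; have := normr_ge0 b; have := normr_ge0 c; have := normr_ge0 d.
by rewrite /M; split; lra.
Qed.

Lemma measure_eq_cauchy (mu1 mu2 : {finite_measure set P2 -> \bar R}) (E : set P2) :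
  {ae @lebC R, forall p, Defs.cauchy mu1 (toC p) = Defs.cauchy mu2 (toC p)} -> measurable E -> mu1 E = mu2 E.
Proof.
move=> ae mE.
have [g1 [mg1 g10 gp1 gN1 gi1]] := dominating_exists mu1 ae.
have [g2 [mg2 g20 gp2 gN2 gi2]] := dominating_exists mu2 ae.
pose N : set P2 := ~` [set p | Defs.cauchy mu1 (toC p) = Defs.cauchy mu2 (toC p)].
(* The sum is finite only where both majorants are, so one choice of lines serves both measures. *)
pose g p := (g1 p + g2 p)%E.
have mg : measurable_fun setT g by exact: emeasurable_funD.
have g0 p : (0 <= g p)%E by exact: adde_ge0.
have gpot1 p : (pot mu1 (toC p) <= g p)%E by rewrite (le_trans (gp1 p))// leeDl.
have gpot2 p : (pot mu2 (toC p) <= g p)%E by rewrite (le_trans (gp2 p))// leeDr.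
have gN p : (g p < +oo)%E -> ~ N p by move=> H; apply: gN1; apply: le_lt_trans H; rewrite leeDl.
have gint q (e : R) : (\int[@lebC R]_(p in ball q e) g p < +oo)%E.
  rewrite ge0_integralD//; first exact: lte_add_pinfty.
  - exact: measurable_ball2.
  - exact: measurable_funTS.
  - exact: measurable_funTS.
have eqr (a b c d : R) : a < b -> c < d -> mu1 (rect a b c d) = mu2 (rect a b c d).
  move=> ab cd; pose M := `|a| + `|b| + `|c| + `|d|.
  have [aV aH] := fin_lines M mg g0 gint.
  have [Ma Mb Mc Md] := abs_sum_bounds a b c d; rewrite -/M in Ma Mb Mc Md.
  have aV' : {ae leb, forall x, a < x < b -> vfin M g x}.
    apply: ae_imp aV => x H /andP[x1 x2]; apply: H.
    by rewrite (le_trans Ma (ltW x1)) (le_trans (ltW x2) Mb).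
  have aH' : {ae leb, forall y, c < y < d -> hfin M g y}.
    apply: ae_imp aH => x H /andP[x1 x2]; apply: H.
    by rewrite (le_trans Mc (ltW x1)) (le_trans (ltW x2) Md).
  have key a' b' c' d' : a < a' -> a' < b' -> b' < b -> c < c' -> c' < d' -> d' < d ->
      vfin M g a' -> vfin M g b' -> hfin M g c' -> hfin M g d' -> mu1 (rect a' b' c' d') = mu2 (rect a' b' c' d').
    move=> a1 a2 a3 c1 c2 c3 Ga Gb Gc Gd.
    have Ma' := le_trans Ma (ltW a1); have Mb' := le_trans (ltW a3) Mb.
    have Mc' := le_trans Mc (ltW c1); have Md' := le_trans (ltW c3) Md.
    have h1 y := @fin_hgood mu1 g M mg g0 gpot1 a' b' y Ma' Mb'.
    have v1 x := @fin_vgood mu1 g M mg g0 gpot1 c' d' x Mc' Md'.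
    have h2 y := @fin_hgood mu2 g M mg g0 gpot2 a' b' y Ma' Mb'.
    have v2 x := @fin_vgood mu2 g M mg g0 gpot2 c' d' x Mc' Md'.
    have H1 := rect_formula a2 c2 (h1 _ Gc) (h1 _ Gd) (v1 _ Ga) (v1 _ Gb).
    have H2 := rect_formula a2 c2 (h2 _ Gc) (h2 _ Gd) (v2 _ Ga) (v2 _ Gb).
    have dh y t : a' <= t <= b' -> rderiv (fun x => x +i* y) t 1 by move=> _; exact: rderiv_horizontal.
    have dv x t : c' <= t <= d' -> rderiv (fun y => x +i* y) t 'i by move=> _; exact: rderiv_vertical.
    have ch : ctn (fun=> 1 : R[i]) `[a', b'] by exact: ctn_cst.
    have cv : ctn (fun=> 'i : R[i]) `[c', d'] by exact: ctn_cst.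
    have Eh y : hfin M g y -> hside mu1 a' b' y = hside mu2 a' b' y.
      move=> Gy; apply: (hside_eq mg g0 gpot1 gN a2 Ma' Mb' Gy (K := Defs.cauchy mu2)) => [x _ /contrapT //|].
      have [i1 _ _] := curve_fubini a2 (dh y) ch (h2 _ Gy) (- 'i).
      exact: integrable_measurable i1.
    have Ev x : vfin M g x -> vside mu1 c' d' x = vside mu2 c' d' x.
      move=> Gx; apply: (vside_eq mg g0 gpot1 gN c2 Mc' Md' Gx (K := Defs.cauchy mu2)) => [y _ /contrapT //|].
      have [i1 _ _] := curve_fubini c2 (dv x) cv (v2 _ Gx) (- 'i).
      exact: integrable_measurable i1.
    move: H1; rewrite !Eh// !Ev// H2 => /mulfI; rewrite mulf_neq0//; last by rewrite gt_eqF ?pi_gt0.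
    move=> /(_ isT) Efin.
    have f1 : mu1 (rect a' b' c' d') \is a fin_num by rewrite fin_num_measure//; exact: measurable_rect.
    have f2 : mu2 (rect a' b' c' d') \is a fin_num by rewrite fin_num_measure//; exact: measurable_rect.
    by rewrite -(fineK f1) -(fineK f2) Efin.
  have mono (m : {measure set P2 -> \bar R}) a' b' c' d' : a < a' -> b' < b -> c < c' -> d' < d ->
      (m (rect a' b' c' d') <= m (rect a b c d))%E.
    move=> *; apply: meas_le; [exact: measurable_rect|exact: measurable_rect|].
    by apply: rect_subset; exact: ltW.
  apply/eqP; rewrite eq_le; apply/andP; split; apply: (rect_le ab cd aV' aH') => a' b' c' d' a1 a2 a3 c1 c2 c3 Ga Gb Gc Gd.
    have le12 : (mu1 (rect a' b' c' d') <= mu2 (rect a' b' c' d'))%E by rewrite key.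
    exact: le_trans le12 (mono mu2 a' b' c' d' a1 a3 c1 c3).
  have le21 : (mu2 (rect a' b' c' d') <= mu1 (rect a' b' c' d'))%E by rewrite key.
  exact: le_trans le21 (mono mu1 a' b' c' d' a1 a3 c1 c3).
by apply: measure_eq_rect eqr mE; exact: mu_fin.
Qed.

(** On good sides the Cauchy transform may be replaced by [H]; having the primitive [V], its side
    integrals cancel at the corners, and [rect_formula] gives measure 0. *)
Lemma rect_null_cauchy (mu : {finite_measure set P2 -> \bar R}) (H V : R[i] -> R[i]) (a b c d : R) : a < b -> c < d ->
  (forall p, `[a, b]%classic p.1 -> `[c, d]%classic p.2 -> cderiv V (toC p) (H (toC p)) /\ ccont H (toC p)) ->
  {ae @lebC R, forall p, `[a, b]%classic p.1 -> `[c, d]%classic p.2 -> Defs.cauchy mu (toC p) = H (toC p)} ->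
  mu (rect a b c d) = 0%E.
Proof.
move=> ab cd HV ae.
have [g [mg g0 gpot gN gint]] := dominating_exists mu ae.
pose M := `|a| + `|b| + `|c| + `|d|.
have [aV aH] := fin_lines M mg g0 gint.
have [Ma Mb Mc Md] := abs_sum_bounds a b c d; rewrite -/M in Ma Mb Mc Md.
have aV' : {ae leb, forall x, a < x < b -> vfin M g x}.
  apply: ae_imp aV => x h /andP[x1 x2]; apply: h.
  by rewrite (le_trans Ma (ltW x1)) (le_trans (ltW x2) Mb).
have aH' : {ae leb, forall y, c < y < d -> hfin M g y}.
  apply: ae_imp aH => x h /andP[x1 x2]; apply: h.
  by rewrite (le_trans Mc (ltW x1)) (le_trans (ltW x2) Md).
apply/eqP; rewrite eq_le measure_ge0 andbT.
apply: (rect_le ab cd aV' aH') => a' b' c' d' a1 a2 a3 c1 c2 c3 Ga Gb Gc Gd.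
have Ma' := le_trans Ma (ltW a1); have Mb' := le_trans (ltW a3) Mb.
have Mc' := le_trans Mc (ltW c1); have Md' := le_trans (ltW c3) Md.
have h1 y := @fin_hgood mu g M mg g0 gpot a' b' y Ma' Mb'.
have v1 x := @fin_vgood mu g M mg g0 gpot c' d' x Mc' Md'.
have H1 := rect_formula a2 c2 (h1 _ Gc) (h1 _ Gd) (v1 _ Ga) (v1 _ Gb).
have inab x : a' <= x <= b' -> `[a, b]%classic x.
  by move=> /andP[x1 x2]; rewrite /= in_itv/= (le_trans (ltW a1) x1) (le_trans x2 (ltW a3)).
have incd y : c' <= y <= d' -> `[c, d]%classic y.
  by move=> /andP[x1 x2]; rewrite /= in_itv/= (le_trans (ltW c1) x1) (le_trans x2 (ltW c3)).
have dV t d0 (f : R -> R[i]) k : cderiv V (f t) (H (f t)) -> rderiv f t d0 ->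
    is_derive t 1 (fun s => complex.Re (V (f s) * k)) (complex.Re (H (f t) * (d0 * k))).
  move=> dV df.
  have := rderiv_Re (cderiv_rderiv_comp (cderiv_affine 0 k (V (f t))) (cderiv_rderiv_comp dV df)).
  under eq_fun do rewrite add0r mulrC.
  by rewrite mulrC -mulrA.
have Eh y : c' <= y <= d' -> hfin M g y ->
    hside mu a' b' y = complex.Re (V (b' +i* y) * - 'i) - complex.Re (V (a' +i* y) * - 'i).
  move=> yr Gy.
  have cc0 : ctn (fun x => H (x +i* y) * (- 'i * 1)) `[a', b'].
    apply: ctnM; last exact: ctn_cst.
    apply: (@ctn_comp _ H (fun x => x +i* y)).
      by apply: (@rderiv_ctn _ _ (fun=> 1)) => t _; exact: rderiv_horizontal.
    by move=> x; rewrite /= in_itv/= => /inab xr; have [_] := HV (x, y) xr (incd _ yr).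
  have cR := ctn_Re cc0.
  rewrite (hside_eq mg g0 gpot gN a2 Ma' Mb' Gy (K := H)).
  - have D x : a' <= x <= b' -> is_derive x 1 (fun x => complex.Re (V (x +i* y) * - 'i))
        (complex.Re (H (x +i* y) * (- 'i * 1))).
      move=> /inab xr; have [dx _] := HV (x, y) xr (incd _ yr).
      by have := dV x 1 (fun x => x +i* y) (- 'i) dx (rderiv_horizontal y x); rewrite [1 * _]mulrC.
    exact: (rint_FTC (ltW a2) D cR).
  - by move=> x /inab xr /contrapT/=; apply => //; exact: incd.
  - exact: (subspace_continuous_measurable_fun (measurable_itv _) cR).
have Ev x : a' <= x <= b' -> vfin M g x ->
    vside mu c' d' x = complex.Re (V (x +i* d') * - 'i) - complex.Re (V (x +i* c') * - 'i).
  move=> xr Gx.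
  have cc0 : ctn (fun y => H (x +i* y) * (- 'i * 'i)) `[c', d'].
    apply: ctnM; last exact: ctn_cst.
    apply: (@ctn_comp _ H (fun y => x +i* y)).
      by apply: (@rderiv_ctn _ _ (fun=> 'i)) => t _; exact: rderiv_vertical.
    by move=> y; rewrite /= in_itv/= => /incd yr; have [_] := HV (x, y) (inab _ xr) yr.
  have cR := ctn_Re cc0.
  rewrite (vside_eq mg g0 gpot gN c2 Mc' Md' Gx (K := H)).
  - have D y : c' <= y <= d' -> is_derive y 1 (fun y => complex.Re (V (x +i* y) * - 'i))
        (complex.Re (H (x +i* y) * (- 'i * 'i))).
      move=> /incd yr; have [dx _] := HV (x, y) (inab _ xr) yr.
      by have := dV y 'i (fun y => x +i* y) (- 'i) dx (rderiv_vertical x y); rewrite ['i * _]mulrC.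
    exact: (rint_FTC (ltW c2) D cR).
  - by move=> y /incd yr /contrapT/=; apply => //; exact: inab.
  - exact: (subspace_continuous_measurable_fun (measurable_itv _) cR).
have fm : mu (rect a' b' c' d') \is a fin_num by rewrite fin_num_measure//; exact: measurable_rect.
have pi2 : 2 * pi != 0 :> R by rewrite mulf_neq0// gt_eqF ?pi_gt0.
have f0 : fine (mu (rect a' b' c' d')) = 0.
  apply: (mulfI pi2); rewrite mulr0 -H1 !Eh ?lexx ?ltW// !Ev ?lexx ?ltW//; ring.
have : (mu (rect a' b' c' d') <= 0)%E by rewrite -(fineK fm) f0.
by [].
Qed.

End GoodRectangles.

(** The countably many dyadic squares in which [P] fails only on a null set cover all points having
    a good ball, so no uncountable union occurs. *)
Lemma locally_ae (R : realType) (P : set (R * R)) :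
  {ae @lebC R, forall p, exists2 e : R, 0 < e & {ae @lebC R, forall q, ball p e q -> P q}} ->
  {ae @lebC R, forall p, P p}.
Proof.
set G := (fun p : R * R => _) => aeG.
pose A n k : set (R * R) :=
  if (pickle_inv k : option (int * int)) is Some c then
    (if `[< (@lebC R).-negligible (dysq n c `\` P) >] then dysq n c `\` P else set0) else set0.
have nA n k : (@lebC R).-negligible (A n k).
  by rewrite /A; case: pickle_inv => [c|]; [case: asboolP => // _|]; exact: negligible_set0.
have nAA : (@lebC R).-negligible (\bigcup_n \bigcup_k A n k).
  by apply: negligible_bigcup => n; apply: negligible_bigcup => k; exact: nA.
apply: negligibleS (negligibleU aeG nAA) => p /= nP.
have [[e e0 aeP]|] := pselect (G p); last by left.
right; have [n ne] : exists n : nat, 2 ^- n < e.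
  exists (Num.truncn e^-1).+1; rewrite -[ltRHS]invrK ltf_pV2 ?posrE ?invr_gt0 ?exprn_gt0//.
  by rewrite (lt_trans (truncnS_gt _))// -natrX ltr_nat ltn_expl.
exists n; first by [].
exists (pickle (dy n p)); first by [].
rewrite /A pickleK_inv asboolT; first by split.
apply: negligibleS aeP => q [/= Hq nPq] H; apply: nPq; apply: H.
by apply: le_ball (ltW ne) _ _; apply: dysq_ball; rewrite Hq.
Qed.

(** * Uniqueness, and vanishing near points with bounded arcs *)

Section Uniqueness.
Variable R : realType.
Local Notation P2 := (R * R)%type.
Variables (reg : set R[i]) (Rq : R[i] -> R[i]).
Hypothesis chartP : forall z0, reg z0 -> exists W h h' rho r0 m, chart reg Rq z0 W h h' rho r0 m.
Hypothesis finP : exists L : seq R[i], forall s, ~ reg s -> s \in L.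
Hypothesis dense_closed : {ae @lebC R, forall p, on_closed reg Rq (toC p)}.

(** Almost every point lies on a closed trajectory, whose arcs are bounded; there [local_cauchy]
    provides one function [H] for both Cauchy transforms. *)
Lemma solves_unique (mu1 mu2 : {finite_measure set P2 -> \bar R}) (E : set P2) :
  solves reg Rq mu1 -> solves reg Rq mu2 -> measurable E -> mu1 E = mu2 E.
Proof.
move=> s1 s2; apply: measure_eq_cauchy; apply: locally_ae.
apply: ae_imp dense_closed => p [g [T [cg g0]]].
have bp := closed_bounded_arcs chartP cg; rewrite g0 in bp.
have [e [H [V [e0 _ _ HC]]]] := local_cauchy chartP finP dense_closed bp.
exists (e / 2); first by rewrite divr_gt0.
apply: ae_imp (ae_and (HC _ s1) (HC _ s2)) => q [h1 h2] /ball2_nc.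
by rewrite mulrC divfK// => pq; rewrite h1// h2.
Qed.

Lemma solves_null (mu : {finite_measure set P2 -> \bar R}) (p : P2) : solves reg Rq mu ->
  bounded_arcs reg Rq (toC p) -> exists2 e : R, 0 < e & mu (ball p e) = 0%E.
Proof.
move=> s bp; have [e [H [V [e0 dV cH HC]]]] := local_cauchy chartP finP dense_closed bp.
pose d := e / 4; have d0 : 0 < d by rewrite divr_gt0.
have sub (q : P2) : `[p.1 - d, p.1 + d]%classic q.1 -> `[p.2 - d, p.2 + d]%classic q.2 ->
    cball (toC p) e (toC q).
  rewrite /= !in_itv/= => /andP[a1 a2] /andP[b1 b2].
  rewrite /cball/= toCB; apply: le_lt_trans (nc_le _) _ => /=.
  have : `|q.1 - p.1| <= d by rewrite ler_norml; apply/andP; split; lra.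
  have : `|q.2 - p.2| <= d by rewrite ler_norml; apply/andP; split; lra.
  by rewrite /d; lra.
exists d => //; apply/eqP; rewrite eq_le measure_ge0 andbT.
have Z : mu (rect (p.1 - d) (p.1 + d) (p.2 - d) (p.2 + d)) = 0%E.
  apply: (@rect_null_cauchy _ mu H V); [lra|lra| |].
  - by move=> q h1 h2; split; [apply: dV|apply: cH]; exact: sub.
  - by apply: ae_imp (HC _ s) => q h h1 h2; apply: h; exact: sub.
have : (mu (ball p d) <= mu (rect (p.1 - d) (p.1 + d) (p.2 - d) (p.2 + d)))%E.
  apply: meas_le; [exact: measurable_ball2|exact: measurable_rect|].
  move=> q [/= b1 b2]; move: b1 b2; rewrite /ball/= !ltr_norml => /andP[a1 a2] /andP[b1 b2].
  by split; rewrite /= in_itv/=; apply/andP; split; lra.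
by rewrite Z.
Qed.

End Uniqueness.

(** * Translation to the polynomial data *)

Section Polynomials.
Variable R : realType.
Local Notation P2 := (R * R)%type.

Lemma poly_roots (p : {poly R[i]}) : p != 0 -> exists L : seq R[i], forall z, p.[z] = 0 -> z \in L.
Proof.
move=> p0; have [L E] := closed_field_poly_normal p; exists L => z.
move=> /rootP; rewrite E rootZ ?lead_coef_eq0// root_prod_XsubC.
by [].
Qed.

Lemma ae_notin (L : seq R[i]) : {ae @lebC R, forall p, toC p \notin L}.
Proof.
elim: L => [|z L IH]; first exact: ae_all.
suff H : {ae @lebC R, forall p, toC p != z}.
  by apply: ae_imp (ae_and H IH) => p [h1 h2]; rewrite inE negb_or h1.
exists ([set complex.Re z] `*` [set complex.Im z]); split.
- exact: measurableX.
- rewrite /lebC product_measure1E; [|exact: measurable_set1..].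
  by apply: etrans (congr2 mule (lebesgue_measure_set1 _) (lebesgue_measure_set1 _)) _; rewrite mule0.
- by move=> [x y] /= /negP/negPn/eqP <-.
Qed.

Lemma finite_fin_num (mu : {measure set P2 -> \bar R}) : (mu setT < +oo)%E -> fin_num_fun mu.
Proof. by move=> h A mA; rewrite ge0_fin_numE// finite_meas. Qed.

(** The finiteness proof is an argument of the alias, so that the finite-measure structure can be
    inferred from the term. *)
Definition finite_of (mu : {measure set P2 -> \bar R}) (h : (mu setT < +oo)%E) : set P2 -> \bar R := mu.

HB.instance Definition _ mu h := Measure.on (@finite_of mu h).
HB.instance Definition _ mu h := Measure_isFinite.Build _ _ _ (@finite_of mu h) (finite_fin_num h).

Lemma horiz_arc_harc (U1 U2 : {poly R[i]}) (I : set R) (x y : R -> R) : U1 != 0 -> U2 != 0 -> horiz_arc U1 U2 I x y ->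
  harc (regular (U1 %/ gcdp U1 U2) (U2 %/ gcdp U1 U2)) (Rquad U1 U2) (fun t => x t +i* y t) I.
Proof.
move=> U10 U20 [_ [_ [_ H]]] t /H[/derivableP dx /derivableP dy ns pos]; exists (derive1 x t +i* derive1 y t); split => //.
  by apply/rderiv_ReIm; rewrite !derive1E; split.
by apply: contrapT => nr; apply: ns; apply/sing_finE.
Qed.

Lemma harc_horiz_arc (U1 U2 : {poly R[i]}) (I : set R) (g : R -> R[i]) : U1 != 0 -> U2 != 0 ->
  open I -> is_interval I -> I 0 ->
  harc (regular (U1 %/ gcdp U1 U2) (U2 %/ gcdp U1 U2)) (Rquad U1 U2) g I ->
  horiz_arc U1 U2 I (fun t => complex.Re (g t)) (fun t => complex.Im (g t)).
Proof.
move=> U10 U20 oI iI I0 H; split => //; split => //; split => // t /H[d [/rderiv_ReIm[d1 d2] rg pos]].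
have E : complex.Re (g t) +i* complex.Im (g t) = g t by case: (g t).
split; rewrite ?E.
- exact: is_derive_derivable d1.
- exact: is_derive_derivable d2.
- by move=> /sing_finE; apply.
have -> : derive1 (fun t => complex.Re (g t)) t +i* derive1 (fun t => complex.Im (g t)) t = d.
  by rewrite !derive1E !derive_val; case: (d).
by [].
Qed.

(** The two clauses of [K_Psi] about arcs negate to a positive distance from each finite singular
    point and to boundedness, the latter standing for the singular point at infinity. *)
Lemma notK_bounded_arcs (U1 U2 : {poly R[i]}) (z : R[i]) : U1 != 0 -> U2 != 0 -> ~ K_Psi U1 U2 z ->
  bounded_arcs (regular (U1 %/ gcdp U1 U2) (U2 %/ gcdp U1 U2)) (Rquad U1 U2) z.
Proof.
move=> U10 U20 nK; split.
  by apply: contrapT => nr; apply: nK; left; apply/sing_finE.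
move=> I g oI iI I0 ag g0; have := harc_horiz_arc U10 U20 oI iI I0 ag => hI.
have E t : complex.Re (g t) +i* complex.Im (g t) = g t by case: (g t).
split=> [s /sing_finE sf|]; apply: contrapT => H; apply: nK; right.
  exists I, (fun t => complex.Re (g t)), (fun t => complex.Im (g t)); split => //; first by rewrite E.
  left; exists s; split; first exact: sf.
  move=> e e0; apply: contrapT => H2; apply: H; exists e => // t It.
  rewrite leNgt; apply/negP => lt; apply: H2; exists t; split => //.
  by rewrite E nc_normE ltcR.
exists I, (fun t => complex.Re (g t)), (fun t => complex.Im (g t)); split => //; first by rewrite E.
right => M; apply: contrapT => H2; apply: H; exists M => t It.
by rewrite leNgt; apply/negP => lt; apply: H2; exists t; split; rewrite // E nc_normE ltcR.
Qed.

(** At a root of the gcd, [U1.[z] / U2.[z]] reads 0 / 0 = 0 and may differ from the reduced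
    quotient; these finitely many points form a null set. *)
Lemma cauchy_sq_solves (U1 U2 : {poly R[i]}) (mu : {measure set P2 -> \bar R}) (h : (mu setT < +oo)%E) :
  U1 != 0 -> cauchy_sq_eq U1 U2 mu ->
  solves (regular (U1 %/ gcdp U1 U2) (U2 %/ gcdp U1 U2)) (Rquad U1 U2) (finite_of h).
Proof.
move=> U10 H; have [L HL] := poly_roots (gcd_neq0 U2 U10).
apply: ae_imp (ae_and H (ae_notin L)) => p [[_ [_ E]] nL] [q1 q2].
have g0 : (gcdp U1 U2).[toC p] != 0 by apply: contra nL => /eqP/HL.
rewrite [LHS]E /Rquad opprK -[in LHS](Q1g U1 U2) -[X in _ / X.[_]](Q2g U1 U2) !hornerM.
by rewrite -mulf_div divff// mulr1.
Qed.

End Polynomials.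

Theorem mainTheorem4 (R : realType) (U1 U2 : {poly R[i]}) :
  U1 \is monic -> U2 \is monic -> size U2 = (size U1 + 2)%N ->
  strebel U1 U2 ->
  (forall mu1 mu2 : {measure set (R * R)%type -> \bar R},
      prob_compact mu1 -> cauchy_sq_eq U1 U2 mu1 ->
      prob_compact mu2 -> cauchy_sq_eq U1 U2 mu2 ->
      forall A : set (R * R), measurable A -> mu1 A = mu2 A) /\
  (forall mu : {measure set (R * R)%type -> \bar R},
      prob_compact mu -> cauchy_sq_eq U1 U2 mu ->
      forall p, msupp mu p -> K_Psi U1 U2 (toC p)).
Proof.
move=> /monic_neq0 U10 /monic_neq0 U20 _ st.
pose reg := regular (U1 %/ gcdp U1 U2) (U2 %/ gcdp U1 U2).
have chartP z0 : reg z0 -> exists W h h' rho r0 m, chart reg (Rquad U1 U2) z0 W h h' rho r0 m.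
  exact: quad_chart.
have finP : exists L : seq R[i], forall s, ~ reg s -> s \in L.
  have [L1 H1] := poly_roots (Q1_neq0 U2 U10); have [L2 H2] := poly_roots (Q2_neq0 U1 U20).
  exists (L1 ++ L2) => s /not_andP[|] /negP/negPn/eqP s0; rewrite mem_cat; first by rewrite (H1 _ s0).
  by rewrite (H2 _ s0) orbT.
have dense : {ae @lebC R, forall p, on_closed reg (Rquad U1 U2) (toC p)}.
  apply: ae_imp (st : {ae @lebC R, forall p, on_closed_traj U1 U2 (toC p)}) => p [x [y [T [T0 h per E]]]].
  exists (fun t => x t +i* y t), T; split => //; split => //; first exact: horiz_arc_harc.
  by move=> t; have [-> ->] := per t.
have fin (mu : {measure set (R * R)%type -> \bar R}) : prob_compact mu -> (mu setT < +oo)%E.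
  by move=> [-> _]; exact: ltry.
split=> [mu1 mu2 p1 c1 p2 c2 A mA|mu pm c p sp].
  exact: (solves_unique chartP finP dense (cauchy_sq_solves (fin _ p1) U10 c1) (cauchy_sq_solves (fin _ p2) U10 c2) mA).
apply: contrapT => /(notK_bounded_arcs U10 U20) bp.
have [e e0 E] := solves_null chartP finP dense (cauchy_sq_solves (fin _ pm) U10 c) bp.
by have := sp e e0; rewrite [X in (_ < X)%E]E ltxx.
Qed.
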